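(* Let $B$ be the open unit ball of $\mathbb{R}^3$ centered at the origin $o$. Let $K_0>0$ be a constant and let $f_1:[0,1]\to\mathbb{R}$ be a $C^1$ function with $f_1(0)=0$, $f_1'(0)\neq 0$ and $$\limsup_{t\to 0^+}\frac{f_1'(t)-f_1'(0)}{t}<+\infty .$$ Then there exists a constant $\bar\eta>0$, depending on $f_1$ and $K_0$, such that the following holds for every $\mu$ with $0<\mu<\pi^2$ and every $\eta$ with $0\le\eta\le\bar\eta$. Suppose that the function $f(t)=K_0+\eta f_1(t)$ is non-negative and non-increasing on $[0,1]$, and set $K(x)=f(|x|)$ for $x\in\bar B$ (so $K(o)=K_0$). Then the problem $$-\Delta u=K(x)u^5+\mu u\ \text{ in } B,\qquad u>0\ \text{ in } B,\qquad u=0\ \text{ on }\partial B$$ admits a solution if and only if $$-\frac{f_1'(0)\,\eta}{16\pi K_0}<g_\mu^{B}(o,o),$$ where $g_\mu^B$ is the regular part of the Green's function of $-\Delta-\mu$ on $B$ with zero Dirichlet boundary condition.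
   Context: Here $|x|$ is the Euclidean norm on $\mathbb{R}^3$. For $0<\mu<\pi^2$ (note that $\pi^2$ is the first Dirichlet eigenvalue of $-\Delta$ on $B$), the Green's function $G_\mu^B(x,y)$ is the solution of $-\Delta_x G_\mu^B(\cdot,y)-\mu G_\mu^B(\cdot,y)=\delta_y$ in $B$, $G_\mu^B(\cdot,y)=0$ on $\partial B$. Its regular part is defined by $G_\mu^B(x,y)=\frac{1}{4\pi|x-y|}+g_\mu^B(x,y)$, where $g_\mu^B$ is extended continuously to the diagonal. A known explicit value is $$g_\mu^B(o,o)=-\frac{\sqrt{\mu}\,\cos(\sqrt{\mu})}{4\pi\sin(\sqrt{\mu})}.$$ A solution is understood as a classical solution $u\in C^2(\bar B)$; since $K$ is Lipschitz on $\bar B$, by standard elliptic regularity this is equivalent to a positive weak solution $u\in H_0^1(B)$. *)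

(* Defs.v *)
From mathcomp Require Import all_boot all_order all_algebra.
From mathcomp Require Import all_classical all_reals all_analysis.

Set Implicit Arguments.
Unset Strict Implicit.
Unset Printing Implicit Defensive.

Import Order.TTheory GRing.Theory Num.Theory.
Import numFieldNormedType.Exports.

Local Open Scope classical_set_scope.
Local Open Scope ring_scope.

(* The library norm [`|x|] on ['rV[R]_3] is the max norm, so the Euclidean norm
   is defined here; both induce the same topology and derivatives. *)
Definition enorm (R : realType) (x : 'rV[R]_3) : R :=
  Num.sqrt (\sum_(i < 3) x ord0 i ^+ 2).

Definition unit_ball (R : realType) : set 'rV[R]_3 := [set x | enorm x < 1].
Definition closed_unit_ball (R : realType) : set 'rV[R]_3 :=
  [set x | enorm x <= 1].
Definition unit_sphere (R : realType) : set 'rV[R]_3 := [set x | enorm x = 1].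
Arguments unit_ball R : clear implicits.
Arguments closed_unit_ball R : clear implicits.
Arguments unit_sphere R : clear implicits.

Definition basis_vec (R : realType) (i : 'I_3) : 'rV[R]_3 := delta_mx ord0 i.
Arguments basis_vec R i : clear implicits.

Definition partial (R : realType) (i : 'I_3) (u : 'rV[R]_3 -> R) :
  'rV[R]_3 -> R := 'D_(basis_vec R i) u.

Definition laplacian (R : realType) (u : 'rV[R]_3 -> R) (x : 'rV[R]_3) : R :=
  \sum_(i < 3) partial i (partial i u) x.

Definition extends_continuously (R : realType) (v : 'rV[R]_3 -> R) : Prop :=
  exists w : 'rV[R]_3 -> R,
    {within closed_unit_ball R, continuous w} /\
    (forall x, unit_ball R x -> v x = w x).

(* [C^2] on the closed ball: twice differentiable in the open ball, with [u]
   continuous up to the boundary and all partial derivatives of order one and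
   two extending continuously to the closed ball. *)
Definition C2_closed_ball (R : realType) (u : 'rV[R]_3 -> R) : Prop :=
  [/\ {within closed_unit_ball R, continuous u},
      forall i x, unit_ball R x -> derivable u x (basis_vec R i),
      forall i j x, unit_ball R x -> derivable (partial i u) x (basis_vec R j),
      forall i, extends_continuously (partial i u)
    & forall i j, extends_continuously (partial j (partial i u))].

Definition classical_solution (R : realType) (K : 'rV[R]_3 -> R) (mu : R)
    (u : 'rV[R]_3 -> R) : Prop :=
  [/\ C2_closed_ball u,
      forall x, unit_ball R x ->
        - laplacian u x = K x * u x ^+ 5 + mu * u x,
      forall x, unit_ball R x -> 0 < u x
    & forall x, unit_sphere R x -> u x = 0].

Definition iter_partial (R : realType) (s : seq 'I_3) (phi : 'rV[R]_3 -> R) :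
  'rV[R]_3 -> R := foldr (@partial R) phi s.

(* Smooth functions on the whole space with compact support inside the open unit
   ball (the support is bounded, so requiring its closure to lie in the ball is
   the same as compactness). *)
Definition test_function (R : realType) (phi : 'rV[R]_3 -> R) : Prop :=
  [/\ forall s, continuous (iter_partial s phi),
      forall s i x, derivable (iter_partial s phi) x (basis_vec R i)
    & closure [set x | phi x != 0] `<=` unit_ball R].

Definition vec3 (R : realType) (p : R * R * R) : 'rV[R]_3 :=
  \row_(i < 3) [tuple p.1.1; p.1.2; p.2]`_i.

Notation lebesgue3 R :=
  ((@lebesgue_measure R \x @lebesgue_measure R) \x @lebesgue_measure R)%E.

(* [Gy] is the Green's function with pole [y]: the equation
   [- Delta Gy - mu Gy = delta_y] holds in the sense of distributions on the
   ball, and the boundary value [0] is attained continuously.  The value of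
   [Gy] at the pole itself is irrelevant. *)
Definition green_function_at (R : realType) (mu : R) (y : 'rV[R]_3)
    (Gy : 'rV[R]_3 -> R) : Prop :=
  [/\ (lebesgue3 R).-integrable (@vec3 R @^-1` unit_ball R)
        (EFin \o (Gy \o @vec3 R)),
      forall phi, test_function phi ->
        \int[lebesgue3 R]_(p in @vec3 R @^-1` unit_ball R)
          (Gy (vec3 p) * (- laplacian phi (vec3 p) - mu * phi (vec3 p)))
        = phi y,
      {within closed_unit_ball R `\ y, continuous Gy}
    & forall x, unit_sphere R x -> Gy x = 0].

Definition green_function (R : realType) (mu : R)
    (G : 'rV[R]_3 -> 'rV[R]_3 -> R) : Prop :=
  forall y, unit_ball R y -> green_function_at mu y (G ^~ y).

Definition regular_part (R : realType) (G g : 'rV[R]_3 -> 'rV[R]_3 -> R) :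
    Prop :=
  (forall x y, unit_ball R x -> unit_ball R y -> x != y ->
     G x y = (4 * pi * enorm (x - y))^-1 + g x y) /\
  (forall y, unit_ball R y ->
     {for (y, y), continuous (fun p : 'rV[R]_3 * 'rV[R]_3 => g p.1 p.2)}).

(* Derivative relative to [[0, 1]] (one-sided at the endpoints): only the values
   of [f] on [[0, 1]] matter. *)
Definition diffquot01 (R : realType) (f : R -> R) (t : R) : set_system R :=
  (f s - f t) / (s - t) @[s --> within [set` `[0, 1]] t^'].

Definition deriv01 (R : realType) (f : R -> R) (t : R) : R :=
  lim (diffquot01 f t).

Definition C1_01 (R : realType) (f : R -> R) : Prop :=
  (forall t, t \in `[0, 1] -> cvg (diffquot01 f t)) /\
  {within [set` `[0, 1]], continuous (deriv01 f)}.

(* Main.v *)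
Require Import Defs.
From HB Require Import structures.
From mathcomp Require Import all_boot all_order all_algebra.
From mathcomp Require Import all_classical all_reals all_analysis.
From mathcomp Require Import measurable_realfun.
From mathcomp Require Import ring lra.
Import Order.TTheory GRing.Theory Num.Theory.
Import numFieldNormedType.Exports.
Local Open Scope classical_set_scope.
Local Open Scope ring_scope.

Set Implicit Arguments.
Unset Strict Implicit.
Unset Printing Implicit Defensive.

(* Write th = sqrt mu and v(r) = r u(r), so that a radial solution satisfies
   v'' = -(K v^5 / r^4 + mu v), v(0) = v(1) = 0.  With psi = sin(th r) sin(th (1 - r))
   as multiplier, a Pohozaev function E satisfies
   E' = v^6 / (6 r^4) (psi K' + 4 K (psi' - psi / r)),
   vanishes at 0 and is nonpositive, resp. zero, at 1 when v(1) >= 0, resp. v(1) = 0.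
   Near 0 the weight in brackets is r times f_1'(0) eta sin th - 4 K_0 th cos th, up to
   a positive factor.

   Nonexistence: moving planes make every solution radial.  If the number above is
   nonpositive, the upper bound on (f_1'(t) - f_1'(0)) / t and the smallness of eta make
   the weight nonpositive on all of (0, 1), so E is decreasing, a contradiction.

   Existence: if the number is positive, shoot from 0 with slope a = v'(0).  For small a
   the nonlinearity is negligible and v(1) > 0.  For large a the profile is a bubble of
   width a^-2 with v = O(1/a) away from 0, and v(1) >= 0 would make E gain order a^-2 near
   0 but lose only order a^-6 afterwards; hence v(1) < 0 and some slope in between gives
   v(1) = 0.

   The condition of the theorem is the sign of that number, because any Green function
   has g(o, o) = - th cot th / (4 pi).  This is obtained by testing the equation with
   sin(th (1 - r)) / r cut off near the origin and near the sphere, radial integrals being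
   evaluated by the divergence theorem. *)

(** * Derivatives and Pohozaev multipliers on the half-line *)

(** The multiplier psi is a product of two solutions of w'' + mu w = 0, one vanishing at 0 and the
    other at 1; this removes the linear term mu v from E' altogether and leaves v^6 with an explicit
    weight. The inequality cot(th (1 - r)) >= cot th + th r carries the sign of the weight from r =
    0 to the whole interval, and its slack th^2 r pays for the growth C r of f_1' - f_1'(0); this is
    the origin of the threshold 4 K_0 / C.

    In the moving planes argument the part of Hopf's lemma is played by explicit barriers evaluated
    at a minimum point. They give a uniform step length as long as the plane stays away from the
    centre, which is reached by continuity.

    The bubble estimate rests on the fact that r^2 / v^2 is exactly quadratic in r for the model
    profile A r / sqrt(1 + K_0 A^4 r^2 / 3).

    Radial integrals are measured in units of one positive constant, [flux_const], which cancels;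
    the factor 4 pi in the result comes from the normalisation of the singular part alone. *)

Section RealCalculus.
Context {R : realType}.
Implicit Types (f g d : R -> R) (a b c x y : R).

(** A relation with the derivative as an explicit value: [dauto] can leave the value to unification
    and build it from the syntax of the function. *)
Definition der f x (l : R) : Prop := is_derive x 1 f l.

Lemma der_eq f x a b : der f x a -> a = b -> der f x b.
Proof. by move=> h <-. Qed.

Lemma derC c x : der (fun=> c) x 0.
Proof. exact: is_derive_cst. Qed.

Lemma derI x : der (fun y => y) x 1.
Proof. exact: is_derive_id. Qed.

Lemma derD f g x a b : der f x a -> der g x b ->
  der (fun y => f y + g y) x (a + b).
Proof. by move=> ? ?; exact: is_deriveD. Qed.

Lemma derN f x a : der f x a -> der (fun y => - f y) x (- a).
Proof. by move=> ?; exact: is_deriveN. Qed.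

Lemma derM f g x a b : der f x a -> der g x b ->
  der (fun y => f y * g y) x (a * g x + f x * b).
Proof.
move=> hf hg; have := is_deriveM hf hg.
by rewrite /GRing.scale /= addrC [g x * a]mulrC.
Qed.

Lemma derX f n x a : der f x a ->
  der (fun y => f y ^+ n) x (n%:R * f x ^+ n.-1 * a).
Proof.
by move=> hf; have := is_deriveX n hf; rewrite exprfctE.
Qed.

Lemma derV f x a : f x != 0 -> der f x a ->
  der (fun y => (f y)^-1) x (- a / f x ^+ 2).
Proof.
move=> fx0 hf; have dfx : derivable f x 1 by case: hf.
apply: DeriveDef; first exact: derivableV.
rewrite deriveV //; have -> : 'D_1 f x = a by case: hf.
by rewrite /GRing.scale /= mulNr mulrC mulNr.
Qed.

Lemma derO f g x a b : der f x a -> der g (f x) b ->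
  der (fun y => g (f y)) x (b * a).
Proof. by move=> hf hg; have := is_derive1_comp hg hf. Qed.

Lemma der_sin f x a : der f x a -> der (fun y => sin (f y)) x (cos (f x) * a).
Proof. by move=> hf; exact: (derO hf (is_derive_sin _)). Qed.

Lemma der_cos f x a : der f x a -> der (fun y => cos (f y)) x (- sin (f x) * a).
Proof. by move=> hf; exact: (derO hf (is_derive_cos _)). Qed.

Lemma der_cont f x a : der f x a -> {for x, continuous f}.
Proof. by case=> h _; apply: differentiable_continuous; apply/derivable1_diffP. Qed.

Lemma der_within f (A : set R) (df : R -> R) :
  (forall x, A x -> der f x (df x)) -> {within A, continuous f}.
Proof.
move=> h; apply: continuous_in_subspaceT => x /set_mem Ax.
exact: der_cont (h _ Ax).
Qed.

Lemma mvt f d a b : a < b -> (forall x, a <= x <= b -> der f x (d x)) ->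
  exists2 c, a < c < b & f b - f a = d c * (b - a).
Proof.
move=> ab h.
have [||c] := @MVT R f d a b ab.
- by move=> x; rewrite in_itv /= => /andP[? ?]; apply: h; rewrite !ltW.
- by apply: (@der_within _ _ d) => x /=; rewrite in_itv /=; exact: h.
by rewrite in_itv /= => ? ?; exists c.
Qed.

Lemma der_le f d a b : a <= b -> (forall x, a <= x <= b -> der f x (d x)) ->
  (forall x, a < x < b -> 0 <= d x) -> f a <= f b.
Proof.
rewrite le_eqVlt => /predU1P[-> //|ab] h hd.
have [c cab e] := mvt ab h.
by rewrite -subr_ge0 e mulr_ge0 ?hd // subr_ge0 ltW.
Qed.

Lemma der_lt f d a b : a < b -> (forall x, a <= x <= b -> der f x (d x)) ->
  (forall x, a < x < b -> 0 < d x) -> f a < f b.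
Proof.
move=> ab h hd; have [c cab e] := mvt ab h.
by rewrite -subr_gt0 e mulr_gt0 ?hd // subr_gt0.
Qed.

(** No value at 0 is involved, because the functions in use contain negative powers of [r]. By
    monotonicity it suffices that [f] comes arbitrarily close to being nonnegative somewhere before
    [b]. *)
Lemma der_le_at0 f d b : 0 < b -> (forall x, 0 < x <= b -> der f x (d x)) ->
  (forall x, 0 < x < b -> 0 <= d x) ->
  (forall e, 0 < e -> exists2 x, 0 < x < b & - e <= f x) -> 0 <= f b.
Proof.
move=> b0 h hd h0; rewrite leNgt; apply/negP => fb.
have [|x /andP[x0 xb] hx] := h0 (- f b / 2); first by lra.
have : f x <= f b.
  apply: (@der_le _ d) => [|y /andP[? ?]|y /andP[? ?]]; first exact: ltW.
    by apply: h; apply/andP; split=> //; lra.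
  by apply: hd; apply/andP; split=> //; lra.
lra.
Qed.

Lemma der_shift f (t l : R) : der (fun s => f (s + t)) 0 l -> der f t l.
Proof.
move=> h.
have h' : der (fun y => y - t) t 1 by have := derD (derI t) (derC (- t) t); rewrite addr0.
have h2 : der (fun s => f (s + t)) (t - t) l by rewrite subrr.
have e : (fun y => f (y - t + t)) = f by apply/funext => s; rewrite subrK.
by have := derO h' h2; rewrite mulr1 e.
Qed.

End RealCalculus.

(** Recursion on the syntax of the function, the derivative being filled in on the way. What remains
    are nonvanishing denominators and, after [dsolve], one algebraic identity. *)
Ltac dauto :=
  lazymatch goal with
  | |- der (fun _ => ?c) _ _ => notypeclasses refine (derC _ _)
  | |- der (fun y => y) _ _ => notypeclasses refine (derI _)
  | |- der (fun y => _ + _) _ _ => notypeclasses refine (derD _ _); dauto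
  | |- der (fun y => - _) _ _ => notypeclasses refine (derN _); dauto
  | |- der (fun y => _ * _) _ _ => notypeclasses refine (derM _ _); dauto
  | |- der (fun y => _ ^+ _) _ _ => notypeclasses refine (derX _ _); dauto
  | |- der ( *%R ?c) _ _ =>
    notypeclasses refine (derM (f := fun=> c) (g := fun y => y) _ _); dauto
  | |- der ( +%R ?c) _ _ =>
    notypeclasses refine (derD (f := fun=> c) (g := fun y => y) _ _); dauto
  | |- der -%R _ _ => notypeclasses refine (derN (derI _))
  | |- der (fun y => _^-1) _ _ => notypeclasses refine (derV _ _); [ | dauto]
  | |- der GRing.inv _ _ => notypeclasses refine (derV (f := fun y => y) _ _); [ | dauto]
  | |- der (fun y => sin _) _ _ => notypeclasses refine (der_sin _); dauto
  | |- der sin _ _ => notypeclasses refine (is_derive_sin _)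
  | |- der (fun y => cos _) _ _ => notypeclasses refine (der_cos _); dauto
  | |- der cos _ _ => notypeclasses refine (is_derive_cos _)
  | |- _ => first [eassumption | match goal with h : _ |- _ => notypeclasses refine (h _ _) end | idtac]
  end.
Ltac dsolve := notypeclasses refine (der_eq _ _); [ dauto | ].

(** * Continuity at a point, derived from the syntax of the function *)

Section Continuity.
Context {R : realType} {T : topologicalType}.
Implicit Types (f g : T -> R) (x : T).

Definition ct f x : Prop := {for x, continuous f}.

Lemma ctC (c : R) x : ct (fun=> c) x.
Proof. exact: cvg_cst. Qed.

Lemma ctD f g x : ct f x -> ct g x -> ct (fun y => f y + g y) x.
Proof. by move=> ? ?; exact: cvgD. Qed.

Lemma ctN f x : ct f x -> ct (fun y => - f y) x.
Proof. by move=> ?; exact: cvgN. Qed.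

Lemma ctM f g x : ct f x -> ct g x -> ct (fun y => f y * g y) x.
Proof. by move=> ? ?; exact: cvgM. Qed.

Lemma ctV f x : f x != 0 -> ct f x -> ct (fun y => (f y)^-1) x.
Proof. by move=> ? ?; exact: cvgV. Qed.

Lemma ctO f (h : R -> R) x : ct f x -> {for f x, continuous h} ->
  ct (fun y => h (f y)) x.
Proof. by move=> cf ch; exact: (@continuous_comp _ _ _ f h x cf ch). Qed.

Lemma ctX f n x : ct f x -> ct (fun y => f y ^+ n) x.
Proof.
by move=> cf; apply: (ctO (h := fun t => t ^+ n) cf); exact: exprn_continuous.
Qed.

Lemma ct_sin f x : ct f x -> ct (fun y => sin (f y)) x.
Proof. by move=> cf; apply: (ctO (h := sin) cf); exact: continuous_sin. Qed.

Lemma ct_cos f x : ct f x -> ct (fun y => cos (f y)) x.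
Proof. by move=> cf; apply: (ctO (h := cos) cf); exact: continuous_cos. Qed.

Lemma ct_sqrt f x : ct f x -> ct (fun y => Num.sqrt (f y)) x.
Proof. by move=> cf; apply: (ctO (h := Num.sqrt) cf); exact: sqrt_continuous. Qed.

Lemma ct_dist f x : ct f x -> forall e : R, 0 < e ->
  \forall y \near x, `|f y - f x| < e.
Proof.
move=> /cvgrPdist_lt cf e e0; near=> y; rewrite distrC; near: y; exact: cf.
Unshelve. all: by end_near. Qed.

Lemma ct_min f g x : ct f x -> ct g x -> ct (fun y => Num.min (f y) (g y)) x.
Proof. by move=> ? ?; exact: continuous_min. Qed.

Lemma ct_max f g x : ct f x -> ct g x -> ct (fun y => Num.max (f y) (g y)) x.
Proof. by move=> ? ?; exact: continuous_max. Qed.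

End Continuity.

Lemma ctI {R : realType} (x : R) : ct (fun y => y) x.
Proof. exact: cvg_id. Qed.

Ltac ctauto :=
  lazymatch goal with
  | |- ct (fun _ => ?c) _ => notypeclasses refine (@ctC _ _ _ _)
  | |- ct (fun y => y) _ => notypeclasses refine (@ctI _ _)
  | |- ct (fun y => _ + _) _ => notypeclasses refine (ctD _ _); ctauto
  | |- ct (fun y => - _) _ => notypeclasses refine (ctN _); ctauto
  | |- ct (fun y => _ * _) _ => notypeclasses refine (ctM _ _); ctauto
  | |- ct (fun y => _ ^+ _) _ => notypeclasses refine (ctX _); ctauto
  | |- ct ( *%R ?c) _ =>
    notypeclasses refine (ctM (f := fun=> c) (g := fun y => y) _ _); ctauto
  | |- ct ( +%R ?c) _ =>
    notypeclasses refine (ctD (f := fun=> c) (g := fun y => y) _ _); ctauto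
  | |- ct -%R _ => notypeclasses refine (ctN (@ctI _ _))
  | |- ct (fun y => _^-1) _ => notypeclasses refine (ctV _ _); [ | ctauto]
  | |- ct GRing.inv _ => notypeclasses refine (ctV (f := fun y => y) _ _); [ | ctauto]
  | |- ct (fun y => sin _) _ => notypeclasses refine (ct_sin _); ctauto
  | |- ct sin _ => notypeclasses refine (ct_sin (@ctI _ _))
  | |- ct (fun y => cos _) _ => notypeclasses refine (ct_cos _); ctauto
  | |- ct cos _ => notypeclasses refine (ct_cos (@ctI _ _))
  | |- ct (fun y => Num.sqrt _) _ => notypeclasses refine (ct_sqrt _); ctauto
  | |- ct (fun y => Num.min _ _) _ => notypeclasses refine (ct_min _ _); ctauto
  | |- ct (Num.min ?c) _ =>
    notypeclasses refine (ct_min (f := fun=> c) (g := fun y => y) _ _); ctauto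
  | |- ct (fun y => Num.max _ _) _ => notypeclasses refine (ct_max _ _); ctauto
  | |- _ => first [eassumption | match goal with h : _ |- _ => notypeclasses refine (h _ _) end | match goal with h : _ |- _ => notypeclasses refine (h _) end | idtac]
  end.

(** * The Pohozaev function of the radial equation *)

Section Pohozaev.
Context {R : realType}.
Variables (K dK v v1 : R -> R) (th : R).

Definition poho_mult (r : R) : R := sin (th * r) * sin (th * (1 - r)).
Definition poho_mult' (r : R) : R :=
  th * (cos (th * r) * sin (th * (1 - r)) - sin (th * r) * cos (th * (1 - r))).

Definition poho_weight (r : R) : R :=
  poho_mult r * dK r + 4 * K r * (poho_mult' r - poho_mult r / r).

(** Half the product of the Wronskians of [v] with [sin (th r)] and with [sin (th (1 - r))], plus
    the potential term. Both sines solve the linear equation, so each Wronskian has a derivative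
    free of the linear term. *)
Definition poho (r : R) : R :=
  (sin (th * r) * v1 r - th * cos (th * r) * v r) *
  (sin (th * (1 - r)) * v1 r + th * cos (th * (1 - r)) * v r) / 2 +
  poho_mult r * K r * v r ^+ 6 / (6 * r ^+ 4).

Lemma poho_der (r : R) : 0 < r -> der v r (v1 r) ->
  der v1 r (- (K r * v r ^+ 5 / r ^+ 4 + th ^+ 2 * v r)) -> der K r (dK r) ->
  der poho r (v r ^+ 6 / (6 * r ^+ 4) * poho_weight r).
Proof.
move=> r0 hv hv1 hK; have rn : r != 0 by rewrite gt_eqF.
rewrite /poho /poho_mult; dsolve.
  by rewrite mulf_neq0 ?expf_neq0 ?pnatr_eq0.
rewrite /poho_weight /poho_mult /poho_mult' /=.
by field.
Qed.

End Pohozaev.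

(** * Elementary bounds on sine, cosine and cotangent *)

Section TrigBounds.
Context {R : realType}.
Implicit Types x th r : R.

Lemma sin_lex x : 0 <= x -> sin x <= x.
Proof.
move=> x0; rewrite -subr_ge0.
have := @der_le R (fun y => y - sin y) (fun y => 1 - cos y) 0 x x0.
rewrite sin0 subr0; apply=> [y _|y _]; first by dsolve.
by rewrite subr_ge0 cos_le1.
Qed.

Lemma abs_sin_lex x : 0 <= x -> `|sin x| <= x.
Proof.
move=> x0; rewrite ler_norml sin_lex // andbT.
have := @der_le R (fun y => y + sin y) (fun y => 1 + cos y) 0 x x0.
rewrite sin0 addr0 => h; rewrite -subr_ge0 opprK addrC; apply: h => [y _|y _].
  by dsolve.
by have := cos_geN1 y; lra.
Qed.

Lemma xcosx_lt_sinx x : 0 < x < pi -> x * cos x < sin x.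
Proof.
move=> /andP[x0 xpi]; rewrite -subr_gt0.
have := @der_lt R (fun y => sin y - y * cos y) (fun y => y * sin y) 0 x x0.
rewrite sin0 mul0r subr0; apply=> [y _|y /andP[y0 yx]].
  by dsolve => /=; ring.
by rewrite mulr_gt0 // sin_gt0_pi // y0 (lt_trans yx).
Qed.

(** The function [cot (th (1 - y)) - th y] has derivative [th cot^2 >= 0], so it is at least its
    value [cot th] at 0. *)
Lemma cot_ge th r : 0 < th < pi -> 0 <= r < 1 ->
  (cos th / sin th + th * r) * sin (th * (1 - r)) <= cos (th * (1 - r)).
Proof.
move=> /andP[t0 tpi] /andP[r0 r1].
have sp y : 0 <= y <= r -> 0 < sin (th * (1 - y)).
  move=> /andP[y0 yr]; apply: sin_gt0_pi; apply/andP; split.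
    by rewrite mulr_gt0 // subr_gt0 (le_lt_trans yr).
  by apply: le_lt_trans tpi; rewrite ler_piMr ?(ltW t0) // lerBlDr lerDl.
rewrite -ler_pdivlMr ?sp ?r0 ?lexx // -lerBrDr.
have := @der_le R (fun y => cos (th * (1 - y)) / sin (th * (1 - y)) - th * y)
  (fun y => th * (cos (th * (1 - y)) / sin (th * (1 - y))) ^+ 2) 0 r r0.
rewrite subr0 !mulr1 mulr0 subr0; apply=> [y /sp sy|y _].
  dsolve; first by rewrite gt_eqF.
  by move: sy => /=; move: (sin _) (cos _) => s c s0; field; rewrite gt_eqF.
by rewrite mulr_ge0 ?(ltW t0) ?sqr_ge0.
Qed.

End TrigBounds.

(** * No radial solution when the weight is nonpositive *)

Section Nonexistence.
Context {R : realType}.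

(** Near the origin [v] and [sin (th r)] are [O(r)], hence so is the first Wronskian, and
    [v^6 / r^4] is [O(r^2)]: the Pohozaev function tends to 0 there. *)
Lemma poho_bound0 (K v v1 : R -> R) (th K0 M r : R) : 0 < th -> 0 < r <= 1 ->
  0 <= K r <= K0 -> 0 <= M -> `|v r| <= M * r -> `|v1 r| <= M ->
  `|poho K v v1 th r| <= (th * M * (M + th * M) + K0 * M ^+ 6) * r.
Proof.
move=> t0 /andP[r0 r1] /andP[K0r Kr] M0 vb v1b.
have tr : 0 <= th * r by rewrite mulr_ge0 // ltW.
rewrite mulrDl; apply: le_trans (ler_normD _ _) _; apply: lerD.
  have h1 : `|sin (th * r) * v1 r - th * cos (th * r) * v r| <=
      2 * (th * M * r).
    apply: le_trans (ler_normB _ _) _; rewrite mulr2n mulrDl !mul1r.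
    rewrite !normrM (gtr0_norm t0); apply: lerD.
      by rewrite mulrAC ler_pM // abs_sin_lex.
    by rewrite -[leRHS]mulrA ler_pM ?mulr_ge0 ?(ltW t0) // ler_piMr ?(ltW t0) ?cos_max.
  have h2 : `|sin (th * (1 - r)) * v1 r + th * cos (th * (1 - r)) * v r| <=
      M + th * M.
    apply: le_trans (ler_normD _ _) _.
    rewrite !normrM (gtr0_norm t0); apply: lerD.
      by rewrite -[leRHS]mul1r ler_pM // sin_max.
    apply: ler_pM; rewrite ?mulr_ge0 ?(ltW t0) //.
      by rewrite ler_piMr ?(ltW t0) ?cos_max.
    by apply: le_trans vb _; rewrite ler_piMr.
  rewrite -mulrA normrM normrM [`|2^-1|]gtr0_norm ?invr_gt0 //.
  have -> : th * M * (M + th * M) * r = 2 * (th * M * r) * ((M + th * M) / 2).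
    by field.
  by apply: ler_pM => //; apply: ler_pM.
rewrite /poho_mult 3!normrM (ger0_norm K0r) normrM.
have -> : `|(6 * r ^+ 4)^-1| = (6 * r ^+ 4)^-1.
  by rewrite gtr0_norm // invr_gt0 mulr_gt0 // exprn_gt0.
have h6 : `|v r ^+ 6| <= M ^+ 6 * r ^+ 6.
  by rewrite normrX -exprMn lerXn2r // ?nnegrE ?mulr_ge0 // ltW.
have h0 : 0 < 6 * r ^+ 4 by rewrite mulr_gt0 // exprn_gt0.
apply: (@le_trans _ _ (1 * 1 * K0 * (M ^+ 6 * r ^+ 6) / (6 * r ^+ 4))).
  rewrite ler_pM2r ?invr_gt0 //.
  by do 3 (apply: ler_pM; rewrite ?mulr_ge0 //); exact: sin_max.
rewrite ler_pdivrMr // !mul1r.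
have -> : K0 * M ^+ 6 * r * (6 * r ^+ 4) = K0 * (M ^+ 6 * r ^+ 5) * 6 by ring.
rewrite -mulrA ler_wpM2l ?(le_trans K0r) // -mulrA.
rewrite ler_wpM2l ?exprn_ge0 // exprS.
have := exprn_ge0 5 (ltW r0); set q := r ^+ 5 => q0; nra.
Qed.

(** At the sphere it is the second Wronskian that vanishes to first order. The factor 16 bounds
    [r^-4] on [[1/2, 1)]. *)
Lemma poho_bound1 (K v v1 : R -> R) (th K0 M r : R) : 0 < th -> 1/2 <= r < 1 ->
  0 <= K r <= K0 -> 0 <= M -> `|v r| <= M * (1 - r) -> `|v1 r| <= M ->
  `|poho K v v1 th r| <=
  (th * M * (M + th * M) + 16 * K0 * M ^+ 6) * (1 - r).
Proof.
move=> t0 /andP[r2 r1] /andP[K0r Kr] M0 vb v1b.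
have r0 : 0 < r by lra.
have s0 : 0 <= 1 - r by lra.
have tr : 0 <= th * (1 - r) by rewrite mulr_ge0 // ltW.
rewrite mulrDl; apply: le_trans (ler_normD _ _) _; apply: lerD.
  have h1 : `|sin (th * (1 - r)) * v1 r + th * cos (th * (1 - r)) * v r| <=
      2 * (th * M * (1 - r)).
    apply: le_trans (ler_normD _ _) _; rewrite mulr2n mulrDl !mul1r.
    rewrite !normrM (gtr0_norm t0); apply: lerD.
      by rewrite mulrAC ler_pM // abs_sin_lex.
    by rewrite -[leRHS]mulrA ler_pM ?mulr_ge0 ?(ltW t0) // ler_piMr ?(ltW t0) ?cos_max.
  have h2 : `|sin (th * r) * v1 r - th * cos (th * r) * v r| <= M + th * M.
    apply: le_trans (ler_normB _ _) _.
    rewrite !normrM (gtr0_norm t0); apply: lerD.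
      by rewrite -[leRHS]mul1r ler_pM // sin_max.
    apply: ler_pM; rewrite ?mulr_ge0 ?(ltW t0) //.
      by rewrite ler_piMr ?(ltW t0) ?cos_max.
    by apply: le_trans vb _; rewrite ler_piMr //; lra.
  rewrite -mulrA mulrC normrM normrM [`|2^-1|]gtr0_norm ?invr_gt0 //.
  have -> : th * M * (M + th * M) * (1 - r) =
      2 * (th * M * (1 - r)) / 2 * (M + th * M).
    by field.
  by apply: ler_pM => //; apply: ler_pM.
rewrite /poho_mult 3!normrM (ger0_norm K0r) normrM.
have -> : `|(6 * r ^+ 4)^-1| = (6 * r ^+ 4)^-1.
  by rewrite gtr0_norm // invr_gt0 mulr_gt0 // exprn_gt0.
have h6 : `|v r ^+ 6| <= M ^+ 6 * (1 - r) ^+ 6.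
  by rewrite normrX -exprMn lerXn2r // ?nnegrE ?mulr_ge0 // ltW.
have h0 : 0 < 6 * r ^+ 4 by rewrite mulr_gt0 // exprn_gt0.
apply: (@le_trans _ _ (1 * 1 * K0 * (M ^+ 6 * (1 - r) ^+ 6) / (6 * r ^+ 4))).
  rewrite ler_pM2r ?invr_gt0 //.
  by do 3 (apply: ler_pM; rewrite ?mulr_ge0 //); exact: sin_max.
rewrite ler_pdivrMr // !mul1r.
have -> : 16 * K0 * M ^+ 6 * (1 - r) * (6 * r ^+ 4) =
  K0 * (M ^+ 6 * ((1 - r) * (96 * r ^+ 4))) by ring.
rewrite ler_wpM2l ?(le_trans K0r) // ler_wpM2l ?exprn_ge0 // exprS.
rewrite ler_wpM2l //; apply: (@le_trans _ _ 1); first by rewrite exprn_ile1 //; lra.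
have : (1/2) ^+ 4 <= r ^+ 4 by rewrite lerXn2r // nnegrE; lra.
lra.
Qed.

(** The Pohozaev function tends to 0 at both ends, is nonincreasing, and decreases strictly near 0,
    where [K > 0]. The condition coupling [dK] with [A0 = - th cot th] is stated with [K0], which
    dominates [K r]; where [A0 - th^2 r] is nonpositive, [dK <= 0] settles the sign. *)
Lemma no_radial_solution (K dK v v1 : R -> R) (th K0 M d : R) :
  let A0 := - (th * cos th / sin th) in
  0 < th < pi -> 0 <= M -> 0 < d ->
  (forall r, 0 < r < 1 -> [/\ der v r (v1 r),
     der v1 r (- (K r * v r ^+ 5 / r ^+ 4 + th ^+ 2 * v r)) & der K r (dK r)]) ->
  (forall r, 0 < r < 1 -> 0 <= K r <= K0) ->
  (forall r, 0 < r < 1 -> dK r <= 0) ->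
  (forall r, 0 < r < d -> 0 < K r) ->
  (forall r, 0 < r < 1 -> 0 < A0 - th ^+ 2 * r ->
     dK r + 4 * K0 * (A0 - th ^+ 2 * r) <= 0) ->
  (forall r, 0 < r < 1 -> [/\ 0 < v r, v r <= M * r, v r <= M * (1 - r)
     & `|v1 r| <= M]) -> False.
Proof.
move=> A0 /andP[t0 tpi] M0 d0 hd Kb dKb Kp key vb.
have st r : 0 < r < 1 -> 0 < sin (th * r).
  move=> /andP[r0 r1]; apply: sin_gt0_pi; rewrite mulr_gt0 //=.
  by apply: lt_trans tpi; rewrite gtr_pMr.
have st1 : 0 < sin th by rewrite sin_gt0_pi // t0.
have weight r : 0 < r < 1 -> poho_weight K dK th r <= 0 /\
    (0 < K r -> poho_weight K dK th r < 0).
  move=> r01; have /andP[r0 r1] := r01.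
  pose s := sin (th * r); pose S := sin (th * (1 - r)).
  have s0 : 0 < s by exact: st.
  have S0 : 0 < S by apply: st; lra.
  (* Strictly negative by [th r cos (th r) < sin (th r)]: this term makes the weight strictly
     negative wherever [K r > 0]. *)
  have hc : th * (S * cos (th * r) * r - S * s / th) < 0.
    have : th * r * cos (th * r) < s.
      by apply: xcosx_lt_sinx; rewrite mulr_gt0 //=; apply: lt_trans tpi; rewrite gtr_pMr.
    rewrite pmulr_rlt0 // subr_lt0 ltr_pdivlMr // => h.
    have -> : S * cos (th * r) * r * th = S * (th * r * cos (th * r)) by ring.
    by rewrite ltr_pM2l.
  have hC : - (A0 - th ^+ 2 * r) * S <= th * cos (th * (1 - r)).
    have := @cot_ge R th r; rewrite t0 tpi ltW //= r1 => /(_ isT isT).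
    rewrite -(ler_pM2l t0); apply: le_trans.
    suff -> : - (A0 - th ^+ 2 * r) * S =
      th * ((cos th / sin th + th * r) * sin (th * (1 - r))) by [].
    by rewrite /A0 /S; field; rewrite gt_eqF.
  have e : r * poho_weight K dK th r = r * (s * S) * dK r +
      4 * K r * (th * (S * cos (th * r) * r - S * s / th) -
      r * s * (th * cos (th * (1 - r)))).
    rewrite /poho_weight /poho_mult /poho_mult' -/s -/S.
    by field; rewrite !gt_eqF.
  have /andP[K0r Kr] := Kb r r01.
  (* By [cot_ge] the cosine can be replaced by [A0 - th^2 r], which bounds the expression by a
     positive multiple of [dK r + 4 K r (A0 - th^2 r)]. *)
  have main : r * (s * S) * dK r - 4 * K r * (r * s * (th * cos (th * (1 - r))))
     <= 0.
    apply: (@le_trans _ _ (r * (s * S) * (dK r + 4 * K r * (A0 - th ^+ 2 * r)))).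
      rewrite [leRHS]mulrDr lerD2l -mulrN.
      have -> : r * (s * S) * (4 * K r * (A0 - th ^+ 2 * r)) =
        4 * K r * (- (r * s * (- (A0 - th ^+ 2 * r) * S))) by ring.
      rewrite ler_wpM2l ?mulr_ge0 // lerN2 ler_wpM2l //.
      by rewrite mulr_ge0 // ltW.
    rewrite pmulr_rle0; last by rewrite !mulr_gt0.
    have dr := dKb r r01; have [h|h] := ltP 0 (A0 - th ^+ 2 * r).
      have := key r r01 h; set q := _ - _ in h *; nra.
    have : 4 * K r * (A0 - th ^+ 2 * r) <= 0 by rewrite mulr_ge0_le0 // mulr_ge0.
    lra.
  rewrite -(pmulr_rle0 _ r0) -(pmulr_rlt0 _ r0) e; split=> [|Kr0].
    have : 4 * K r * (th * (S * cos (th * r) * r - S * s / th)) <= 0.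
      by rewrite mulr_ge0_le0 // ?mulr_ge0 // ltW.
    lra.
  have : 4 * K r * (th * (S * cos (th * r) * r - S * s / th)) < 0.
    by rewrite pmulr_rlt0 // mulr_gt0.
  lra.
have D r (h : 0 < r < 1) : der (poho K v v1 th) r
    (v r ^+ 6 / (6 * r ^+ 4) * poho_weight K dK th r).
  by have [? ? ?] := hd r h; have /andP[? ?] := h; exact: poho_der.
have fac r : 0 < r < 1 -> 0 < v r ^+ 6 / (6 * r ^+ 4).
  move=> h; have [? _ _ _] := vb r h; have /andP[? ?] := h.
  by rewrite divr_gt0 ?mulr_gt0 ?exprn_gt0.
pose E := poho K v v1 th.
have mono a b : 0 < a -> a <= b -> b < 1 -> E b <= E a.
  move=> a0 ab b1; rewrite -lerN2.
  apply: (@der_le R (fun y => - E y) (fun r => - (v r ^+ 6 / (6 * r ^+ 4) * poho_weight K dK th r)) a b ab).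
    by move=> x /andP[? ?]; apply: derN; apply: D; lra.
  move=> x /andP[? ?]; have x01 : 0 < x < 1 by lra.
  by rewrite oppr_ge0 pmulr_rle0 ?fac //; have [] := weight x x01.
(* On [[a, b]] the coefficient is positive, so [E b < E a], while monotonicity and the limit at 0
   give [E a <= 0]. Then [E <= E b < 0] up to the sphere contradicts the limit there. *)
pose b := Num.min d (1/2) / 2; pose a := b / 2; have ha : a = b / 2 by [].
have b0 : 0 < b by rewrite divr_gt0 // lt_min d0; lra.
have bd : 2 * b <= d by rewrite mulrC divfK // ge_min lexx.
have b1 : 2 * b <= 1/2 by rewrite mulrC divfK // ge_min lexx orbT.
have Eba : E b < E a.
  rewrite -ltrN2.
  apply: (@der_lt R (fun y => - E y) (fun r => - (v r ^+ 6 / (6 * r ^+ 4) * poho_weight K dK th r))).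
  - by lra.
  - by move=> x /andP[? ?]; apply: derN; apply: D; lra.
  move=> x /andP[? ?]; have x01 : 0 < x < 1 by lra.
  rewrite oppr_gt0 pmulr_rlt0 ?fac //; have [_] := weight x x01; apply.
  by apply: Kp; lra.
have K00 : 0 <= K0 by have := Kb (1/2); lra.
pose C0 := th * M * (M + th * M) + K0 * M ^+ 6 + 1.
have M6 : 0 <= K0 * M ^+ 6 by rewrite mulr_ge0 // exprn_ge0.
have MM : 0 <= th * M * (M + th * M) by rewrite !(mulr_ge0, addr_ge0) // ltW.
have C00 : 0 < C0 by rewrite /C0; lra.
have Ea : E a <= 0.
  rewrite leNgt; apply/negP => Ea.
  pose x := Num.min a (E a / (2 * C0)).
  have x0 : 0 < x by rewrite lt_min; apply/andP; split; [lra|rewrite divr_gt0 // mulr_gt0].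
  have xa : x <= a by rewrite ge_min lexx.
  have xE : x <= E a / (2 * C0) by rewrite ge_min lexx orbT.
  have x01 : 0 < x < 1 by lra.
  have h1 : E a <= E x by apply: mono => //; lra.
  have [v0 v1' v2 v3] := vb x x01.
  have := @poho_bound0 K v v1 th K0 M x t0.
  rewrite x0 ltW ?Kb //=; last by lra.
  move=> /(_ isT isT M0); rewrite (gtr0_norm v0) => /(_ v1' v3).
  move=> /(le_trans (ler_norm _)).
  rewrite ler_pdivlMr in xE; last by lra.
  have := mulr_ge0 (ltW x0) M6; rewrite /C0 -/E in xE *; nra.
pose C1 := th * M * (M + th * M) + 16 * K0 * M ^+ 6 + 1.
have C10 : 0 < C1 by rewrite /C1 -mulrA; lra.
have Eb : E b < 0 by lra.
pose x := 1 - Num.min (1/2) (- E b / (2 * C1)).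
have x1 : 1 - x <= 1/2 by rewrite subKr ge_min lexx.
have xE : 1 - x <= - E b / (2 * C1) by rewrite subKr ge_min lexx orbT.
have x0 : 0 < 1 - x.
  by rewrite subKr lt_min; apply/andP; split; [lra|rewrite divr_gt0 // ?mulr_gt0 // oppr_gt0].
have x01 : 0 < x < 1 by lra.
have h1 : E x <= E b by apply: mono; lra.
have [v0 v1' v2 v3] := vb x x01.
have := @poho_bound1 K v v1 th K0 M x t0.
have -> : 1 / 2 <= x < 1 by lra.
rewrite Kb // => /(_ isT isT M0); rewrite (gtr0_norm v0) => /(_ v2 v3).
rewrite ler_norml => /andP[h _].
rewrite ler_pdivlMr in xE; last by lra.
rewrite /C1 -/E in xE h; lra.
Qed.

End Nonexistence.

(** * Consequences of the hypotheses on [f1] *)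

Section C1Hypotheses.
Context {R : realType}.
Implicit Types (f : R -> R) (s t e L C d : R).

Lemma diffquot01_near f t : t \in `[0, 1] -> cvg (diffquot01 f t) ->
  forall e : R, 0 < e -> exists2 d : R, 0 < d & forall s, s \in `[0, 1] -> s != t ->
  `|s - t| < d -> `|(f s - f t) / (s - t) - deriv01 f t| < e.
Proof.
move=> t01 ct e e0.
have /cvgrPdist_lt /(_ e e0) : diffquot01 f t --> deriv01 f t by [].
rewrite !near_withinE => -[d /= d0 hd].
exists d => // s s01 st sd; rewrite distrC; apply: hd => //=.
by rewrite distrC.
Qed.

Lemma C1_01_der f t : C1_01 f -> 0 < t < 1 -> der f t (deriv01 f t).
Proof.
move=> [cf _] /andP[t0 t1].
have t01 : t \in `[0, 1] by rewrite in_itv /= !ltW.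
suff h : h^-1 *: (f (h *: 1 + t) - f t) @[h --> 0^'] --> deriv01 f t.
  apply: DeriveDef; first by apply/cvg_ex; exists (deriv01 f t).
  exact: cvg_lim.
apply/cvgrPdist_lt => e e0.
have [d d0 hd] := diffquot01_near t01 (cf t t01) e0.
have m0 : 0 < Num.min d (Num.min t (1 - t)) by rewrite !lt_min d0 t0 subr_gt0.
near=> h.
have h0 : h != 0 by near: h; exact: nbhs_dnbhs_neq.
have : `|h| < Num.min d (Num.min t (1 - t)).
  near: h; apply: (@nbhs_dnbhs _ (0 : R)).
  by exists (Num.min d (Num.min t (1 - t))) => //= y /=; rewrite sub0r normrN.
rewrite !lt_min => /and3P[hd1 /ltr_normlP[h1 _] /ltr_normlP[_ h2]].
rewrite distrC [h *: 1]mulr1 [_ *: _]mulrC.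
have := hd (h + t); rewrite addrK; apply=> //.
  by rewrite in_itv /=; lra.
by rewrite -subr_eq0 addrK.
Unshelve. all: by end_near. Qed.

Lemma C1_01_bounded f : C1_01 f ->
  exists2 L : R, 0 < L & forall t, t \in `[0, 1] -> `|deriv01 f t| <= L.
Proof.
move=> [_ cd]; have [M [_ hM]] :=
  compact_bounded (continuous_compact cd (@segment_compact _ 0 1)).
exists (`|M| + 1) => [|t t01]; first by rewrite ltr_wpDl.
by apply: hM; [rewrite (le_lt_trans (ler_norm _)) // ltrDl|exists t].
Qed.

Lemma C1_01_within f : C1_01 f -> {within `[0, 1], continuous f}.
Proof.
move=> [cf _]; apply/subspace_continuousP => t t01.
apply/cvgrPdist_lt => e e0.
have [d d0 hd] := diffquot01_near t01 (cf t t01) ltr01.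
pose D := `|deriv01 f t| + 1.
have D0 : 0 < D by rewrite ltr_wpDl.
have m0 : 0 < Num.min d (e / D) by rewrite lt_min d0 divr_gt0.
rewrite near_withinE; exists (Num.min d (e / D)) => //= s.
rewrite /= lt_min distrC => /andP[sd se] s01.
have [->|st] := eqVneq s t; first by rewrite subrr normr0.
have := hd s s01 st sd; have s0 : 0 < `|s - t| by rewrite normr_gt0 subr_eq0.
move=> h; rewrite ltr_pdivlMr // in se.
have : `|(f s - f t) / (s - t)| < D.
  rewrite -(subrK (deriv01 f t) (_ / _)) addrC.
  by apply: le_lt_trans (ler_normD _ _) _; rewrite ltrD2l.
rewrite normrM normfV ltr_pdivrMr // => h2.
by rewrite distrC; apply: lt_trans h2 _; rewrite mulrC.
Qed.

Lemma C1_01_lipschitz f L : C1_01 f ->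
  (forall t, t \in `[0, 1] -> `|deriv01 f t| <= L) ->
  forall s t, s \in `[0, 1] -> t \in `[0, 1] -> `|f s - f t| <= L * `|s - t|.
Proof.
move=> cf hL s t; wlog st : s t / s <= t => [wl|].
  have [/wl//|/ltW ts] := leP s t.
  by move=> s01 t01; rewrite distrC [`|s - t|]distrC; exact: wl.
rewrite !in_itv /= => /andP[s0 s1] /andP[t0 t1].
move: st; rewrite le_eqVlt => /predU1P[->|st]; first by rewrite !subrr normr0 mulr0.
have [||c] := @MVT R f (deriv01 f) s t st.
- move=> x; rewrite in_itv /= => /andP[sx xt].
  by apply: C1_01_der => //; rewrite (le_lt_trans s0 sx) (lt_le_trans xt t1).
- apply: continuous_subspaceW (C1_01_within cf) => x /=.
  by rewrite !in_itv /= => /andP[sx xt]; rewrite (le_trans s0 sx) (le_trans xt t1).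
rewrite in_itv /= => /andP[sc ct] e.
rewrite distrC e normrM distrC [`|s - t|]distrC ler_wpM2r // hL //.
by rewrite in_itv /= ltW ?(le_lt_trans s0 sc) // ltW // (lt_le_trans ct).
Qed.

Lemma C1_01_deriv_at0 f : C1_01 f -> forall e : R, 0 < e ->
  exists2 d : R, 0 < d <= 1 & forall t, 0 <= t < d -> `|deriv01 f t - deriv01 f 0| <= e.
Proof.
move=> [_ /subspace_continuousP cd] e e0.
have i0 : [set` `[(0:R), 1]] 0 by rewrite /= in_itv /= lexx ler01.
have /cvgrPdist_lt /(_ e e0) := cd 0 i0.
rewrite near_withinE => -[d /= d0 hd].
exists (Num.min d 1) => [|t]; first by rewrite lt_min d0 ltr01 ge_min lexx orbT.
rewrite lt_min => /and3P[t0 td t1]; rewrite distrC ltW // hd //=.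
  by rewrite sub0r normrN ger0_norm.
by rewrite in_itv /= t0 ltW.
Qed.

(** Below some [d] the limsup provides the constant; beyond [d], a bound [L] on the derivative gives
    [2 L <= (2 L / d) t]. *)
Lemma limsup_bound f : C1_01 f ->
  (limf_esup (fun t : R => ((deriv01 f t - deriv01 f 0) / t)%:E) 0^'+ < +oo)%E ->
  exists2 C : R, 0 < C & forall t, 0 < t < 1 -> deriv01 f t - deriv01 f 0 <= C * t.
Proof.
move=> cf /ereal_inf_lt [_ [A hA <-] hs].
have [L L0 hL] := C1_01_bounded cf.
have [C hC] : exists C : R, forall t, A t -> (deriv01 f t - deriv01 f 0) / t <= C.
  case: (ereal_sup _) hs (@ereal_sup_ubound _ [set ((deriv01 f t - deriv01 f 0) / t)%:E | t in A]) => // [C|] _ ub.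
    by exists C => t At; rewrite -lee_fin; apply: ub; exists t.
  (* A supremum equal to -oo contradicts the existence of a point in [A], so any constant serves. *)
  exists 0 => t At; have := ub ((deriv01 f t - deriv01 f 0) / t)%:E.
  by rewrite leNgt ltNyr => h; suff: false by []; apply: h; exists t.
have : \forall t \near 0^'+, A t by exact: hA.
rewrite near_withinE => -[d /= d0 hd].
exists (Num.max C 0 + 1 + 2 * L / d) => [|t /andP[t0 t1]].
  apply: addr_gt0; last by rewrite divr_gt0 // mulr_gt0.
  by rewrite ltr_wpDl // le_max lexx orbT.
have M0 : 0 <= Num.max C 0 by rewrite le_max lexx orbT.
have [td|dt] := ltP t d.
  have : A t by apply: hd => //=; rewrite sub0r normrN gtr0_norm.
  move/hC; rewrite ler_pdivrMr // => /le_trans; apply.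
  rewrite ler_pM2r // -addrA; apply: (@le_trans _ _ (Num.max C 0)).
    by rewrite le_max lexx.
  by rewrite lerDl addr_ge0 // ltW // divr_gt0 // mulr_gt0.
have i0 : (0:R) \in `[0, 1] by rewrite in_itv /= lexx ler01.
have it : t \in `[0, 1] by rewrite in_itv /= !ltW.
apply: (@le_trans _ _ (2 * L)).
  have := hL 0 i0; have := hL t it; rewrite !ler_norml; lra.
apply: (@le_trans _ _ (2 * L / d * t)).
  by rewrite mulrAC ler_pdivlMr // ler_wpM2l // mulr_ge0 // ltW.
by rewrite ler_pM2r // lerDr addr_ge0.
Qed.

End C1Hypotheses.

(** * Moving planes on the ball *)

Section StrictDerivative.
Context {R : realType} {V : normedModType R}.
Implicit Types (f : V -> R) (x y v w : V) (l m t : R).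

(** The difference quotient converges uniformly in the base point. This makes the derivative
    additive in the direction, so continuous partial derivatives yield derivatives along every line,
    in particular along reflected coordinate axes. *)
Definition strict_deriv f x v l := forall e : R, 0 < e -> exists2 d : R, 0 < d &
  forall y t, `|y - x| < d -> `|t| < d ->
    `|f (y + t *: v) - f y - t * l| <= e * `|t|.

Lemma strict_derivD f x v w l m : strict_deriv f x v l -> strict_deriv f x w m ->
  strict_deriv f x (v + w) (l + m).
Proof.
move=> hv hw e e0; have e2 : 0 < e / 2 by rewrite divr_gt0.
have [d1 d10 h1] := hv _ e2; have [d2 d20 h2] := hw _ e2.
have v0 : 0 < `|v| + 1 by rewrite ltr_wpDl.
pose d := Num.min d1 (Num.min (d2 / 2) (d2 / 2 / (`|v| + 1))).
exists d => [|y t]; first by rewrite !lt_min d10 !divr_gt0.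
rewrite !lt_min => /and3P[y1 y2 y3] /and3P[t1 t2 t3].
have tv : `|y + t *: v - x| < d2.
  rewrite addrAC (le_lt_trans (ler_normD _ _)) // normrZ.
  have -> : d2 = d2 / 2 + d2 / 2 by field.
  rewrite ltr_leD //; rewrite ltr_pdivlMr // in t3.
  by apply: le_trans (ltW t3); rewrite ler_wpM2l // lerDl.
have -> : f (y + t *: (v + w)) - f y - t * (l + m) =
  (f (y + t *: v + t *: w) - f (y + t *: v) - t * m) +
  (f (y + t *: v) - f y - t * l) by rewrite scalerDr addrA; ring.
rewrite (le_trans (ler_normD _ _)) //.
have -> : e * `|t| = e / 2 * `|t| + e / 2 * `|t| by field.
by apply: lerD; [apply: h2 => //; apply: lt_le_trans t2 _; lra | exact: h1].
Qed.

Lemma strict_derivZ f x v l a : strict_deriv f x v l ->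
  strict_deriv f x (a *: v) (a * l).
Proof.
move=> h e e0; have a0 : 0 < `|a| + 1 by rewrite ltr_wpDl.
have [d d0 hd] := h (e / (`|a| + 1)) (divr_gt0 e0 a0).
exists (Num.min d (d / (`|a| + 1))) => [|y t]; first by rewrite lt_min d0 divr_gt0.
rewrite !lt_min => /andP[y1 _] /andP[_ t2].
rewrite ltr_pdivlMr // in t2.
have at1 : `|t * a| < d.
  by rewrite normrM; apply: le_lt_trans t2; rewrite ler_wpM2l // lerDl.
have := hd y (t * a) y1 at1; rewrite scalerA mulrA => /le_trans; apply.
rewrite normrM mulrAC ler_pdivrMr // -mulrA ler_wpM2l ?(ltW e0) //.
by rewrite ler_wpM2l // lerDl.
Qed.

Lemma strict_deriv_der f x v l : strict_deriv f x v l ->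
  der (fun t => f (x + t *: v)) 0 l.
Proof.
move=> h; suff c : (fun s : R => s^-1 *: (f (x + (s *: 1 + 0 : R) *: v) -
      f (x + (0 : R) *: v))) @ 0^' --> l.
  apply: DeriveDef; first by apply/cvg_ex; exists l.
  exact: cvg_lim.
apply/cvgrPdist_lt => e e0; have e2 : 0 < e / 2 by rewrite divr_gt0.
have [d d0 hd] := h _ e2; near=> t.
have t0 : t != 0 by near: t; exact: nbhs_dnbhs_neq.
have td : `|t| < d.
  near: t; apply: (@nbhs_dnbhs _ (0 : R)).
  by exists d => //= y /=; rewrite sub0r normrN.
have := hd x t; rewrite subrr normr0 => /(_ d0 td).
rewrite addr0 scale0r addr0 [t *: 1]mulr1 [t^-1 *: _]mulrC => b.
have -> : l - (f (x + t *: v) - f x) / t = - ((f (x + t *: v) - f x - t * l) / t).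
  by field.
rewrite normrN normrM normfV (@le_lt_trans _ _ (e / 2)) //; last by lra.
by rewrite ler_pdivrMr // normr_gt0.
Unshelve. all: by end_near. Qed.

Lemma der_line f x v t : derivable f (x + t *: v) v ->
  der (fun s => f (x + s *: v)) t ('D_v f (x + t *: v)).
Proof.
move=> h; have c : (fun s : R => s^-1 *: (f (x + (s *: 1 + t : R) *: v) -
    f (x + t *: v))) = (fun s : R => s^-1 *: ((f \o shift (x + t *: v)) (s *: v) - f (x + t *: v))).
  apply/funext => s /=; rewrite [s *: 1]mulr1 scalerDl.
  by rewrite addrCA.
apply: DeriveDef; first by rewrite /derivable /= c.
by rewrite /derive /= c.
Qed.

(** Mean value theorem on the segment from [y] to [y + t v], along which the derivative stays close
    to its value at [x]. *)
Lemma strict_deriv_partial f x v : (\forall y \near x, derivable f y v) ->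
  {for x, continuous ('D_v f)} -> strict_deriv f x v ('D_v f x).
Proof.
move=> hd hc e e0.
move/cvgrPdist_lt : hc => /(_ e e0) hc.
have hnear : \forall y \near x, derivable f y v /\ `|'D_v f y - 'D_v f x| < e.
  near=> y; split; first by near: y.
  by rewrite distrC; near: y; exact: hc.
have /nbhs_ballP[d /= d0 hb] := hnear.
have v0 : 0 < `|v| + 1 by rewrite ltr_wpDl.
exists (Num.min (d / 2) (d / 2 / (`|v| + 1))) => [|y t].
  by rewrite lt_min !divr_gt0.
rewrite !lt_min => /andP[y1 _] /andP[t1 t2].
have hs s : 0 <= s <= 1 -> derivable f (y + (t * s) *: v) v /\
    `|'D_v f (y + (t * s) *: v) - 'D_v f x| < e.
  move=> /andP[s0 s1]; apply: hb; rewrite -ball_normE /ball_ /= distrC addrAC.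
  rewrite (le_lt_trans (ler_normD _ _)) // normrZ.
  have -> : d = d / 2 + d / 2 by field.
  rewrite ltr_leD // (@le_trans _ _ (`|t| * `|v|)) //.
    rewrite ler_wpM2r // normrM ler_piMr // ger0_norm //.
  rewrite ltr_pdivlMr // in t2; apply: le_trans (ltW t2).
  by rewrite ler_wpM2l // lerDl.
pose F s := f (y + (t * s) *: v) - s * (t * 'D_v f x).
have [||c /andP[c0 c1]] := @mvt R F (fun s => t * ('D_v f (y + (t * s) *: v) - 'D_v f x)) 0 1.
- exact: ltr01.
- move=> s s01; rewrite /F; have [h1 _] := hs s s01.
  have h2 := der_line h1.
  have h3 : der (fun s => t * s) s t by dsolve => /=; ring.
  have h4 := derO h3 h2.
  by dsolve => /=; ring.
rewrite /F mulr1 mulr0 scale0r addr0 mul0r subr0 mul1r subr0 mulr1.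
move=> E; rewrite addrAC E normrM mulrC ler_wpM2r //.
by have [|_ /ltW] := hs c; rewrite ?(ltW c0) ?(ltW c1).
Unshelve. all: by end_near. Qed.

End StrictDerivative.

(** * Euclidean geometry and extrema in three dimensions *)

Section Space.
Context {R : realType}.
Implicit Types (x y n v : 'rV[R]_3) (i j : 'I_3).

Local Notation B := (@unit_ball R).

Definition nsq x : R := \sum_(i < 3) x ord0 i ^+ 2.
Definition dot x y : R := \sum_(i < 3) x ord0 i * y ord0 i.

Lemma sum3 (F : 'I_3 -> R) : \sum_i F i = F 0 + F 1 + F 2.
Proof.
rewrite !big_ord_recl big_ord0 addr0 addrA.
by congr (F _ + F _ + F _); apply: val_inj.
Qed.

Lemma nsq_ge0 x : 0 <= nsq x.
Proof. by apply: sumr_ge0 => i _; rewrite sqr_ge0. Qed.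

Lemma nsq_continuous : continuous nsq.
Proof.
move=> x; rewrite (_ : nsq = fun y => y ord0 0 ^+ 2 + y ord0 1 ^+ 2 + y ord0 2 ^+ 2);
  last by apply/funext => y; rewrite /nsq sum3.
have c i : ct (fun y : 'rV[R]_3 => y ord0 i) x by exact: coord_continuous.
suff: ct (fun y : 'rV[R]_3 => y ord0 0 ^+ 2 + y ord0 1 ^+ 2 + y ord0 2 ^+ 2) x by []; ctauto.
Qed.

Lemma dot_continuous n : continuous (dot ^~ n).
Proof.
move=> x; rewrite (_ : dot ^~ n = fun y => y ord0 0 * n ord0 0 +
  y ord0 1 * n ord0 1 + y ord0 2 * n ord0 2);
  last by apply/funext => y; rewrite /dot sum3.
have c i : ct (fun y : 'rV[R]_3 => y ord0 i) x by exact: coord_continuous.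
suff: ct (fun y : 'rV[R]_3 => y ord0 0 * n ord0 0 + y ord0 1 * n ord0 1 + y ord0 2 * n ord0 2) x by []; ctauto.
Qed.

Lemma enorm_ge0 x : 0 <= enorm x.
Proof. exact: sqrtr_ge0. Qed.

Lemma sqr_enorm x : enorm x ^+ 2 = nsq x.
Proof. by rewrite sqr_sqrtr // nsq_ge0. Qed.

Lemma enorm_continuous : continuous (@enorm R).
Proof.
move=> x; apply: (@continuous_comp _ _ _ nsq (@Num.sqrt R)).
  exact: nsq_continuous.
exact: sqrt_continuous.
Qed.

Lemma unit_ballE x : unit_ball R x = (nsq x < 1) :> Prop.
Proof. by rewrite /unit_ball /= -sqr_enorm -[in RHS](expr1n _ 2) ltr_pXn2r // ?nnegrE ?enorm_ge0. Qed.

Lemma closed_unit_ballE x : closed_unit_ball R x = (nsq x <= 1) :> Prop.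
Proof. by rewrite /closed_unit_ball /= -sqr_enorm -[in RHS](expr1n _ 2) ler_pXn2r // ?nnegrE ?enorm_ge0. Qed.

Lemma unit_sphereE x : unit_sphere R x <-> nsq x = 1.
Proof.
rewrite /unit_sphere /= -sqr_enorm; split=> [->|/eqP]; first by rewrite expr1n.
by rewrite sqrf_eq1 => /orP[/eqP //|/eqP h]; have := enorm_ge0 x; rewrite h; lra.
Qed.

Lemma nsqD x v t : nsq (x + t *: v) = nsq x + 2 * t * dot x v + t ^+ 2 * nsq v.
Proof. by rewrite /nsq /dot !sum3 !mxE; ring. Qed.

Lemma dotD x v n t : dot (x + t *: v) n = dot x n + t * dot v n.
Proof. by rewrite /dot !sum3 !mxE; ring. Qed.

Lemma nsq0 x : nsq x = 0 -> x = 0.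
Proof.
move=> /eqP; rewrite psumr_eq0 => [/allP h|i _]; last exact: sqr_ge0.
apply/rowP => i; rewrite mxE; apply/eqP; rewrite -sqrf_eq0.
by apply: h; rewrite mem_index_enum.
Qed.

Lemma basis_vecE i j : basis_vec R i ord0 j = (i == j)%:R.
Proof. by rewrite mxE eqxx eq_sym. Qed.

Lemma vec_basis v : v = \sum_i v ord0 i *: basis_vec R i.
Proof. exact: row_sum_delta. Qed.

Lemma open_nsq_lt (a : R) : open [set x | nsq x < a].
Proof.
have -> : [set x | nsq x < a] = nsq @^-1` [set t | t < a] by [].
by apply: open_comp => [x _|]; [exact: nsq_continuous|exact: open_lt].
Qed.

Lemma nsq_le_compact (A : set 'rV[R]_3) (a : R) :
  closed A -> A `<=` [set x | nsq x <= a] -> compact A.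
Proof.
move=> cA sA; apply: bounded_closed_compact => //.
exists (a + 1); split; first by rewrite num_real.
move=> M aM x /sA /= xa; have a0 : 0 <= a by by apply: le_trans xa; exact: nsq_ge0.
rewrite /Num.norm /= mx_normrE; apply: (big_ind (fun z : R => z <= M)) => [|u v uM vM|[k i] _ /=].
- lra.
- by rewrite ge_max uM vM.
rewrite ord1 -(ler_pXn2r (_ : 0 < 2)%N) ?nnegrE //; last by lra.
rewrite real_normK ?num_real //.
have : x ord0 i ^+ 2 <= nsq x.
  by rewrite /nsq (bigD1 i) //= lerDl sumr_ge0 // => j _; rewrite sqr_ge0.
by nra.
Qed.

Lemma continuous_EVT_min (A : set 'rV[R]_3) (F : 'rV[R]_3 -> R) (a : R) :
  closed A -> A `<=` [set x | nsq x <= a] -> (forall x, A x -> {for x, continuous F}) ->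
  forall y, A y -> exists2 c, A c & forall x, A x -> F c <= F x.
Proof.
move=> cA sA cF y Ay.
have A0 : A !=set0 by exists y.
have cFA : {within A, continuous F}.
  by apply: continuous_in_subspaceT => x /set_mem /cF.
have [c Ac hc] := EVT_min_rV A0 (nsq_le_compact cA sA) cFA.
by exists c; [exact: set_mem|move=> x Ax; apply: hc; exact: mem_set].
Qed.

Lemma open_line (O : set 'rV[R]_3) x v : open O -> O x ->
  exists2 d : R, 0 < d & forall t, `|t| < d -> O (x + t *: v).
Proof.
move=> oO Ox.
have c : {for 0, continuous (fun t : R => x + t *: v)}.
  by move=> t; apply: cvgD; [exact: cvg_cst|apply: cvgZr_tmp; exact: cvg_id].
have /c/nbhs_ballP[d /= d0 hd] : nbhs (x + (0 : R) *: v) O.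
  by apply: open_nbhs_nbhs; rewrite scale0r addr0.
exists d => // t td; apply: (hd t).
by rewrite -ball_normE /ball_ /= sub0r normrN.
Qed.

Lemma strict_deriv_sum (f : 'rV[R]_3 -> R) x (D : 'I_3 -> R) :
  (forall i, strict_deriv f x (basis_vec R i) (D i)) ->
  forall v, strict_deriv f x v (\sum_i v ord0 i * D i).
Proof.
move=> h v; rewrite {1}(vec_basis v).
apply: (big_ind2 (fun v l => strict_deriv f x v l)).
- by move=> e e0; exists 1 => // y t _ _; rewrite scaler0 addr0 mulr0 !subrr normr0 mulr_ge0 // ltW.
- by move=> *; exact: strict_derivD.
- by move=> i _; exact: strict_derivZ.
Qed.

End Space.

(** * Solutions on the ball, extended by zero *)

Section BallSolution.
Context {R : realType}.
Implicit Types (x y n v : 'rV[R]_3) (i j : 'I_3).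

(** Extension by zero makes [U] continuous on the whole space, so that minima of expressions in [U]
    and its reflections can be taken without tracking domains. Derivatives are recorded in the
    strict sense because reflections turn coordinate axes into arbitrary directions. *)
Record ball_sol (k : R -> R) (mu : R) (U : 'rV[R]_3 -> R)
    (D : 'I_3 -> 'rV[R]_3 -> R) (DD : 'I_3 -> 'I_3 -> 'rV[R]_3 -> R) : Prop := {
  bs_cont : continuous U;
  bs_pos : forall x, nsq x < 1 -> 0 < U x;
  bs_out : forall x, 1 <= nsq x -> U x = 0;
  bs_D : forall x, nsq x < 1 -> forall v,
    strict_deriv U x v (\sum_i v ord0 i * D i x);
  bs_DD : forall x, nsq x < 1 -> forall i v,
    strict_deriv (D i) x v (\sum_j v ord0 j * DD i j x);
  bs_bound : exists2 M : R, 0 < M & forall i x, nsq x < 1 -> `|D i x| <= M;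
  bs_eq : forall x, nsq x < 1 ->
    - (\sum_i DD i i x) = k (enorm x) * U x ^+ 5 + mu * U x }.

Lemma closed_ball_closed : closed (@closed_unit_ball R).
Proof.
have -> : @closed_unit_ball R = nsq @^-1` [set t | t <= 1].
  by apply/funext => x; exact: closed_unit_ballE.
by apply: preimage_closed; [move=> x _; exact: nsq_continuous|exact: closed_le].
Qed.

Lemma extends_bounded (w : 'rV[R]_3 -> R) : extends_continuously w ->
  exists2 M, 0 < M & forall x, nsq x < 1 -> `|w x| <= M.
Proof.
move=> [z [cz wz]].
have cB : compact (@closed_unit_ball R).
  by apply: (@nsq_le_compact _ _ 1 closed_ball_closed) => x; rewrite closed_unit_ballE.
have [M [_ hM]] := compact_bounded (continuous_compact cz cB).
exists (`|M| + 1) => [|x x1]; first by rewrite ltr_wpDl.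
rewrite wz ?unit_ballE //; apply: hM.
  by rewrite (le_lt_trans (ler_norm _)) // ltrDl.
by exists x => //; rewrite closed_unit_ballE ltW.
Qed.

Lemma unit_ball_open : open (@unit_ball R).
Proof.
have -> : @unit_ball R = [set x | nsq x < 1].
  by apply/funext => x; exact: unit_ballE.
exact: open_nsq_lt.
Qed.

Lemma extends_continuous (w : 'rV[R]_3 -> R) : extends_continuously w ->
  forall x, nsq x < 1 -> {for x, continuous w}.
Proof.
move=> [z [cz wz]] x x1.
have : {within @unit_ball R, continuous w}.
  apply: (@subspace_eq_continuous _ _ _ z) => [y /set_mem /wz //|].
  apply: continuous_subspaceW cz => y.
  by rewrite unit_ballE closed_unit_ballE; exact: ltW.
rewrite continuous_open_subspace; last exact: unit_ball_open.
by apply; apply/mem_set; rewrite unit_ballE.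
Qed.

Lemma strict_deriv_open_eq (O : set 'rV[R]_3) (f g : 'rV[R]_3 -> R) x v l :
  open O -> O x -> (forall y, O y -> f y = g y) ->
  strict_deriv f x v l -> strict_deriv g x v l.
Proof.
move=> oO Ox fg hf e e0; have [d d0 hd] := hf e e0.
have /nbhs_ballP[r /= r0 hr] : nbhs x O by apply: open_nbhs_nbhs.
have v0 : 0 < `|v| + 1 by rewrite ltr_wpDl.
exists (Num.min d (Num.min (r / 2) (r / 2 / (`|v| + 1)))) => [|y t].
  by rewrite !lt_min d0 !divr_gt0.
rewrite !lt_min => /and3P[y1 y2 _] /and3P[t1 _ t2].
rewrite ltr_pdivlMr // in t2.
have Oy : O y by apply: hr; rewrite -ball_normE /ball_ /= distrC; lra.
rewrite -!fg //; first exact: hd.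
apply: hr; rewrite -ball_normE /ball_ /= distrC addrAC.
rewrite (le_lt_trans (ler_normD _ _)) // normrZ.
have -> : r = r / 2 + r / 2 by field.
rewrite ltrD // (le_lt_trans _ t2) // ler_wpM2l // lerDl //.
Qed.

Lemma classical_ball_sol (k : R -> R) (mu : R) (u : 'rV[R]_3 -> R) :
  classical_solution (fun x => k (enorm x)) mu u ->
  exists D DD, ball_sol k mu (fun x => if nsq x < 1 then u x else 0) D DD.
Proof.
move=> [[cu d1 d2 c1 c2] eu pu zu].
exists (fun i => partial i u), (fun i j => partial j (partial i u)).
pose O := @unit_ball R.
have OE x : O x = (nsq x < 1) :> Prop by exact: unit_ballE.
have nearO x (P : 'rV[R]_3 -> Prop) : nsq x < 1 -> (forall y, O y -> P y) ->
    \forall y \near x, P y.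
  move=> x1 hP; apply: filterS hP _.
  by apply: open_nbhs_nbhs; split; [exact: unit_ball_open|rewrite OE].
split.
- have : {within (@closed_unit_ball R `|` nsq @^-1` [set t | 1 <= t]),
    continuous (fun x => if nsq x < 1 then u x else 0)}.
    apply: withinU_continuous; first exact: closed_ball_closed.
    + by apply: preimage_closed; [move=> x _; exact: nsq_continuous|exact: closed_ge].
    + apply: subspace_eq_continuous cu => x /set_mem; rewrite closed_unit_ballE => x1.
      rewrite /from_subspace /=; case: (ltP (nsq x) 1) => // x2.
      by apply: zu; apply/unit_sphereE; apply/eqP; rewrite eq_le x1.
    + apply: (@subspace_eq_continuous _ _ _ (fun=> 0)) => [x /set_mem /= x1|].
        by rewrite /from_subspace /= ltNge x1.
      by move=> x; exact: cst_continuous.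
  rewrite (_ : _ `|` _ = setT); first by move=> h; apply/continuous_subspace_setT; exact: h.
  apply/seteqP; split=> // x _; have [x1|x1] := leP (nsq x) 1; [left|right] => //=.
    by rewrite closed_unit_ballE.
  exact: ltW.
- by move=> x x1; rewrite x1; apply: pu; rewrite unit_ballE.
- by move=> x; rewrite leNgt => /negbTE ->.
- move=> x x1; apply: strict_deriv_sum => i.
  apply: (@strict_deriv_open_eq O u); first exact: unit_ball_open.
  + by rewrite OE.
  + by move=> y; rewrite OE => ->.
  apply: strict_deriv_partial; first by apply: nearO => // y Oy; exact: d1.
  exact: (extends_continuous (c1 i)).
- move=> x x1 i; apply: strict_deriv_sum => j.
  apply: strict_deriv_partial; first by apply: nearO => // y Oy; exact: d2.
  exact: (extends_continuous (c2 i j)).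
- have [M0 M00 h0] := extends_bounded (c1 0).
  have [M1 M10 h1] := extends_bounded (c1 1).
  have [M2 M20 h2] := extends_bounded (c1 2).
  exists (M0 + M1 + M2) => [|i x x1]; first by rewrite !addr_gt0.
  case: i => -[|[|[|//]]] li.
  + have -> : Ordinal li = 0 by apply: val_inj.
    by have := h0 x x1; lra.
  + have -> : Ordinal li = 1 by apply: val_inj.
    by have := h1 x x1; lra.
  + have -> : Ordinal li = 2 by apply: val_inj.
    by have := h2 x x1; lra.
- move=> x x1; rewrite x1 -eu ?unit_ballE //.
Qed.

End BallSolution.

(** * Laplacians along coordinate lines and the minimum principle *)

Section LineLaplacian.
Context {R : realType}.
Implicit Types (x y n v : 'rV[R]_3) (i j : 'I_3) (F G : 'rV[R]_3 -> R).

(* Second derivatives along the coordinate lines through [x], summed to [L]; no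
   differentiability in other directions is involved. *)
Definition has_lap F x (L : R) := exists h1 : 'I_3 -> R -> R, exists h2 : 'I_3 -> R,
  exists2 d : R, 0 < d & [/\ forall i t, `|t| < d ->
      der (fun s => F (x + s *: basis_vec R i)) t (h1 i t),
    forall i, der (h1 i) 0 (h2 i) & L = \sum_i h2 i].

Lemma has_lapD F G x L M : has_lap F x L -> has_lap G x M ->
  has_lap (fun y => F y + G y) x (L + M).
Proof.
move=> [f1 [f2 [d d0 [hf hf2 ->]]]] [g1 [g2 [e e0 [hg hg2 ->]]]].
exists (fun i t => f1 i t + g1 i t), (fun i => f2 i + g2 i), (Num.min d e).
  by rewrite lt_min d0.
split=> [i t|i|]; last by rewrite big_split.
  by rewrite lt_min => /andP[? ?]; apply: derD; [exact: hf|exact: hg].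
exact: derD.
Qed.

Lemma has_lapZ F x L (a : R) : has_lap F x L -> has_lap (fun y => a * F y) x (a * L).
Proof.
move=> [f1 [f2 [d d0 [hf hf2 ->]]]].
exists (fun i t => a * f1 i t), (fun i => a * f2 i), d => //.
split=> [i t td|i|]; last by rewrite mulr_sumr.
  by apply: der_eq; [apply: derM; [exact: derC|exact: hf]|rewrite mul0r add0r].
by apply: der_eq; [apply: derM; [exact: derC|exact: hf2]|rewrite mul0r add0r].
Qed.

Lemma has_lapN F x L : has_lap F x L -> has_lap (fun y => - F y) x (- L).
Proof.
move=> /(@has_lapZ _ _ _ (-1)); rewrite mulN1r.
by rewrite (_ : (fun y => -1 * F y) = (fun y => - F y)) //; apply/funext => y; rewrite mulN1r.
Qed.

(** A negative second derivative would make [h1] negative just to the right of 0, and [h] would fall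
    below [h 0]. *)
Lemma der_second_min (h h1 : R -> R) (h2 d : R) : 0 < d ->
  (forall t, `|t| < d -> der h t (h1 t)) -> der h1 0 h2 ->
  (forall t, `|t| < d -> h 0 <= h t) -> 0 <= h2.
Proof.
move=> d0 hh hh1 hmin.
have h10 : h1 0 = 0.
  have i0 : (0 : R) \in `]- d, d[ by rewrite in_itv /= oppr_lt0 d0.
  have hab : - d <= d by lra.
  have hdv t : t \in `]- d, d[ -> derivable h t 1.
    by rewrite in_itv /= -ltr_norml => /hh [].
  have hm t : t \in `]- d, d[ -> h 0 <= h t.
    by rewrite in_itv /= -ltr_norml => /hmin.
  have [_ E] := derive1_at_min hab hdv i0 hm.
  have z : `|0 : R| < d by rewrite normr0.
  by have [_ <-] := hh 0 z.
rewrite leNgt; apply/negP => h20.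
have hc : s^-1 *: (h1 (s *: 1 + 0) - h1 0) @[s --> 0^'] --> h2.
  by case: hh1 => cv <-.
have h2n : 0 < - h2 by lra.
have [e e0 he] : exists2 e : R, 0 < e & forall t, 0 < t < e -> h1 t < 0.
  move/cvgrPdist_lt : hc => /(_ _ h2n); rewrite near_withinE => -[e /= e0 he].
  exists e => // t /andP[t0 te].
  have := he t; rewrite /= sub0r normrN gtr0_norm // => /(_ te (lt0r_neq0 t0)).
  rewrite h10 subr0 addr0 [t *: 1]mulr1 [_ *: _]mulrC ltr_norml => /andP[hq _].
  have : h1 t / t < 0 by lra.
  by rewrite pmulr_llt0 // invr_gt0.
pose t := Num.min d e / 2.
have t0 : 0 < t by rewrite divr_gt0 // lt_min d0.
have td : 2 * t <= d by rewrite mulrC divfK // ge_min lexx.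
have te : 2 * t <= e by rewrite mulrC divfK // ge_min lexx orbT.
have ht s : 0 <= s <= t -> `|s| < d by move=> /andP[s0 st]; rewrite ger0_norm //; lra.
have : h t < h 0.
  rewrite -ltrN2; apply: (@der_lt R (fun s => - h s) (fun s => - h1 s)) => // s.
    by move=> /ht /hh hs; apply: derN.
  by move=> /andP[s0 st]; rewrite oppr_gt0; apply: he; lra.
by rewrite ltNge hmin // ht // lexx ltW.
Qed.

Lemma has_lap_min F x L (O : set 'rV[R]_3) : open O -> O x ->
  (forall y, O y -> F x <= F y) -> has_lap F x L -> 0 <= L.
Proof.
move=> oO Ox hmin [f1 [f2 [d d0 [hf hf2 ->]]]]; apply: sumr_ge0 => i _.
have [e e0 he] := open_line (basis_vec R i) oO Ox.
apply: (@der_second_min (fun t => F (x + t *: basis_vec R i)) (f1 i) _ (Num.min d e)) => //.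
- by rewrite lt_min d0.
- by move=> t; rewrite lt_min => /andP[td _]; exact: hf.
- by move=> t; rewrite lt_min => /andP[_ /he Ot]; rewrite scale0r addr0; exact: hmin.
Qed.

Lemma has_lap_nsq x (q q1 q2 : R -> R) : (forall s, der q s (q1 s)) ->
  (forall s, der q1 s (q2 s)) ->
  has_lap (fun y => q (nsq y)) x (4 * nsq x * q2 (nsq x) + 6 * q1 (nsq x)).
Proof.
move=> hq hq1.
have e1 i : nsq (basis_vec R i) = 1.
  rewrite /nsq (bigD1 i) //= basis_vecE eqxx expr1n big1 ?addr0 // => j ji.
  by rewrite basis_vecE eq_sym (negbTE ji) expr0n.
have e2 i : dot x (basis_vec R i) = x ord0 i.
  rewrite /dot (bigD1 i) //= basis_vecE eqxx mulr1 big1 ?addr0 // => j ji.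
  by rewrite basis_vecE eq_sym (negbTE ji) mulr0.
pose Q i (t : R) := nsq x + 2 * t * x ord0 i + t ^+ 2.
have dQ i t : der (Q i) t (2 * (x ord0 i + t)) by rewrite /Q; dsolve => /=; ring.
exists (fun i t => q1 (Q i t) * (2 * (x ord0 i + t))).
exists (fun i => q2 (nsq x) * (2 * x ord0 i) ^+ 2 + q1 (nsq x) * 2).
exists 1 => //; split=> [i t _|i|].
- rewrite (_ : (fun s => _) = fun s => q (Q i s)); first exact: (derO (dQ i t) (hq _)).
  by apply/funext => s; rewrite nsqD e1 e2 mulr1.
- have h := derO (dQ i 0) (hq1 (Q i 0)).
  dsolve; rewrite /= /Q; set a := nsq x + _ + _.
  have -> : a = nsq x by rewrite /a; ring.
  by ring.
- by rewrite sum3 {1}/nsq sum3; ring.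
Qed.

Lemma has_lap_dot x n (q q1 q2 : R -> R) (a : R) : (forall s, der q s (q1 s)) ->
  (forall s, der q1 s (q2 s)) ->
  has_lap (fun y => q (dot y n - a)) x (nsq n * q2 (dot x n - a)).
Proof.
move=> hq hq1.
have e2 i : dot (basis_vec R i) n = n ord0 i.
  rewrite /dot (bigD1 i) //= basis_vecE eqxx mul1r big1 ?addr0 // => j ji.
  by rewrite basis_vecE eq_sym (negbTE ji) mul0r.
pose Q i (t : R) := dot x n + t * n ord0 i - a.
have dQ i t : der (Q i) t (n ord0 i) by rewrite /Q; dsolve => /=; ring.
exists (fun i t => q1 (Q i t) * n ord0 i).
exists (fun i => q2 (dot x n - a) * n ord0 i ^+ 2).
exists 1 => //; split=> [i t _|i|].
- rewrite (_ : (fun s => _) = fun s => q (Q i s)); first exact: (derO (dQ i t) (hq _)).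
  by apply/funext => s; rewrite dotD e2.
- have h := derO (dQ i 0) (hq1 (Q i 0)).
  dsolve; rewrite /= /Q; set b := dot x n + _ - _.
  have -> : b = dot x n - a by rewrite /b; ring.
  by ring.
- by rewrite sum3 /nsq sum3; ring.
Qed.

Variables (k : R -> R) (mu : R) (U : 'rV[R]_3 -> R).
Variables (D : 'I_3 -> 'rV[R]_3 -> R) (DD : 'I_3 -> 'I_3 -> 'rV[R]_3 -> R).
Hypothesis bs : ball_sol k mu U D DD.

Lemma bs_der x v t : nsq (x + t *: v) < 1 ->
  der (fun s => U (x + s *: v)) t (\sum_i v ord0 i * D i (x + t *: v)).
Proof.
move=> h; apply: der_shift; have := strict_deriv_der (bs_D bs h v).
suff -> : (fun s => U (x + t *: v + s *: v)) = (fun s => U (x + (s + t) *: v)) by [].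
by apply/funext => s; rewrite -addrA -scalerDl [t + s]addrC.
Qed.

Lemma bs_der2 x v : nsq x < 1 ->
  der (fun s => \sum_i v ord0 i * D i (x + s *: v)) 0
    (\sum_i v ord0 i * \sum_j v ord0 j * DD i j x).
Proof.
move=> x1; have h i := strict_deriv_der (bs_DD bs x1 i v).
rewrite sum3 (_ : (fun s => _) = fun s => v ord0 0 * D 0 (x + s *: v) +
  v ord0 1 * D 1 (x + s *: v) + v ord0 2 * D 2 (x + s *: v));
  last by apply/funext => s; rewrite sum3.
have h0 := h 0; have h1 := h 1; have h2 := h 2.
by dsolve; rewrite !mul0r !add0r.
Qed.

Definition refl n (lam : R) x : 'rV[R]_3 := x - (2 * (dot x n - lam)) *: n.

Lemma nsq_refl n lam x : nsq n = 1 ->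
  nsq (refl n lam x) = nsq x - 4 * lam * (dot x n - lam).
Proof. by move=> n1; rewrite /refl -scaleNr nsqD n1; ring. Qed.

Lemma refl_line n lam x v t :
  refl n lam (x + t *: v) = refl n lam x + t *: (v - (2 * dot v n) *: n).
Proof.
by apply/rowP => i; rewrite /refl dotD !mxE; ring.
Qed.

Lemma sum_basis i (f : 'I_3 -> R) : \sum_j basis_vec R i ord0 j * f j = f i.
Proof.
rewrite (bigD1 i) //= basis_vecE eqxx mul1r big1 ?addr0 // => j ji.
by rewrite basis_vecE eq_sym (negbTE ji) mul0r.
Qed.

Lemma has_lap_U x : nsq x < 1 -> has_lap U x (- (k (enorm x) * U x ^+ 5 + mu * U x)).
Proof.
move=> x1.
exists (fun i t => \sum_j basis_vec R i ord0 j * D j (x + t *: basis_vec R i)).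
exists (fun i => \sum_l basis_vec R i ord0 l * \sum_j basis_vec R i ord0 j * DD l j x).
have hd i := open_line (basis_vec R i) (@open_nsq_lt R 1) x1.
have [d0 d00 h0] := hd 0; have [d1 d10 h1] := hd 1; have [d2 d20 h2] := hd 2.
exists (Num.min d0 (Num.min d1 d2)); first by rewrite !lt_min d00 d10.
split=> [i t|i|]; last 1 first.
- rewrite -(bs_eq bs x1) opprK; apply: eq_bigr => i _.
  by rewrite !sum_basis.
- rewrite !lt_min => /and3P[t0 t1 t2]; apply: bs_der.
  case: i => -[|[|[|//]]] li.
  + by have -> : Ordinal li = 0 by [apply: val_inj]; exact: h0.
  + by have -> : Ordinal li = 1 by [apply: val_inj]; exact: h1.
  + by have -> : Ordinal li = 2 by [apply: val_inj]; exact: h2.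
- exact: bs_der2.
Qed.

Lemma has_lap_refl n lam x : nsq n = 1 -> nsq (refl n lam x) < 1 ->
  has_lap (fun y => U (refl n lam y)) x
   (- (k (enorm (refl n lam x)) * U (refl n lam x) ^+ 5 + mu * U (refl n lam x))).
Proof.
move=> n1; set y := refl n lam x => y1.
pose w i := basis_vec R i - (2 * dot (basis_vec R i) n) *: n.
exists (fun i t => \sum_j w i ord0 j * D j (y + t *: w i)).
exists (fun i => \sum_l w i ord0 l * \sum_j w i ord0 j * DD l j y).
have hd i := open_line (w i) (@open_nsq_lt R 1) y1.
have [d0 d00 h0] := hd 0; have [d1 d10 h1] := hd 1; have [d2 d20 h2] := hd 2.
exists (Num.min d0 (Num.min d1 d2)); first by rewrite !lt_min d00 d10.
split=> [i t|i|]; last 1 first.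
- rewrite -(bs_eq bs y1) opprK.
  have e2 i : dot (basis_vec R i) n = n ord0 i.
    rewrite /dot (bigD1 i) //= basis_vecE eqxx mul1r big1 ?addr0 // => j ji.
    by rewrite basis_vecE eq_sym (negbTE ji) mul0r.
  have we i j : w i ord0 j = (i == j)%:R - 2 * n ord0 i * n ord0 j.
    by rewrite /w !mxE eqxx /= e2 eq_sym.
  rewrite !sum3 !we /= -/(nsq n); move: n1; rewrite /nsq sum3.
  move: (n ord0 0) (n ord0 1) (n ord0 2) => a b c e.
  (* The trace of the Hessian conjugated by [I - 2 n n^T] is the trace plus a multiple of
     [|n|^2 - 1]; symmetry of the Hessian does not enter this identity. *)
  transitivity (DD 0 0 y + DD 1 1 y + DD 2 2 y +
    4 * (a ^+ 2 + b ^+ 2 + c ^+ 2 - 1) *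
    (a * (a * DD 0 0 y + b * DD 0 1 y + c * DD 0 2 y) +
     b * (a * DD 1 0 y + b * DD 1 1 y + c * DD 1 2 y) +
     c * (a * DD 2 0 y + b * DD 2 1 y + c * DD 2 2 y))); last by ring.
  by rewrite e; ring.
- rewrite !lt_min => /and3P[t0 t1 t2].
  rewrite (_ : (fun s => _) = fun s => U (y + s *: w i)); last first.
    by apply/funext => s; rewrite refl_line.
  apply: bs_der; case: i => -[|[|[|//]]] li.
  + by have -> : Ordinal li = 0 by [apply: val_inj]; exact: h0.
  + by have -> : Ordinal li = 1 by [apply: val_inj]; exact: h1.
  + by have -> : Ordinal li = 2 by [apply: val_inj]; exact: h2.
- exact: bs_der2.
Qed.

End LineLaplacian.

(** * Comparison of a solution with its reflections *)

Section MovingPlanes.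
Context {R : realType}.
Implicit Types (x y n v : 'rV[R]_3) (i j : 'I_3) (lam : R).

Variables (k : R -> R) (mu K0 : R) (U : 'rV[R]_3 -> R).
Variables (D : 'I_3 -> 'rV[R]_3 -> R) (DD : 'I_3 -> 'I_3 -> 'rV[R]_3 -> R).
Hypothesis bs : ball_sol k mu U D DD.
Hypothesis mu0 : 0 < mu.
Hypothesis k_bound : forall t, 0 <= t <= 1 -> 0 <= k t <= K0.
Hypothesis k_noninc : forall s t, 0 <= s -> s <= t -> t <= 1 -> k t <= k s.

Lemma bs_nonneg x : 0 <= U x.
Proof.
have [x1|x1] := ltP (nsq x) 1; first exact: ltW (bs_pos bs x1).
by rewrite (bs_out bs x1).
Qed.

Lemma ct_U x : ct U x. Proof. exact: bs_cont bs x. Qed.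
Lemma ct_nsq x : ct (@nsq R) x. Proof. exact: nsq_continuous. Qed.
Lemma ct_dot n x : ct (dot ^~ n) x. Proof. exact: dot_continuous. Qed.

Lemma ct_refl n lam x : ct (fun y => U (refl n lam y)) x.
Proof.
apply: (@continuous_comp _ _ _ (refl n lam) U); last exact: bs_cont bs _.
suff : (fun y => y - (2 * (dot y n - lam)) *: n) @ x -->
  x - (2 * (dot x n - lam)) *: n by [].
apply: (@cvgB _ _ _ (nbhs x) (nbhs_filter x) id (fun y => (2 * (dot y n - lam)) *: n)).
  by move=> A.
apply: cvgZr_tmp.
have c : ct (fun y => 2 * (dot y n - lam)) x by have c := @ct_dot n x; ctauto.
exact: c.
Qed.

Lemma closed_le_fun (F G : 'rV[R]_3 -> R) : continuous F -> continuous G ->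
  closed [set x | F x <= G x].
Proof.
move=> cF cG.
have -> : [set x | F x <= G x] = (fun x => F x - G x) @^-1` [set t | t <= 0].
  by apply/funext => x /=; rewrite subr_le0.
by apply: preimage_closed => [x _|]; [exact: (ctD (cF x) (ctN (cG x)))|exact: closed_le].
Qed.

Lemma open_lt_fun (F G : 'rV[R]_3 -> R) : continuous F -> continuous G ->
  open [set x | F x < G x].
Proof.
move=> cF cG.
have -> : [set x | F x < G x] = (fun x => F x - G x) @^-1` [set t | t < 0].
  by apply/funext => x /=; rewrite subr_lt0.
by apply: open_comp => [x _|]; [exact: (ctD (cF x) (ctN (cG x)))|exact: open_lt].
Qed.

Lemma bs_max : exists2 M, 0 < M & forall x, U x <= M.
Proof.
have cA : closed [set x : 'rV[R]_3 | nsq x <= 1].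
  by apply: closed_le_fun; [exact: nsq_continuous|exact: cst_continuous].
have c0 : nsq (0 : 'rV[R]_3) <= 1 by rewrite /nsq sum3 !mxE; lra.
have [||c c1 hc] := @continuous_EVT_min R _ (fun x => - U x) 1 cA _ _ 0 c0.
- by [].
- by move=> x _; apply: ctN; exact: ct_U.
exists (U c + 1) => [|x]; first by rewrite ltr_wpDl // bs_nonneg.
have [x1|x1] := leP (nsq x) 1.
  by have := hc x x1; rewrite lerN2; lra.
by rewrite (bs_out bs (ltW x1)) addr_ge0 // bs_nonneg.
Qed.

Lemma enorm01 x : nsq x <= 1 -> 0 <= enorm x <= 1.
Proof.
by move=> h; rewrite enorm_ge0 /=; have := closed_unit_ballE x; rewrite /closed_unit_ball /= => ->.
Qed.

(* [s + 2 s^2] with [s = 1 - |x|^2] is subharmonic where [|x|^2 >= 4/5]. *)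
Lemma boundary_growth : exists2 c, 0 < c & forall x, nsq x <= 1 -> c * (1 - nsq x) <= U x.
Proof.
have cn := @nsq_continuous R.
have cc (a : R) : continuous (fun _ : 'rV[R]_3 => a) by exact: cst_continuous.
have n0 : nsq (0 : 'rV[R]_3) = 0 by rewrite /nsq sum3 !mxE; ring.
have [||z z1 hz] := @continuous_EVT_min R [set x | nsq x <= 4/5] U 1
   (closed_le_fun cn (cc _)) _ (fun x _ => @ct_U x) 0.
- by move=> x /=; lra.
- by rewrite /= n0; lra.
have m0 : 0 < U z by apply: (bs_pos bs); rewrite /= in z1; lra.
(* The barrier vanishes on the sphere, equals [7/25 U z] where [nsq = 4/5], hence lies below [U]
   there, and its Laplacian [U z (40 s - 30)] is positive for [s >= 4/5]. *)
pose q (s : R) := U z * ((1 - s) + 2 * (1 - s) ^+ 2).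
have q1 s : der q s (U z * (-5 + 4 * s)) by rewrite /q; dsolve => /=; ring.
have q2 s : der (fun s => U z * (-5 + 4 * s)) s (U z * 4) by dsolve => /=; ring.
pose A := [set x : 'rV[R]_3 | 4/5 <= nsq x] `&` [set x | nsq x <= 1].
have F0 x : A x -> 0 <= U x - q (nsq x).
  move=> Ax; rewrite leNgt; apply/negP => xn.
  have cA : closed A by apply: closedI; apply: closed_le_fun.
  have [||c [c4 c1] hc] := @continuous_EVT_min R A (fun x => U x - q (nsq x)) 1 cA _ _ x Ax.
  - by move=> y [].
  - move=> y _; have h1 := @ct_U y; have h2 := @ct_nsq y.
    by suff: ct (fun x => U x - q (nsq x)) y by []; rewrite /q; ctauto.
  rewrite /= in c4 c1.
  have cneg : U c - q (nsq c) < 0 by exact: le_lt_trans (hc _ Ax) xn.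
  have c1' : nsq c < 1.
    rewrite lt_neqAle c1 andbT; apply/eqP => e.
    by have := bs_nonneg c; move: cneg; rewrite /q e; lra.
  have c4' : 4/5 < nsq c.
    rewrite lt_neqAle c4 andbT; apply/eqP => e.
    by have := hz c; rewrite /= -e; move: cneg; rewrite /q -e => h /(_ (lexx _)); lra.
  have oO : open ([set x : 'rV[R]_3 | 4/5 < nsq x] `&` [set x | nsq x < 1]).
    by apply: openI; apply: open_lt_fun.
  have hO y : ([set x : 'rV[R]_3 | 4/5 < nsq x] `&` [set x | nsq x < 1]) y ->
      U c - q (nsq c) <= U y - q (nsq y).
    by move=> [y4 y1]; apply: hc; split; exact: ltW.
  have := has_lap_min oO (conj c4' c1') hO
    (has_lapD (has_lap_U bs c1') (has_lapN (has_lap_nsq c q1 q2))).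
  have /andP[kc _] := k_bound (enorm01 c1).
  have : 0 <= k (enorm c) * U c ^+ 5 + mu * U c.
    by rewrite addr_ge0 // mulr_ge0 ?exprn_ge0 ?bs_nonneg // ltW.
  nra.
exists (U z) => // x x1; have [x4|x4] := leP (nsq x) (4/5).
  have := hz x x4; have := nsq_ge0 x; nra.
have := F0 x (conj (ltW x4) x1); rewrite /q.
have : 0 <= (1 - nsq x) ^+ 2 by rewrite sqr_ge0.
by nra.
Qed.

Definition good n lam := forall x, nsq x <= 1 -> 0 <= dot x n - lam ->
  U x <= U (refl n lam x).

Lemma pow5_lip (a b M : R) : 0 <= a -> a <= b -> b <= M ->
  b ^+ 5 - a ^+ 5 <= 5 * M ^+ 4 * (b - a).
Proof.
move=> a0 ab bM; have b0 := le_trans a0 ab; have M0 := le_trans b0 bM.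
have bb : b ^+ 4 <= M ^+ 4 by rewrite lerXn2r // nnegrE.
have h (p q : nat) : (p + q = 4)%N -> b ^+ p * a ^+ q <= M ^+ 4.
  move=> <-; rewrite exprD; apply: ler_pM; rewrite ?exprn_ge0 //.
    by rewrite lerXn2r // nnegrE.
  by rewrite lerXn2r ?nnegrE // (le_trans ab).
have -> : b ^+ 5 - a ^+ 5 = (b ^+ 4 * a ^+ 0 + b ^+ 3 * a ^+ 1 + b ^+ 2 * a ^+ 2 +
  b ^+ 1 * a ^+ 3 + b ^+ 0 * a ^+ 4) * (b - a) by ring.
rewrite ler_wpM2r ?subr_ge0 //.
have h0 := h 4 0 erefl; have h1 := h 3 1 erefl; have h2 := h 2 2 erefl.
have h3 := h 1 3 erefl; have h4 := h 0 4 erefl.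
lra.
Qed.

Lemma refl_fix n lam x : dot x n - lam = 0 -> refl n lam x = x.
Proof. by rewrite /refl => ->; rewrite mulr0 scale0r subr0. Qed.

Lemma ct_tau n lam x : ct (fun y => dot y n - lam) x.
Proof. by have c := @ct_dot n x; ctauto. Qed.

(* In a cap of width [d] the supersolution [2 - (t/d)^2] absorbs the zeroth order
   term of the equation for the difference [U (refl x) - U x]. *)
Lemma narrow_cap : exists2 d, 0 < d & forall n lam, nsq n = 1 -> 0 <= lam ->
  (forall x, nsq x <= 1 -> d <= dot x n - lam -> U x <= U (refl n lam x)) ->
  good n lam.
Proof.
have [M M0 hM] := bs_max.
have K00 : 0 <= K0 by have := k_bound (_ : 0 <= 0 <= 1); rewrite lexx ler01 => /(_ isT) /andP[/le_trans]; apply.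
(* Lipschitz constant on [[0, M]] of the right-hand side of the equation. The cap width [(1 + C)^-1]
   makes [C d^2 < 1]. *)
pose C := 5 * K0 * M ^+ 4 + mu.
have M4 : 0 <= M ^+ 4 by rewrite exprn_ge0 // ltW.
have C0 : 0 < C by rewrite /C ltr_wpDl // mulr_ge0 // mulr_ge0.
exists (1 + C)^-1; first by rewrite invr_gt0 addr_gt0.
set d := (1 + C)^-1; have d0 : 0 < d by rewrite invr_gt0 addr_gt0.
have Cd : C * d ^+ 2 < 1.
  have dC : d * (1 + C) = 1 by rewrite mulVf // gt_eqF // addr_gt0.
  have -> : C * d ^+ 2 = d * (1 + C) * d - d ^+ 2 by ring.
  by rewrite dC mul1r; have := sqr_ge0 (d - 1/2); lra.
move=> n lam n1 lam0 far x x1 tx; rewrite leNgt; apply/negP => wx.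
have xd : dot x n - lam < d by rewrite ltNge; apply/negP => /(far x x1); rewrite leNgt wx.
pose w y := U (refl n lam y) - U y.
pose ze y := 2 - ((dot y n - lam) / d) ^+ 2.
pose A := ([set y : 'rV[R]_3 | nsq y <= 1] `&` [set y | 0 <= dot y n - lam]) `&`
  [set y | dot y n - lam <= d].
have ctau := @ct_tau n lam.
have cA : closed A.
  by do 2 (apply: closedI; [|apply: closed_le_fun; rewrite -/(continuous _);
     first [exact: cst_continuous|exact: ctau]]);
     apply: closed_le_fun; [exact: nsq_continuous|exact: cst_continuous].
have zeA y : A y -> 1 <= ze y <= 2.
  move=> [[_ /= t0] /= td]; rewrite /ze.
  have h : 0 <= (dot y n - lam) / d <= 1.
    by rewrite divr_ge0 ?(ltW d0) //= ler_pdivrMr // mul1r.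
  by move: h; set q := _ / d => /andP[q0 q1]; apply/andP; split; nra.
have cw y : ct w y by have h1 := @ct_U y; have h2 := @ct_refl n lam y; rewrite /w; ctauto.
have cze y : ct ze y by have h1 := @ct_dot n y; rewrite /ze; ctauto.
have Ax : A x := conj (conj x1 tx) (ltW xd).
have [||c Ac hc] := @continuous_EVT_min R A (fun y => w y / ze y) 1 cA _ _ x Ax.
- by move=> y [[]].
- move=> y /zeA /andP[z1 _]; have h1 := cw y; have h2 := cze y.
  suff: ct (fun x => w x / ze x) y by [].
  by ctauto; rewrite gt_eqF //; lra.
(* [w - m ze] attains its minimum 0 at [c], which turns out to be an interior point, so its
   Laplacian there is nonnegative. As [ze <= 2], this would force [1 / d^2 <= C]. *)
pose m := w c / ze c.
have m0 : m < 0.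
  apply: le_lt_trans (hc x Ax) _; have /andP[z1 _] := zeA x Ax.
  by rewrite pmulr_llt0 ?invr_gt0 ?subr_lt0 //; lra.
have /andP[zc1 zc2] := zeA c Ac.
have wc : w c = m * ze c by rewrite /m divfK // gt_eqF //; lra.
have wA y : A y -> m * ze y <= w y.
  by move=> Ay; have /andP[z1 _] := zeA y Ay; rewrite -ler_pdivlMr ?hc //; lra.
have [[c1 /= tc] /= td] := Ac; rewrite /= in c1.
have wc0 : w c < 0 by rewrite wc; nra.
have c1' : nsq c < 1.
  rewrite lt_neqAle c1 andbT; apply/eqP => e.
  move: wc0; rewrite /w (bs_out bs (_ : 1 <= nsq c)) ?e // subr0.
  by rewrite ltNge bs_nonneg.
have tc' : 0 < dot c n - lam.
  rewrite lt_neqAle tc andbT; apply/eqP => /esym e.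
  by move: wc0; rewrite /w refl_fix // subrr ltxx.
have td' : dot c n - lam < d.
  by rewrite ltNge; apply/negP => /(far c c1); rewrite -subr_ge0 -/(w c) leNgt wc0.
have r1 : nsq (refl n lam c) <= nsq c.
  by rewrite nsq_refl // lerBlDr lerDl mulr_ge0 // mulr_ge0.
pose O := ([set y : 'rV[R]_3 | nsq y < 1] `&` [set y | 0 < dot y n - lam]) `&`
  [set y | dot y n - lam < d].
have oO : open O.
  by do 2 (apply: openI; [|apply: open_lt_fun;
     first [exact: cst_continuous|exact: ctau]]);
     apply: open_lt_fun; [exact: nsq_continuous|exact: cst_continuous].
have Oc : O c by [].
have hO y : O y -> w c + - (m * ze c) <= w y + - (m * ze y).
  move=> [[y1 y2] y3]; rewrite -wc subrr subr_ge0; apply: wA.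
  by split=> /=; [split; exact: ltW|exact: ltW].
have q1 s : der (fun s => 2 - (s / d) ^+ 2) s (- 2 * s / d ^+ 2).
  by dsolve => /=; field; rewrite gt_eqF.
have q2 s : der (fun s => - 2 * s / d ^+ 2) s (- 2 / d ^+ 2).
  by dsolve => /=; field; rewrite gt_eqF.
have := has_lap_min oO Oc hO (has_lapD (has_lapD
  (has_lap_refl bs n1 (le_lt_trans r1 c1')) (has_lapN (has_lap_U bs c1')))
  (has_lapN (has_lapZ m (has_lap_dot c n lam q1 q2)))).
rewrite n1 mul1r.
(* For [lam >= 0] the reflection moves points of the cap towards the centre, where the nonincreasing
   coefficient is at least as large. *)
have ek : k (enorm c) <= k (enorm (refl n lam c)).
  apply: k_noninc; rewrite ?enorm_ge0 //; last by have /andP[] := enorm01 c1.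
  by rewrite -(ler_pXn2r (_ : 0 < 2)%N) ?nnegrE ?enorm_ge0 // !sqr_enorm.
have /andP[k0 kK] := k_bound (enorm01 c1).
move: wc0 wc hM r1; rewrite /w; set a := U (refl n lam c); set b := U c.
move=> wc0 wc hM _.
have a0 : 0 <= a by exact: bs_nonneg.
have ab : a <= b by lra.
have h5 := pow5_lip a0 ab (hM c).
have a5 : 0 <= a ^+ 5 by rewrite exprn_ge0.
have b5 : a ^+ 5 <= b ^+ 5 by rewrite lerXn2r // nnegrE (le_trans a0).
have i1 : k (enorm c) * b ^+ 5 - k (enorm (refl n lam c)) * a ^+ 5 <= K0 * (5 * M ^+ 4 * (b - a)).
  apply: (@le_trans _ _ (k (enorm c) * (b ^+ 5 - a ^+ 5))).
    by rewrite mulrBr lerD2l lerN2 ler_wpM2r.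
  by apply: ler_pM => //; rewrite subr_ge0.
have i2 : b - a <= - m * 2 by rewrite -opprB wc mulNr; nra.
have i3 : C * (b - a) <= C * (- m * 2) by rewrite ler_wpM2l // ltW.
have dd : 0 < d ^+ 2 by rewrite exprn_gt0.
have i4 : - m * 2 / d ^+ 2 <= C * (- m * 2) -> False.
  rewrite ler_pdivrMr // => h; have : 0 < - m * 2 by lra.
  by nra.
move=> h; apply: i4; apply: le_trans i3.
have -> : - m * 2 / d ^+ 2 = m * (- 2 / d ^+ 2) by ring.
by rewrite /C; lra.
Qed.

(** A quantitative Hopf lemma. On the sphere [U x = 0] and [1 - nsq (refl n lam x) = 4 lam (dot x n
    - lam)], so the growth bound is the claim itself; inside the cap [good] makes the difference
    superharmonic. The auxiliary term [e (1 - nsq x)] makes the inequality strict at a minimum. *)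
Lemma good_linear c n lam : 0 < c -> (forall x, nsq x <= 1 -> c * (1 - nsq x) <= U x) ->
  nsq n = 1 -> 0 <= lam -> good n lam ->
  forall x, nsq x <= 1 -> 0 <= dot x n - lam ->
  4 * c * lam * (dot x n - lam) <= U (refl n lam x) - U x.
Proof.
move=> c0 growth n1 lam0 gd x x1 tx.
suff H e : 0 < e -> 0 <= (U (refl n lam x) - U x) + (- (4 * c * lam * (dot x n - lam)))
    + e * (1 - nsq x).
  rewrite leNgt; apply/negP => h.
  pose e := (4 * c * lam * (dot x n - lam) - (U (refl n lam x) - U x)) / 2.
  have e0 : 0 < e by rewrite divr_gt0 // subr_gt0.
  have := H e e0; have : e * (1 - nsq x) <= e.
    by rewrite ler_piMr ?(ltW e0) // lerBlDr lerDl nsq_ge0.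
  by rewrite /e; lra.
move=> e0; rewrite leNgt; apply/negP => xn.
pose F y := (U (refl n lam y) - U y) + (- (4 * c * lam * (dot y n - lam)))
    + e * (1 - nsq y).
pose A := [set y : 'rV[R]_3 | nsq y <= 1] `&` [set y | 0 <= dot y n - lam].
have ctau := @ct_tau n lam.
have cA : closed A.
  by apply: closedI; apply: closed_le_fun;
    first [exact: cst_continuous|exact: ctau|exact: nsq_continuous].
have cF y : ct F y.
  have h1 := @ct_U y; have h2 := @ct_refl n lam y; have h3 := @ct_dot n y.
  by have h4 := @ct_nsq y; rewrite /F; ctauto.
have [|z [z1 tz] hz] := @continuous_EVT_min R A F 1 cA _ (fun y _ => cF y) x (conj x1 tx).
- by move=> y [].
rewrite /= in z1 tz.
have Fz : F z < 0 by apply: le_lt_trans (hz x (conj x1 tx)) xn.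
have z1' : nsq z < 1.
  rewrite lt_neqAle z1 andbT; apply/eqP => e1.
  move: Fz; rewrite /F (bs_out bs (_ : 1 <= nsq z)) ?e1 // subr0 subrr mulr0 addr0.
  have := growth (refl n lam z); rewrite nsq_refl // e1.
  have : 0 <= 4 * lam * (dot z n - lam) by rewrite !mulr_ge0.
  by move=> h /(_ _); rewrite lerBlDr lerDl => /(_ h); lra.
have tz' : 0 < dot z n - lam.
  rewrite lt_neqAle tz andbT; apply/eqP => /esym e1.
  move: Fz; rewrite /F refl_fix // subrr e1 mulr0 oppr0 !add0r ltNge.
  by rewrite mulr_ge0 // ?(ltW e0) // subr_ge0.
have r1 : nsq (refl n lam z) <= nsq z.
  by rewrite nsq_refl // lerBlDr lerDl mulr_ge0 // mulr_ge0.
pose O := [set y : 'rV[R]_3 | nsq y < 1] `&` [set y | 0 < dot y n - lam].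
have oO : open O.
  by apply: openI; apply: open_lt_fun;
    first [exact: cst_continuous|exact: ctau|exact: nsq_continuous].
have hO y : O y -> F z <= F y.
  by move=> [y1 y2]; apply: hz; split; exact: ltW.
have q1 s : der (fun s : R => - (4 * c * lam * s)) s (- (4 * c * lam)).
  by dsolve => /=; ring.
have q2 s : der (fun s : R => - (4 * c * lam)) s 0 by exact: derC.
have p1 s : der (fun s : R => e * (1 - s)) s (- e) by dsolve => /=; ring.
have p2 s : der (fun s : R => - e) s 0 by exact: derC.
have := has_lap_min oO (conj z1' tz') hO (has_lapD (has_lapD (has_lapD
  (has_lap_refl bs n1 (le_lt_trans r1 z1')) (has_lapN (has_lap_U bs z1')))
  (has_lap_dot z n lam q1 q2)) (has_lap_nsq z p1 p2)).
rewrite !mulr0 add0r addr0.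
have ek : k (enorm z) <= k (enorm (refl n lam z)).
  apply: k_noninc; rewrite ?enorm_ge0 //; last by have /andP[] := enorm01 z1.
  by rewrite -(ler_pXn2r (_ : 0 < 2)%N) ?nnegrE ?enorm_ge0 // !sqr_enorm.
have /andP[k0 kK] := k_bound (enorm01 z1).
have := gd z z1 tz; set a := U (refl n lam z); set b := U z => ba.
have b0 : 0 <= b by exact: bs_nonneg.
have b5 : 0 <= b ^+ 5 by rewrite exprn_ge0.
have a5 : b ^+ 5 <= a ^+ 5 by rewrite lerXn2r // nnegrE (le_trans b0).
have : k (enorm z) * b ^+ 5 <= k (enorm (refl n lam z)) * a ^+ 5 by apply: ler_pM.
have : mu * b <= mu * a by rewrite ler_wpM2l // ltW.
lra.
Qed.

Lemma dot_sqr_le n x : nsq n = 1 -> dot x n ^+ 2 <= nsq x.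
Proof.
move=> n1; have := nsq_ge0 (x + (- dot x n) *: n).
by rewrite nsqD n1; lra.
Qed.

(** Moving the plane from [lam + s] to [lam] shifts the reflected point by [2 s] along [n], which
    costs at most [6 M1 s], the three partial derivatives being bounded by [M1]. At distance [d]
    from the plane the linear gain is at least [2 c lam d]. *)
Lemma good_step c d M1 n lam s : nsq n = 1 -> 0 < c -> 0 < d -> 0 < s -> 2 * s <= d ->
  0 < lam -> 3 * M1 * s <= c * lam * d ->
  (forall x, nsq x <= 1 -> c * (1 - nsq x) <= U x) ->
  (forall i x, nsq x < 1 -> `|D i x| <= M1) ->
  good n (lam + s) ->
  forall x, nsq x <= 1 -> d <= dot x n - lam -> U x <= U (refl n lam x).
Proof.
move=> n1 c0 d0 s0 sd l0 hs growth hM gd x x1 tx.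
have ls0 : 0 <= lam + s by lra.
have t' : d / 2 <= dot x n - (lam + s) by lra.
have t'0 : 0 <= dot x n - (lam + s) by lra.
have := good_linear c0 growth n1 ls0 gd x1 t'0.
set y := refl n (lam + s) x => lin.
have ey r : y + r *: n = refl n (lam + s + r / 2) x.
  by apply/rowP => i; rewrite /y /refl !mxE; field.
have yB r : - (2 * s) <= r <= 0 -> nsq (y + r *: n) < 1.
  move=> /andP[r1 r2]; rewrite ey nsq_refl //.
  have : 0 < 4 * (lam + s + r / 2) * (dot x n - (lam + s + r / 2)).
    by rewrite !mulr_gt0 //; lra.
  lra.
have dn r : - (2 * s) <= r <= 0 ->
    der (fun r => U (y + r *: n)) r (\sum_i n ord0 i * D i (y + r *: n)).
  by move=> /yB h; exact: (bs_der bs h).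
have s20 : - (2 * s) < 0 by lra.
have [z /andP[z1 z2]] := mvt s20 dn.
rewrite scale0r addr0 ey.
have -> : lam + s + - (2 * s) / 2 = lam by field.
have zB : nsq (y + z *: n) < 1 by apply: yB; rewrite !ltW.
have nD i : n ord0 i * D i (y + z *: n) <= M1.
  apply: le_trans (hM i _ zB); apply: le_trans (ler_norm _) _.
  rewrite normrM ler_piMl // -(ler_pXn2r (_ : 0 < 2)%N) ?nnegrE // expr1n.
  rewrite real_normK ?num_real // -n1 /nsq (bigD1 i) //= lerDl.
  by apply: sumr_ge0 => j _; rewrite sqr_ge0.
rewrite sum3; have := nD 0; have := nD 1; have := nD 2.
move: (_ * D 0 _) (_ * D 1 _) (_ * D 2 _) => a2 a1 a0 h0 h1 h2 E.
have E2 : U y - U (refl n lam x) <= 3 * M1 * (2 * s).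
  by rewrite E sub0r opprK ler_wpM2r //; lra.
have : 4 * c * lam * (d / 2) <= 4 * c * (lam + s) * (dot x n - (lam + s)).
  by apply: ler_pM; rewrite ?mulr_ge0 ?ler_wpM2l ?mulr_ge0 //; lra.
lra.
Qed.

(** The step [s] depends only on the final position [lam], so finitely many steps lead there from
    the sphere. *)
Lemma good_all n lam : nsq n = 1 -> 0 < lam < 1 -> good n lam.
Proof.
move=> n1 /andP[l0 l1].
have [d d0 narrow] := narrow_cap; have [c c0 growth] := boundary_growth.
have [M1 M10 hM] := bs_bound bs.
(* Points of the closed ball at distance [d] beyond such a plane lie on the sphere, where [U]
   vanishes. *)
have base r : 0 <= r -> 1 - d <= r -> good n r.
  move=> r0 rd; apply: narrow => // x x1 tx.
  rewrite (bs_out bs) ?bs_nonneg //; apply: le_trans (dot_sqr_le x n1).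
  by rewrite -[leLHS](expr1n _ 2) lerXn2r // ?nnegrE; lra.
pose s := Num.min (d / 2) (c * lam * d / (3 * M1)).
have s0 : 0 < s by rewrite lt_min !divr_gt0 // !mulr_gt0.
have sd : 2 * s <= d.
  by have : s <= d / 2 by [rewrite ge_min lexx]; lra.
have sM : 3 * M1 * s <= c * lam * d.
  by rewrite mulrC -ler_pdivlMr ?mulr_gt0 // ge_min lexx orbT.
suff H N r : lam <= r -> 1 - d - N%:R * s <= r -> good n r.
  have := archi_boundP (ltW (divr_gt0 ltr01 s0)); set N := Num.bound _ => hN.
  apply: (H N) => //; rewrite ltr_pdivrMr // in hN; lra.
elim: N r => [|N IH] r lr hr; first by apply: base; lra.
have [rd|rd] := leP (1 - d) r; first by apply: base; lra.
apply: narrow => //; first by lra.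
apply: (@good_step c d M1 n r s) => //; first by lra.
- by apply: le_trans sM _; rewrite ler_pM2r // ler_pM2l.
- by apply: IH; first lra; rewrite -natr1 in hr; lra.
Qed.

(** The gain degenerates as the plane approaches the centre, so planes through it are reached by
    letting [lam] tend to 0. Applying this to [n] and to [- n] gives both inequalities. *)
Lemma refl_sym n x : nsq n = 1 -> nsq x <= 1 -> U (refl n 0 x) = U x.
Proof.
have half m y : nsq m = 1 -> nsq y <= 1 -> 0 <= dot y m -> U y <= U (refl m 0 y).
  move=> m1 y1; rewrite le_eqVlt => /predU1P[e|t0].
    by rewrite refl_fix // -e subr0.
  rewrite leNgt; apply/negP => h.
  pose e := U y - U (refl m 0 y); have e0 : 0 < e by rewrite subr_gt0.
  have cr : {for (0 : R), continuous (fun l => U (refl m l y))}.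
    apply: (@continuous_comp _ _ _ (fun l => refl m l y) U); last exact: bs_cont bs _.
    suff : (fun l : R => y - (2 * (dot y m - l)) *: m) @ (0 : R) -->
      y - (2 * (dot y m - 0)) *: m by [].
    apply: (@cvgB _ _ _ (nbhs (0:R)) (nbhs_filter (0 : R)) (fun=> y)
      (fun l => (2 * (dot y m - l)) *: m)); first exact: cvg_cst.
    apply: cvgZr_tmp.
    have cl : ct (fun l : R => 2 * (dot y m - l)) 0 by ctauto.
    exact: cl.
  have [d /= d0 hd] := ct_dist cr e0.
  pose l := Num.min d (Num.min 1 (dot y m)) / 2.
  have l0 : 0 < l by rewrite divr_gt0 // !lt_min d0 t0 ltr01.
  have h2 : 2 * l <= d by rewrite mulrC divfK // ge_min lexx.
  have h3 : 2 * l <= 1 by rewrite mulrC divfK // !ge_min lexx orbT.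
  have h4 : 2 * l <= dot y m by rewrite mulrC divfK // !ge_min lexx !orbT.
  have := @hd l; rewrite /= sub0r normrN gtr0_norm // ltr_norml => /(_ _)/andP[|_]; first lra.
  have l01 : 0 < l < 1 by lra.
  have := good_all m1 l01 y1; rewrite /e => H1 H2.
  by have := H1 (_ : 0 <= dot y m - l); lra.
have inv m y : refl m 0 y = refl (- m) 0 y.
  by apply/rowP => i; rewrite /refl /dot !sum3 !mxE; ring.
have nN m : nsq (- m) = nsq m by rewrite /nsq !sum3 !mxE; ring.
have dN m y : dot y (- m) = - dot y m by rewrite /dot !sum3 !mxE; ring.
have invol m y : nsq m = 1 -> refl m 0 (refl m 0 y) = y.
  move=> m1; have e : dot (refl m 0 y) m = - dot y m.
    by rewrite /refl -scaleNr dotD (_ : dot m m = nsq m) ?m1 //; ring.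
  by apply/rowP => i; rewrite {1}/refl e /refl !mxE; ring.
have pos m y : nsq m = 1 -> nsq y <= 1 -> 0 <= dot y m -> U (refl m 0 y) = U y.
  move=> m1 y1 t0; apply/eqP; rewrite eq_le half // andbT.
  rewrite -[leRHS](congr1 U (invol m y m1)) [X in _ <= U X]inv; apply: half.
  - by rewrite nN.
  - by rewrite nsq_refl // mulr0 mul0r subr0.
  - by rewrite dN /refl -scaleNr dotD (_ : dot m m = nsq m) ?m1 //; lra.
move=> n1 x1; have [t0|t0] := leP 0 (dot x n); first exact: pos.
by rewrite inv pos ?nN // dN; lra.
Qed.

(** Points of equal norm are exchanged by the reflection in their perpendicular bisector, a plane
    through the centre. *)
Lemma ball_sol_radial x y : nsq x = nsq y -> nsq x <= 1 -> U x = U y.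
Proof.
move=> xy x1; have [->//|nxy] := eqVneq x y.
have n0 : 0 < nsq (x - y).
  rewrite lt_neqAle nsq_ge0 andbT eq_sym; apply: contra nxy => /eqP /nsq0 /eqP.
  by rewrite subr_eq0.
pose a := (Num.sqrt (nsq (x - y)))^-1.
have a2 : a ^+ 2 * nsq (x - y) = 1.
  by rewrite exprVn sqr_sqrtr ?ltW // mulVf // gt_eqF.
have n1 : nsq (a *: (x - y)) = 1.
  by rewrite -[RHS]a2 /nsq !sum3 !mxE; ring.
rewrite -(refl_sym n1 x1); congr (U _).
have e : 2 * dot x (x - y) = nsq (x - y).
  have -> : 2 * dot x (x - y) = nsq (x - y) + (nsq x - nsq y).
    by rewrite /dot /nsq !sum3 !mxE; ring.
  by rewrite xy subrr addr0.
have e2 : dot x (a *: (x - y)) = a * dot x (x - y).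
  by rewrite /dot !sum3 !mxE; ring.
apply/rowP => i; rewrite /refl e2 subr0 scalerA.
have -> : 2 * (a * dot x (x - y)) * a = 1 by rewrite -[RHS]a2 -e; ring.
by rewrite !mxE; ring.
Qed.

End MovingPlanes.

(** * Nonexistence *)

Section DerExtras.
Context {R : realType}.

Lemma der_near_eq (f g : R -> R) (x l e : R) : 0 < e ->
  (forall y, `|y - x| < e -> f y = g y) -> der f x l -> der g x l.
Proof.
move=> e0 fg; apply: near_eq_is_derive.
by exists e => // y /=; rewrite distrC; exact: fg.
Qed.

Lemma der_unique (f : R -> R) (x a b : R) : der f x a -> der f x b -> a = b.
Proof. by move=> [_ <-] [_ <-]. Qed.

(** The difference quotient at 0 is [g] itself. This serves where a derivative of [g] at 0 is not at
    hand. *)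
Lemma der_mul_id (g : R -> R) : ct g 0 -> der (fun s => s * g s) 0 (g 0).
Proof.
move=> cg.
suff c : (fun s : R => s^-1 *: ((s *: 1 + 0 : R) * g (s *: 1 + 0) - 0 * g 0)) @ 0^' --> g 0.
  by apply: DeriveDef; [apply/cvg_ex; exists (g 0)|exact: cvg_lim].
have cg' : g @ 0^' --> g 0 by apply: cvg_trans cg; apply: cvg_app; exact: cvg_within.
apply: cvg_trans cg'; apply: near_eq_cvg; near=> s.
have s0 : s != 0 by near: s; exact: nbhs_dnbhs_neq.
rewrite mul0r subr0 addr0 [s *: 1]mulr1 [_ *: _]mulrA mulVf // mul1r //.
Unshelve. all: by end_near. Qed.

Lemma der_sqrt (x : R) : 0 < x -> der Num.sqrt x (2 * Num.sqrt x)^-1.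
Proof. by move=> x0; exact: is_derive1_sqrt. Qed.

End DerExtras.

(** * The radial profile and its ordinary differential equation *)

Section RadialODE.
Context {R : realType}.
Implicit Types (x y n v : 'rV[R]_3) (i j : 'I_3) (r s t : R).

Variables (k : R -> R) (mu K0 : R) (U : 'rV[R]_3 -> R).
Variables (D : 'I_3 -> 'rV[R]_3 -> R) (DD : 'I_3 -> 'I_3 -> 'rV[R]_3 -> R).
Hypothesis bs : ball_sol k mu U D DD.
Hypothesis mu0 : 0 < mu.
Hypothesis k_bound : forall t, 0 <= t <= 1 -> 0 <= k t <= K0.
Hypothesis k_noninc : forall s t, 0 <= s -> s <= t -> t <= 1 -> k t <= k s.

Let e0 : 'rV[R]_3 := basis_vec R 0.
Definition profile (r : R) : R := U (r *: e0).
Definition profile1 (r : R) : R := D 0 (r *: e0).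

Lemma nsq_basis r : nsq (r *: e0) = r ^+ 2.
Proof. by rewrite /nsq sum3 !mxE /=; ring. Qed.

Lemma enorm_basis r : 0 <= r -> enorm (r *: e0) = r.
Proof. by move=> r0; rewrite -[LHS]/(Num.sqrt (nsq _)) nsq_basis sqrtr_sqr ger0_norm. Qed.

Lemma sqr_lt1 r : 0 < r < 1 -> r ^+ 2 < 1.
Proof. by move=> /andP[? ?]; rewrite expr_lt1 // ltW. Qed.

Lemma der_profile r : 0 < r < 1 -> der profile r (profile1 r).
Proof.
move=> r01; have := @bs_der _ _ _ _ _ _ bs 0 e0 r.
rewrite add0r nsq_basis sqr_lt1 // => /(_ isT); rewrite sum_basis.
by rewrite (_ : (fun s => _) = profile) //; apply/funext => s; rewrite add0r.
Qed.

Lemma der_profile1 r : 0 < r < 1 -> der profile1 r (DD 0 0 (r *: e0)).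
Proof.
move=> r01; apply: der_shift.
have h : nsq (r *: e0) < 1 by rewrite nsq_basis sqr_lt1.
have := strict_deriv_der (bs_DD bs h 0 e0); rewrite sum_basis.
rewrite (_ : (fun s => _) = fun s => profile1 (s + r)) //; apply/funext => s.
by rewrite /profile1 scalerDl addrC.
Qed.

(** On the line [r e0 + s e_i] radial symmetry gives the partial derivative [s profile1(rho) / rho]
    with [rho = sqrt (r^2 + s^2)]; the value is the derivative of this at [s = 0]. *)
Lemma radial_DD i r : i != 0 -> 0 < r < 1 -> DD i i (r *: e0) = profile1 r / r.
Proof.
move=> i0 r01; have /andP[r0 r1] := r01.
have h : nsq (r *: e0) < 1 by rewrite nsq_basis sqr_lt1.
have H := strict_deriv_der (bs_DD bs h i (basis_vec R i)).
rewrite sum_basis in H.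
pose rho (s : R) := Num.sqrt (r ^+ 2 + s ^+ 2).
have nl s : nsq (r *: e0 + s *: basis_vec R i) = r ^+ 2 + s ^+ 2.
  rewrite nsqD nsq_basis; have -> : dot (r *: e0) (basis_vec R i) = 0.
    rewrite /dot (bigD1 0) //= !mxE /= [0 == i]eq_sym (negbTE i0) mulr0 big1 ?addr0 // => j j0.
    by rewrite !mxE /= (negbTE j0) mulr0 mul0r.
  by rewrite (_ : nsq (basis_vec R i) = 1) ?mulr1 ?mulr0 ?addr0 // /nsq
    (eq_bigr (fun j => basis_vec R i ord0 j * basis_vec R i ord0 j)) ?sum_basis ?basis_vecE ?eqxx.
have p0 s : 0 < r ^+ 2 + s ^+ 2 by rewrite ltr_wpDr ?sqr_ge0 ?exprn_gt0.
have rho0 s : 0 < rho s by rewrite sqrtr_gt0.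
have rho2 s : rho s ^+ 2 = r ^+ 2 + s ^+ 2 by rewrite sqr_sqrtr // ltW.
have drho s : der rho s (s / rho s).
  have dq : der (fun s : R => r ^+ 2 + s ^+ 2) s (2 * s) by dsolve => /=; ring.
  by apply: der_eq (derO dq (der_sqrt (p0 s))) _; rewrite -/(rho s); field; rewrite gt_eqF.
(* For [|s| < e < 1] one has [s^2 < e], so the line stays in the ball. *)
pose e := 1 - r ^+ 2.
have e00 : 0 < e by rewrite subr_gt0 sqr_lt1.
have e1 : e < 1 by rewrite /e gtrBl exprn_gt0.
have se s : `|s| < e -> r ^+ 2 + s ^+ 2 < 1.
  move=> /[dup] se; rewrite ltr_norml => /andP[s1 s2].
  suff : s ^+ 2 < e by rewrite /e; lra.
  nra.
have rho1 s : `|s| < e -> 0 < rho s < 1.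
  by move=> /se h1; rewrite rho0 /= -(ltr_pXn2r (_ : 0 < 2)%N) ?nnegrE ?ltW // rho2 expr1n.
have DE s : `|s| < e -> s * (profile1 (rho s) / rho s) =
    D i (r *: e0 + s *: basis_vec R i).
  move=> hs; have h1 : nsq (r *: e0 + s *: basis_vec R i) < 1 by rewrite nl se.
  have d1 := bs_der bs h1; rewrite sum_basis in d1.
  have d2 := derO (drho s) (der_profile (rho1 s hs)).
  rewrite mulrCA.
  (* The equality holds for every [t], both sides being 0 outside the ball; the radius 1 is
     arbitrary. *)
  suff Hn t : `|t - s| < 1 -> profile (rho t) = U (r *: e0 + t *: basis_vec R i).
    exact: der_unique (der_near_eq ltr01 Hn d2) d1.
  move=> _.
  have nt : nsq (rho t *: e0) = nsq (r *: e0 + t *: basis_vec R i).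
    by rewrite nl nsq_basis rho2.
  have [t1|t1] := leP (nsq (rho t *: e0)) 1.
    exact: (ball_sol_radial bs mu0 k_bound k_noninc).
  by rewrite /profile (bs_out bs (ltW t1)) (bs_out bs) // -nt ltW.
have c0 : ct (fun s => profile1 (rho s) / rho s) 0.
  have hr : rho 0 = r by rewrite /rho expr0n addr0 sqrtr_sqr gtr0_norm.
  have c1 : ct rho 0 by exact: der_cont (drho 0).
  have c2 : {for rho 0, continuous profile1}.
    by rewrite hr; exact: der_cont (der_profile1 r01).
  by have c3 := ctO c1 c2; ctauto; rewrite hr gt_eqF.
have DE0 s : `|s - 0| < e -> s * (profile1 (rho s) / rho s) =
  D i (r *: e0 + s *: basis_vec R i) by rewrite subr0; exact: DE.
rewrite (der_unique H (der_near_eq e00 DE0 (der_mul_id c0))).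
by rewrite /rho expr0n addr0 sqrtr_sqr gtr0_norm.
Qed.

Lemma profile_ode r : 0 < r < 1 -> let v s := s * profile s in
  let v1 s := profile s + s * profile1 s in
  der v r (v1 r) /\ der v1 r (- (k r * v r ^+ 5 / r ^+ 4 + mu * v r)).
Proof.
move=> r01 v v1; have /andP[r0 r1] := r01.
have h1 := der_profile r01; have h2 := der_profile1 r01.
split; first by rewrite /v /v1; dsolve => /=; ring.
have h : nsq (r *: e0) < 1 by rewrite nsq_basis sqr_lt1.
have := bs_eq bs h; rewrite sum3 (@radial_DD 1) // (@radial_DD 2) // (enorm_basis (ltW r0)) -/(profile r).
move=> E; rewrite /v /v1; dsolve => /=.
have -> : k r * (r * profile r) ^+ 5 / r ^+ 4 + mu * (r * profile r) =
  r * (k r * profile r ^+ 5 + mu * profile r) by field; rewrite gt_eqF.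
by rewrite -E; field; rewrite gt_eqF.
Qed.

Lemma profile_bounds : exists2 M, 0 <= M & forall r, 0 < r < 1 ->
  let v s := s * profile s in let v1 s := profile s + s * profile1 s in
  [/\ 0 < v r, v r <= M * r, v r <= M * (1 - r) & `|v1 r| <= M].
Proof.
have [M1 M10 hM1] := bs_bound bs; have [M M0 hM] := bs_max bs.
exists (M + M1) => [|r r01 v v1]; first by rewrite addr_ge0 // ltW.
have /andP[r0 r1] := r01.
have h : nsq (r *: e0) < 1 by rewrite nsq_basis sqr_lt1.
have u0 : 0 < profile r by exact: (bs_pos bs h).
have uM : profile r <= M by exact: hM.
have dM := hM1 0 _ h.
split.
- by rewrite /v mulr_gt0.
- by rewrite /v mulrC ler_pM2r //; lra.
- suff : profile r <= M1 * (1 - r).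
    rewrite /v; move: u0; set p := profile r => p0 hp.
    have : r * p <= p by rewrite ler_piMl // ltW.
    have q0 : 0 <= M * (1 - r) by rewrite mulr_ge0 //; lra.
    lra.
  rewrite leNgt; apply/negP => hlt.
  pose e := (profile r - M1 * (1 - r)) / 2.
  have e00 : 0 < e by rewrite divr_gt0 // subr_gt0.
  have c1 : ct profile 1.
    apply: (@continuous_comp _ _ _ (fun s : R => s *: e0) U); last exact: bs_cont bs _.
    by apply: cvgZr_tmp; apply: cvg_id.
  have [d /= d0 hd] := ct_dist c1 e00.
  (* Derivatives exist only inside the ball, so the mean value theorem is applied up to a point
     [s < 1] where continuity at 1 already makes the profile smaller than [e]. *)
  pose s := Num.max ((r + 1) / 2) (1 - d / 2).
  have s1 : s < 1 by rewrite gt_max; apply/andP; split; lra.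
  have sr : (r + 1) / 2 <= s by rewrite le_max lexx.
  have sd : 1 - d / 2 <= s by rewrite le_max lexx orbT.
  have := hd s; rewrite /= ger0_norm; last by lra.
  have p1 : profile 1 = 0 by rewrite /profile (bs_out bs) // nsq_basis expr1n.
  rewrite p1 subr0 => /(_ _)/(le_lt_trans (ler_norm _)) hs.
  have {}hs : profile s < e by apply: hs; lra.
  have rs : r < s by lra.
  have [|z /andP[z1 z2] E] := @mvt R profile profile1 r s rs.
    by move=> t /andP[t1 t2]; apply: der_profile; lra.
  have hz : nsq (z *: e0) < 1 by rewrite nsq_basis sqr_lt1 //; lra.
  have := hM1 0 _ hz; rewrite -/(profile1 z) ler_norml => /andP[zz _].
  have : - M1 * (s - r) <= profile1 z * (s - r) by rewrite ler_wpM2r //; lra.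
  have : M1 * (s - r) <= M1 * (1 - r) by rewrite ler_pM2l //; lra.
  by rewrite /e in hs; lra.
- apply: le_trans (ler_normD _ _) _; apply: lerD; first by rewrite gtr0_norm.
  apply: le_trans dM; rewrite normrM ler_piMl // gtr0_norm //; exact: ltW.
Qed.

End RadialODE.

(** * From a solution to the inequality on the regular part *)

Section NonexistenceHalf.
Context {R : realType}.

Lemma der_noninc (f : R -> R) (a b x l : R) : a < x < b ->
  (forall s t, a <= s -> s <= t -> t <= b -> f t <= f s) -> der f x l -> l <= 0.
Proof.
move=> /andP[ax xb] hf [fd fl]; rewrite leNgt; apply/negP => l0.
have hc : s^-1 *: (f (s *: 1 + x) - f x) @[s --> 0^'] --> l by rewrite -fl.
move/cvgrPdist_lt : hc => /(_ _ l0); rewrite near_withinE => -[e /= e0 he].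
pose s := Num.min e (b - x) / 2.
have s0 : 0 < s by rewrite divr_gt0 // lt_min e0 subr_gt0.
have h1 : 2 * s <= e by rewrite mulrC divfK // ge_min lexx.
have h2 : 2 * s <= b - x by rewrite mulrC divfK // ge_min lexx orbT.
have := he s; rewrite /= sub0r normrN gtr0_norm // => /(_ _ (lt0r_neq0 s0)).
rewrite [s *: 1]mulr1 [_ *: _]mulrC ltr_norml => /(_ _)/andP[|_ h]; first by lra.
have : f (s + x) - f x <= 0 by rewrite subr_le0 hf //; lra.
have : 0 < (f (s + x) - f x) / s by lra.
by rewrite pmulr_lgt0 ?invr_gt0 //; lra.
Qed.

Variables (K0 mu eta C : R) (f1 : R -> R).
Hypotheses (K00 : 0 < K0) (f1C1 : C1_01 f1) (f10 : f1 0 = 0).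
Hypotheses (mu0 : 0 < mu) (mupi : mu < pi ^+ 2) (eta0 : 0 <= eta).
Hypothesis fnn : forall t, t \in `[0, 1] -> 0 <= K0 + eta * f1 t.
Hypothesis fnoninc :
  {in `[0, 1] &, forall s t, s <= t -> K0 + eta * f1 t <= K0 + eta * f1 s}.

Definition coef (r : R) : R := K0 + eta * f1 r.

Lemma sqrt_mu_bound : 0 < Num.sqrt mu < pi.
Proof.
rewrite sqrtr_gt0 mu0 /= -(ltr_pXn2r (_ : 0 < 2)%N) ?nnegrE ?sqrtr_ge0 ?pi_ge0 //.
by rewrite sqr_sqrtr // ltW.
Qed.

Lemma coef_noninc s t : 0 <= s -> s <= t -> t <= 1 -> coef t <= coef s.
Proof.
by move=> s0 st t1; apply: fnoninc => //; rewrite in_itv /=; apply/andP; split=> //; lra.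
Qed.

Lemma coef_bound t : 0 <= t <= 1 -> 0 <= coef t <= K0.
Proof.
move=> /andP[t0 t1]; rewrite fnn ?in_itv /= ?t0 //.
by have := coef_noninc (lexx 0) t0 t1; rewrite {2}/coef f10 mulr0 addr0.
Qed.

Lemma coef_der r : 0 < r < 1 -> der coef r (eta * deriv01 f1 r).
Proof.
move=> r01; have h := C1_01_der f1C1 r01.
by rewrite /coef; dsolve => /=; ring.
Qed.

Lemma coef_der_le0 r : 0 < r < 1 -> eta * deriv01 f1 r <= 0.
Proof. by move=> r01; apply: der_noninc r01 coef_noninc (coef_der r01). Qed.

Lemma coef_near0 : exists2 L, 0 < L & forall r, 0 <= r <= 1 -> K0 - L * r <= coef r /\
  (0 < r < 1 -> - L <= eta * deriv01 f1 r).
Proof.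
have [L L0 hL] := C1_01_bounded f1C1.
exists (eta * L + 1) => [|r r01]; first by rewrite ltr_wpDl // mulr_ge0 // ltW.
have /andP[r0 r1] := r01.
have i0 : (0 : R) \in `[0, 1] by rewrite in_itv /= lexx ler01.
have ir : r \in `[0, 1] by rewrite in_itv /= r0.
split=> [|_].
  have := C1_01_lipschitz f1C1 hL ir i0; rewrite f10 !subr0 (ger0_norm r0).
  rewrite ler_norml => /andP[h _]; have : eta * - (L * r) <= eta * f1 r by rewrite ler_wpM2l.
  by rewrite /coef; lra.
have := hL r ir; rewrite ler_norml => /andP[h _].
have : eta * - L <= eta * deriv01 f1 r by rewrite ler_wpM2l.
lra.
Qed.

(** The growth [eta C r <= 4 K0 r] has to be absorbed by [4 K0 th^2 r]. This works because the
    condition to be checked concerns radii with [A0 > th^2 r] only: there [cos th < 0], hence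
    [th >= 1]. *)
Lemma solution_implies_green u :
  (forall t, 0 < t < 1 -> deriv01 f1 t - deriv01 f1 0 <= C * t) -> eta * C <= 4 * K0 ->
  classical_solution (fun x => K0 + eta * f1 (enorm x)) mu u ->
  - (deriv01 f1 0 * eta) / (4 * K0) <
  - (Num.sqrt mu * cos (Num.sqrt mu) / sin (Num.sqrt mu)).
Proof.
set th := Num.sqrt mu; move=> hC etaC hu; rewrite ltNge; apply/negP => hA.
have /andP[t0 tpi] := sqrt_mu_bound; rewrite -/th in t0 tpi.
have th2 : th ^+ 2 = mu by rewrite sqr_sqrtr // ltW.
have [D [DD bs]] := @classical_ball_sol R coef mu u hu.
have kb t : 0 <= t <= 1 -> 0 <= coef t <= K0 := @coef_bound t.
have [M M0 hM] := profile_bounds bs.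
have [L L0 hL] := coef_near0.
set U := fun x : 'rV[R]_3 => _ in bs hM.
apply: (@no_radial_solution R coef (fun r => eta * deriv01 f1 r)
  (fun r => r * profile U r) (fun r => profile U r + r * profile1 D r) th K0 M
  (Num.min 1 (K0 / (2 * L)))) => //.
- by rewrite t0.
- by rewrite lt_min ltr01 divr_gt0 // mulr_gt0.
- move=> r r01; have [h1 h2] := profile_ode bs mu0 kb coef_noninc r01.
  by split=> //; [rewrite th2|exact: coef_der].
- by move=> r /andP[r0 r1]; apply: coef_bound; rewrite !ltW.
- exact: coef_der_le0.
- move=> r; rewrite lt_min => /and3P[r0 r1 r2].
  have [|h _] := hL r; first by rewrite !ltW.
  by rewrite ltr_pdivlMr ?mulr_gt0 // in r2; nra.
move=> r r01 hr; have /andP[r0 r1] := r01.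
set A0 := - (_ / _) in hA hr *.
have c0 : cos th < 0.
  rewrite ltNge; apply/negP => c0.
  have : A0 <= 0 by rewrite oppr_le0 mulr_ge0 ?invr_ge0 ?sin_ge0_pi ?(ltW t0) ?(ltW tpi) ?mulr_ge0 // ltW.
  have : 0 <= th ^+ 2 * r by rewrite mulr_ge0 ?sqr_ge0 // ltW.
  lra.
have th1 : 1 <= th ^+ 2.
  have : 1 <= th.
    rewrite leNgt; apply/negP => h; suff : 0 < cos th by lra.
    by apply: cos_gt0_pihalf; have := pihalf_ge1 R; lra.
  by move=> h; nra.
have h1 : eta * (deriv01 f1 r - deriv01 f1 0) <= eta * (C * r).
  by rewrite ler_wpM2l // hC.
have h2 : eta * C * r <= 4 * K0 * r by rewrite ler_pM2r.
have h3 : K0 * r <= K0 * (th ^+ 2 * r) by rewrite ler_pM2l // ler_peMl // ltW.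
rewrite ler_pdivlMr ?mulr_gt0 // in hA.
by rewrite mulrBr; lra.
Qed.

End NonexistenceHalf.

(** * Existence by shooting *)

Section Primitive.
Context {R : realType}.
Local Notation lam := (@lebesgue_measure R).

(** The integral starts at -1 so that 0 is an interior point of the interval of integration;
    two-sided derivatives are then available on all of [[0, 1]]. *)
Definition prim (f : R -> R) (x : R) : R :=
  (\int[lam]_(t in [set` `[(-1 : R), x]]) f t) -
  (\int[lam]_(t in [set` `[(-1 : R), 0]]) f t).

Lemma prim0 f : prim f 0 = 0.
Proof. by rewrite /prim subrr. Qed.

Lemma prim_der (f : R -> R) x : continuous f -> -1 < x < 2 -> der (prim f) x (f x).
Proof.
move=> cf /andP[x1 x2].
have fi : lam.-integrable `[(-1 : R), 2] (EFin \o f).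
  apply: continuous_compact_integrable; first exact: segment_compact.
  exact: continuous_subspaceT.
have [h1 h2] := continuous_FTC1_closed x2 fi x1 (cf x).
rewrite /prim; apply: der_eq; first apply: derD.
- by apply: DeriveDef; [exact: h1|rewrite -derive1E; exact: h2].
- exact: derC.
by rewrite addr0.
Qed.

End Primitive.

(** * Second-order equations with a Lipschitz right-hand side on the unit interval *)

Section Picard.
Context {R : realType}.
Implicit Types (w : R -> R) (a r : R).

(** Clamping extends data on [[0, 1]] continuously to the line, so that Picard iterates have
    two-sided derivatives at the endpoints. *)
Definition cl (r : R) : R := Num.max 0 (Num.min 1 r).

Lemma cl01 r : 0 <= cl r <= 1.
Proof. by rewrite le_max lexx /= ge_max ler01 ge_min lexx. Qed.

Lemma cl_id r : 0 <= r <= 1 -> cl r = r.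
Proof. by move=> /andP[r0 r1]; rewrite /cl (min_idPr r1) (max_idPr r0). Qed.

Lemma ct_cl r : ct cl r.
Proof. by rewrite /cl; ctauto. Qed.

Variables (g : R -> R -> R) (M : R).
Hypothesis M0 : 0 < M.
Hypothesis g0 : forall r, g r 0 = 0.
Hypothesis glip : forall r x y, 0 <= r <= 1 -> `|g r x - g r y| <= M * `|x - y|.
Hypothesis gcont : forall w, continuous (fun r => w (cl r)) -> w 0 = 0 ->
  continuous (fun r => g (cl r) (w (cl r))).

(** In the norm weighted by [exp (- la r)] two integrations gain [la^-2]; with [2 M <= la^2] the
    Lipschitz constant [M] becomes a contraction factor 1/2. *)
Let la : R := 2 * M + 1.
Let E (r : R) : R := expR (la * r).

Let la0 : 0 < la. Proof. by have := M0; rewrite /la; lra. Qed.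
Let laM : 2 * M <= la ^+ 2. Proof. by have := sqr_ge0 M; have := M0; rewrite /la; lra. Qed.

Lemma der_weight r : der E r (la * E r).
Proof.
have h : der (fun r => la * r) r la by dsolve => /=; ring.
by apply: der_eq (derO h (is_derive_expR _)) _; rewrite mulrC.
Qed.

Lemma weight_0 : E 0 = 1.
Proof. by rewrite /E mulr0 expR0. Qed.

Lemma weight_ge1 r : 0 <= r -> 1 <= E r.
Proof. by move=> r0; rewrite -expR0 ler_expR mulr_ge0 // ltW. Qed.

(* Two integrations of [|d''| <= B e^(la r)] gain the factor [la^-2]. *)
Lemma second_order_bound (d d1 d2 : R -> R) (B al : R) : 0 <= B -> 0 <= al ->
  (forall r, 0 <= r <= 1 -> [/\ der d r (d1 r), der d1 r (d2 r) & `|d2 r| <= B * E r]) ->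
  d 0 = 0 -> `|d1 0| <= al ->
  forall r, 0 <= r <= 1 -> `|d r| <= (al + B / la ^+ 2) * E r.
Proof.
move=> B0 al0 h d00 d10.
suff H (d' d1' d2' : R -> R) :
  (forall r, 0 <= r <= 1 -> [/\ der d' r (d1' r), der d1' r (d2' r) & d2' r <= B * E r]) ->
    d' 0 = 0 -> d1' 0 <= al ->
    forall r, 0 <= r <= 1 -> d' r <= (al + B / la ^+ 2) * E r.
  move=> r r01; rewrite ler_norml; apply/andP; split.
    rewrite lerNl; apply: (H (fun r => - d r) (fun r => - d1 r) (fun r => - d2 r)) => //.
    - move=> s /h [h1 h2 h3]; split; [exact: derN|exact: derN|].
      by apply: le_trans h3; rewrite -normrN ler_norm.
    - by rewrite d00 oppr0.
    - by apply: le_trans d10; rewrite -normrN ler_norm.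
  apply: (H d d1 d2) => //; last by apply: le_trans d10; exact: ler_norm.
  by move=> s /h [h1 h2 h3]; split=> //; apply: le_trans h3; exact: ler_norm.
move=> {}h d00' d10' r r01.
have step1 s : 0 <= s <= 1 -> 0 <= al + B / la * E s - d1' s.
  move=> /andP[s0 s1].
  have := @der_le R (fun s => al + B / la * E s - d1' s) (fun s => B * E s - d2' s) 0 s s0.
  rewrite weight_0 mulr1 => hh; apply: le_trans (hh _ _).
  - by have : 0 <= B / la by [rewrite divr_ge0 // ltW]; lra.
  - move=> x /andP[x0 x1]; have [|h1 h2 _] := h x; first by rewrite x0 (le_trans x1).
    by have hE := der_weight x; dsolve => /=; field; rewrite gt_eqF.
  - move=> x /andP[x0 x1]; have [|_ _ h3] := h x; last by rewrite subr_ge0.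
    by rewrite ltW //= (le_trans (ltW x1)).
have /andP[r0 r1] := r01.
have := @der_le R (fun s => al * s + B / la ^+ 2 * E s - d' s)
  (fun s => al + B / la * E s - d1' s) 0 r r0.
rewrite weight_0 mulr0 mulr1 d00' add0r subr0 => hh.
have : 0 <= al * r + B / la ^+ 2 * E r - d' r.
  apply: le_trans (hh _ _).
  - by rewrite divr_ge0 // sqr_ge0.
  - move=> x /andP[x0 x1]; have [|h1 h2 _] := h x; first by rewrite x0 (le_trans x1).
    by have hE := der_weight x; dsolve => /=; field; rewrite gt_eqF.
  - by move=> x /andP[x0 x1]; apply: step1; rewrite ltW //= (le_trans (ltW x1)).
have : al * r <= al * E r by rewrite ler_wpM2l // (le_trans r1) // weight_ge1.
lra.
Qed.

Definition pic1 a w (t : R) : R := a - prim (fun s => g (cl s) (w (cl s))) t.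
Definition pic a w : R -> R := prim (fun t => pic1 a w (cl t)).

Lemma pic_der a w : continuous (fun r => w (cl r)) -> w 0 = 0 ->
  forall r, 0 <= r <= 1 -> der (pic a w) r (pic1 a w r) /\
    der (pic1 a w) r (- g r (w r)).
Proof.
move=> cw w0 r r01; have cg := gcont cw w0; have /andP[r0 r1] := r01.
have d1 s : -1 < s < 2 -> der (pic1 a w) s (- g (cl s) (w (cl s))).
  move=> s12; have h := prim_der cg s12; rewrite /pic1.
  by apply: der_eq; [apply: derD; [exact: derC|apply: derN; exact: h]|rewrite add0r].
split; last by rewrite -{2 3}(cl_id r01); apply: d1; lra.
have cp : continuous (fun t => pic1 a w (cl t)).
  move=> t; apply: (@continuous_comp _ _ _ cl (pic1 a w)); first exact: ct_cl.
  by apply: der_cont (d1 _ _); have /andP[? ?] := cl01 t; lra.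
by rewrite -{2}(cl_id r01); apply: prim_der => //; lra.
Qed.

Lemma pic_cl a w : continuous (fun r => w (cl r)) -> w 0 = 0 ->
  continuous (fun r => pic a w (cl r)).
Proof.
move=> cw w0 r; apply: (@continuous_comp _ _ _ cl (pic a w)); first exact: ct_cl.
by have [h _] := pic_der a cw w0 (cl01 r); exact: der_cont h.
Qed.

Lemma pic_0 a w : pic a w 0 = 0. Proof. exact: prim0. Qed.
Lemma pic1_0 a w : pic1 a w 0 = a. Proof. by rewrite /pic1 prim0 subr0. Qed.

Lemma pic_contract a b w w' B : 0 <= B ->
  continuous (fun r => w (cl r)) -> w 0 = 0 ->
  continuous (fun r => w' (cl r)) -> w' 0 = 0 ->
  (forall r, 0 <= r <= 1 -> `|w r - w' r| <= B * E r) ->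
  forall r, 0 <= r <= 1 -> `|pic a w r - pic b w' r| <= (`|a - b| + B / 2) * E r.
Proof.
move=> B0 cw w0 cw' w0' hB r r01.
have := @second_order_bound (fun r => pic a w r - pic b w' r)
  (fun r => pic1 a w r - pic1 b w' r) (fun r => - g r (w r) - - g r (w' r))
  (M * B) `|a - b|.
rewrite !pic_0 !pic1_0 subrr; move=> H.
apply: le_trans (H _ _ _ _ _ r r01) _ => //.
- by rewrite mulr_ge0 // ltW.
- move=> s s01; have [h1 h2] := pic_der a cw w0 s01.
  have [h3 h4] := pic_der b cw' w0' s01; split.
  + exact: (derD h1 (derN h3)).
  + exact: (derD h2 (derN h4)).
  + rewrite -opprD normrN; apply: le_trans (glip _ _ s01) _.
    by rewrite -mulrA ler_pM2l // hB.
rewrite ler_wpM2r ?expR_ge0 // lerD2l ler_pdivrMr ?exprn_gt0 //.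
have := ler_wpM2l B0 laM; lra.
Qed.

Definition pseq a (n : nat) : R -> R := iter n (pic a) (fun=> 0).

Lemma pseq_ok a n : continuous (fun r => pseq a n (cl r)) /\ pseq a n 0 = 0.
Proof.
elim: n => [|n [c h]]; first by split=> //; exact: cst_continuous.
by split; [exact: pic_cl|exact: pic_0].
Qed.

Lemma pseq_dist a n r : 0 <= r <= 1 ->
  `|pseq a n.+1 r - pseq a n r| <= (`|a| / 2 ^+ n) * E r.
Proof.
elim: n r => [|n IH] r r01.
  rewrite expr0 divr1 /= subr0.
  have c0 : continuous (fun r : R => (fun=> 0 : R) (cl r)) by exact: cst_continuous.
  have := @second_order_bound (pic a (fun=> 0)) (pic1 a (fun=> 0)) (fun r => - g r 0) 0 `|a|.
  rewrite mul0r addr0; apply=> //; last by rewrite pic1_0.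
  - move=> s s01; have [h1 h2] := @pic_der a (fun=> 0) c0 erefl s s01; split=> //.
    by rewrite g0 oppr0 normr0 mul0r.
  - exact: pic_0.
have [c1 z1] := pseq_ok a n; have [c2 z2] := pseq_ok a n.+1.
have B0 : 0 <= `|a| / 2 ^+ n by rewrite divr_ge0 // exprn_ge0.
have h := pic_contract a a B0 c2 z2 c1 z1 IH r01.
by rewrite (subrr a) normr0 add0r in h; rewrite exprSr invfM mulrA.
Qed.

Lemma pow2_small (e : R) : 0 < e -> exists n, (2 ^+ n)^-1 < e :> R.
Proof.
move=> e0; have := archi_boundP (ltW (divr_gt0 ltr01 e0)); set N := Num.bound _ => hN.
exists N; rewrite invf_plt ?posrE ?exprn_gt0 //.
rewrite div1r in hN; apply: lt_le_trans hN _.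
by rewrite -natrX ler_nat ltnW // ltn_expl.
Qed.

(** The intervals of radius [b n r] around the iterates are nested, and the supremum of their left
    ends lies in all of them. *)
Lemma pseq_limit a : exists w : R -> R, forall n r, 0 <= r <= 1 ->
  `|pseq a n r - w r| <= (2 * `|a| / 2 ^+ n) * E r.
Proof.
pose b n r := 2 * `|a| / 2 ^+ n * E r.
have b0 n r : 0 <= b n r by rewrite /b mulr_ge0 ?expR_ge0 // divr_ge0 ?exprn_ge0 // mulr_ge0.
exists (fun r => sup (range (fun n => pseq a n r - b n r))) => n r r01.
have bS m : b m.+1 r + `|a| / 2 ^+ m * E r = b m r.
  by rewrite /b exprSr; field; rewrite expf_neq0 ?pnatr_eq0.
have incr m p : pseq a m r - b m r <= pseq a (p + m) r - b (p + m)%N r.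
  elim: p => [//|p IH]; apply: le_trans IH _; rewrite addSn.
  have := pseq_dist a (p + m) r01; rewrite ler_norml => /andP[h _].
  have := bS (p + m)%N; lra.
have decr m p : pseq a (p + m) r + b (p + m)%N r <= pseq a m r + b m r.
  elim: p => [//|p IH]; apply: le_trans _ IH; rewrite addSn.
  have := pseq_dist a (p + m) r01; rewrite ler_norml => /andP[_ h].
  have := bS (p + m)%N; lra.
have cross m p : pseq a m r - b m r <= pseq a p r + b p r.
  apply: le_trans (incr m p) _; apply: le_trans _ (decr p m).
  by rewrite [(p + m)%N]addnC lerD2l; have := b0 (m + p)%N r; lra.
have ub m : ubound (range (fun n => pseq a n r - b n r)) (pseq a m r + b m r).
  by move=> _ [p _ <-]; exact: cross.
have h1 : pseq a n r - b n r <= sup (range (fun n => pseq a n r - b n r)).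
  by apply: ub_le_sup; [exists (pseq a n r + b n r); exact: ub|exists n].
have h2 : sup (range (fun n => pseq a n r - b n r)) <= pseq a n r + b n r.
  by apply: ge_sup (ub n); exists (pseq a n r - b n r); exists n.
by rewrite -/(b n r) ler_norml; apply/andP; split; lra.
Qed.

(** The fixed point equation is available on [[0, 1]] only; [v] is the image [pic a w], which has
    two-sided derivatives there. The witness [w] is exported in order to compare solutions with
    different slopes. *)
Lemma picard a : exists v v1 : R -> R, [/\ v 0 = 0, v1 0 = a,
  forall r, 0 <= r <= 1 -> der v r (v1 r) /\ der v1 r (- g r (v r)) &
  exists w, [/\ v = pic a w, continuous (fun r => w (cl r)), w 0 = 0 &
    forall r, 0 <= r <= 1 -> v r = w r]].
Proof.
have [w hw] := pseq_limit a.
have E1 r : 0 <= r <= 1 -> E r <= E 1.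
  by move=> /andP[_ r1]; rewrite ler_expR ler_pM2l.
have unif n r : 0 <= r <= 1 -> `|pseq a n r - w r| <= 2 * `|a| * E 1 / 2 ^+ n.
  move=> r01; apply: le_trans (hw n r r01) _; rewrite mulrAC.
  rewrite ler_wpM2r ?invr_ge0 ?exprn_ge0 // ler_wpM2l ?E1 // mulr_ge0 //.
pose c := 2 * `|a| * E 1 + 1.
have c0 : 0 < c by rewrite ltr_wpDl // mulr_ge0 ?mulr_ge0 ?expR_ge0.
have small e : 0 < e -> exists n, forall r, 0 <= r <= 1 -> `|pseq a n r - w r| < e.
  move=> e0; have [n hn] := pow2_small (divr_gt0 e0 c0); exists n => r r01.
  apply: le_lt_trans (unif n r r01) _; rewrite ltr_pdivlMr // mulrC in hn.
  apply: le_lt_trans hn; rewrite ler_wpM2r ?invr_ge0 ?exprn_ge0 // /c; lra.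
have w0 : w 0 = 0.
  apply/eqP; rewrite -normr_eq0 eq_le normr_ge0 andbT leNgt; apply/negP => h.
  have [n hn] := small _ h; have := hn 0; rewrite (pseq_ok a n).2 sub0r normrN lexx ler01.
  by move=> /(_ isT); rewrite ltxx.
have cw : continuous (fun r => w (cl r)).
  move=> r; apply/cvgrPdist_lt => e e0.
  have [n hn] := small (e / 3) (divr_gt0 e0 (ltr0n _ 3)).
  have := ct_dist ((pseq_ok a n).1 r) (divr_gt0 e0 (ltr0n R 3)).
  apply: filterS => s hs; have h1 := hn _ (cl01 r); have h2 := hn _ (cl01 s).
  move: h1 h2 hs; rewrite !ltr_norml => /andP[? ?] /andP[? ?] /andP[? ?].
  by apply/andP; split; lra.
have E0 : 0 <= E 1 by exact: expR_ge0.
have vw r : 0 <= r <= 1 -> pic a w r = w r.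
  move=> r01; apply/eqP; rewrite -subr_eq0 -normr_eq0 eq_le normr_ge0 andbT.
  rewrite leNgt; apply/negP => h.
  have h3 : 0 < `|pic a w r - w r| / (2 * c) by rewrite divr_gt0 // mulr_gt0.
  have [n hn] := pow2_small h3.
  have [cn zn] := pseq_ok a n.
  have B0 : 0 <= 2 * `|a| / 2 ^+ n by rewrite divr_ge0 ?exprn_ge0 ?mulr_ge0.
  have hw' s : 0 <= s <= 1 -> `|w s - pseq a n s| <= 2 * `|a| / 2 ^+ n * E s.
    by rewrite distrC; exact: hw.
  have := pic_contract a a B0 cw w0 cn zn hw' r01; rewrite (subrr a) normr0 add0r.
  have := unif n.+1 r r01; rewrite -[pseq a n.+1]/(pic a (pseq a n)).
  have := E1 r r01; have := @expR_ge0 R (la * r); rewrite -/(E r) => e0 e1 u1 u2.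
  have u3 : `|pic a w r - w r| <= 2 * `|a| / 2 ^+ n / 2 * E r + 2 * `|a| * E 1 / 2 ^+ n.+1.
    rewrite -(subrKA (pic a (pseq a n) r)); apply: le_trans (ler_normD _ _) _.
    exact: lerD.
  have p0 : 0 < (2 ^+ n)^-1 :> R by rewrite invr_gt0 exprn_gt0.
  have u4 : 2 * `|a| / 2 ^+ n / 2 * E r <= 2 * `|a| * E 1 / 2 ^+ n / 2.
    have -> : 2 * `|a| * E 1 / 2 ^+ n / 2 = 2 * `|a| / 2 ^+ n / 2 * E 1 by ring.
    by rewrite ler_wpM2l // divr_ge0.
  have u5 : 2 * `|a| * E 1 / 2 ^+ n.+1 = 2 * `|a| * E 1 / 2 ^+ n / 2.
    by rewrite exprSr; field; rewrite expf_neq0 ?pnatr_eq0.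
  rewrite ltr_pdivlMr ?mulr_gt0 // in hn.
  have z0 : 0 <= `|a| * E 1 * (2 ^+ n)^-1 by apply: mulr_ge0; [exact: mulr_ge0|exact: ltW].
  have u6 : `|pic a w r - w r| <= 2 * (`|a| * E 1 * (2 ^+ n)^-1).
    apply: le_trans u3 _; rewrite u5; apply: le_trans (lerD u4 (lexx _)) _.
    by rewrite le_eqVlt; apply/orP; left; apply/eqP; field; rewrite expf_neq0 ?pnatr_eq0.
  move: hn; apply/negP; rewrite -leNgt; apply: le_trans u6 _; rewrite -subr_ge0 /c.
  have -> : (2 ^+ n)^-1 * (2 * (2 * `|a| * E 1 + 1)) - 2 * (`|a| * E 1 * (2 ^+ n)^-1) =
    2 * (`|a| * E 1 * (2 ^+ n)^-1) + 2 * (2 ^+ n)^-1 by ring.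
  by apply: addr_ge0; apply: mulr_ge0 => //; exact: ltW.
exists (pic a w), (pic1 a w); split.
- exact: pic_0.
- exact: pic1_0.
- by move=> r r01; rewrite vw //; exact: pic_der.
- by exists w; split.
Qed.

(** Contraction improves a bound [B] on the weighted distance to [|a - b| + B / 2]; iteration drives
    it to [2 |a - b|]. *)
Lemma picard_dist a b w w' : continuous (fun r => w (cl r)) -> w 0 = 0 ->
  continuous (fun r => w' (cl r)) -> w' 0 = 0 ->
  (forall r, 0 <= r <= 1 -> pic a w r = w r) ->
  (forall r, 0 <= r <= 1 -> pic b w' r = w' r) ->
  `|w 1 - w' 1| <= 2 * `|a - b| * E 1.
Proof.
move=> cw w0 cw' w0' fw fw'.
have [B B0 hB] : exists2 B, 0 <= B & forall r, 0 <= r <= 1 -> `|w r - w' r| <= B * E r.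
  have cd : {within `[(0:R), 1], continuous (fun r => w (cl r) - w' (cl r))}.
    apply: continuous_subspaceT => r; have h1 := cw r; have h2 := cw' r.
    by apply: cvgB.
  have [B [_ hB]] := compact_bounded (continuous_compact cd (@segment_compact _ 0 1)).
  exists (`|B| + 1) => [|r r01]; first by rewrite addr_ge0.
  have /andP[r0 _] := r01.
  apply: (@le_trans _ _ (`|B| + 1)); last by rewrite ler_peMr ?weight_ge1 // addr_ge0.
  apply: hB; first by rewrite (le_lt_trans (ler_norm _)) // ltrDl.
  by exists r; [rewrite /= in_itv|rewrite (cl_id r01)].
have iter_bound n r : 0 <= r <= 1 -> `|w r - w' r| <= (2 * `|a - b| + B / 2 ^+ n) * E r.
  elim: n r => [|n IH] r r01.
    rewrite expr0 divr1; apply: le_trans (hB r r01) _.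
    by rewrite ler_wpM2r ?expR_ge0 // lerDr mulr_ge0.
  have B1 : 0 <= 2 * `|a - b| + B / 2 ^+ n by rewrite addr_ge0 ?mulr_ge0 ?divr_ge0 ?exprn_ge0.
  have := pic_contract a b B1 cw w0 cw' w0' IH r01; rewrite fw // fw' // => /le_trans; apply.
  rewrite ler_wpM2r ?expR_ge0 // exprSr.
  suff -> : `|a - b| + (2 * `|a - b| + B / 2 ^+ n) / 2 = 2 * `|a - b| + B / (2 ^+ n * 2) by [].
  by field; rewrite expf_neq0 ?pnatr_eq0.
rewrite leNgt; apply/negP => h.
pose c := B * E 1 + 1; have c0 : 0 < c by rewrite ltr_wpDl // mulr_ge0 ?expR_ge0.
have h' : 0 < (`|w 1 - w' 1| - 2 * `|a - b| * E 1) / c by rewrite divr_gt0 // subr_gt0.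
have [n hn] := pow2_small h'.
have := iter_bound n 1; rewrite ler01 lexx => /(_ isT).
rewrite ltr_pdivlMr // in hn; have p0 : 0 < (2 ^+ n)^-1 :> R by rewrite invr_gt0 exprn_gt0.
by rewrite /c in hn; lra.
Qed.

Lemma picard_family : exists V V1 : R -> R -> R,
  (forall a, [/\ V a 0 = 0, V1 a 0 = a &
    forall r, 0 <= r <= 1 -> der (V a) r (V1 a r) /\ der (V1 a) r (- g r (V a r))]) /\
  (exists2 C, 0 <= C & forall a b, `|V a 1 - V b 1| <= C * `|a - b|).
Proof.
have /choice [W hW] : forall a, exists w, [/\ continuous (fun r => w (cl r)), w 0 = 0 &
    forall r, 0 <= r <= 1 -> pic a w r = w r].
  move=> a; have [v [v1 [_ _ _ [w [-> cw w0 vw]]]]] := picard a.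
  by exists w.
exists (fun a => pic a (W a)), (fun a => pic1 a (W a)); split.
  move=> a; have [cw w0 vw] := hW a; split; [exact: pic_0|exact: pic1_0|].
  by move=> r r01; rewrite vw //; exact: pic_der.
exists (2 * E 1) => [|a b]; first by rewrite mulr_ge0 ?expR_ge0.
have [cw w0 vw] := hW a; have [cw' w0' vw'] := hW b.
have i1 : 0 <= (1:R) <= 1 by rewrite ler01 lexx.
by rewrite vw // vw' // mulrAC; exact: (picard_dist cw w0 cw' w0' vw vw').
Qed.

End Picard.

(** * Shooting with a truncated nonlinearity *)

Section Shooting.
Context {R : realType}.
Implicit Types (r s a w : R).

Lemma der_neg_right (f : R -> R) (x l : R) : der f x l -> l < 0 ->
  exists2 e : R, 0 < e & forall t, 0 < t < e -> f (x + t) < f x.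
Proof.
move=> [fd fl] l0.
have hc : s^-1 *: (f (s *: 1 + x) - f x) @[s --> 0^'] --> l by rewrite -fl.
have nl0 : 0 < - l by lra.
move/cvgrPdist_lt : hc => /(_ _ nl0); rewrite near_withinE => -[e /= e0 he].
exists e => // t /andP[t0 te].
have := he t; rewrite /= sub0r normrN gtr0_norm // => /(_ te (lt0r_neq0 t0)).
rewrite [t *: 1]mulr1 [_ *: _]mulrC ltr_norml => /andP[h _].
have : (f (t + x) - f x) / t < 0 by lra.
by rewrite pmulr_llt0 ?invr_gt0 // subr_lt0 addrC.
Qed.

Variables (K : R -> R) (K0 mu A d : R).
Hypotheses (K00 : 0 < K0) (mu0 : 0 < mu) (mupi : Num.sqrt mu < pi) (A0 : 0 < A).
Hypothesis Kb : forall r, 0 <= r <= 1 -> 0 <= K r <= K0.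
Hypothesis Kc : continuous (fun r => K (cl r)).
Hypotheses (d0 : 0 < d) (Kd : forall r, 0 < r < d -> 0 < K r).

Let th : R := Num.sqrt mu.

Definition trunc (x : R) : R := Num.max 0 (Num.min A x).
(** For [r > 0] and [0 <= w <= A r] this is [K w^5 / r^4 + mu w]. Truncating [w / r] makes it
    globally Lipschitz in [w] and continuous at [r = 0]; nonnegative solutions of slope [a <= A] do
    not see the truncation, since they satisfy [v <= a r]. *)
Definition rhs (r w : R) : R := r * K r * trunc (w / r) ^+ 5 + mu * w.

Lemma th_bound : 0 < th < pi.
Proof. by rewrite /th sqrtr_gt0 mu0. Qed.

Lemma th_sqr : th ^+ 2 = mu.
Proof. by rewrite sqr_sqrtr // ltW. Qed.

Lemma trunc_bound x : 0 <= trunc x <= A.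
Proof. by rewrite /trunc le_max lexx /= ge_max (ltW A0) ge_min lexx. Qed.

Lemma trunc_id x : 0 <= x <= A -> trunc x = x.
Proof. by move=> /andP[x0 xA]; rewrite /trunc (min_idPr xA) (max_idPr x0). Qed.

Lemma trunc_le x a : x <= a -> 0 <= a -> trunc x <= a.
Proof. by move=> xa a0; rewrite ge_max a0 /= ge_min xa orbT. Qed.

Lemma trunc_lip x y : `|trunc x - trunc y| <= `|x - y|.
Proof.
rewrite ler_norml; have := ler_norm (x - y); have := ler_norm (- (x - y)); rewrite normrN.
set e := `|x - y| => h1 h2; have A0' := A0.
rewrite /trunc /Order.max /Order.min.
by case: (ltP A x); case: (ltP A y); case: (ltP 0 A); case: (ltP 0 x); case: (ltP 0 y) => *; apply/andP; split; lra.
Qed.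

Lemma rhs0 r : rhs r 0 = 0.
Proof.
by rewrite /rhs mul0r trunc_id ?lexx ?(ltW A0) // expr0n /= !mulr0 addr0.
Qed.

Lemma rhs_lip r x y : 0 <= r <= 1 ->
  `|rhs r x - rhs r y| <= (5 * K0 * A ^+ 4 + mu) * `|x - y|.
Proof.
move=> r01; have /andP[r0 r1] := r01; have /andP[k0 kK] := Kb r01.
have -> : rhs r x - rhs r y =
    K r * (r * (trunc (x / r) ^+ 5 - trunc (y / r) ^+ 5)) + mu * (x - y).
  by rewrite /rhs; ring.
apply: le_trans (ler_normD _ _) _; rewrite mulrDl normrM [`|mu * _|]normrM.
rewrite (gtr0_norm mu0) (ger0_norm k0) lerD2r.
have [->|rn] := eqVneq r 0.
  by rewrite mul0r normr0 mulr0 !mulr_ge0 ?exprn_ge0 // ltW.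
have rp : 0 < r by rewrite lt_neqAle eq_sym rn.
have H x' y' : y' <= x' -> `|trunc x' ^+ 5 - trunc y' ^+ 5| <= 5 * A ^+ 4 * `|x' - y'|.
  move=> yx; have /andP[t0 tA] := trunc_bound x'; have /andP[s0 sA] := trunc_bound y'.
  have ts : trunc y' <= trunc x'.
    by rewrite /trunc; rewrite le_max2 // le_min2.
  rewrite ger0_norm; last by rewrite subr_ge0 lerXn2r.
  apply: le_trans (pow5_lip s0 ts tA) _; rewrite ler_wpM2l ?mulr_ge0 ?exprn_ge0 ?(ltW A0) //.
  by apply: le_trans (trunc_lip _ _); rewrite ler_norm.
have {}H x' y' : `|trunc x' ^+ 5 - trunc y' ^+ 5| <= 5 * A ^+ 4 * `|x' - y'|.
  by have [/H//|/ltW/H] := leP y' x'; rewrite distrC [`|y' - x'|]distrC.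
have h := H (x / r) (y / r); rewrite -mulrBl normrM normfV (gtr0_norm rp) in h.
rewrite normrM (gtr0_norm rp).
apply: (@le_trans _ _ (K0 * (r * (5 * A ^+ 4 * (`|x - y| / r))))).
  apply: ler_pM => //; first by rewrite mulr_ge0.
  by rewrite ler_pM2l.
suff -> : K0 * (r * (5 * A ^+ 4 * (`|x - y| / r))) = 5 * K0 * A ^+ 4 * `|x - y| by [].
by field.
Qed.

Lemma rhs_cont (w : R -> R) : continuous (fun r => w (cl r)) -> w 0 = 0 ->
  continuous (fun r => rhs (cl r) (w (cl r))).
Proof.
move=> cw w0 r; have c1 := @ct_cl R r; have c2 := cw r; have c3 := @Kc r.
suff : ct (fun r => rhs (cl r) (w (cl r))) r by [].
have [cr|cr] := eqVneq (cl r) 0; last first.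
  rewrite /rhs.
  have c4 : ct (fun r => trunc (w (cl r) / cl r)) r by rewrite /trunc; ctauto.
  by ctauto.
rewrite /rhs; apply: ctD; last by ctauto.
rewrite /ct; apply/cvgrPdist_lt => e e0.
pose C := K0 * A ^+ 5 + 1.
have C0 : 0 < C by rewrite ltr_wpDl // mulr_ge0 ?exprn_ge0 // ltW.
have := ct_dist c1 (divr_gt0 e0 C0); apply: filterS => s; rewrite cr subr0.
have /andP[s0 s1] := cl01 s; rewrite (ger0_norm s0) ltr_pdivlMr // => hs.
rewrite !mul0r sub0r normrN.
have /andP[k0 kK] := Kb (cl01 s); have /andP[t0 tA] := trunc_bound (w (cl s) / cl s).
rewrite ger0_norm ?mulr_ge0 ?exprn_ge0 //.
apply: le_lt_trans hs; rewrite -mulrA ler_wpM2l //.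
apply: (@le_trans _ _ (K0 * A ^+ 5)); last by rewrite /C lerDl.
by apply: ler_pM; rewrite ?exprn_ge0 // lerXn2r // nnegrE (ltW A0).
Qed.

Section OneSolution.
Variables (v v1 : R -> R) (a : R).
Hypotheses (a0 : 0 < a) (v00 : v 0 = 0) (v10 : v1 0 = a).
Hypothesis ode : forall r, 0 <= r <= 1 -> der v r (v1 r) /\ der v1 r (- rhs r (v r)).

(** The Wronskian with [sin (th r)] starts at 0 and is nonincreasing, so [v / sin (th r)] is
    nonincreasing as well. The size and sign of [v] are read off this ratio. *)
Let W r := sin (th * r) * v1 r - th * cos (th * r) * v r.

Lemma sin_pos r : 0 < r <= 1 -> 0 < sin (th * r).
Proof.
move=> /andP[r0 r1]; have /andP[t0 tpi] := th_bound; apply: sin_gt0_pi.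
by rewrite mulr_gt0 //=; apply: le_lt_trans tpi; rewrite ler_piMr // ltW.
Qed.

Lemma wronskian_der r : 0 <= r <= 1 ->
  der W r (- (sin (th * r) * (r * K r * trunc (v r / r) ^+ 5))).
Proof.
move=> r01; have [h1 h2] := ode r01; rewrite /W; dsolve => /=.
by rewrite /rhs -th_sqr; ring.
Qed.

Lemma wronskian_0 : W 0 = 0.
Proof. by rewrite /W mulr0 sin0 v00 mul0r mulr0 subrr. Qed.

Lemma wronskian_term_ge0 r : 0 <= r <= 1 -> 0 <= sin (th * r) * (r * K r * trunc (v r / r) ^+ 5).
Proof.
move=> r01; have /andP[r0 r1] := r01; have /andP[k0 _] := Kb r01.
have /andP[t0 _] := trunc_bound (v r / r).
have s0 : 0 <= sin (th * r).
  move: r0; rewrite le_eqVlt => /predU1P[<-|r0]; first by rewrite mulr0 sin0.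
  by apply/ltW/sin_pos; rewrite r0.
by rewrite !mulr_ge0 // exprn_ge0.
Qed.

Lemma wronskian_noninc r s : 0 <= r -> r <= s -> s <= 1 -> W s <= W r.
Proof.
move=> r0 rs s1; rewrite -lerN2.
apply: (@der_le R (fun x => - W x) (fun x => sin (th * x) * (x * K x * trunc (v x / x) ^+ 5)) r s rs).
  move=> x /andP[x0 x1]; apply: der_eq; last exact: opprK.
  by apply: derN; apply: wronskian_der; apply/andP; split; lra.
by move=> x /andP[x0 x1]; apply: wronskian_term_ge0; apply/andP; split; lra.
Qed.

Lemma wronskian_le0 r : 0 <= r <= 1 -> W r <= 0.
Proof. by move=> /andP[r0 r1]; rewrite -wronskian_0; exact: wronskian_noninc. Qed.

Lemma ratio_der r : 0 < r <= 1 -> der (fun r => v r / sin (th * r)) r (W r / sin (th * r) ^+ 2).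
Proof.
move=> r01; have s0 := sin_pos r01; have /andP[r0 r1] := r01.
have [|h1 h2] := ode (r := r); first by rewrite ltW.
dsolve; first by rewrite gt_eqF.
by rewrite /= /W; field; rewrite gt_eqF.
Qed.

Lemma shoot_pos_near0 : exists2 e, 0 < e <= 1 & forall r, 0 < r < e -> 0 < v r.
Proof.
have i0 : 0 <= (0:R) <= 1 by rewrite lexx ler01.
have [h _] := ode i0.
have hn : der (fun r => - v r) 0 (- a) by apply: derN; rewrite -v10.
have [|e e0 he] := der_neg_right hn; first by rewrite oppr_lt0.
exists (Num.min e 1) => [|r]; first by rewrite lt_min e0 ltr01 ge_min lexx orbT.
rewrite lt_min => /and3P[r0 re _]; have := he r; rewrite r0 re add0r v00 => /(_ isT).
lra.
Qed.

Lemma wronskian_lt0 r : 0 < r <= 1 -> W r < 0.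
Proof.
move=> /andP[r0 r1]; have [e /andP[e0 e1] he] := shoot_pos_near0.
pose s := Num.min r (Num.min e d) / 2.
have m0 : 0 < Num.min r (Num.min e d) by rewrite !lt_min r0 e0 d0.
have s0 : 0 < s by rewrite divr_gt0.
have sr : 2 * s <= r by rewrite mulrC divfK // ge_min lexx.
have se : 2 * s <= e by rewrite mulrC divfK // !ge_min lexx orbT.
have sd : 2 * s <= d by rewrite mulrC divfK // !ge_min lexx !orbT.
apply: (@le_lt_trans _ _ (W s)); first by apply: wronskian_noninc; lra.
rewrite -wronskian_0 -ltrN2.
apply: (@der_lt R (fun x => - W x) (fun x => sin (th * x) * (x * K x * trunc (v x / x) ^+ 5)) 0 s s0).
  move=> x /andP[x0 x1]; apply: der_eq; last exact: opprK.
  by apply: derN; apply: wronskian_der; apply/andP; split; lra.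
move=> x /andP[x0 x1]; have vx : 0 < v x by apply: he; lra.
have kx : 0 < K x by apply: Kd; lra.
rewrite mulr_gt0 ?sin_pos //; first by lra.
apply: mulr_gt0; [exact: mulr_gt0|apply: exprn_gt0].
by rewrite /trunc lt_max; apply/orP; right; rewrite lt_min A0 divr_gt0.
Qed.

(** The ratio [v / sin (th r)] is nonincreasing with limit [a / th] at 0. In place of the limit,
    slopes at 0 are compared: a larger ratio [q] at [r] would give [v >= q sin (th s)] on [(0, r)],
    although [a < q th]. *)
Lemma shoot_le_sin r : 0 < r <= 1 -> v r <= a / th * sin (th * r).
Proof.
move=> r01; have s0 := sin_pos r01; have /andP[t0 tpi] := th_bound.
rewrite -ler_pdivrMr // leNgt; apply/negP => h; set q := v r / sin (th * r) in h.
have /andP[r0 r1] := r01.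
have hq s : 0 < s < r -> q * sin (th * s) <= v s.
  move=> /andP[x0 xr]; have sx : 0 < sin (th * s) by apply: sin_pos; lra.
  rewrite -ler_pdivlMr // /q -lerN2.
  apply: (@der_le R (fun x => - (v x / sin (th * x))) (fun x => - (W x / sin (th * x) ^+ 2)) s r).
  - exact: ltW.
  - by move=> x /andP[? ?]; apply: derN; apply: ratio_der; lra.
  - move=> x /andP[? ?]; rewrite -mulNr divr_ge0 ?sqr_ge0 // oppr_ge0.
    by apply: wronskian_le0; apply/andP; split; lra.
have i0 : 0 <= (0:R) <= 1 by rewrite lexx ler01.
have [h0 _] := ode i0.
have hn : der (fun r => v r - q * sin (th * r)) 0 (a - q * th).
  by dsolve => /=; rewrite v10 mulr0 cos0; ring.
have [|e e0 he] := der_neg_right hn; first by rewrite subr_lt0 -ltr_pdivrMr.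
pose s := Num.min r e / 2.
have x0 : 0 < s by rewrite divr_gt0 // lt_min r0.
have sr : 2 * s <= r by rewrite mulrC divfK // ge_min lexx.
have se : 2 * s <= e by rewrite mulrC divfK // ge_min lexx orbT.
have := he s; rewrite add0r mulr0 sin0 mulr0 subr0 v00 => /(_ _).
have := hq s; lra.
Qed.

Lemma shoot_le r : 0 <= r <= 1 -> v r <= a * r.
Proof.
move=> /andP[r0 r1]; move: r0; rewrite le_eqVlt => /predU1P[<-|r0]; first by rewrite v00 mulr0.
have /andP[t0 tpi] := th_bound.
apply: le_trans (shoot_le_sin _) _; first by rewrite r0.
rewrite -mulrA ler_pM2l // mulrC ler_pdivrMr // [r * th]mulrC sin_lex //.
by rewrite mulr_ge0 // ltW.
Qed.

(** Sturm comparison: the ratio decreases strictly and is nonnegative at 1, where [sin th > 0]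
    because [th < pi]. *)
Lemma shoot_pos : 0 <= v 1 -> forall r, 0 < r < 1 -> 0 < v r.
Proof.
move=> v11 r /andP[r0 r1].
have sr : 0 < sin (th * r) by apply: sin_pos; rewrite r0 ltW.
have s1 : 0 < sin (th * 1) by apply: sin_pos; rewrite ltr01 lexx.
have : v 1 / sin (th * 1) < v r / sin (th * r).
  rewrite -ltrN2.
  apply: (@der_lt R (fun x => - (v x / sin (th * x))) (fun x => - (W x / sin (th * x) ^+ 2)) r 1) => //.
  - by move=> x /andP[? ?]; apply: derN; apply: ratio_der; lra.
  - move=> x /andP[? ?]; rewrite -mulNr divr_gt0 ?exprn_gt0 ?sin_pos ?oppr_gt0 ?wronskian_lt0 //; lra.
by move=> h; rewrite -(pmulr_lgt0 _ (_ : 0 < (sin (th * r))^-1)) ?invr_gt0 // (le_lt_trans _ h) // divr_ge0 // ltW.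
Qed.

Lemma ode_pos r : a <= A -> 0 < r <= 1 -> 0 <= v r ->
  der v1 r (- (K r * v r ^+ 5 / r ^+ 4 + mu * v r)).
Proof.
move=> aA /andP[r0 r1] vr; have r01 : 0 <= r <= 1 by rewrite ltW.
have [_ h] := ode r01; apply: der_eq h _; congr (- _).
rewrite /rhs trunc_id; first by field; rewrite gt_eqF.
rewrite divr_ge0 ?(ltW r0) //= ler_pdivrMr //; apply: le_trans (shoot_le r01) _.
by rewrite ler_pM2r.
Qed.

(** If [v 1 <= 0], the bound [W >= - th K0 a^5 x^3] keeps the ratio [v / sin (th r)] below
    [C = th K0 a^5 / sin(th)^2], whereas its limit at 0 is [a / th]. The hypothesis on [a] says
    exactly that [C < a / th]. *)
Lemma small_slope : th * K0 / sin th ^+ 2 * a ^+ 4 * th < 1 -> a <= A -> 0 < v 1.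
Proof.
move=> ha aA; rewrite ltNge; apply/negP => v11.
have /andP[t0 tpi] := th_bound.
have s1 : 0 < sin th by rewrite sin_gt0_pi // t0.
have sl x : 0 < x <= 1 -> x * sin th <= sin (th * x).
  move=> /andP[x0 x1]; have := @der_le R (fun x => - (sin (th * x) / x))
    (fun x => (sin (th * x) - th * x * cos (th * x)) / x ^+ 2) x 1 x1.
  rewrite lerN2 mulr1 divr1 => h; rewrite mulrC -ler_pdivlMr //; apply: h.
    move=> y /andP[y1 y2]; have y0 : y != 0 by rewrite gt_eqF // (lt_le_trans x0).
    by dsolve => //=; field.
  move=> y /andP[y1 y2]; rewrite divr_ge0 ?sqr_ge0 // subr_ge0 ltW // xcosx_lt_sinx //.
  have y0 : 0 < y := lt_trans x0 y1.
  by rewrite mulr_gt0 //=; apply: lt_trans tpi; rewrite gtr_pMr.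
have Wlow x : 0 <= x <= 1 -> - (th * K0 * a ^+ 5 * x ^+ 3) <= W x.
  move=> /andP[x0 x1].
  have := @der_le R (fun x => W x + th * K0 * a ^+ 5 * x ^+ 3)
    (fun x => - (sin (th * x) * (x * K x * trunc (v x / x) ^+ 5)) +
      3 * (th * K0 * a ^+ 5 * x ^+ 2)) 0 x x0.
  rewrite wronskian_0 expr0n mulr0 addr0 => h; rewrite -subr_ge0 opprK; apply: h.
    move=> y /andP[y0 y1]; have hW := wronskian_der (r := y).
    by apply: der_eq; [apply: derD; [apply: hW; rewrite y0 (le_trans y1)|dauto]|rewrite /=; ring].
  move=> y /andP[y0 yx]; have y1 : y <= 1 by exact: le_trans (ltW yx) x1.
  have i : 0 <= y <= 1 by rewrite ltW.
  have /andP[k0 kK] := Kb i; have /andP[q0 _] := trunc_bound (v y / y).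
  have tq : trunc (v y / y) <= a.
    apply: trunc_le (ltW a0); rewrite ler_pdivrMr //; exact: shoot_le.
  have q5 : trunc (v y / y) ^+ 5 <= a ^+ 5 by rewrite lerXn2r // nnegrE ltW.
  have sy : 0 <= sin (th * y) by apply/ltW/sin_pos; rewrite y0.
  have sy2 : sin (th * y) <= th * y by apply: sin_lex; rewrite mulr_ge0 // ltW.
  have p1 : y * K y * trunc (v y / y) ^+ 5 <= y * K0 * a ^+ 5.
    by apply: ler_pM; rewrite ?mulr_ge0 ?exprn_ge0 ?(ltW y0) // ler_pM2l.
  have p2 : sin (th * y) * (y * K y * trunc (v y / y) ^+ 5) <= th * y * (y * K0 * a ^+ 5).
    by apply: ler_pM => //; rewrite !mulr_ge0 ?exprn_ge0 // ltW.
  have p3 : 0 <= th * K0 * a ^+ 5 * y ^+ 2 by rewrite !mulr_ge0 ?exprn_ge0 // ltW.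
  have p4 : th * y * (y * K0 * a ^+ 5) = th * K0 * a ^+ 5 * y ^+ 2 by ring.
  by rewrite p4 in p2; lra.
pose C := th * K0 / sin th ^+ 2 * a ^+ 5.
have C0 : 0 < C by rewrite /C mulr_gt0 ?exprn_gt0 // divr_gt0 ?exprn_gt0 ?mulr_gt0.
have key s : 0 < s < 1 -> v s <= C * sin (th * s).
  move=> /andP[x0 x1]; have sx : 0 < sin (th * s) by apply: sin_pos; lra.
  rewrite -ler_pdivrMr //.
  have := @der_le R (fun x => v x / sin (th * x) + C * x) (fun x => W x / sin (th * x) ^+ 2 + C) s 1 (ltW x1).
  rewrite mulr1 => h.
  have : v s / sin (th * s) + C * s <= v 1 / sin th + C * 1.
    apply: h => x /andP[y0 y1].
      by apply: der_eq; [apply: derD; [apply: ratio_der; lra|dauto]|rewrite /=; ring].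
    have yp : 0 < x := lt_trans x0 y0.
    have sy : x * sin th <= sin (th * x) by apply: sl; lra.
    have sp : 0 < sin (th * x) by apply: sin_pos; lra.
    have w := Wlow x; have {}w : - (th * K0 * a ^+ 5 * x ^+ 3) <= W x by apply: w; apply/andP; split; lra.
    have e1 : C * sin (th * x) ^+ 2 >= th * K0 * a ^+ 5 * x ^+ 2.
      have -> : th * K0 * a ^+ 5 * x ^+ 2 = C * (x * sin th) ^+ 2.
        by rewrite /C; field; rewrite gt_eqF.
      by rewrite ler_pM2l // lerXn2r // nnegrE ?mulr_ge0 // ltW.
    have e2 : th * K0 * a ^+ 5 * x ^+ 3 <= th * K0 * a ^+ 5 * x ^+ 2.
      rewrite ler_pM2l; last by rewrite !mulr_gt0 ?exprn_gt0.
      by rewrite exprS ler_piMl ?exprn_ge0 ?ltW.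
    have -> : W x / sin (th * x) ^+ 2 + C = (C * sin (th * x) ^+ 2 + W x) / sin (th * x) ^+ 2.
      by field; rewrite gt_eqF.
    by rewrite divr_ge0 ?sqr_ge0 //; lra.
  have : v 1 / sin th <= 0 by rewrite pmulr_lle0 // invr_gt0.
  have : 0 <= C * s by rewrite mulr_ge0 ?ltW.
  lra.
have i0 : 0 <= (0:R) <= 1 by rewrite lexx ler01.
have [h0 _] := ode i0.
have hn : der (fun r => C * sin (th * r) - v r) 0 (C * th - a).
  by dsolve => /=; rewrite v10 mulr0 cos0; ring.
have [|e e0 he] := der_neg_right hn.
  have -> : C * th - a = a * (th * K0 / sin th ^+ 2 * a ^+ 4 * th - 1).
    by rewrite /C; ring.
  by rewrite pmulr_rlt0 // subr_lt0.
pose s := Num.min 1 e / 2.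
have x0 : 0 < s by rewrite divr_gt0 // lt_min ltr01.
have sr : 2 * s <= 1 by rewrite mulrC divfK // ge_min lexx.
have se : 2 * s <= e by rewrite mulrC divfK // ge_min lexx orbT.
have := he s; rewrite add0r mulr0 sin0 mulr0 v00 subr0 => /(_ _).
have := key s; lra.
Qed.

End OneSolution.

(** Intermediate value theorem in the slope, all solutions being taken with the same truncation
    level [A]; the slope found is at most [A], so the truncation is inactive for its solution. *)
Lemma shooting : (forall v v1, v 0 = 0 -> v1 0 = A ->
    (forall r, 0 <= r <= 1 -> der v r (v1 r) /\ der v1 r (- rhs r (v r))) -> v 1 < 0) ->
  exists a v v1, [/\ 0 < a, v 0 = 0, v1 0 = a, v 1 = 0 &
    [/\ forall r, 0 <= r <= 1 -> der v r (v1 r), forall r, 0 < r <= 1 ->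
      der v1 r (- (K r * v r ^+ 5 / r ^+ 4 + mu * v r)),
      ct v1 0, forall r, 0 < r < 1 -> 0 < v r & forall r, 0 <= r <= 1 -> v r <= a * r]].
Proof.
move=> hA; have /andP[t0 tpi] := th_bound.
have s1 : 0 < sin th by rewrite sin_gt0_pi // t0.
have M0 : 0 < 5 * K0 * A ^+ 4 + mu by rewrite addr_gt0 // !mulr_gt0 ?exprn_gt0.
have [V [V1 [hV [C C0 hC]]]] := picard_family M0 rhs0 rhs_lip rhs_cont.
pose q := th * K0 / sin th ^+ 2 * th.
have q0 : 0 < q by rewrite mulr_gt0 // divr_gt0 ?exprn_gt0 // mulr_gt0.
(* Since [a0 <= 1], one gets [q a0^4 <= q a0 <= 1/2], as [small_slope] demands. *)
pose a0 := Num.min (Num.min 1 (2 * q)^-1) A.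
have a00 : 0 < a0 by rewrite !lt_min ltr01 A0 invr_gt0 mulr_gt0.
have a0A : a0 <= A by rewrite ge_min lexx orbT.
have a01 : a0 <= 1 by rewrite !ge_min lexx.
have a0q : a0 <= (2 * q)^-1 by rewrite !ge_min lexx orbT.
have F0 : 0 < V a0 1.
  have [h1 h2 h3] := hV a0; apply: (small_slope a00 h1 h2 h3) => //.
  have -> : th * K0 / sin th ^+ 2 * a0 ^+ 4 * th = q * a0 ^+ 4 by rewrite /q; ring.
  have : a0 ^+ 4 <= a0 by rewrite exprS ler_piMr ?exprn_ile1 ?(ltW a00).
  have : q * a0 <= 1/2.
    rewrite mulrC; apply: le_trans (ler_wpM2r (ltW q0) a0q) _.
    by rewrite invfM mulfVK ?gt_eqF //; lra.
  move=> h h'; have : q * a0 ^+ 4 <= q * a0 by rewrite ler_pM2l.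
  lra.
have FA : V A 1 < 0 by have [h1 h2 h3] := hV A; exact: hA h3.
have cF : {within `[a0, A], continuous (fun a => V a 1)}.
  apply: continuous_subspaceT => a; apply/cvgrPdist_lt => e e0.
  have C1 : 0 < C + 1 by rewrite ltr_wpDl.
  exists (e / (C + 1)); first by rewrite /= divr_gt0.
  move=> b /=; rewrite ltr_pdivlMr // => hb.
  apply: le_lt_trans (hC a b) _; apply: le_lt_trans hb.
  by rewrite mulrC ler_wpM2l // lerDl.
have mid : Num.min (V a0 1) (V A 1) <= 0 <= Num.max (V a0 1) (V A 1).
  by rewrite ge_min le_max (ltW FA) (ltW F0) orbT.
have [a] := IVT a0A cF mid; rewrite in_itv /= => /andP[aa0 aA] a1.
have ap : 0 < a by exact: lt_le_trans aa0.
have [h1 h2 h3] := hV a; have i0 : 0 <= (0:R) <= 1 by rewrite lexx ler01.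
have pos := shoot_pos ap h1 h2 h3; rewrite a1 lexx in pos.
exists a, (V a), (V1 a); split=> //; split.
- by move=> r /h3 [].
- move=> r /andP[r0 r1]; apply: (ode_pos ap h1 h2 h3) => //; first by rewrite r0.
  move: r1; rewrite le_eqVlt => /predU1P[->|r1]; first by rewrite a1.
  by rewrite ltW // pos // r0.
- by have [_ h] := h3 0 i0; exact: der_cont h.
- exact: pos.
- by move=> r r01; exact: (shoot_le ap h1 h2 h3 r01).
Qed.

End Shooting.

(** * Decay of solutions with large slope away from the origin *)

Section BubbleBound.
Context {R : realType}.
Implicit Types (r s t : R).

Variables (K dK v v1 : R -> R) (A K0 mu L d : R).
Hypotheses (A0 : 0 < A) (K00 : 0 < K0) (mu0 : 0 < mu) (L0 : 0 < L).
Hypotheses (d01 : 0 < d <= 1) (Ld : 4 * L * d <= K0) (muA : mu <= K0 * A ^+ 4).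
Hypotheses (v00 : v 0 = 0) (v10 : v1 0 = A).
Hypothesis hv : forall r, 0 <= r <= 1 -> der v r (v1 r) /\
  der v1 r (- (K r * v r ^+ 5 / r ^+ 4 + mu * v r)).
Hypothesis vpos : forall r, 0 < r < 1 -> 0 < v r.
Hypothesis vle : forall r, 0 <= r <= 1 -> v r <= A * r.
Hypothesis Kb : forall r, 0 <= r <= 1 -> 0 <= K r <= K0.
Hypothesis Kd : forall r, 0 < r < d -> [/\ der K r (dK r), - L <= dK r & K0 / 2 <= K r].

Let g r := K r * v r ^+ 5 / r ^+ 4 + mu * v r.

Lemma force_bound r : 0 <= r < 1 -> 0 <= g r <= 2 * K0 * A ^+ 5 * r.
Proof.
move=> /andP[r0 r1]; move: r0; rewrite le_eqVlt => /predU1P[<-|r0].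
  by rewrite /g v00 expr0n /= !mulr0 mul0r add0r lexx.
have i : 0 <= r <= 1 by rewrite !ltW.
have /andP[k0 kK] := Kb i; have vp : 0 < v r by apply: vpos; rewrite r0.
apply/andP; split; first by rewrite /g addr_ge0 ?divr_ge0 ?mulr_ge0 ?exprn_ge0 // ltW.
have h5 : v r ^+ 5 <= (A * r) ^+ 5 by rewrite lerXn2r ?nnegrE ?vle ?mulr_ge0 // ltW.
have h1 : K r * v r ^+ 5 / r ^+ 4 <= K0 * A ^+ 5 * r.
  rewrite ler_pdivrMr ?exprn_gt0 //.
  have -> : K0 * A ^+ 5 * r * r ^+ 4 = K0 * (A * r) ^+ 5 by ring.
  by apply: ler_pM => //; rewrite exprn_ge0 // ltW.
have h2 : mu * v r <= K0 * A ^+ 4 * (A * r).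
  by apply: ler_pM => //; rewrite ?(ltW mu0) ?(ltW vp) ?vle.
have -> : 2 * K0 * A ^+ 5 * r = K0 * A ^+ 5 * r + K0 * A ^+ 4 * (A * r) by ring.
by rewrite /g lerD.
Qed.

Lemma slope_lower r : 0 <= r < 1 -> A - K0 * A ^+ 5 * r ^+ 2 <= v1 r.
Proof.
move=> /andP[r0 r1].
have := @der_le R (fun s => v1 s + K0 * A ^+ 5 * s ^+ 2) (fun s => - g s + 2 * K0 * A ^+ 5 * s) 0 r r0.
rewrite v10 expr0n mulr0 addr0 -lerBlDr; apply.
  move=> x /andP[x0 xr]; have [|_ h] := hv (r := x); first by rewrite x0 /= (le_trans xr) // ltW.
  by rewrite -/(g x) in h; dsolve => /=; ring.
move=> x /andP[x0 xr]; have [|_ h] := andP (force_bound (r := x) _); last by lra.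
by rewrite ltW //= (lt_trans xr).
Qed.

Lemma shoot_lower r : 0 <= r < 1 -> A * r - K0 * A ^+ 5 * r ^+ 3 <= v r.
Proof.
move=> /andP[r0 r1].
have := @der_le R (fun s => v s - A * s + K0 * A ^+ 5 * s ^+ 3)
  (fun s => v1 s - A + 3 * K0 * A ^+ 5 * s ^+ 2) 0 r r0.
rewrite v00 expr0n !mulr0 addr0 subrr => h.
suff : 0 <= v r - A * r + K0 * A ^+ 5 * r ^+ 3 by lra.
apply: h => [x /andP[x0 xr]|x /andP[x0 xr]].
  have [|h _] := hv (r := x); first by rewrite x0 /= (le_trans xr) // ltW.
  by dsolve => /=; ring.
have := slope_lower (r := x); rewrite (ltW x0) (lt_trans xr) // => /(_ isT).
have : 0 <= K0 * A ^+ 5 * x ^+ 2 by rewrite !mulr_ge0 ?exprn_ge0 // ltW.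
lra.
Qed.

(** The length scale [A^-2] of the bubble. The factor gives
    [K0 A^4 core^2 = K0 / (1 + K0)^2 <= 1/2], so that [v] stays above half its tangent [A r]. *)
Definition core : R := (1 + K0)^-1 / A ^+ 2.

Lemma core_gt0 : 0 < core.
Proof. by rewrite divr_gt0 ?exprn_gt0 // invr_gt0 addr_gt0. Qed.

Lemma core_lower r : 0 <= r <= core -> r < 1 -> A / 2 * r <= v r.
Proof.
move=> /andP[r0 rc] r1; have := shoot_lower (r := r); rewrite r0 r1 => /(_ isT).
apply: le_trans.
have h1 : r ^+ 2 <= core ^+ 2 by rewrite lerXn2r // nnegrE (le_trans r0).
have K1 : 0 < 1 + K0 by rewrite addr_gt0.
have h2 : K0 * A ^+ 4 * core ^+ 2 <= 1 / 2.
  have -> : K0 * A ^+ 4 * core ^+ 2 = K0 / (1 + K0) ^+ 2.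
    by rewrite /core; field; rewrite !gt_eqF.
  by rewrite ler_pdivrMr ?exprn_gt0 //; have := sqr_ge0 K0; lra.
have h3 : K0 * A ^+ 4 * r ^+ 2 <= 1 / 2.
  by apply: le_trans h2; rewrite ler_pM2l // mulr_gt0 ?exprn_gt0.
have -> : A * r - K0 * A ^+ 5 * r ^+ 3 = A * r * (1 - K0 * A ^+ 4 * r ^+ 2) by ring.
have h4 : A * r * (1 / 2) <= A * r * (1 - K0 * A ^+ 4 * r ^+ 2).
  by rewrite ler_wpM2l ?mulr_ge0 ?(ltW A0) //; lra.
lra.
Qed.

Lemma slope_noninc r s : 0 <= r -> r <= s -> s < 1 -> v1 s <= v1 r.
Proof.
move=> r0 rs s1; rewrite -lerN2; apply: (@der_le R (fun x => - v1 x) g r s) => //.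
  move=> x /andP[x0 x1]; have [|_ h] := hv (r := x); first by rewrite (le_trans r0) //= (le_trans x1) // ltW.
  by apply: der_eq; [apply: derN; exact: h|rewrite opprK].
move=> x /andP[x0 x1]; have [|] := andP (force_bound (r := x) _) => //.
by rewrite (le_trans r0 (ltW x0)) (lt_trans x1).
Qed.

(** This is [- r^2 (v / r)']; its sign gives the monotonicity of [v / r]. *)
Let m r := v r - r * v1 r.

Lemma defect_der r : 0 <= r <= 1 -> der m r (r * g r).
Proof. by move=> /hv [h1 h2]; rewrite -/(g r) in h2; rewrite /m; dsolve => /=; ring. Qed.

Lemma defect_ge0 r : 0 <= r < 1 -> 0 <= m r.
Proof.
move=> /andP[r0 r1]; have -> : 0 = m 0 by rewrite /m v00 mul0r subr0.
apply: (@der_le R m (fun x => x * g x) 0 r) => // x /andP[x0 x1].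
  by apply: defect_der; rewrite x0 (le_trans x1) // ltW.
have [|h _] := andP (force_bound (r := x) _); first by rewrite ltW //= (lt_trans x1).
by rewrite mulr_ge0 // ltW.
Qed.

(** Where [K >= K0 / 2] one has [c K >= L], which outweighs [dK >= - L]; the condition on [d] keeps
    [c r <= 1/2]. *)
Let c := 2 * L / K0.

Let c_gt0 : 0 < c. Proof. by rewrite /c divr_gt0 // mulr_gt0. Qed.
Let c_d : c * d <= 1 / 2.
Proof. by rewrite /c mulrAC ler_pdivrMr //; have := Ld; lra. Qed.

(* [Y] is the Pohozaev functional corrected by the term [c v m], which
   compensates for the decrease of [K]. *)
Let Y r := 3 * v1 r * (r * v1 r - v r) + K r * v r ^+ 6 / r ^+ 3 + mu * r * v r ^+ 2 +
  c * v r * m r.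

Lemma poho_defect_der r : 0 < r < d -> der Y r (dK r * v r ^+ 6 / r ^+ 3 + 4 * mu * v r * m r +
  c * v1 r * m r + c * v r * (r * g r)).
Proof.
move=> rd; have /andP[r0 rd'] := rd; have /andP[d0 d1] := d01.
have [|h1 h2] := hv (r := r); first by rewrite ltW //= ltW // (lt_le_trans rd').
have [h3 _ _] := Kd rd; have rn : r != 0 by rewrite gt_eqF.
rewrite /Y /m; dsolve; first by rewrite expf_neq0.
by rewrite /g /=; field.
Qed.

(** As long as [v1 >= 0], every term of [Y'] other than the one with [dK] is nonnegative, and
    [c v r g] contains [c K v^6 / r^3], which outweighs that one. Moreover [Y] is bounded below by a
    multiple of [- r] near 0. *)
Lemma poho_defect_ge0 r : 0 < r < d -> 0 <= v1 r -> 0 <= Y r.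
Proof.
move=> /andP[r0 rd] v1r; have /andP[d0 d1] := d01.
have pos x : 0 < x <= r -> [/\ 0 < v x, 0 <= m x, 0 <= v1 x, 0 <= K x & 0 <= g x].
  move=> /andP[x0 xr]; have x1 : x < 1 by lra.
  have i : 0 <= x < 1 by rewrite ltW.
  have i' : 0 <= x <= 1 by rewrite !ltW.
  split; first by apply: vpos; rewrite x0.
  - exact: defect_ge0.
  - by apply: le_trans v1r _; apply: slope_noninc; lra.
  - by have /andP[] := Kb i'.
  - by have /andP[] := force_bound i.
apply: (@der_le_at0 R Y (fun x => dK x * v x ^+ 6 / x ^+ 3 + 4 * mu * v x * m x +
  c * v1 x * m x + c * v x * (x * g x)) r r0).
- by move=> x /andP[x0 xr]; apply: poho_defect_der; lra.
- move=> x /andP[x0 xr]; have [|p1 p2 p3 p4 p5] := pos x; first by rewrite x0 ltW.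
  have [|_ kL kK] := Kd (r := x); first by rewrite x0 (lt_trans xr).
  have v6 : 0 <= v x ^+ 6 / x ^+ 3 by rewrite divr_ge0 ?exprn_ge0 // ltW.
  have e1 : c * v x * (x * g x) = c * K x * (v x ^+ 6 / x ^+ 3) + c * (mu * x * v x ^+ 2).
    by rewrite /g; field; rewrite gt_eqF.
  have e2 : L * (v x ^+ 6 / x ^+ 3) <= c * K x * (v x ^+ 6 / x ^+ 3).
    rewrite ler_wpM2r //; have : c * (K0 / 2) <= c * K x by rewrite ler_wpM2l // ltW.
    by apply: le_trans; rewrite /c le_eqVlt; apply/orP; left; apply/eqP; field; rewrite gt_eqF.
  have e3 : - L * (v x ^+ 6 / x ^+ 3) <= dK x * (v x ^+ 6 / x ^+ 3) by rewrite ler_wpM2r.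
  have e4 : 0 <= 4 * mu * v x * m x by rewrite !mulr_ge0 // ltW.
  have e5 : 0 <= c * v1 x * m x by rewrite mulr_ge0 // mulr_ge0 // ltW.
  have e6 : 0 <= c * (mu * x * v x ^+ 2).
    by apply: mulr_ge0; [exact: ltW|rewrite !mulr_ge0 ?exprn_ge0 // ltW].
  by rewrite e1 -mulrA; lra.
- move=> e e0; pose x := Num.min (r / 2) (e / (3 * A ^+ 2)).
  have A2 : 0 < 3 * A ^+ 2 by rewrite mulr_gt0 ?exprn_gt0.
  have x0 : 0 < x by rewrite lt_min !divr_gt0.
  have xr : x <= r / 2 by rewrite ge_min lexx.
  have xe : x <= e / (3 * A ^+ 2) by rewrite ge_min lexx orbT.
  rewrite ler_pdivlMr // in xe.
  exists x; first by rewrite x0 /=; lra.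
  have [|p1 p2 p3 p4 p5] := pos x; first by rewrite x0 /=; lra.
  have vx : v x <= A * x by apply: vle; apply/andP; split; lra.
  have v1x : v1 x <= A by rewrite -v10; apply: slope_noninc; lra.
  have t1 : 0 <= K x * v x ^+ 6 / x ^+ 3.
    by rewrite divr_ge0 ?mulr_ge0 ?exprn_ge0 // ltW.
  have t2 : 0 <= mu * x * v x ^+ 2 by rewrite !mulr_ge0 ?exprn_ge0 // ltW.
  have t3 : 0 <= c * v x * m x.
    by apply: mulr_ge0 => //; apply: mulr_ge0; exact: ltW.
  have t4 : v1 x * v x <= A * (A * x) by apply: ler_pM => //; exact: ltW.
  have t5 : 0 <= v1 x * (x * v1 x) by rewrite !mulr_ge0 // ltW.
  rewrite /Y -[3 * v1 x * _]mulrA mulrBr; lra.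
Qed.

(** [2 r h] is the derivative of [r^2 / v^2]. For the model profile
    [A r / sqrt (1 + K0 A^4 r^2 / 3)] it is the constant [K0 A^2 / 3], of which a fraction is
    preserved below. *)
Let h r := m r / v r ^+ 3.

Lemma defect_ratio_der r : 0 < r < 1 -> der h r ((r * g r * v r - 3 * m r * v1 r) / v r ^+ 4).
Proof.
move=> r01; have /andP[r0 r1] := r01; have vp := vpos r01.
have i : 0 <= r <= 1 by rewrite !ltW.
have [h1 _] := hv i; have h2 := defect_der i.
rewrite /h; dsolve; first by rewrite expf_neq0 // gt_eqF.
by rewrite /=; field; rewrite gt_eqF.
Qed.

(** In the core [v >= A x / 2] and [K >= K0 / 2] give [m' >= K0 A^5 x^2 / 64]; integration turns 64
    into 192, and [v <= A r] divides by [A^3 r^3]. *)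
Lemma defect_ratio_core r : 0 < r <= core -> r < d -> K0 * A ^+ 2 / 192 <= h r.
Proof.
move=> /andP[r0 rc] rd; have /andP[d0 d1] := d01; have r1 : r < 1 by lra.
have vp : 0 < v r by apply: vpos; rewrite r0.
have hm : K0 * A ^+ 5 / 192 * r ^+ 3 <= m r.
  have := @der_le R (fun x => m x - K0 * A ^+ 5 / 192 * x ^+ 3)
    (fun x => x * g x - K0 * A ^+ 5 / 64 * x ^+ 2) 0 r (ltW r0).
  have m00 : m 0 = 0 by rewrite /m v00 mul0r subr0.
  rewrite m00 expr0n mulr0 subr0 subr_ge0; apply.
    move=> x /andP[x0 xr]; have hx := defect_der (r := x).
    apply: der_eq; first apply: derD; [apply: hx; lra| |].
      by dauto.
    by rewrite /=; field.
  move=> x /andP[x0 xr]; have x1 : x < 1 by lra.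
  have vx : A / 2 * x <= v x by apply: core_lower; lra.
  have [|_ _ kK] := Kd (r := x); first by rewrite x0 /=; lra.
  have A2x : 0 <= A / 2 * x by rewrite mulr_ge0 ?divr_ge0 // ltW.
  have v5 : (A / 2 * x) ^+ 5 <= v x ^+ 5 by rewrite lerXn2r // nnegrE (le_trans A2x).
  have h1 : K0 / 2 * (A / 2 * x) ^+ 5 <= K x * v x ^+ 5.
    by apply: ler_pM; rewrite ?exprn_ge0 ?divr_ge0 // ltW.
  have h2 : x * (K0 / 2 * (A / 2 * x) ^+ 5 / x ^+ 4) <= x * (K x * v x ^+ 5 / x ^+ 4).
    by rewrite ler_pM2l // ler_pM2r // invr_gt0 exprn_gt0.
  have e : x * (K0 / 2 * (A / 2 * x) ^+ 5 / x ^+ 4) = K0 * A ^+ 5 / 64 * x ^+ 2.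
    by field; rewrite gt_eqF.
  have h3 : 0 <= x * (mu * v x).
    by rewrite !mulr_ge0 ?(ltW x0) ?(ltW mu0) // (le_trans A2x).
  by rewrite e in h2; rewrite /g mulrDr; lra.
rewrite ler_pdivlMr ?exprn_gt0 //; apply: le_trans hm.
have v3 : v r ^+ 3 <= (A * r) ^+ 3.
  by rewrite lerXn2r ?nnegrE ?(ltW vp) ?mulr_ge0 ?(ltW A0) ?(ltW r0) // vle // !ltW.
have -> : K0 * A ^+ 5 / 192 * r ^+ 3 = K0 * A ^+ 2 / 192 * (A * r) ^+ 3 by ring.
have KA : 0 < K0 * A ^+ 2 by rewrite mulr_gt0 ?exprn_gt0.
by apply: ler_wpM2l v3; apply: (divr_ge0 (ltW KA)); rewrite ler0n.
Qed.

(** [Y >= 0] amounts to [h' >= - c h], so [h / (1 - c x)] is nondecreasing beyond the core; since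
    [c x <= 1/2], at most half of the value in the core is lost. *)
Lemma defect_ratio_lower r : 0 < r < d -> 0 <= v1 r -> K0 * A ^+ 2 / 384 <= h r.
Proof.
move=> /andP[r0 rd] v1r; have /andP[d0 d1] := d01.
have KA : 0 < K0 * A ^+ 2 by rewrite mulr_gt0 ?exprn_gt0.
have [rc|rc] := leP r core.
  by have := defect_ratio_core (r := r); rewrite r0 rc => /(_ isT rd); lra.
have cg := core_gt0; have hc : K0 * A ^+ 2 / 192 <= h core.
  by apply: defect_ratio_core; [rewrite cg lexx|lra].
have cx x : x <= r -> 1/2 <= 1 - c * x.
  move=> xr; have : c * x <= c * d by rewrite ler_pM2l // (le_trans xr) // ltW.
  by have := c_d; lra.
have c0 := c_gt0.
have mono : h core / (1 - c * core) <= h r / (1 - c * r).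
  apply: (@der_le R (fun x => h x / (1 - c * x))
    (fun x => (((x * g x * v x - 3 * m x * v1 x) / v x ^+ 4) * (1 - c * x) + c * h x) / (1 - c * x) ^+ 2) core r) => //.
  - exact: ltW.
  - move=> x /andP[x0 xr]; have hx := defect_ratio_der (r := x).
    have {}hx : der h x ((x * g x * v x - 3 * m x * v1 x) / v x ^+ 4) by apply: hx; lra.
    have q := cx x xr; have q1 : 1 - c * x != 0 by rewrite gt_eqF //; lra.
    have q2 : v x != 0 by rewrite gt_eqF // vpos //; lra.
    by dsolve => //=; field; rewrite q1 q2.
  move=> x /andP[x0 xr]; have xp : 0 < x by lra.
  have x1 : 0 < x < 1 by lra.
  have vp := vpos x1; have mp : 0 <= m x by apply: defect_ge0; lra.
  have v1x : 0 <= v1 x by apply: le_trans v1r _; apply: slope_noninc; lra.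
  have y : 0 <= Y x by apply: poho_defect_ge0 => //; lra.
  have e : x * g x * v x = K x * v x ^+ 6 / x ^+ 3 + mu * x * v x ^+ 2.
    by rewrite /g; field; rewrite gt_eqF.
  have y2 : - (c * v x * m x) <= x * g x * v x - 3 * m x * v1 x.
    by move: y; rewrite /Y e /m; lra.
  have q := cx x (ltW xr).
  have h1 : - (c * h x) <= (x * g x * v x - 3 * m x * v1 x) / v x ^+ 4.
    rewrite ler_pdivlMr ?exprn_gt0 //; apply: le_trans y2.
    by rewrite /h le_eqVlt; apply/orP; left; apply/eqP; field; rewrite gt_eqF.
  have hp : 0 <= h x by rewrite /h divr_ge0 ?exprn_ge0 // ltW.
  rewrite divr_ge0 ?sqr_ge0 //.
  have h2 : - (c * h x) * (1 - c * x) <= (x * g x * v x - 3 * m x * v1 x) / v x ^+ 4 * (1 - c * x).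
    by rewrite ler_wpM2r //; lra.
  have : 0 <= c * x * (c * h x).
    have c0' := ltW c0; apply: mulr_ge0; apply: mulr_ge0 => //; exact: ltW.
  by set z := _ / _ * _ in h2 *; lra.
have q1 := cx r (lexx _); have q2 := cx core (ltW rc).
have hcp : 0 <= h core.
  by apply: le_trans hc; apply: (divr_ge0 (ltW KA)); rewrite ler0n.
have : h core <= h core / (1 - c * core).
  rewrite ler_pdivlMr; last by lra.
  by rewrite ler_piMr // lerBlDr lerDl; apply: mulr_ge0; exact: ltW.
move=> t1; have t2 := le_trans t1 mono; rewrite ler_pdivlMr in t2; last by lra.
have : h core * (1/2) <= h core * (1 - c * r) by rewrite ler_wpM2l.
lra.
Qed.

(** Integration of [(r^2 / v^2)' = 2 r h] from 0, with the lower bound on [h]. *)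
Lemma bubble_bound_pos r : 0 < r < d -> 0 <= v1 r -> K0 * A ^+ 2 / 384 * v r ^+ 2 <= 1.
Proof.
move=> /andP[r0 rd] v1r; have /andP[d0 d1] := d01.
set h0 := K0 * A ^+ 2 / 384.
have KA : 0 < K0 * A ^+ 2 by rewrite mulr_gt0 ?exprn_gt0.
have h00 : 0 < h0 by apply: (divr_gt0 KA); rewrite ltr0n.
have r1 : 0 < r < 1 by lra.
have vp := vpos r1.
suff : 0 <= r ^+ 2 / v r ^+ 2 - h0 * r ^+ 2.
  rewrite subr_ge0 ler_pdivlMr ?exprn_gt0 // mulrAC.
  by rewrite -[leRHS]mul1r ler_pM2r // exprn_gt0.
apply: (@der_le_at0 R (fun x => x ^+ 2 / v x ^+ 2 - h0 * x ^+ 2)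
  (fun x => 2 * x * (h x - h0)) r r0).
- move=> x /andP[x0 xr]; have x1 : 0 < x < 1 by lra.
  have vx := vpos x1; have [|h1 _] := hv (r := x); first by lra.
  dsolve; first by rewrite expf_neq0 // gt_eqF.
  by rewrite /h /m /=; field; rewrite gt_eqF.
- move=> x /andP[x0 xr]; rewrite mulr_ge0 ?mulr_ge0 ?(ltW x0) // subr_ge0.
  apply: defect_ratio_lower; first by lra.
  by apply: le_trans v1r _; apply: slope_noninc; lra.
move=> e e0; pose x := Num.min (r / 2) (e / h0).
have x0 : 0 < x by rewrite lt_min; apply/andP; split; apply: divr_gt0.
have xr : x <= r / 2 by rewrite ge_min lexx.
have xe : x <= e / h0 by rewrite ge_min lexx orbT.
rewrite ler_pdivlMr // in xe.
exists x; first by rewrite x0 /=; lra.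
have : 0 <= x ^+ 2 / v x ^+ 2 by rewrite divr_ge0 ?sqr_ge0.
have : h0 * x ^+ 2 <= h0 * x by rewrite ler_pM2l // expr2 ler_piMr ?ltW //; lra.
lra.
Qed.

(** Past the maximum of [v], where [v1 < 0], the bound is inherited from the zero [s] of [v1]. *)
Lemma bubble_bound r : 0 < r < d -> v r ^+ 2 <= 384 / (K0 * A ^+ 2).
Proof.
move=> rd; have /andP[r0 rd'] := rd; have /andP[d0 d1] := d01.
have KA : 0 < K0 * A ^+ 2 by rewrite mulr_gt0 ?exprn_gt0.
rewrite ler_pdivlMr // mulrC.
suff : K0 * A ^+ 2 / 384 * v r ^+ 2 <= 1 by lra.
have [v1r|v1r] := leP 0 (v1 r); first exact: bubble_bound_pos.
have cv : {within `[0, r], continuous v1}.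
  apply: (@der_within _ _ _ (fun x => - g x)) => x /=; rewrite in_itv /= => /andP[x0 xr].
  by have [|_ hx] := hv (r := x); first by lra.
have mid : Num.min (v1 0) (v1 r) <= 0 <= Num.max (v1 0) (v1 r).
  by rewrite ge_min le_max v10 (ltW v1r) (ltW A0) orbT.
have [s] := IVT (ltW r0) cv mid; rewrite in_itv /= => /andP[s0 sr] s1.
have sp : 0 < s.
  rewrite lt_neqAle s0 andbT; apply/eqP => e; move: s1; rewrite -e v10 => a0.
  by move: A0; rewrite a0 ltxx.
have sd : 0 < s < d by lra.
have := bubble_bound_pos sd; rewrite s1 lexx => /(_ isT); apply: le_trans.
apply: ler_wpM2l; first by apply: (divr_ge0 (ltW KA)); rewrite ler0n.
have vr : 0 < v r by apply: vpos; lra.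
rewrite lerXn2r ?nnegrE ?(ltW vr) //; first by rewrite ltW // vpos //; lra.
rewrite -lerN2; apply: (@der_le R (fun x => - v x) (fun x => - v1 x) s r) => //.
  by move=> x /andP[x0 xr]; have [|hx _] := hv (r := x); [lra|exact: derN].
move=> x /andP[x0 xr]; rewrite oppr_ge0 -s1; apply: slope_noninc; lra.
Qed.

End BubbleBound.

(** * Sign of the Pohozaev weight near the origin *)

Section Blowup.
Context {R : realType}.
Implicit Types (r s t : R).

Lemma cos_gex x : 0 <= x -> 1 - x ^+ 2 / 2 <= cos x :> R.
Proof.
move=> x0; have := @der_le R (fun y => cos y + y ^+ 2 / 2) (fun y => y - sin y) 0 x x0.
rewrite cos0 expr0n mul0r addr0 -lerBlDr; apply=> y /andP[y0 _].
  by dsolve => /=; field.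
by rewrite subr_ge0 sin_lex // ltW.
Qed.

Variables (K dK : R -> R) (K0 mu L k1 : R).
Hypotheses (K00 : 0 < K0) (mu0 : 0 < mu) (mupi : Num.sqrt mu < pi) (L0 : 0 < L).
Hypothesis Kb : forall r, 0 <= r <= 1 -> 0 <= K r <= K0.
Hypothesis Kc : continuous (fun r => K (cl r)).
Hypothesis Klow : forall r, 0 <= r <= 1 -> K0 - L * r <= K r.
Hypothesis Kder : forall r, 0 < r < 1 -> [/\ der K r (dK r), dK r <= 0 & - L <= dK r].
Hypothesis dK0 : forall e, 0 < e -> exists2 d, 0 < d & forall t, 0 < t < d -> k1 - e <= dK t.

Let th : R := Num.sqrt mu.
Hypotheses (k1le : k1 <= 0) (cth : cos th < 0).
Hypothesis sig : 0 < k1 * sin th - 4 * K0 * th * cos th.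

(** With [x = th r], [r] times the weight is at least [(x^2 / th) (sg - error)], the error being at
    most [sg / 2] near 0; hence the constant [th sg / 2]. *)
Lemma weight_near0 : exists2 c, 0 < c & exists2 d, 0 < d & forall r, 0 < r < d ->
  c * r <= poho_weight K dK th r.
Proof.
set sg := k1 * sin th - 4 * K0 * th * cos th.
have /andP[t0 tpi] : 0 < th < pi by exact: th_bound.
have s1 : 0 < sin th by rewrite sin_gt0_pi // t0.
exists (th * sg / 2); first by rewrite divr_gt0 // mulr_gt0.
have sg8 : 0 < sg / 8 by rewrite divr_gt0.
have [d d0 hd] := dK0 sg8.
pose c := - cos th.
have c0 : 0 < c by rewrite oppr_gt0.
have c1 : c <= 1 by rewrite lerNl cos_geN1.
(* Coefficient of the first-order error in [x]. The choice of [d1] makes it cost at most [sg / 4],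
   and the variation of [dK] costs another [sg / 4]. *)
pose C := - k1 + 12 * K0 * th + 4 * L.
have C0 : 0 < C.
  have : 0 < 12 * K0 * th by rewrite mulr_gt0 // mulr_gt0.
  by move: k1le L0 => ? ?; rewrite /C; lra.
pose d1 := Num.min (Num.min d 1) (Num.min (Num.min (th^-1) (c / (3 * th)))
   (Num.min (sg / (4 * C) / th) (K0 / L))).
exists d1.
  rewrite !lt_min d0 ltr01 invr_gt0 t0 /=; apply/andP; split.
    by apply: divr_gt0 => //; apply: mulr_gt0.
  by apply/andP; split; [do 2 apply: divr_gt0 => //; apply: mulr_gt0|apply: divr_gt0].
move=> r /andP[r0]; rewrite !lt_min => /and3P[/andP[rd r1] /andP[rt rc] /andP[rs rL]].
pose x := th * r.
have x0 : 0 < x by rewrite mulr_gt0.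
have x1 : x <= 1 by rewrite /x mulrC -ler_pdivlMr // div1r ltW.
have x3 : 3 * x <= c.
  rewrite ltr_pdivlMr ?mulr_gt0 // in rc; rewrite /x.
  by have -> : 3 * (th * r) = r * (3 * th) by [ring]; exact: ltW.
have xC : C * x <= sg / 4.
  rewrite ltr_pdivlMr // ltr_pdivlMr ?mulr_gt0 // in rs.
  by have -> : C * x = r * th * (4 * C) / 4 by [rewrite /x; field]; lra.
have LK : L * r <= K0 by rewrite mulrC -ler_pdivlMr // ltW.
have r01 : 0 < r < 1 by rewrite r0 r1.
have [_ dle dge] := Kder r01.
have [|kk kK] := andP (Kb (r := r) _); first by rewrite !ltW.
have kl := Klow (r := r); have {}kl : K0 - L * r <= K r by apply: kl; rewrite !ltW.
have dk := hd r; have {}dk : k1 - sg / 8 <= dK r by apply: dk; rewrite r0.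
have cx := cos_gex (ltW x0); have cx1 := cos_le1 x.
have sx : sin x <= x by rewrite sin_lex // ltW.
have xpi : x < pi by apply: le_lt_trans tpi; rewrite /x ler_piMr // ltW.
have sx0 : 0 < sin x by rewrite sin_gt0_pi // x0.
have sx2 : x * cos x < sin x by rewrite xcosx_lt_sinx // x0.
have x1' : x ^+ 2 <= x by rewrite expr2 ler_piMl // ltW.
have x2 : 0 < x ^+ 2 by rewrite exprn_gt0.
have eS : sin (th * (1 - r)) = sin th * cos x + c * sin x.
  by rewrite mulrBr mulr1 sinB /c; ring.
have eC : - cos (th * (1 - r)) = c * cos x - sin th * sin x.
  by rewrite mulrBr mulr1 cosB /c; ring.
have S0 : 0 < sin (th * (1 - r)).
  rewrite sin_gt0_pi // mulr_gt0 ?subr_gt0 //=.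
  by apply: le_lt_trans tpi; rewrite ler_piMr ?(ltW t0) // lerBlDr lerDl ltW.
have S1 := sin_le1 (th * (1 - r)).
have s11 := sin_le1 th.
have Sle : sin (th * (1 - r)) <= sin th + x.
  rewrite eS; apply: lerD; first by rewrite ler_piMr // ltW.
  by apply: le_trans sx; rewrite ler_piMl // ltW.
have psi_le : poho_mult th r <= x * (sin th + x).
  by rewrite /poho_mult -/x; apply: ler_pM => //; exact: ltW.
have psi0 : 0 <= poho_mult th r by rewrite /poho_mult -/x mulr_ge0 // ltW.
have Clow : c - x - c * (x ^+ 2 / 2) <= - cos (th * (1 - r)).
  rewrite eC; have h1 : sin th * sin x <= x.
    by apply: le_trans sx; rewrite ler_piMl // ltW.
  have h2 : c * (1 - x ^+ 2 / 2) <= c * cos x by rewrite ler_wpM2l // ltW.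
  lra.
(* Of the two products into which [r psi' - psi] splits, the first is of third order in [x] and the
   second is [c x^2] to leading order. *)
have D : x ^+ 2 * (c - 3 * x) <= r * poho_mult' th r - poho_mult th r.
  have -> : r * poho_mult' th r - poho_mult th r =
    (x * cos x - sin x) * sin (th * (1 - r)) + x * (sin x * - cos (th * (1 - r))).
    by rewrite /poho_mult /poho_mult' /x; ring.
  have h1 : - (x * (x ^+ 2 / 2)) <= (x * cos x - sin x) * sin (th * (1 - r)).
    have i1 : x * (1 - x ^+ 2 / 2) <= x * cos x by rewrite ler_wpM2l // ltW.
    have i2 : (x * cos x - sin x) * sin (th * (1 - r)) >= (x * cos x - sin x) * 1.
      by rewrite ler_wnM2l // subr_le0 ltW.
    lra.
  have h2 : x * (x * (1 - x ^+ 2 / 2) * (c - x - c * (x ^+ 2 / 2))) <=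
      x * (sin x * - cos (th * (1 - r))).
    rewrite ler_pM2l //; apply: ler_pM => //.
    - by rewrite mulr_ge0 ?(ltW x0) //; lra.
    - have : c * (x ^+ 2 / 2) <= 1 * (x ^+ 2 / 2) by rewrite ler_wpM2r // divr_ge0 // ltW.
      lra.
    - by apply: le_trans (ltW sx2); rewrite ler_wpM2l // ltW.
  apply: le_trans (lerD h1 h2).
  have -> : - (x * (x ^+ 2 / 2)) + x * (x * (1 - x ^+ 2 / 2) * (c - x - c * (x ^+ 2 / 2))) =
    x ^+ 2 * (c - 3 * x + (3 / 2 * x - c * x ^+ 2 + x ^+ 3 / 2 + c * (x ^+ 2 / 2) ^+ 2)) by field.
  rewrite ler_pM2l // lerDl.
  have i1 : c * x ^+ 2 <= 1 * x by apply: ler_pM => //; exact: ltW.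
  have i2 : 0 <= x ^+ 3 / 2 by rewrite divr_ge0 // exprn_ge0 // ltW.
  have i3 : 0 <= c * (x ^+ 2 / 2) ^+ 2 by rewrite mulr_ge0 ?sqr_ge0 // ltW.
  lra.
have main : (x ^+ 2 / th) * (sg / 2) <= r * poho_weight K dK th r.
  have -> : r * poho_weight K dK th r = r * (poho_mult th r * dK r) +
    4 * (K r * (r * poho_mult' th r - poho_mult th r)).
    by rewrite /poho_weight; field; rewrite gt_eqF.
  have h1 : r * (x * (sin th + x) * dK r) <= r * (poho_mult th r * dK r).
    by rewrite ler_pM2l // ler_wnM2r.
  have h2 : (K0 - L * r) * (x ^+ 2 * (c - 3 * x)) <= K r * (r * poho_mult' th r - poho_mult th r).
    apply: ler_pM => //; first by lra.
    by rewrite mulr_ge0 ?(ltW x2) //; lra.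
  have e : r * (x * (sin th + x) * dK r) + 4 * ((K0 - L * r) * (x ^+ 2 * (c - 3 * x))) =
    x ^+ 2 / th * ((sin th + x) * dK r + 4 * ((K0 * th - L * x) * (c - 3 * x))).
    by rewrite /x; field; rewrite gt_eqF.
  have h3 : sg / 2 <= (sin th + x) * dK r + 4 * ((K0 * th - L * x) * (c - 3 * x)).
    have j1 : (sin th + x) * (k1 - sg / 8) <= (sin th + x) * dK r.
      by rewrite ler_wpM2l // addr_ge0 // ltW.
    have j2 : (sin th + x) * (sg / 8) <= 2 * (sg / 8).
      by rewrite ler_wpM2r ?(ltW sg8) //; lra.
    have j3 : L * x * (c - 3 * x) <= L * x * 1.
      apply: ler_wpM2l; [apply: mulr_ge0; exact: ltW|lra].
    have j4 : sg = k1 * sin th + 4 * K0 * th * c by rewrite /sg /c; ring.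
    by rewrite /C in xC; lra.
  have p : 0 < x ^+ 2 / th by rewrite divr_gt0.
  have h4 : x ^+ 2 / th * (sg / 2) <= x ^+ 2 / th * ((sin th + x) * dK r + 4 * ((K0 * th - L * x) * (c - 3 * x))).
    by rewrite ler_pM2l.
  by rewrite -e in h4; lra.
rewrite -(ler_pM2l r0); apply: le_trans main.
by rewrite /x le_eqVlt; apply/orP; left; apply/eqP; field; rewrite gt_eqF.
Qed.

End Blowup.

(** * Solutions with large slope become negative at the sphere *)

Section BlowupContradiction.
Context {R : realType}.
Implicit Types (r s t : R).

Variables (K dK : R -> R) (K0 mu L k1 : R).
Hypotheses (K00 : 0 < K0) (mu0 : 0 < mu) (mupi : Num.sqrt mu < pi) (L0 : 0 < L).
Hypothesis Kb : forall r, 0 <= r <= 1 -> 0 <= K r <= K0.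
Hypothesis Klow : forall r, 0 <= r <= 1 -> K0 - L * r <= K r.
Hypothesis Kder : forall r, 0 < r < 1 -> [/\ der K r (dK r), dK r <= 0 & - L <= dK r].
Hypothesis dK0 : forall e, 0 < e -> exists2 d, 0 < d & forall t, 0 < t < d -> k1 - e <= dK t.

Let th : R := Num.sqrt mu.
Hypotheses (k1le : k1 <= 0) (cth : cos th < 0).
Hypothesis sig : 0 < k1 * sin th - 4 * K0 * th * cos th.

Section OneProfile.
Variables (v v1 : R -> R) (A d c3 : R).
Hypotheses (A0 : 0 < A) (muA : mu <= K0 * A ^+ 4) (c30 : 0 < c3).
Hypotheses (v00 : v 0 = 0) (v10 : v1 0 = A) (v1ge : 0 <= v 1).
Hypothesis ode : forall r, 0 <= r <= 1 -> der v r (v1 r) /\ der v1 r (- rhs K mu A r (v r)).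
Hypotheses (d01 : 0 < d <= 1) (Ld : 4 * L * d <= K0).
Hypothesis hw : forall r, 0 < r < d -> c3 * r <= poho_weight K dK th r.

Lemma sqrt_mu_gt0 : 0 < th. Proof. by have /andP[] := th_bound mu0 mupi. Qed.

Lemma bubble_pos r : 0 < r < 1 -> 0 < v r.
Proof.
have /andP[d0 d1] := d01.
have coef_near_origin x : 0 < x < d -> 0 < K x.
  move=> /andP[x0 xd]; have x01 : 0 <= x <= 1 by rewrite ltW //= ltW // (lt_le_trans xd).
  have := Klow x01; have : L * x <= L * d by rewrite ler_pM2l // ltW.
  by have := K00; have := Ld; lra.
by move=> r01; exact: (shoot_pos mu0 mupi A0 Kb d0 coef_near_origin A0 v00 v10 ode v1ge).
Qed.

Lemma bubble_le r : 0 <= r <= 1 -> v r <= A * r.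
Proof. exact: (shoot_le mu0 mupi A0 Kb A0 v00 v10 ode). Qed.

Lemma bubble_ge0 r : 0 <= r <= 1 -> 0 <= v r.
Proof.
move=> /andP[]; rewrite le_eqVlt => /predU1P[<-|r0]; first by rewrite v00.
by rewrite le_eqVlt => /predU1P[->//|r1]; apply/ltW/bubble_pos; rewrite r0.
Qed.

(** Nonnegativity of [v] on the whole interval, a consequence of [v 1 >= 0], makes the truncation
    inactive. *)
Lemma bubble_ode r : 0 <= r <= 1 -> der v r (v1 r) /\
  der v1 r (- (K r * v r ^+ 5 / r ^+ 4 + mu * v r)).
Proof.
move=> r01; split; first by have [] := ode r01.
have /andP[] := r01; rewrite le_eqVlt => /predU1P[e|r0] r1.
  have [_ h] := ode r01; apply: der_eq h _.
  by rewrite -e v00 /rhs expr0n /= !mul0r !mulr0 mul0r.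
apply: (ode_pos mu0 mupi A0 Kb A0 v00 v10 ode) => //; first by rewrite r0.
exact: bubble_ge0.
Qed.

Lemma coef_near_origin r : 0 < r < d -> [/\ der K r (dK r), - L <= dK r & K0 / 2 <= K r].
Proof.
have /andP[d0 d1] := d01.
move=> /andP[r0 rd]; have r01 : 0 < r < 1 by rewrite r0 (lt_le_trans rd).
have [h1 _ h3] := Kder r01; split=> //.
have r01' : 0 <= r <= 1 by have /andP[? ?] := r01; rewrite !ltW.
have := Klow r01'; have : L * r <= L * d by rewrite ler_pM2l // ltW.
by have := K00; have := Ld; lra.
Qed.

Let M := A + 2 * K0 * A ^+ 5.
Let KA5 : 0 < K0 * A ^+ 5. Proof. by rewrite mulr_gt0 ?exprn_gt0. Qed.
Let M0 : 0 <= M. Proof. by have := KA5; have := A0; rewrite /M; lra. Qed.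

Lemma bubble_slope_bound r : 0 <= r < 1 -> `|v1 r| <= M.
Proof.
move=> r01; have /andP[r0 r1] := r01.
have := slope_lower A0 mu0 muA v00 v10 bubble_ode bubble_pos bubble_le Kb r01.
have := slope_noninc A0 mu0 muA v00 bubble_ode bubble_pos bubble_le Kb (lexx 0) r0 r1; rewrite v10.
have : K0 * A ^+ 5 * r ^+ 2 <= K0 * A ^+ 5 * 1 by rewrite ler_pM2l // exprn_ile1 // ltW.
have := A0; have := KA5.
by move=> i1 i2 i3 i4 i5; rewrite ler_norml /M; apply/andP; split; lra.
Qed.

Let E := poho K v v1 th.
Let E' r := v r ^+ 6 / (6 * r ^+ 4) * poho_weight K dK th r.

Lemma bubble_poho_der r : 0 < r < 1 -> der E r (E' r).
Proof.
move=> r01; have /andP[r0 r1] := r01; have [|h1 h2'] := bubble_ode (r := r); first by rewrite !ltW.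
have [h3 _ _] := Kder r01; apply: poho_der => //.
by rewrite sqr_sqrtr // ltW.
Qed.

Lemma poho_factor_ge0 r : 0 < r < 1 -> 0 <= v r ^+ 6 / (6 * r ^+ 4).
Proof.
move=> r01; have /andP[r0 r1] := r01.
by rewrite divr_ge0 ?mulr_ge0 ?exprn_ge0 // ltW // bubble_pos.
Qed.

Lemma bubble_poho_der_ge0 r : 0 < r < d -> 0 <= E' r.
Proof.
have /andP[d0 d1] := d01; move=> rd; have /andP[r0 rd'] := rd.
have r01 : 0 < r < 1 by rewrite r0 (lt_le_trans rd').
apply: mulr_ge0; first exact: poho_factor_ge0.
by apply: le_trans (hw rd); rewrite mulr_ge0 // ltW.
Qed.

(** [E] is nondecreasing on [(0, d)] and tends to 0 at the origin by [poho_bound0]. *)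
Lemma bubble_poho_ge0 r : 0 < r < d -> 0 <= E r.
Proof.
have t0 := sqrt_mu_gt0; have /andP[d0 d1] := d01; move=> /andP[r0 rd].
have thM : 0 <= th * M by rewrite mulr_ge0 // ltW.
apply: (@der_le_at0 R E E' r r0).
- by move=> x /andP[x0 xr]; apply: bubble_poho_der; lra.
- by move=> x /andP[x0 xr]; apply: bubble_poho_der_ge0; lra.
move=> e e0; pose C := th * M * (M + th * M) + K0 * M ^+ 6 + 1.
have C0 : 0 < C.
  apply: ltr_wpDl => //; apply: addr_ge0; last by apply: mulr_ge0; [exact: ltW|exact: exprn_ge0].
  by apply: mulr_ge0 => //; apply: addr_ge0.
pose x := Num.min (r / 2) (e / C).
have x0 : 0 < x by rewrite lt_min; apply/andP; split; apply: divr_gt0.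
have xr : x <= r / 2 by rewrite ge_min lexx.
have xe : x <= e / C by rewrite ge_min lexx orbT.
rewrite ler_pdivlMr // in xe; clearbody x.
have xxr : 0 < x < r by lra.
have x01 : 0 < x <= 1 by lra.
have x01' : 0 <= x <= 1 by lra.
have x01'' : 0 <= x < 1 by lra.
exists x => //.
have vM : `|v x| <= M * x.
  rewrite ger0_norm ?bubble_ge0 //; apply: le_trans (bubble_le x01') _.
  by rewrite ler_pM2r // /M; have := KA5; lra.
have := @poho_bound0 R K v v1 th K0 M x t0 x01 (Kb x01') M0 vM (bubble_slope_bound x01'').
rewrite -/E ler_norml => /andP[h _]; apply: le_trans h; rewrite lerNl opprK.
by apply: le_trans xe; rewrite mulrC ler_pM2l // /C lerDl.
Qed.

Lemma bubble_poho_mono r s : 0 < r -> r <= s -> s < d -> E r <= E s.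
Proof.
have /andP[d0 d1] := d01; move=> r0 rs sd; apply: (@der_le R E E' r s rs).
  by move=> x /andP[x0 xd]; apply: bubble_poho_der; lra.
by move=> x /andP[x0 xd]; apply: bubble_poho_der_ge0; lra.
Qed.

Let co := core A K0.

(** On [[co / 2, co]] one has [v >= A x / 2], so [E'] is at least [(c3 / 6) 2^-6 A^6 x^3]; as [co]
    is of order [A^-2], the gain is of order [A^6 co^4 = A^-2]. *)
Lemma core_gain : co < d -> c3 / 6 * (2^-1) ^+ 6 * A ^+ 6 * (co / 2) ^+ 4 <= E co.
Proof.
have /andP[d0 d1] := d01; move=> cod.
have co0 : 0 < co by exact: core_gt0.
have cc : co / 2 < co by lra.
have [|x /andP[x0 xc] eE] := @mvt R E E' (co / 2) co cc.
  by move=> x /andP[x0 xc]; apply: bubble_poho_der; lra.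
have xp : 0 < x by lra.
have Ec2 : 0 <= E (co / 2) by apply: bubble_poho_ge0; lra.
have vx : A / 2 * x <= v x.
  apply: (core_lower A0 K00 mu0 muA v00 v10 bubble_ode bubble_pos bubble_le Kb); last by lra.
  by rewrite -/co; lra.
have wx : c3 * x <= poho_weight K dK th x by apply: hw; lra.
have i : 0 <= A / 2 * x by rewrite mulr_ge0 ?divr_ge0 // ltW.
have v6 : (A / 2 * x) ^+ 6 <= v x ^+ 6 by rewrite lerXn2r // nnegrE (le_trans i).
have i1 : (A / 2 * x) ^+ 6 / (6 * x ^+ 4) * (c3 * x) <= E' x.
  apply: ler_pM => //.
  - by rewrite divr_ge0 ?mulr_ge0 ?exprn_ge0 ?divr_ge0 // ltW.
  - by rewrite mulr_ge0 // ltW.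
  - by rewrite ler_pM2r // invr_gt0 mulr_gt0 ?exprn_gt0.
have e1 : (A / 2 * x) ^+ 6 / (6 * x ^+ 4) * (c3 * x) = c3 / 6 * (2^-1) ^+ 6 * A ^+ 6 * x ^+ 3.
  by field; rewrite gt_eqF.
have i2 : (co / 2) ^+ 3 <= x ^+ 3 by rewrite lerXn2r // ?nnegrE ltW // divr_gt0.
have i3 : c3 / 6 * (2^-1) ^+ 6 * A ^+ 6 * (co / 2) ^+ 3 <= E' x.
  apply: le_trans i1; rewrite e1 ler_pM2l //; apply: mulr_gt0; last exact: exprn_gt0.
  by apply: mulr_gt0; [apply: divr_gt0|apply: exprn_gt0; rewrite invr_gt0].
have e2 : co - co / 2 = co / 2 by field.
rewrite e2 in eE.
apply: (@le_trans _ _ (E co - E (co / 2))); last by rewrite gerBl.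
by rewrite eE [(co / 2) ^+ 4]exprSr mulrA ler_pM2r // divr_gt0.
Qed.

Variable d' : R.
Hypotheses (d'0 : 0 < d') (d'd : d' < d).

Lemma bubble_quotient_noninc r : d' <= r < 1 -> v r / r <= v d' / d'.
Proof.
move=> /andP[dr r1]; have dp := d'0; rewrite -lerN2.
apply: (@der_le R (fun x => - (v x / x)) (fun x => (v x - x * v1 x) / x ^+ 2) d' r) => //.
  move=> x /andP[x0 xr]; have [|h1 _] := bubble_ode (r := x); first by lra.
  have xn : x != 0 by rewrite gt_eqF //; lra.
  by dsolve => //=; field.
move=> x /andP[x0 xr]; rewrite divr_ge0 ?sqr_ge0 //.
by apply: (defect_ge0 A0 mu0 muA v00 bubble_ode bubble_pos bubble_le Kb); lra.
Qed.

Let q := 384 / (K0 * d' ^+ 2).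

Lemma bubble_quotient_small : (v d' / d') ^+ 2 <= q / A ^+ 2.
Proof.
have rd : 0 < d' < d by rewrite d'0.
have := bubble_bound A0 K00 mu0 L0 d01 Ld muA v00 v10 bubble_ode bubble_pos bubble_le Kb coef_near_origin rd.
rewrite /q; set Cn : R := 384; move: Cn => Cn.
rewrite expr_div_n => h; rewrite ler_pdivrMr ?exprn_gt0 //.
suff -> : Cn / (K0 * d' ^+ 2) / A ^+ 2 * d' ^+ 2 = Cn / (K0 * A ^+ 2) by [].
by field; rewrite !gt_eqF.
Qed.

Let C4 := L + 4 * K0 * (2 * th + d'^-1).

Lemma poho_weight_lower r : d' <= r < 1 -> - C4 <= poho_weight K dK th r.
Proof.
have t0 := sqrt_mu_gt0; have dp := d'0; have LL := L0.
move=> /andP[dr r1]; have r0 : 0 < r by lra.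
have r01 : 0 < r < 1 by lra.
have [_ dle dge] := Kder r01; have [|k0 kK] := andP (Kb (r := r) _); first by lra.
have s0 : 0 <= sin (th * r).
  by apply/ltW/sin_gt0_pi; rewrite mulr_gt0 //=; apply: lt_trans mupi; rewrite gtr_pMr.
have S0 : 0 <= sin (th * (1 - r)).
  apply/ltW/sin_gt0_pi; rewrite mulr_gt0 ?subr_gt0 //=; apply: lt_trans mupi.
  by rewrite gtr_pMr //; lra.
have psi0 : 0 <= poho_mult th r by rewrite mulr_ge0.
have psi1 : poho_mult th r <= 1 by rewrite -[leRHS]mulr1; apply: ler_pM => //; exact: sin_le1.
have i1 : - L <= poho_mult th r * dK r.
  have : poho_mult th r * (- dK r) <= 1 * L by apply: ler_pM => //; lra.
  lra.
have i2 : - (2 * th) <= poho_mult' th r.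
  have b1 : `|cos (th * r) * sin (th * (1 - r))| <= 1.
    by rewrite normrM -[leRHS]mulr1 ler_pM // ?cos_max ?sin_max.
  have b2 : `|sin (th * r) * cos (th * (1 - r))| <= 1.
    by rewrite normrM -[leRHS]mulr1 ler_pM // ?cos_max ?sin_max.
  move: b1 b2; rewrite !ler_norml => /andP[b1 _] /andP[_ b2].
  have : th * (-2) <= poho_mult' th r by rewrite /poho_mult' ler_pM2l //; lra.
  lra.
have i3 : poho_mult th r / r <= d'^-1.
  rewrite -[leRHS]mul1r; apply: ler_pM => //; first by rewrite invr_ge0 ltW.
  by rewrite lef_pV2 ?posrE.
have dv : 0 < d'^-1 by rewrite invr_gt0.
have i4 : 4 * K r * (- (poho_mult' th r - poho_mult th r / r)) <= 4 * K0 * (2 * th + d'^-1).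
  have [j|j] := leP 0 (- (poho_mult' th r - poho_mult th r / r)).
    by apply: ler_pM; rewrite ?mulr_ge0 //; [rewrite ler_pM2l|lra].
  apply: (@le_trans _ _ 0); first by apply: mulr_ge0_le0; [apply: mulr_ge0|exact: ltW].
  apply: mulr_ge0; first by rewrite mulr_ge0 // ltW.
  by apply: addr_ge0; [apply: mulr_ge0 => //; exact: ltW|exact: ltW].
by rewrite /poho_weight /C4; lra.
Qed.

Let C6 := C4 / 6 * q ^+ 3.

Lemma weight_loss_gt0 : 0 < C4.
Proof.
have t0 := sqrt_mu_gt0; apply: addr_gt0 => //; apply: mulr_gt0; first exact: mulr_gt0.
by apply: addr_gt0; [apply: mulr_gt0|rewrite invr_gt0].
Qed.

Lemma bubble_const_gt0 : 0 < q.
Proof. by apply: divr_gt0; [rewrite ltr0n|rewrite mulr_gt0 ?exprn_gt0]. Qed.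

(** Beyond [d'] the quotient [v / x] stays [O(1 / A)] because it is nonincreasing, and the weight is
    bounded below, so [E'] is bounded below by a multiple of [- A^-6]. *)
Lemma bubble_poho_lower r : d' < r < 1 -> E d' - C6 / A ^+ 6 <= E r.
Proof.
move=> /andP[dr r1]; have dp := d'0; have C40 := weight_loss_gt0; have q0 := bubble_const_gt0.
have u2 := bubble_quotient_small; have A0' := A0.
have c60 : 0 <= C6 / A ^+ 6.
  apply: divr_ge0; last by rewrite exprn_ge0 // ltW.
  by apply: mulr_ge0; [apply: divr_ge0 => //; exact: ltW|rewrite exprn_ge0 // ltW].
have := @der_le R (fun x => E x + C6 / A ^+ 6 * x) (fun x => E' x + C6 / A ^+ 6) d' r (ltW dr).
move=> h; have {}h : E d' + C6 / A ^+ 6 * d' <= E r + C6 / A ^+ 6 * r.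
  apply: h => x /andP[x0 xr].
    have hx : der E x (E' x) by apply: bubble_poho_der; lra.
    by apply: der_eq; [apply: derD; [exact: hx|dauto]|rewrite /=; ring].
  have xp : 0 < x by lra.
  have x01 : 0 < x < 1 by lra.
  have dx : d' <= x < 1 by lra.
  have w := poho_weight_lower dx; have U := bubble_quotient_noninc dx.
  have Ux : 0 <= v x / x by rewrite divr_ge0 ?ltW // bubble_pos.
  have j0 : (v x / x) ^+ 2 <= q / A ^+ 2.
    by apply: le_trans u2; rewrite lerXn2r // nnegrE // (le_trans Ux).
  have j1 : (v x / x) ^+ 6 <= q ^+ 3 / A ^+ 6.
    have -> : q ^+ 3 / A ^+ 6 = (q / A ^+ 2) ^+ 3 by move: q => z; field; rewrite gt_eqF.
    have -> : (v x / x) ^+ 6 = ((v x / x) ^+ 2) ^+ 3 by rewrite -exprM.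
    by rewrite lerXn2r // nnegrE ?sqr_ge0 // (le_trans _ j0) ?sqr_ge0.
  have j2 : v x ^+ 6 / (6 * x ^+ 4) <= q ^+ 3 / A ^+ 6 / 6.
    have -> : v x ^+ 6 / (6 * x ^+ 4) = (v x / x) ^+ 6 * x ^+ 2 / 6.
      by field; rewrite gt_eqF.
    rewrite ler_pM2r ?invr_gt0 //; apply: le_trans j1.
    by rewrite ler_piMr ?exprn_ge0 // exprn_ile1 // ltW //; lra.
  have j3 := poho_factor_ge0 x01.
  have j4 : v x ^+ 6 / (6 * x ^+ 4) * - C4 <= E' x by rewrite /E' ler_wpM2l.
  have j5 : v x ^+ 6 / (6 * x ^+ 4) * C4 <= q ^+ 3 / A ^+ 6 / 6 * C4 by rewrite ler_pM2r.
  have e : C6 / A ^+ 6 = q ^+ 3 / A ^+ 6 / 6 * C4 by rewrite /C6; ring.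
  rewrite e -lerBlDr sub0r; apply: le_trans j4; rewrite mulrN lerN2.
  exact: j5.
have h1 : C6 / A ^+ 6 * r <= C6 / A ^+ 6 by rewrite ler_piMr // ltW.
have h2 : 0 <= C6 / A ^+ 6 * d' by rewrite mulr_ge0 // ltW.
move: h h1 h2; move: (C6 / A ^+ 6) => z; lra.
Qed.

(** The first Wronskian is nonpositive, and the second is nonnegative up to [O(1 - r)] because
    [v >= 0]; so their product is bounded above by [O(1 - r)] whatever the value of [v 1 >= 0]. The
    condition [1 - th^-1 <= r] keeps [th (1 - r)] below [pi / 2]. *)
Lemma bubble_poho_upper r : 1 - th^-1 <= r -> 1/2 <= r < 1 ->
  E r <= (th * M * (M + th * A) + 3 * th * K0 * A ^+ 6) * (1 - r).
Proof.
have t0 := sqrt_mu_gt0; have M0' := M0; have A0' := A0.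
have thA : 0 <= th * A by rewrite mulr_ge0 // ltW.
move=> rt /andP[r2 r1]; have r0 : 0 < r by lra.
have i : 0 <= r <= 1 by lra.
have i' : 0 <= r < 1 by lra.
have x0 : 0 <= th * (1 - r) by rewrite mulr_ge0 ?(ltW t0) //; lra.
have x1 : th * (1 - r) <= 1.
  have : th * (1 - r) <= th * th^-1 by rewrite ler_pM2l //; lra.
  by rewrite mulfV // gt_eqF.
have ph : 1 <= pi / 2 :> R by exact: pihalf_ge1.
have c0 : 0 <= cos (th * (1 - r)) by apply: cos_ge0_pihalf; lra.
have W := wronskian_le0 mu0 mupi A0 Kb v00 ode i; rewrite /= -/th in W.
have vr := bubble_ge0 i; have v1r := bubble_slope_bound i'; have vA := bubble_le i.
have vA' : v r <= A by apply: le_trans vA _; rewrite ler_piMr // ltW.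
rewrite mulrDl /E /poho; apply: lerD.
  set W1 := sin (th * r) * _ - _ in W *.
  have W1b : - W1 <= M + th * A.
    have b1 : - (sin (th * r) * v1 r) <= 1 * M.
      apply: le_trans (ler_norm _) _; rewrite normrN normrM.
      by apply: ler_pM => //; exact: sin_max.
    have b2 : th * cos (th * r) * v r <= th * 1 * A.
      apply: (@le_trans _ _ (th * 1 * v r)); last by rewrite mulr1 ler_pM2l.
      by rewrite ler_wpM2r // ler_pM2l // cos_le1.
    rewrite /W1; lra.
  have W2b : - (th * (1 - r) * M) <= sin (th * (1 - r)) * v1 r + th * cos (th * (1 - r)) * v r.
    have b1 : - (sin (th * (1 - r)) * v1 r) <= th * (1 - r) * M.
      apply: le_trans (ler_norm _) _; rewrite normrN normrM.
      by apply: ler_pM => //; exact: abs_sin_lex.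
    have b2 : 0 <= th * cos (th * (1 - r)) * v r by rewrite !mulr_ge0 // ltW.
    lra.
  set W2 := sin (th * (1 - r)) * _ + _ in W2b *.
  have b3 : - W1 * - (th * (1 - r) * M) <= - W1 * W2 by rewrite ler_wpM2l // oppr_ge0.
  have b4 : - W1 * (th * (1 - r) * M) <= (M + th * A) * (th * (1 - r) * M).
    by rewrite ler_wpM2r // mulr_ge0.
  have b5 : 0 <= (M + th * A) * (th * (1 - r) * M).
    by apply: mulr_ge0; [exact: addr_ge0|exact: mulr_ge0].
  clearbody W1 W2.
  have -> : th * M * (M + th * A) * (1 - r) = (M + th * A) * (th * (1 - r) * M) by ring.
  move: b3 b4 b5; move: (th * (1 - r) * M) (M + th * A) => z w; lra.
have /andP[k0 kK] := Kb i.
have s0 : 0 <= sin (th * r).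
  by apply/ltW/sin_gt0_pi; rewrite mulr_gt0 //=; apply: lt_trans mupi; rewrite gtr_pMr.
have S1 : sin (th * (1 - r)) <= th * (1 - r) by exact: sin_lex.
have S0 : 0 <= sin (th * (1 - r)).
  by apply: sin_ge0_pi; rewrite x0 /=; apply: le_trans x1 _; have := pi_ge2 R; lra.
have psi1 : poho_mult th r <= 1 * (th * (1 - r)).
  by rewrite /poho_mult; apply: ler_pM => //; exact: sin_le1.
have psi0 : 0 <= poho_mult th r by rewrite mulr_ge0.
have v6 : v r ^+ 6 / (6 * r ^+ 4) <= A ^+ 6 * 3.
  have r4 : 0 < r ^+ 4 by rewrite exprn_gt0.
  rewrite ler_pdivrMr ?mulr_gt0 //.
  have b1 : v r ^+ 6 <= A ^+ 6 by rewrite lerXn2r // nnegrE // ltW.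
  have b2 : (1/2) ^+ 4 <= r ^+ 4 by rewrite lerXn2r // nnegrE; lra.
  have b3 : 1 <= 3 * (6 * r ^+ 4) by lra.
  by apply: le_trans b1 _; rewrite -mulrA ler_peMr // exprn_ge0 // ltW.
have b1 : poho_mult th r * K r <= th * (1 - r) * K0.
  by apply: ler_pM => //; rewrite mul1r in psi1.
have b2 : poho_mult th r * K r * (v r ^+ 6 / (6 * r ^+ 4)) <= th * (1 - r) * K0 * (A ^+ 6 * 3).
  apply: ler_pM => //; first by rewrite mulr_ge0.
  by apply: poho_factor_ge0; lra.
rewrite -[leLHS]mulrA; apply: le_trans b2 _.
by rewrite le_eqVlt; apply/orP; left; apply/eqP; ring.
Qed.

(* The Pohozaev function gains order [A^-2] in the core and can lose only order
   [A^-6] afterwards, which is impossible for large [A]. *)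
Lemma profile_gap : co < d' ->
  c3 / 6 * (2^-1) ^+ 6 * A ^+ 6 * (co / 2) ^+ 4 <= C6 / A ^+ 6.
Proof.
have t0 := sqrt_mu_gt0; have dp := d'0; have dd := d'd; have /andP[d0 d1] := d01.
move=> cod; have co0 : 0 < co by exact: core_gt0.
have g1 : c3 / 6 * (2^-1) ^+ 6 * A ^+ 6 * (co / 2) ^+ 4 <= E co by apply: core_gain; lra.
have g2 : E co <= E d' by apply: bubble_poho_mono => //; exact: ltW.
rewrite leNgt; apply/negP => gap.
move: gap; rewrite -subr_gt0; set g := _ - _ => gap.
pose C := th * M * (M + th * A) + 3 * th * K0 * A ^+ 6 + 1.
have thA : 0 <= th * A by rewrite mulr_ge0 // ltW.
have C0 : 0 < C.
  apply: ltr_wpDl => //; apply: addr_ge0.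
    by apply: mulr_ge0; [apply: mulr_ge0 => //; exact: ltW|exact: addr_ge0].
  by apply: mulr_ge0; [rewrite !mulr_ge0 // ltW|rewrite exprn_ge0 // ltW].
(* So close to the sphere that the upper bound [(C - 1) y] is smaller than the gap [g]. *)
pose y := Num.min (Num.min (1/2) (th^-1)) (Num.min ((1 - d') / 2) (g / (2 * C))).
have y0 : 0 < y.
  rewrite !lt_min invr_gt0 t0 andbT; apply/andP; split; first by lra.
  by apply/andP; split; [lra|apply: divr_gt0 => //; exact: mulr_gt0].
have y1 : y <= 1/2 by rewrite !ge_min lexx.
have y2 : y <= th^-1 by rewrite !ge_min lexx orbT.
have y3 : y <= (1 - d') / 2 by rewrite !ge_min lexx !orbT.
have y4 : y <= g / (2 * C) by rewrite !ge_min lexx !orbT.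
rewrite ler_pdivlMr ?mulr_gt0 // in y4; clearbody y.
have z1 : E (1 - y) <= (C - 1) * y.
  have -> : (C - 1) * y = (th * M * (M + th * A) + 3 * th * K0 * A ^+ 6) * (1 - (1 - y)).
    by rewrite /C; ring.
  by apply: bubble_poho_upper; lra.
have z2 : E d' - C6 / A ^+ 6 <= E (1 - y) by apply: bubble_poho_lower; lra.
rewrite /g in y4 gap.
move: (C6 / A ^+ 6) (c3 / 6 * _ * _ * _) z2 y4 g1 gap => a b; lra.
Qed.

End OneProfile.

Lemma blowup : exists2 A, 0 < A & forall v v1, v 0 = 0 -> v1 0 = A ->
  (forall r, 0 <= r <= 1 -> der v r (v1 r) /\ der v1 r (- rhs K mu A r (v r))) -> v 1 < 0.
Proof.
have [c3 c30 [dw dw0 hw]] := weight_near0 K00 mu0 mupi L0 Kb Klow Kder dK0 k1le cth sig.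
pose d := Num.min 1 (Num.min dw (K0 / (4 * L))).
have d0 : 0 < d by rewrite !lt_min ltr01 dw0 /= divr_gt0 // mulr_gt0.
have d1 : d <= 1 by rewrite ge_min lexx.
have ddw : d <= dw by rewrite !ge_min lexx orbT.
have Ld : 4 * L * d <= K0 by rewrite mulrC -ler_pdivlMr ?mulr_gt0 // !ge_min lexx !orbT.
clearbody d; pose d' := d / 2.
have d'0 : 0 < d' by rewrite divr_gt0.
have d'd : d' < d by rewrite /d'; lra.
pose q := 384 / (K0 * d' ^+ 2).
pose C6 := (L + 4 * K0 * (2 * th + d'^-1)) / 6 * q ^+ 3.
pose k2 := (1 + K0)^-1.
have k20 : 0 < k2 by rewrite invr_gt0 addr_gt0.
have k21 : k2 < 1 by rewrite invf_lt1 ?ltrDl // addr_gt0.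
pose c5 := c3 / 6 * (2^-1) ^+ 6 * (k2 / 2) ^+ 4.
have c50 : 0 < c5.
  apply: mulr_gt0; last by rewrite exprn_gt0 ?divr_gt0.
  by apply: mulr_gt0; [apply: divr_gt0|apply: exprn_gt0; rewrite invr_gt0].
have C60 : 0 <= C6.
  have t0 : 0 < th by have /andP[] := th_bound mu0 mupi.
  have L0' := L0; have K00' := K00.
  apply: mulr_ge0.
    apply: divr_ge0 => //; apply: addr_ge0; first exact: ltW.
    apply: mulr_ge0; first by rewrite mulr_ge0 // ltW.
    by apply: addr_ge0; [rewrite mulr_ge0 // ltW|rewrite invr_ge0 ltW].
  by apply/exprn_ge0/divr_ge0; rewrite ?ler0n // mulr_ge0 ?sqr_ge0 // ltW.
(* The summands provide [A >= 1], [mu <= K0 A^4], a core smaller than [d'], and [C6 < c5 A^4], which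
   contradicts [profile_gap]. *)
pose A := 1 + mu / K0 + d'^-1 + C6 / c5.
have z1 : 0 < mu / K0 by rewrite divr_gt0.
have z2 : 0 < d'^-1 by rewrite invr_gt0.
have z3 : 0 <= C6 / c5 by rewrite divr_ge0 // ltW.
have A1 : 1 <= A by rewrite /A; lra.
have A0 : 0 < A by lra.
have AA : A <= A ^+ 2 by rewrite expr2 ler_peMr // ltW.
have A4 : A <= A ^+ 4.
  by rewrite [A ^+ 4]exprS; apply: ler_peMr; [exact: ltW|exact: exprn_ege1].
have muA : mu <= K0 * A ^+ 4.
  apply: (@le_trans _ _ (K0 * A)); last by rewrite ler_pM2l.
  by rewrite mulrC -ler_pdivrMr // /A; lra.
have cod : core A K0 < d'.
  rewrite /core -/k2 ltr_pdivrMr ?exprn_gt0 //; apply: lt_le_trans k21 _.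
  rewrite mulrC -ler_pdivrMr // mul1r; apply: le_trans AA.
  by rewrite /A; lra.
exists A => // v v1 v00 v10 ode; rewrite ltNge; apply/negP => v1ge.
have d01 : 0 < d <= 1 by rewrite d0.
have hw' r : 0 < r < d -> c3 * r <= poho_weight K dK th r.
  by move=> /andP[r0 rd]; apply: hw; rewrite r0 /= (lt_le_trans rd).
have := profile_gap A0 muA c30 v00 v10 v1ge ode d01 Ld hw' d'0 d'd cod.
rewrite -/q -/C6 /core -/k2 ler_pdivlMr ?exprn_gt0 //.
have -> : c3 / 6 * 2^-1 ^+ 6 * A ^+ 6 * (k2 / A ^+ 2 / 2) ^+ 4 * A ^+ 6 = c5 * A ^+ 4.
  by rewrite /c5; field; rewrite gt_eqF.
apply/negP; rewrite -ltNge mulrC -ltr_pdivrMr //; apply: lt_le_trans A4.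
by rewrite /A; move: (C6 / c5) z3 => z z3; lra.
Qed.

End BlowupContradiction.

(** * Radial functions that are twice differentiable up to the sphere *)

Section RadialC2.
Context {R : realType}.
Implicit Types (x y v : 'rV[R]_3) (i j : 'I_3) (r s t : R).

Lemma is_derive_line (f : 'rV[R]_3 -> R) x v l :
  der (fun t => f (x + t *: v)) 0 l -> is_derive x v f l.
Proof.
move=> [hd he].
have E : (fun h : R => h^-1 *: (f (h *: v + x) - f x)) =
    (fun h : R => h^-1 *: (f (x + (h *: 1 + 0 : R) *: v) - f (x + (0 : R) *: v))).
  by apply/funext => h; rewrite addr0 scale0r addr0 [h *: 1]mulr1 [h *: v + x]addrC.
apply: DeriveDef; first by rewrite /derivable E; exact: hd.
by rewrite -he /derive E.
Qed.

Lemma der_sqr0 (f : R -> R) (M e : R) : 0 < e ->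
  (forall t, `|t| < e -> `|f t - f 0| <= M * t ^+ 2) -> der f 0 0.
Proof.
move=> e0 h; pose g s := (f s - f 0) / s.
have cg : ct g 0.
  apply/cvgrPdist_lt => z z0; rewrite /g subrr mul0r.
  near=> t; rewrite sub0r normrN.
  have te : `|t| < e.
    by near: t; exact: (@nbhs0_lt _ R).
  have tz : `|t| < z / (`|M| + 1).
    by near: t; apply: (@nbhs0_lt _ R); rewrite divr_gt0 // ltr_wpDl.
  have [->|t0] := eqVneq t 0; first by rewrite subrr mul0r normr0.
  rewrite normrM normfV ltr_pdivrMr ?normr_gt0 //.
  rewrite ltr_pdivlMr ?ltr_wpDl // in tz.
  apply: le_lt_trans (h _ te) _.
  rewrite -(@real_normK _ t) ?num_real // expr2 mulrA ltr_pM2r ?normr_gt0 //.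
  apply: le_lt_trans tz; rewrite mulrC ler_wpM2l //.
  by apply: le_trans (ler_norm _) _; rewrite lerDl.
have := derD (der_mul_id cg) (derC (f 0) 0).
have g0 : g 0 = 0 by rewrite /g subrr mul0r.
rewrite g0 addr0.
apply: (@der_near_eq _ _ _ _ _ 1 ltr01) => y _.
rewrite /g; have [->|y0] := eqVneq y 0; first by rewrite mul0r add0r.
by field.
Unshelve. all: by end_near. Qed.

Lemma nsq_gt0 x : x != 0 -> 0 < nsq x.
Proof. by move=> x0; rewrite lt0r nsq_ge0 andbT; apply: contra x0 => /eqP/nsq0 ->. Qed.

Lemma enorm_gt0 x : x != 0 -> 0 < enorm x.
Proof. by move=> x0; rewrite sqrtr_gt0 nsq_gt0. Qed.

Lemma enorm0 : enorm (0 : 'rV[R]_3) = 0.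
Proof. by rewrite /enorm sum3 !mxE expr0n /= !addr0 sqrtr0. Qed.

Lemma enormZ_basis t i : enorm (t *: basis_vec R i) = `|t|.
Proof.
rewrite -[LHS]/(Num.sqrt (nsq _)) -sqrtr_sqr; congr Num.sqrt.
rewrite /nsq (bigD1 i) //= !mxE !eqxx mulr1 big1 ?addr0 // => j ji.
by rewrite !mxE (negbTE ji) andbF mulr0 expr0n.
Qed.

Lemma dot_basis x i : dot x (basis_vec R i) = x ord0 i.
Proof.
rewrite /dot (bigD1 i) //= basis_vecE eqxx mulr1 big1 ?addr0 // => j ji.
by rewrite basis_vecE eq_sym (negbTE ji) mulr0.
Qed.

Lemma nsq_basis_vec i : nsq (basis_vec R i) = 1.
Proof. by rewrite -sqr_enorm -[basis_vec R i]scale1r enormZ_basis normr1 expr1n. Qed.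

Lemma der_nsq_line x i : der (fun t => nsq (x + t *: basis_vec R i)) 0 (2 * x ord0 i).
Proof.
have -> : (fun t => nsq (x + t *: basis_vec R i)) =
    (fun t => nsq x + 2 * t * x ord0 i + t ^+ 2).
  by apply/funext => t; rewrite nsqD dot_basis nsq_basis_vec mulr1.
by dsolve => /=; ring.
Qed.

Lemma der_enorm_line x i : x != 0 ->
  der (fun t => enorm (x + t *: basis_vec R i)) 0 (x ord0 i / enorm x).
Proof.
move=> x0; have p : 0 < nsq (x + (0 : R) *: basis_vec R i) by rewrite scale0r addr0 nsq_gt0.
apply: der_eq (derO (der_nsq_line x i) (der_sqrt p)) _.
rewrite scale0r addr0 -[Num.sqrt (nsq x)]/(enorm x).
by field; rewrite gt_eqF // enorm_gt0.
Qed.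

Lemma der_radial (F : R -> R) l x i : x != 0 -> der F (enorm x) l ->
  der (fun t => F (enorm (x + t *: basis_vec R i))) 0 (l * (x ord0 i / enorm x)).
Proof.
move=> x0 hF; apply: derO (der_enorm_line i x0) _.
by rewrite scale0r addr0.
Qed.

Lemma der_coord_line x i j : der (fun t : R => (x + t *: basis_vec R j) ord0 i) 0 (i == j)%:R.
Proof.
have -> : (fun t : R => (x + t *: basis_vec R j) ord0 i) =
    (fun t => x ord0 i + t * (i == j)%:R).
  by apply/funext => t; rewrite !mxE eqxx.
by dsolve => /=; ring.
Qed.

(** [A] stands for [U' / r] and [C] for [r A']. The Hessian of the radial function is then
    [A I + C x x^T / |x|^2], whose second term extends continuously by 0 at the origin because
    [C 0 = 0]. *)
Variables (U A C : R -> R).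
Hypotheses (Uc : continuous (fun r => U (cl r))) (Ac : continuous (fun r => A (cl r)))
  (Cc : continuous (fun r => C (cl r))) (C0 : C 0 = 0).
Hypothesis dU : forall r, 0 < r < 1 -> der U r (r * A r).
Hypothesis dA : forall r, 0 < r < 1 -> der A r (C r / r).

Let u x := U (enorm x).

Lemma ball_line x i : unit_ball R x ->
  exists2 d : R, 0 < d & forall t, `|t| < d -> unit_ball R (x + t *: basis_vec R i).
Proof. by move=> hx; exact: open_line unit_ball_open hx. Qed.

Lemma ct_radial (F : R -> R) x : continuous (fun r => F (cl r)) ->
  ct (fun y => F (cl (enorm y))) x.
Proof.
move=> cF; apply: (@continuous_comp _ _ _ (@enorm R) (fun r => F (cl r))).
- exact: enorm_continuous.
- exact: cF.
Qed.

Lemma cl_enorm x : closed_unit_ball R x -> cl (enorm x) = enorm x.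
Proof. by move=> hx; rewrite cl_id // enorm_ge0. Qed.

(** This yields vanishing first derivatives at the origin, where the norm is not differentiable. *)
Lemma radial_quadratic : exists M d, 0 < d /\ forall r, 0 <= r < d -> `|U r - U 0| <= M * r ^+ 2.
Proof.
have cA : ct (fun r => A (cl r)) 0 by exact: Ac.
have [d /= d0 hd] := ct_dist cA ltr01.
exists (`|A 0| + 1), (Num.min d 1); split; first by rewrite lt_min d0 /=.
move=> r; rewrite lt_min => /and3P[r0 rd r1].
have [->|rn] := eqVneq r 0; first by rewrite subrr normr0 expr0n mulr0.
have rp : 0 < r by rewrite lt0r rn.
have [||c] := @MVT R (fun s => U (cl s)) (fun s => s * A s) 0 r rp.
- move=> x; rewrite in_itv /= => /andP[x0 xr].
  have x01 : 0 < x < 1 by rewrite x0 (lt_trans xr).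
  have e0 : 0 < Num.min x (1 - x) by rewrite lt_min x0 subr_gt0 (lt_trans xr).
  apply: (der_near_eq e0) (dU x01) => y; rewrite lt_min !ltr_norml => /andP[/andP[? _] /andP[_ ?]].
  by rewrite cl_id //; lra.
- by apply: continuous_subspaceT.
rewrite in_itv /= => /andP[c0 cr]; rewrite !cl_id ?lexx ?ler01 ?r0 ?(ltW r1) //= subr0 => ->.
rewrite !normrM (gtr0_norm c0) (gtr0_norm rp) expr2 mulrA.
rewrite ler_pM2r // mulrC; apply: ler_pM => //; [exact: ltW| |exact: ltW].
have := hd c; rewrite /= sub0r normrN (gtr0_norm c0) !cl_id ?lexx ?ler01 ?(ltW c0) //=; last by lra.
move=> /(_ (lt_trans cr rd)) h; have := ler_normD (A c - A 0) (A 0); rewrite subrK; lra.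
Qed.

Lemma is_derive_radial1 x i : unit_ball R x -> is_derive x (basis_vec R i) u (A (enorm x) * x ord0 i).
Proof.
move=> hx; apply: is_derive_line; have [->|x0] := eqVneq x 0.
  have [M [d [d0 hM]]] := radial_quadratic.
  rewrite mxE mulr0; apply: (@der_sqr0 _ M d d0) => t td.
  rewrite !add0r /u !enormZ_basis normr0.
  have := hM `|t|; rewrite normr_ge0 td real_normK ?num_real //; exact.
have h : 0 < enorm x < 1 by rewrite enorm_gt0.
have := der_radial i x0 (dU h); move/der_eq; apply.
by field; rewrite gt_eqF // enorm_gt0.
Qed.

Lemma partial_radial1 x i : unit_ball R x -> partial i u x = A (enorm x) * x ord0 i.
Proof. by move=> /(is_derive_radial1 i)[]. Qed.

Lemma is_derive_radial2 x i j : unit_ball R x -> is_derive x (basis_vec R j) (partial i u)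
  (A (enorm x) * (i == j)%:R + x ord0 i * x ord0 j / enorm x ^+ 2 * C (enorm x)).
Proof.
move=> hx; apply: is_derive_line; have [d d0 hd] := ball_line j hx.
suff h : der (fun t => A (enorm (x + t *: basis_vec R j)) * (x + t *: basis_vec R j) ord0 i) 0
   (A (enorm x) * (i == j)%:R + x ord0 i * x ord0 j / enorm x ^+ 2 * C (enorm x)).
  apply: (der_near_eq d0) h => y; rewrite subr0 => yd.
  by rewrite partial_radial1 //; exact: hd.
have [x0|x0] := eqVneq x 0.
  have hx' := hx; rewrite x0 in hd hx' *.
  rewrite enorm0 mxE !mul0r addr0.
  (* At the origin the first derivative is, along the axis, [t A(|t|)] times a constant, and
     [der_mul_id] differentiates it from the continuity of [A]. *)
  have c : ct (fun t : R => A (cl (enorm (t *: basis_vec R j))) * (i == j)%:R) 0.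
    apply: ctM; last exact: ctC.
    apply: (@continuous_comp _ _ _ (fun t : R => t *: basis_vec R j) (fun y => A (cl (enorm y)))).
      by apply: cvgZr_tmp; exact: cvg_id.
    by apply: ct_radial; exact: Ac.
  have := der_mul_id c; rewrite scale0r enorm0 cl_id ?lexx ?ler01 //.
  apply: (der_near_eq d0) => y; rewrite subr0 => yd.
  rewrite add0r cl_enorm ?mxE ?eqxx /=; first by rewrite /basis_vec eq_sym; ring.
  by apply: ltW; have := hd _ yd; rewrite add0r.
have h : 0 < enorm x < 1 by rewrite enorm_gt0.
have h1 := der_radial j x0 (dA h); have h2 := der_coord_line x i j.
dsolve => /=; rewrite scale0r addr0.
by field; rewrite gt_eqF // enorm_gt0.
Qed.

Lemma partial_radial2 x i j : unit_ball R x -> partial j (partial i u) x =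
  A (enorm x) * (i == j)%:R + x ord0 i * x ord0 j / enorm x ^+ 2 * C (enorm x).
Proof. by move=> /(is_derive_radial2 i j)[]. Qed.

Lemma coord_le_enorm x i : `|x ord0 i| <= enorm x.
Proof.
rewrite -sqrtr_sqr ler_sqrt ?nsq_ge0 //.
by rewrite (bigD1 i) //= lerDl sumr_ge0 // => j _; rewrite sqr_ge0.
Qed.

Lemma radial_C2 : C2_closed_ball u.
Proof.
split.
- have -> : {within closed_unit_ball R, continuous u} =
      {within closed_unit_ball R, continuous (fun y => U (cl (enorm y)))}.
    rewrite propeqE; split => h; apply: subspace_eq_continuous h => y /set_mem hy;
      by rewrite /from_subspace /u cl_enorm.
  by apply: continuous_subspaceT => y; exact: ct_radial.
- by move=> i x /(is_derive_radial1 i)[].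
- by move=> i j x /(is_derive_radial2 i j)[].
- move=> i; exists (fun x => A (cl (enorm x)) * x ord0 i); split.
    apply: continuous_subspaceT => y; apply: ctM; first exact: ct_radial.
    exact: coord_continuous.
  by move=> x hx; rewrite partial_radial1 // cl_enorm //; exact: ltW.
move=> i j; exists (fun x => A (cl (enorm x)) * (i == j)%:R +
  x ord0 i * x ord0 j / enorm x ^+ 2 * C (cl (enorm x))); split; last first.
  by move=> x hx; rewrite partial_radial2 // cl_enorm //; exact: ltW.
apply: continuous_subspaceT => y.
have c1 : ct (fun x : 'rV[R]_3 => A (cl (enorm x)) * (i == j)%:R) y.
  by apply: ctM; [exact: ct_radial|exact: ctC].
suff c2 : ct (fun x : 'rV[R]_3 => x ord0 i * x ord0 j / enorm x ^+ 2 * C (cl (enorm x))) y.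
  exact: ctD c1 c2.
have cx k : ct (fun x : 'rV[R]_3 => x ord0 k) y by exact: coord_continuous.
have ce : ct (@enorm R) y by exact: enorm_continuous.
have cC : ct (fun x => C (cl (enorm x))) y by exact: ct_radial.
have [y0|y0] := eqVneq y 0; last first.
  by ctauto; rewrite expf_neq0 // gt_eqF // enorm_gt0.
rewrite y0 in cC *; apply/(@cvgrPdist_lt _ _ _ (nbhs (0 : 'rV[R]_3)) (nbhs_filter _)) => e e0.
near=> x; have : `|C (cl (enorm x)) - C (cl (enorm (0 : 'rV[R]_3)))| < e.
  by near: x; exact: ct_dist cC _ e0.
have cl0 : cl (0 : R) = 0 by rewrite cl_id // lexx ler01.
rewrite !enorm0 cl0 C0 subr0 mulr0 sub0r normrN normrM.
apply: le_lt_trans; rewrite ler_piMl //.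
have [->|x0] := eqVneq x 0; first by rewrite mxE !mul0r normr0.
have ep := enorm_gt0 x0.
rewrite normrM normfV (gtr0_norm (exprn_gt0 2 ep)) ler_pdivrMr ?exprn_gt0 // mul1r normrM expr2.
by apply: ler_pM => //; exact: coord_le_enorm.
Unshelve. all: by end_near. Qed.

Lemma radial_laplacian x : unit_ball R x ->
  laplacian u x = 3 * A (enorm x) + C (enorm x).
Proof.
move=> hx; rewrite /laplacian sum3 !partial_radial2 //=.
have [->|x0] := eqVneq x 0.
  by rewrite !mxE enorm0 C0; ring.
have ep := enorm_gt0 x0.
transitivity (3 * A (enorm x) + (nsq x / enorm x ^+ 2) * C (enorm x)).
  by rewrite /nsq sum3; ring.
by rewrite sqr_enorm divff ?mul1r // gt_eqF // nsq_gt0.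
Qed.

End RadialC2.

(** * From profiles to classical solutions *)

Section Existence.
Context {R : realType}.

(** Profiles are given by a quotient on [(0, 1]] and by a limit value at 0, so continuity is checked
    separately in the two places. *)
Lemma continuous_cl (F : R -> R) : (forall r, 0 < r <= 1 -> ct F r) ->
  (forall e, 0 < e -> exists2 d, 0 < d & forall r, 0 < r < d -> `|F r - F 0| < e) ->
  continuous (fun r => F (cl r)).
Proof.
move=> hF h0 r; have [r0|r0] := eqVneq (cl r) 0; last first.
  apply: (@continuous_comp _ _ _ cl F); first exact: ct_cl.
  by apply: hF; have /andP[c0 ->] := cl01 r; rewrite lt0r r0 c0.
apply/cvgrPdist_lt => e e0; have [d d0 hd] := h0 _ e0.
near=> s; rewrite distrC r0.
have : `|cl s - cl r| < d by near: s; exact: ct_dist (@ct_cl _ r) _ d0.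
have /andP[s0 _] := cl01 s; rewrite r0 subr0 ger0_norm // => sd.
have [->|sn] := eqVneq (cl s) 0; first by rewrite subrr normr0.
by apply: hd; rewrite sd lt0r sn s0.
Unshelve. all: by end_near. Qed.

Lemma der_quot (f : R -> R) l : f 0 = 0 -> der f 0 l ->
  forall e, 0 < e -> exists2 d, 0 < d & forall r, 0 < r < d -> `|f r / r - l| < e.
Proof.
move=> f0 [fd fl] e e0.
have hc : s^-1 *: (f (s *: 1 + 0) - f 0) @[s --> 0^'] --> l by rewrite -fl.
move/cvgrPdist_lt : hc => /(_ _ e0); rewrite near_withinE => -[d /= d0 he].
exists d => // r /andP[r0 rd].
have := he r; rewrite /= sub0r normrN gtr0_norm // => /(_ rd (lt0r_neq0 r0)).
by rewrite addr0 [r *: 1]mulr1 f0 subr0 [_ *: _]mulrC distrC.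
Qed.

Lemma ct_small (f : R -> R) b : ct f 0 -> f 0 = 0 -> 0 < b ->
  forall e, 0 < e -> exists2 x, 0 < x < b & - e <= f x.
Proof.
move=> cf f0 b0 e e0; have [d /= d0 hd] := ct_dist cf e0.
pose x := Num.min b d / 2.
have m0 : 0 < Num.min b d by rewrite lt_min b0 d0.
have mb : Num.min b d <= b by rewrite ge_min lexx.
have md : Num.min b d <= d by rewrite ge_min lexx orbT.
have x0 : 0 < x by rewrite divr_gt0.
exists x; first by rewrite x0 /x; lra.
have := hd x; rewrite /= sub0r normrN (gtr0_norm x0) f0 subr0 => /(_ _)/ltW.
by rewrite ler_norml => h; have [|->//] := andP (h _); rewrite /x; lra.
Qed.

Section Profile.
Variables (K v v1 : R -> R) (mu a : R).
Hypotheses (a0 : 0 < a) (Kc : continuous (fun r => K (cl r))).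
Hypotheses (v00 : v 0 = 0) (v10 : v1 0 = a) (v_1 : v 1 = 0).
Hypothesis dv : forall r, 0 <= r <= 1 -> der v r (v1 r).
Hypothesis dv1 : forall r, 0 < r <= 1 ->
  der v1 r (- (K r * v r ^+ 5 / r ^+ 4 + mu * v r)).
Hypotheses (cv1 : ct v1 0) (vpos : forall r, 0 < r < 1 -> 0 < v r).

(** [U] is [v / r] and [A] is [U' / r], with their limits as values at 0: the equation at the origin
    reads [3 A 0 = - N0]. [C] is defined so that the Laplacian [3 A + C] equals [- N]. *)
Let N0 := K 0 * a ^+ 5 + mu * a.
Let U r := if r == 0 then a else v r / r.
Let A r := if r == 0 then - N0 / 3 else (r * v1 r - v r) / r ^+ 3.
Let N r := K (cl r) * U r ^+ 5 + mu * U r.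
Let C r := - N r - 3 * A r.

Let cl0 : cl (0 : R) = 0. Proof. by rewrite cl_id // lexx ler01. Qed.

Lemma ct_eq_pos (F G : R -> R) r : 0 < r -> (forall s, 0 < s -> F s = G s) -> ct F r -> ct G r.
Proof.
move=> r0 FG cF; suff : G @ r --> F r by rewrite FG.
apply: cvg_trans cF; apply: near_eq_cvg; near=> s; apply: FG.
by near: s; exact: lt_nbhsr.
Unshelve. all: by end_near. Qed.

Lemma sol_posE r : 0 < r -> U r = v r / r. Proof. by rewrite /U => r0; rewrite gt_eqF. Qed.

Lemma slope_posE r : 0 < r -> A r = (r * v1 r - v r) / r ^+ 3.
Proof. by rewrite /A => r0; rewrite gt_eqF. Qed.

Lemma sol_ct r : 0 < r <= 1 -> ct U r.
Proof.
move=> /andP[r0 r1]; have r01 : 0 <= r <= 1 by rewrite ltW.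
have cv : ct v r := der_cont (dv r01).
apply: (@ct_eq_pos (fun r => v r / r)) => // [s s0|]; first by rewrite sol_posE.
by ctauto; rewrite gt_eqF.
Qed.

Lemma slope_ct r : 0 < r <= 1 -> ct A r.
Proof.
move=> /andP[r0 r1]; have r01 : 0 <= r <= 1 by rewrite ltW.
have cv : ct v r := der_cont (dv r01).
have cv1' : ct v1 r by apply: der_cont (dv1 _); rewrite r0.
apply: (@ct_eq_pos (fun r => (r * v1 r - v r) / r ^+ 3)) => // [s s0|]; first by rewrite slope_posE.
by ctauto; rewrite expf_neq0 // gt_eqF.
Qed.

Lemma sol_cl_cont : continuous (fun r => U (cl r)).
Proof.
apply: continuous_cl => [|e e0]; first exact: sol_ct.
have dv0 : der v 0 a by rewrite -v10; apply: dv; rewrite lexx ler01.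
have [d d0 hd] := der_quot v00 dv0 e0.
exists d => // r r0; have /andP[rp _] := r0.
by rewrite sol_posE // /U eqxx; exact: hd.
Qed.

Lemma force_cl_cont : continuous (fun r => N (cl r)).
Proof.
move=> r.
have c1 : ct (fun r => U (cl r)) r by exact: sol_cl_cont.
have c2 : ct (fun r => K (cl r)) r by exact: Kc.
have c3 : ct (fun r => K (cl (cl r))) r.
  by rewrite (_ : (fun r => _) = fun r => K (cl r)) //; apply/funext => s; rewrite [cl (cl s)]cl_id ?cl01.
suff : ct (fun r => K (cl (cl r)) * U (cl r) ^+ 5 + mu * U (cl r)) r by [].
ctauto.
Qed.

Lemma der_defect r : 0 < r <= 1 -> der (fun r => v r - r * v1 r) r (r ^+ 2 * N r).
Proof.
move=> r01; have /andP[r0 r1] := r01; have r01' : 0 <= r <= 1 by rewrite ltW.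
have h1 := dv r01'; have h2 := dv1 r01; dsolve => /=.
by rewrite /N cl_id // sol_posE //; field; rewrite gt_eqF.
Qed.

(** Since [(v - r v1)' = r^2 N] and [N] stays within [e] of [N0] near 0, [v - r v1] lies between
    [(N0 - e) r^3 / 3] and [(N0 + e) r^3 / 3]. *)
Lemma slope_cl_cont : continuous (fun r => A (cl r)).
Proof.
apply: continuous_cl => [|e e0]; first exact: slope_ct.
have cN : ct (fun r => N (cl r)) 0 by exact: force_cl_cont.
have [d /= d0 hd] := ct_dist cN e0.
have hN s : 0 < s -> s < d -> s <= 1 -> `|N s - N0| < e.
  move=> s0 sd s1; have := hd s; rewrite /= sub0r normrN gtr0_norm // => /(_ sd).
  by rewrite cl0 cl_id ?s1 ?ltW // /N cl0 /U eqxx.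
have m1d : 0 < Num.min 1 d by rewrite lt_min ltr01 d0.
exists (Num.min 1 d) => // r; rewrite lt_min => /and3P[r0 r1 rd].
have r3 : 0 < r ^+ 3 by rewrite exprn_gt0.
have cm : ct (fun r => v r - r * v1 r) 0.
  have dv0 := dv (r := 0); have cv : ct v 0 by apply: (der_cont (dv0 _)); rewrite lexx ler01.
  by ctauto.
have up : 0 <= (N0 + e) / 3 * r ^+ 3 - (v r - r * v1 r).
  apply: (@der_le_at0 R (fun s => (N0 + e) / 3 * s ^+ 3 - (v s - s * v1 s))
    (fun s => s ^+ 2 * (N0 + e - N s)) r r0).
  - move=> x /andP[x0 xr]; have h : der (fun r => v r - r * v1 r) x (x ^+ 2 * N x).
      by apply: der_defect; rewrite x0 (le_trans xr) // ltW.
    apply: der_eq; first by apply: derD; [dauto|apply: derN h].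
    by rewrite /=; field.
  - move=> x /andP[x0 xr]; rewrite mulr_ge0 ?sqr_ge0 //.
    have := hN x x0 (lt_trans xr rd) (ltW (lt_trans xr r1)).
    by rewrite ltr_norml; lra.
  apply: ct_small => //; last by rewrite v00 expr0n /= mulr0 mul0r !subr0.
  apply: ctD; last exact: ctN.
  by ctauto.
have lo : 0 <= (v r - r * v1 r) - (N0 - e) / 3 * r ^+ 3.
  apply: (@der_le_at0 R (fun s => (v s - s * v1 s) - (N0 - e) / 3 * s ^+ 3)
    (fun s => s ^+ 2 * (N s - (N0 - e))) r r0).
  - move=> x /andP[x0 xr]; have h : der (fun r => v r - r * v1 r) x (x ^+ 2 * N x).
      by apply: der_defect; rewrite x0 (le_trans xr) // ltW.
    apply: der_eq; first by apply: derD; [exact: h|dauto].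
    by rewrite /=; field.
  - move=> x /andP[x0 xr]; rewrite mulr_ge0 ?sqr_ge0 //.
    have := hN x x0 (lt_trans xr rd) (ltW (lt_trans xr r1)).
    by rewrite ltr_norml; lra.
  apply: ct_small => //; last by rewrite v00 expr0n /= mulr0 mul0r !subr0.
  apply: ctD; first exact: cm.
  by ctauto.
rewrite slope_posE // /A eqxx ltr_norml ltrBrDr ltrBlDr ltr_pdivlMr // ltr_pdivrMr //.
have e3 : 0 < e * r ^+ 3 by rewrite mulr_gt0.
by apply/andP; split; lra.
Qed.

Lemma curv_cl_cont : continuous (fun r => C (cl r)).
Proof.
move=> r; have c1 : ct (fun r => A (cl r)) r by exact: slope_cl_cont.
have c2 : ct (fun r => N (cl r)) r by exact: force_cl_cont.
suff : ct (fun r => - N (cl r) - 3 * A (cl r)) r by [].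
ctauto.
Qed.

Lemma curv_0 : C 0 = 0.
Proof. by rewrite /C /N /A eqxx cl0 /U eqxx -/N0; field. Qed.

Lemma der_sol r : 0 < r < 1 -> der U r (r * A r).
Proof.
move=> /andP[r0 r1]; have h1 : der v r (v1 r) by apply: dv; rewrite !ltW.
apply: (@der_near_eq _ (fun r => v r / r) _ _ _ r r0).
  by move=> y; rewrite ltr_norml => /andP[y1 _]; rewrite sol_posE //; lra.
by rewrite slope_posE //; dsolve => /=; [rewrite gt_eqF|field; rewrite gt_eqF].
Qed.

Lemma der_slope r : 0 < r < 1 -> der A r (C r / r).
Proof.
move=> /andP[r0 r1]; have r01 : 0 < r <= 1 by rewrite r0 ltW.
have h1 : der v r (v1 r) by apply: dv; rewrite !ltW.
have h2 := dv1 r01.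
apply: (@der_near_eq _ (fun r => (r * v1 r - v r) / r ^+ 3) _ _ _ r r0).
  by move=> y; rewrite ltr_norml => /andP[y1 _]; rewrite slope_posE //; lra.
dsolve => /=; first by rewrite expf_neq0 // gt_eqF.
by rewrite /C /N slope_posE // sol_posE // cl_id ?ltW //; field; rewrite gt_eqF.
Qed.

Lemma profile_solution : classical_solution (fun x => K (enorm x)) mu (fun x => U (enorm x)).
Proof.
split.
- exact: (radial_C2 sol_cl_cont slope_cl_cont curv_cl_cont curv_0 der_sol der_slope).
- move=> x hx; rewrite (radial_laplacian sol_cl_cont slope_cl_cont curv_0 der_sol der_slope) // /C /N cl_enorm; last exact: ltW.
  by ring.
- move=> x hx; rewrite /U; case: eqVneq => // x0.
  have r0 : 0 < enorm x by rewrite lt0r x0 enorm_ge0.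
  by rewrite divr_gt0 // vpos // r0.
- by move=> x ->; rewrite /U oner_eq0 v_1 mul0r.
Qed.

End Profile.

Variables (K0 mu eta : R) (f1 : R -> R).
Hypotheses (K00 : 0 < K0) (f1C1 : C1_01 f1) (f10 : f1 0 = 0).
Hypotheses (mu0 : 0 < mu) (mupi : mu < pi ^+ 2) (eta0 : 0 <= eta).
Hypothesis fnn : forall t, t \in `[0, 1] -> 0 <= K0 + eta * f1 t.
Hypothesis fnoninc :
  {in `[0, 1] &, forall s t, s <= t -> K0 + eta * f1 t <= K0 + eta * f1 s}.

Lemma coef_cl : continuous (fun r => coef K0 eta f1 (cl r)).
Proof.
move=> r; suff c : ct (fun r => f1 (cl r)) r.
  suff : ct (fun r => K0 + eta * f1 (cl r)) r by [].
  ctauto.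
have [L L0 hL] := C1_01_bounded f1C1.
have c01 (s : R) : cl s \in `[0, 1] by rewrite in_itv /=; exact: cl01.
apply/cvgrPdist_lt => e e0; near=> s; rewrite distrC.
rewrite (le_lt_trans (C1_01_lipschitz f1C1 hL (c01 s) (c01 r))) //.
rewrite mulrC -ltr_pdivlMr //.
by near: s; apply: ct_dist (@ct_cl _ r) _ _; exact: divr_gt0.
Unshelve. all: by end_near. Qed.

Lemma green_implies_solution :
  - (deriv01 f1 0 * eta) / (4 * K0) <
  - (Num.sqrt mu * cos (Num.sqrt mu) / sin (Num.sqrt mu)) ->
  exists u, classical_solution (fun x => K0 + eta * f1 (enorm x)) mu u.
Proof.
set th := Num.sqrt mu; move=> hA.
have /andP[t0 tpi] := sqrt_mu_bound mu0 mupi; rewrite -/th in t0 tpi.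
have s0 : 0 < sin th by rewrite sin_gt0_pi // t0.
pose k1 := eta * deriv01 f1 0.
have dK0 e : 0 < e -> exists2 d, 0 < d & forall t, 0 < t < d -> k1 - e <= eta * deriv01 f1 t <= k1 + e.
  move=> e0; have ep : 0 < eta + 1 by rewrite ltr_wpDl.
  have [d /andP[d0 _] hd] := C1_01_deriv_at0 f1C1 (divr_gt0 e0 ep).
  exists d => // t /andP[t00 td]; have := hd t; rewrite td ltW // => /(_ isT).
  rewrite ler_pdivlMr // mulrC => h.
  have : `|eta * (deriv01 f1 t - deriv01 f1 0)| <= e.
    apply: le_trans h; rewrite normrM (ger0_norm eta0) ler_wpM2r //; lra.
  by rewrite ler_norml /k1 => /andP[h1 h2]; apply/andP; split; lra.
have k1le : k1 <= 0.
  rewrite leNgt; apply/negP => k10.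
  have k12 : 0 < k1 / 2 by rewrite divr_gt0.
  have [d d0 hd] := dK0 _ k12.
  pose t := Num.min d 1 / 2.
  have m0 : 0 < Num.min d 1 by rewrite lt_min d0 ltr01.
  have md : Num.min d 1 <= d by rewrite ge_min lexx.
  have m1 : Num.min d 1 <= 1 by rewrite ge_min lexx orbT.
  have td : 0 < t < d by rewrite /t; lra.
  have /andP[h _] := hd t td.
  have t01 : 0 < t < 1 by rewrite /t; lra.
  have := coef_der_le0 f1C1 fnoninc t01; lra.
have hA' : - k1 * sin th < - (4 * K0 * (th * cos th)).
  move: hA; rewrite mulNr ltrN2 [deriv01 f1 0 * eta]mulrC -/k1 ltr_pdivrMr // mulrAC ltr_pdivlMr ?mulr_gt0 //.
  by rewrite mulNr ltrN2 [_ * (4 * K0)]mulrC.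
have sig : 0 < k1 * sin th - 4 * K0 * th * cos th by lra.
(* As [k1 <= 0], the inequality [sig] leaves no room for a nonnegative cosine. *)
have cth : cos th < 0.
  rewrite ltNge; apply/negP => c0.
  have i1 : k1 * sin th <= 0 by rewrite mulr_le0_ge0 // ltW.
  have i2 : 0 <= 4 * K0 * th * cos th by rewrite !mulr_ge0 // ltW.
  lra.
have [L L0 hL] := coef_near0 K0 f1C1 f10 eta0.
have Kb (r : R) : 0 <= r <= 1 -> 0 <= coef K0 eta f1 r <= K0.
  exact: (coef_bound f10 fnn fnoninc).
have Klow r : 0 <= r <= 1 -> K0 - L * r <= coef K0 eta f1 r by move=> /hL[h _].
have Kder r : 0 < r < 1 -> [/\ der (coef K0 eta f1) r (eta * deriv01 f1 r),
    eta * deriv01 f1 r <= 0 & - L <= eta * deriv01 f1 r].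
  move=> r01; split; [exact: coef_der|exact: (coef_der_le0 f1C1 fnoninc r01)|].
  by have /andP[? ?] := r01; have [|_] := hL r; [rewrite !ltW|apply].
have dK0' e : 0 < e -> exists2 d, 0 < d & forall t, 0 < t < d -> k1 - e <= eta * deriv01 f1 t.
  by move=> /dK0[d d0 hd]; exists d => // t /hd/andP[].
have [A A0 hA2] := blowup K00 mu0 tpi L0 Kb Klow Kder dK0' k1le cth sig.
pose d := Num.min 1 (K0 / (2 * L)).
have d0 : 0 < d by rewrite lt_min ltr01 divr_gt0 // mulr_gt0.
have Kd r : 0 < r < d -> 0 < coef K0 eta f1 r.
  move=> /andP[r0]; rewrite lt_min ltr_pdivlMr ?mulr_gt0 // => /andP[r1 r2].
  have K00' := K00; by have [|h _] := hL r; [rewrite !ltW|lra].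
have [a [v [v1 [a0 v00 v10 v_1 [dv dv1 cv1 vpos _]]]]] :=
  shooting K00 mu0 tpi A0 Kb coef_cl d0 Kd hA2.
eexists; exact: (profile_solution a0 coef_cl v00 v10 v_1 dv dv1 cv1 vpos).
Qed.

End Existence.

(** * The regular part of the Green function *)

Section SmoothCutoff.
Context {R : realType}.
Implicit Types (F G : R -> R) (t x : R).

(** The derivatives of [exp (- 1 / t)], extended by 0, are linear combinations of the members of
    this family. *)
Definition flat (n : nat) t : R := if 0 < t then expR (- t^-1) / t ^+ n else 0.

Lemma flat_ge0 n t : 0 <= flat n t.
Proof. by rewrite /flat; case: ifP => // t0; rewrite divr_ge0 ?expR_ge0 // exprn_ge0 // ltW. Qed.

Lemma flat_gt0 n t : 0 < t -> 0 < flat n t.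
Proof. by move=> t0; rewrite /flat t0 divr_gt0 ?expR_gt0 // exprn_gt0. Qed.

Lemma flat_le0 n t : t <= 0 -> flat n t = 0.
Proof. by rewrite /flat leNgt; case: (0 < t). Qed.

Lemma expR_ge_pow (k : nat) x : 0 <= x -> (x / k.+1%:R) ^+ k.+1 <= expR x.
Proof.
move=> x0; have k0 : k.+1%:R != 0 :> R by rewrite pnatr_eq0.
have -> : expR x = expR (x / k.+1%:R) ^+ k.+1 by rewrite -expRM_natl mulrC divfK.
have h : 0 <= x / k.+1%:R by rewrite divr_ge0.
rewrite lerXn2r // ?nnegrE ?expR_ge0 //; by apply: le_trans (expR_ge1Dx _); rewrite lerDr.
Qed.

(** A quadratic bound is what the derivative at 0 takes; it comes from [exp y >= (y / k)^k] with
    [k = n + 2] and [y = 1 / t]. *)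
Lemma flat_small n : exists M, forall t, `|flat n t| <= M * t ^+ 2.
Proof.
exists (n.+2%:R ^+ n.+2) => t; rewrite ger0_norm ?flat_ge0 //.
have [t0|t0] := ltP 0 t; last by rewrite flat_le0 // mulr_ge0 ?sqr_ge0 ?exprn_ge0.
have := @expR_ge_pow n.+1 t^-1; rewrite invr_ge0 ltW // => /(_ isT).
rewrite /flat t0 expRN !expr_div_n exprVn.
have np : 0 < n.+2%:R ^+ n.+2 :> R by rewrite exprn_gt0 // ltr0n.
rewrite ler_pdivrMr // => h.
rewrite ler_pdivrMr ?exprn_gt0 // -mulrA -exprD addnC addn2.
rewrite -[leLHS]mulr1 ler_pdivrMl ?expR_gt0 //.
have tp : 0 < t ^+ n.+2 by rewrite exprn_gt0.
by move: h; rewrite -[leLHS]mul1r ler_pdivrMr // mulrA.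
Qed.

Lemma der_expR F x l : der F x l -> der (fun y => expR (F y)) x (expR (F x) * l).
Proof. by move=> hf; exact: (derO hf (is_derive_expR _)). Qed.

Lemma der_flat n t : der (flat n) t (flat n.+2 t - n%:R * flat n.+1 t).
Proof.
have [t0|t0|->] := ltgtP t 0.
- rewrite !flat_le0 ?ltW // mulr0 subrr.
  have e0 : 0 < - t by rewrite oppr_gt0.
  apply: (@der_near_eq _ (fun=> 0) _ _ _ (- t) e0); last exact: derC.
  by move=> y; rewrite ltr_norml => /andP[_ h]; rewrite flat_le0 // ltW //; lra.
- apply: (@der_near_eq _ (fun t => expR (- t^-1) * (t ^+ n)^-1) _ _ _ t t0).
    move=> y; rewrite ltr_norml => /andP[h _]; rewrite /flat ifT //; lra.
  have tn : t != 0 by rewrite gt_eqF.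
  have h1 : der (fun t => expR (- t^-1)) t (expR (- t^-1) * (t ^+ 2)^-1).
    by apply: der_expR; dsolve => //=; field.
  have h2 : der (fun t => (t ^+ n)^-1) t (- (n%:R * t ^+ n.-1) / t ^+ n ^+ 2).
    by dsolve => /=; rewrite ?expf_neq0 // mulr1.
  apply: der_eq (derM h1 h2) _; rewrite /flat t0.
  move: (expR (- t^-1)) => E; case: n h2 => [|n] _ /=.
    by rewrite !expr0 expr2; field.
  rewrite !exprS; have : t ^+ n != 0 by rewrite expf_neq0.
  by move: (t ^+ n) (n.+1%:R) => p k p0; field; rewrite tn p0.
have [M hM] := flat_small n.
rewrite !flat_le0 ?lexx // mulr0 subrr.
have g0 : flat n 0 = 0 by rewrite flat_le0.
have cg : ct (fun s => flat n s / s) 0.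
  apply/cvgrPdist_lt => e e0; near=> s.
  rewrite invr0 mulr0 sub0r normrN.
  have se : `|s| < e / (`|M| + 1) by near: s; apply: (@nbhs0_lt _ R); rewrite divr_gt0 // ltr_wpDl.
  have [->|s0] := eqVneq s 0; first by rewrite invr0 mulr0 normr0.
  have sp : 0 < `|s| by rewrite normr_gt0.
  rewrite normrM normfV ltr_pdivrMr //; apply: le_lt_trans (hM s) _.
  rewrite -(@real_normK _ s) ?num_real // expr2 mulrA ltr_pM2r //.
  rewrite ltr_pdivlMr ?ltr_wpDl // in se; apply: le_lt_trans se; rewrite mulrC ler_wpM2l //.
  by apply: le_trans (ler_norm _) _; rewrite lerDl.
have := der_mul_id cg; rewrite invr0 mulr0; apply: (der_near_eq ltr01) => y _.
have [->|y0] := eqVneq y 0; first by rewrite mul0r g0.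
by rewrite mulrC divfK.
Unshelve. all: by end_near. Qed.

(* Instead of iterating derivatives, smoothness is recorded by a syntactic
   class which differentiation maps into itself. *)
Inductive smooth : (R -> R) -> Prop :=
| smooth_flat n : smooth (flat n)
| smooth_cst c : smooth (fun=> c)
| smooth_id : smooth (fun x => x)
| smooth_sin : smooth sin
| smooth_cos : smooth cos
| smoothD F G : smooth F -> smooth G -> smooth (fun x => F x + G x)
| smoothM F G : smooth F -> smooth G -> smooth (fun x => F x * G x)
| smooth_comp F G : smooth F -> smooth G -> smooth (fun x => F (G x))
| smoothV F : smooth F -> (forall x, F x != 0) -> smooth (fun x => (F x)^-1)
| smooth_sqrt F : smooth F -> (forall x, 0 < F x) -> smooth (fun x => Num.sqrt (F x)).

Lemma smoothN F : smooth F -> smooth (fun x => - F x).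
Proof.
move=> hF; rewrite (_ : (fun x => _) = fun x => -1 * F x); last by apply/funext => x; rewrite mulN1r.
exact: smoothM (smooth_cst _) hF.
Qed.

Lemma smooth_der F : smooth F -> exists2 F', smooth F' & forall x, der F x (F' x).
Proof.
elim=> [n|c||||F1 G1 _ [F' sF dF] _ [G' sG dG]|F1 G1 hF [F' sF dF] hG [G' sG dG]
  |F1 G1 hF [F' sF dF] hG [G' sG dG]|F1 hF [F' sF dF] F0|F1 hF [F' sF dF] F0].
- exists (fun t => flat n.+2 t + - n%:R * flat n.+1 t) => [|t].
    by apply: smoothD; [exact: smooth_flat|apply: smoothM; [exact: smooth_cst|exact: smooth_flat]].
  by apply: der_eq (der_flat n t) _; rewrite mulNr.
- by exists (fun=> 0) => [|x]; [exact: smooth_cst|exact: derC].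
- by exists (fun=> 1) => [|x]; [exact: smooth_cst|exact: derI].
- by exists cos => [|x]; [exact: smooth_cos|exact: is_derive_sin].
- exists (fun x => - sin x) => [|x]; [exact: smoothN smooth_sin|exact: is_derive_cos].
- by exists (fun x => F' x + G' x) => [|x]; [exact: smoothD|exact: derD].
- exists (fun x => F' x * G1 x + F1 x * G' x) => [|x]; last exact: derM.
  by apply: smoothD; exact: smoothM.
- exists (fun x => F' (G1 x) * G' x) => [|x]; last exact: derO.
  by apply: smoothM => //; exact: smooth_comp.
- exists (fun x => - F' x * ((F1 x)^-1 * (F1 x)^-1)) => [|x].
    by apply: smoothM; [exact: smoothN|apply: smoothM; exact: smoothV].
  by apply: der_eq (derV (F0 x) (dF x)) _; rewrite expr2 invfM.
exists (fun x => (2 * Num.sqrt (F1 x))^-1 * F' x) => [|x]; last exact: derO (dF x) (der_sqrt (F0 x)).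
apply: smoothM => //; apply: (@smoothV (fun x => 2 * Num.sqrt (F1 x))) => [|x].
  by apply: smoothM; [exact: smooth_cst|exact: smooth_sqrt].
by rewrite mulf_neq0 // gt_eqF // sqrtr_gt0.
Qed.

Lemma smooth_ct F x : smooth F -> ct F x.
Proof. by move=> /smooth_der[F' _ dF]; exact: der_cont (dF x). Qed.

Let s t := flat 0 t + flat 0 (1 - t).

Lemma step_den_gt0 t : 0 < flat 0 t + flat 0 (1 - t).
Proof.
have [t0|t0] := ltP 0 t; first by rewrite ltr_wpDr ?flat_gt0 ?flat_ge0.
by rewrite ltr_wpDl ?flat_ge0 // flat_gt0 //; lra.
Qed.

Definition step t : R := flat 0 t / (flat 0 t + flat 0 (1 - t)).
Definition step1 t : R := (flat 2 t * flat 0 (1 - t) + flat 0 t * flat 2 (1 - t)) /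
  (flat 0 t + flat 0 (1 - t)) ^+ 2.

Lemma der_step t : der step t (step1 t).
Proof.
have h1 := der_flat 0 t.
have h2 : der (fun t => flat 0 (1 - t)) t (- flat 2 (1 - t)).
  have h : der (fun t => 1 - t) t (- 1) by dsolve => /=; ring.
  by apply: der_eq (derO h (der_flat 0 (1 - t))) _; ring.
have h3 := lt0r_neq0 (step_den_gt0 t).
by rewrite /step /step1; dsolve => //=; field.
Qed.

Lemma smooth_flatC n : smooth (fun t => flat n (1 - t)).
Proof.
apply: (@smooth_comp (flat n) (fun t => 1 - t)); first exact: smooth_flat.
by apply: smoothD; [exact: smooth_cst|apply: smoothN; exact: smooth_id].
Qed.

Lemma smooth_step : smooth step.
Proof.
apply: smoothM; first exact: smooth_flat.
apply: (@smoothV (fun t => flat 0 t + flat 0 (1 - t))) => [|x]; last by rewrite gt_eqF ?step_den_gt0.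
by apply: smoothD; [exact: smooth_flat|exact: smooth_flatC].
Qed.

Lemma smooth_step1 : smooth step1.
Proof.
apply: smoothM.
  apply: smoothD; apply: smoothM; [exact: smooth_flat|exact: smooth_flatC|exact: smooth_flat|exact: smooth_flatC].
apply: (@smoothV (fun t => (flat 0 t + flat 0 (1 - t)) * (flat 0 t + flat 0 (1 - t)))) => [|x].
  by apply: smoothM; apply: smoothD; [exact: smooth_flat|exact: smooth_flatC|exact: smooth_flat|exact: smooth_flatC].
by rewrite mulf_neq0 // gt_eqF ?step_den_gt0.
Qed.

Lemma step_le0 t : t <= 0 -> step t = 0.
Proof. by move=> t0; rewrite /step flat_le0 // mul0r. Qed.

Lemma step_ge1 t : 1 <= t -> step t = 1.
Proof.
move=> t1; have h : 1 - t <= 0 by lra.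
by rewrite /step [flat 0 (1 - t)]flat_le0 // addr0 divff // gt_eqF // flat_gt0; lra.
Qed.

Lemma step01 t : 0 <= step t <= 1.
Proof.
rewrite /step divr_ge0 ?flat_ge0 ?(ltW (step_den_gt0 t)) //=.
by rewrite ler_pdivrMr ?step_den_gt0 // mul1r lerDl flat_ge0.
Qed.

Lemma step1_ge0 t : 0 <= step1 t.
Proof. by rewrite /step1 divr_ge0 ?sqr_ge0 // addr_ge0 // mulr_ge0 // flat_ge0. Qed.

Lemma step1_gt0 t : 0 < t < 1 -> 0 < step1 t.
Proof.
move=> /andP[t0 t1]; have h : 0 < 1 - t by lra.
by rewrite /step1 divr_gt0 ?exprn_gt0 ?step_den_gt0 // addr_gt0 // mulr_gt0 // flat_gt0.
Qed.

Lemma step1_out t : ~~ (0 < t < 1) -> step1 t = 0.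
Proof.
rewrite negb_and -!leNgt /step1 => /orP[t0|t1]; first by rewrite !(flat_le0 _ t0) !mul0r addr0 mul0r.
by have h : 1 - t <= 0 by [lra]; rewrite !(flat_le0 _ h) !mulr0 addr0 mul0r.
Qed.

(** The middle third is the place of a ramp inside another one three times as wide with the same
    centre; there the derivative of the wide ramp will dominate. *)
Lemma step1_lower : exists2 c, 0 < c & forall t, 1/3 <= t <= 2/3 -> c <= step1 t.
Proof.
have h : 1/3 <= 2/3 :> R by lra.
have [|c] := @EVT_min R step1 (1/3) (2/3) h.
  by apply: continuous_subspaceT => x; exact: smooth_ct smooth_step1.
rewrite in_itv /= => /andP[c1 c2] hc; exists (step1 c); first by apply: step1_gt0; lra.
by move=> t ht; apply: hc; rewrite in_itv.
Qed.

Lemma step1_upper : exists2 M, 0 < M & forall t, `|step1 t| <= M.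
Proof.
have [|c c01 hc] := @EVT_max R step1 0 1 ler01.
  by apply: continuous_subspaceT => x; exact: smooth_ct smooth_step1.
exists (step1 c + 1) => [|t]; first by rewrite ltr_wpDl // step1_ge0.
rewrite ger0_norm ?step1_ge0 //; have [h|h] := boolP (0 < t < 1); last first.
  by rewrite step1_out // addr_ge0 // step1_ge0.
by apply: le_trans (hc t _) _; rewrite ?lerDl // in_itv /=; have /andP[? ?] := h; rewrite !ltW.
Qed.

(** The second derivative comes from the closure of [smooth] under differentiation and has no
    formula here; it vanishes off [[0, 1]] because [step1] is locally zero there. *)
Lemma step2_ex : exists f, [/\ smooth f, forall t, der step1 t (f t),
  (forall t, ~~ (0 <= t <= 1) -> f t = 0) & exists2 M, 0 < M & forall t, `|f t| <= M].
Proof.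
have [f sf df] := smooth_der smooth_step1.
have f0 t : ~~ (0 <= t <= 1) -> f t = 0.
  rewrite negb_and -!ltNge => h; apply: der_unique (df t) _.
  have [e e0 he] : exists2 e, 0 < e & forall y, `|y - t| < e -> 0 = step1 y.
    have [t0|t1] := orP h; [exists (- t)|exists (t - 1)]; rewrite ?oppr_gt0 ?subr_gt0 //.
      move=> y; rewrite ltr_norml => /andP[y1 y2]; rewrite step1_out // negb_and -!leNgt.
      by apply/orP; left; lra.
    move=> y; rewrite ltr_norml => /andP[y1 y2]; rewrite step1_out // negb_and -!leNgt.
    by apply/orP; right; lra.
  exact: der_near_eq e0 he (derC 0 t).
exists f; split=> //.
have cf : {within `[0, 1], continuous (fun t => `|f t|)}.
  apply: continuous_subspaceT => x; apply: (@continuous_comp _ _ _ f (fun z => `|z|)).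
    exact: smooth_ct sf.
  exact: norm_continuous.
have [c c01 hc] := @EVT_max R (fun t => `|f t|) 0 1 ler01 cf.
exists (`|f c| + 1) => [|t]; first by rewrite ltr_wpDl.
have [h|h] := boolP (0 <= t <= 1); last by rewrite f0 // normr0 addr_ge0.
by apply: le_trans (hc t _) _; rewrite ?lerDl.
Qed.

End SmoothCutoff.

(** * Smooth radial functions in space *)

Section SmoothRadial.
Context {R : realType}.
Implicit Types (x y : 'rV[R]_3) (i j : 'I_3).

(** Closed under partial derivatives, since those of [F (nsq x)] are [2 x_i F' (nsq x)]. Writing
    radial functions in [|x|^2] avoids the singularity of the norm at the origin. *)
Inductive smooth3 : ('rV[R]_3 -> R) -> Prop :=
| smooth3_coord i : smooth3 (fun x => x ord0 i)
| smooth3_radial F : smooth F -> smooth3 (fun x => F (nsq x))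
| smooth3D f g : smooth3 f -> smooth3 g -> smooth3 (fun x => f x + g x)
| smooth3M f g : smooth3 f -> smooth3 g -> smooth3 (fun x => f x * g x).

Lemma smooth3_cst c : smooth3 (fun=> c).
Proof. exact: smooth3_radial (smooth_cst c). Qed.

Lemma is_derive_radial F (F' : R -> R) x i : der F (nsq x) (F' (nsq x)) ->
  is_derive x (basis_vec R i) (fun x => F (nsq x)) (2 * x ord0 i * F' (nsq x)).
Proof.
move=> dF; apply: is_derive_line.
apply: der_eq (derO (der_nsq_line x i) _) _; first by rewrite scale0r addr0; exact: dF.
by ring.
Qed.

Lemma is_derive_coord x i j : is_derive x (basis_vec R j) (fun x => x ord0 i) (i == j)%:R.
Proof. by apply: is_derive_line; exact: der_coord_line. Qed.

Lemma smooth3_partial f i : smooth3 f ->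
  exists2 f', smooth3 f' & forall x, is_derive x (basis_vec R i) f (f' x).
Proof.
elim=> [j|F sF|f1 g1 hf [f' sf df] hg [g' sg dg]|f1 g1 hf [f' sf df] hg [g' sg dg]].
- exists (fun=> (j == i)%:R) => [|x]; [exact: smooth3_cst|exact: is_derive_coord].
- have [F' sF' dF] := smooth_der sF.
  exists (fun x => 2 * x ord0 i * F' (nsq x)) => [|x]; last exact: is_derive_radial.
  apply: smooth3M; last exact: smooth3_radial.
  by apply: smooth3M; [exact: smooth3_cst|exact: smooth3_coord].
- by exists (fun x => f' x + g' x) => [|x]; [exact: smooth3D|exact: is_deriveD].
exists (fun x => f1 x * g' x + g1 x * f' x) => [|x]; last exact: is_deriveM.
by apply: smooth3D; exact: smooth3M.
Qed.

Lemma smooth3_continuous f : smooth3 f -> continuous f.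
Proof.
elim=> [j|F sF|f1 g1 _ hf _ hg|f1 g1 _ hf _ hg] x.
- exact: coord_continuous.
- apply: (@continuous_comp _ _ _ (@nsq R) F); first exact: nsq_continuous.
  exact: smooth_ct.
- exact: (ctD (hf x) (hg x)).
exact: (ctM (hf x) (hg x)).
Qed.

Lemma smooth3_iter f (s : seq 'I_3) : smooth3 f -> smooth3 (iter_partial s f).
Proof.
move=> sf; elim: s => [//|i s /(@smooth3_partial _ i)[f' sf' df]] /=.
suff -> : partial i (iter_partial s f) = f' by [].
by apply/funext => x; have [] := df x.
Qed.

Variables (F : R -> R) (a : R).

Lemma test_function_radial : smooth F -> a < 1 -> (forall q, a <= q -> F q = 0) ->
  test_function (fun x => F (nsq x)).
Proof.
move=> sF a1 F0; have s3 := smooth3_radial sF.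
split=> [s|s i x|x].
- by apply/smooth3_continuous/smooth3_iter.
- have [f' _ df] := smooth3_partial i (smooth3_iter s s3).
  by have [] := df x.
have cl : closed [set x : 'rV[R]_3 | nsq x <= a].
  have -> : [set x : 'rV[R]_3 | nsq x <= a] = (@nsq R) @^-1` [set t | t <= a] by [].
  by apply: preimage_closed; [move=> y _; exact: nsq_continuous|exact: closed_le].
rewrite closureE => /(_ [set x : 'rV[R]_3 | nsq x <= a]) h.
rewrite unit_ballE; apply: le_lt_trans a1; apply: h; split=> // y /=.
by apply: contraNT; rewrite -ltNge => /ltW/F0 ->.
Qed.

Lemma laplacian_radial F1 F2 x : (forall q, der F q (F1 q)) -> (forall q, der F1 q (F2 q)) ->
  laplacian (fun x => F (nsq x)) x = 4 * nsq x * F2 (nsq x) + 6 * F1 (nsq x).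
Proof.
move=> d1 d2.
have p1 i : partial i (fun x => F (nsq x)) = fun x => 2 * x ord0 i * F1 (nsq x).
  by apply/funext => y; have [] := is_derive_radial i (d1 (nsq y)).
have p2 i : partial i (partial i (fun x => F (nsq x))) x =
    4 * x ord0 i ^+ 2 * F2 (nsq x) + 2 * F1 (nsq x).
  rewrite p1; have h1 := is_derive_radial i (d2 (nsq x)).
  have h2 := is_deriveM (is_derive_cst (2 : R) x (basis_vec R i)) (is_derive_coord x i i).
  have [_ h3] := is_deriveM h2 h1.
  apply: etrans h3 _; rewrite eqxx /GRing.scale /=.
  rewrite (_ : _ x = 2 * x ord0 i) //; ring.
rewrite /laplacian sum3 !p2 /nsq sum3; ring.
Qed.

End SmoothRadial.

(** * A divergence theorem for radial fields *)

Section Flux.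
Context {R : realType}.
Local Notation lam := (@lebesgue_measure R).
Local Notation lam2 := (lam \x lam)%E.
Local Notation I1 := ([set` `[(-1 : R), 1]]).

Lemma integrable_support d (T : measurableType d) (mu : {measure set T -> \bar R})
    (A : set T) (f : T -> R) M : measurable A -> (mu A < +oo)%E ->
  measurable_fun setT f -> (forall x, `|f x| <= M) -> (forall x, ~ A x -> f x = 0) ->
  mu.-integrable setT (EFin \o f).
Proof.
move=> mA fA mf fM f0.
have e : EFin \o f = (EFin \o f) \_ A.
  apply/funext => x; rewrite patchE; case: ifPn => // /negP xA /=.
  by rewrite f0 // => Ax; apply: xA; exact: mem_set.
rewrite e; apply/(integrable_mkcond _ mA).
apply: measurable_bounded_integrable => //; first exact: measurable_funTS.
exists M; split; first exact: num_real.
by move=> N /ltW MN x _ /=; exact: le_trans MN.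
Qed.

Lemma lam_I1 : lam I1 = 2%:E.
Proof.
by rewrite lebesgue_measure_itv /= lte_fin ifT; [congr EFin; ring|lra].
Qed.

Lemma lam2_box : (lam2 (I1 `*` I1) < +oo)%E.
Proof.
rewrite product_measure1E // (_ : _ * _ = 2%:E * 2%:E)%E ?ltry //.
by congr (_ * _)%E; exact: lam_I1.
Qed.

Lemma lam3_box : (lebesgue3 R ((I1 `*` I1) `*` I1) < +oo)%E.
Proof.
rewrite product_measure1E //; last exact: measurableX.
have h1 : (lam I1 < +oo)%E by rewrite lam_I1 ltry.
apply: lte_mul_pinfty; [exact: measure_ge0| |exact: h1].
by rewrite ge0_fin_numE ?lam2_box.
Qed.

Lemma sq_le1 (t : R) : t ^+ 2 <= 1 -> I1 t.
Proof. by move=> h; rewrite /= in_itv /=; apply/andP; split; nra. Qed.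

Lemma ftc_support (F f : R -> R) : (forall x, der F x (f x)) -> continuous f ->
  (forall x, 1 <= x ^+ 2 -> f x = 0 /\ F x = 0) -> (\int[lam]_x (f x)%:E = 0)%E.
Proof.
move=> dF cf f0; have lt12 : -1 < 1 :> R by lra.
have -> : (\int[lam]_x (f x)%:E = \int[lam]_(x in I1) (f x)%:E)%E.
  rewrite [RHS]integral_mkcond; apply: eq_integral => x _.
  rewrite patchE; case: ifPn => // /negP xA.
  have [|-> //] := f0 x; rewrite leNgt; apply/negP => h; apply: xA.
  by apply/mem_set/sq_le1/ltW.
rewrite (@continuous_FTC2 _ f F _ _ lt12).
- have [|_ ->] := f0 1; first by rewrite expr1n.
  by have [|_ ->] := f0 (-1); [rewrite sqrrN expr1n|rewrite subee].
- exact: continuous_subspaceT.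
- have cF x : F @ x --> F x := der_cont (dF x).
  split=> [x _||]; first by have [] := dF x.
  + by apply: cvg_at_right_filter; exact: cF.
  + by apply: cvg_at_left_filter; exact: cF.
by move=> x _; rewrite derive1E; have [] := dF x.
Qed.

Lemma lam2_sigma_finite : sigma_finite setT (lam2 : set (_ * _) -> \bar R).
Proof.
pose I (n : nat) : set R := [set` `[(- n%:R : R)%R, (n%:R : R)%R]].
exists (fun n => I n `*` I n); last first.
  move=> n; split; first by apply: measurableX; exact: measurable_itv.
  rewrite product_measure1E; [|exact: measurable_itv..].
  have h : (lam (I n) < +oo)%E by rewrite lebesgue_measure_itv /=; case: ifP; rewrite ?ltry.
  by apply: lte_mul_pinfty; [exact: measure_ge0|rewrite ge0_fin_numE|exact: h].
rewrite eqEsubset; split=> // -[x y] _; pose m := `|x| + `|y|.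
have [n hn] : exists n, m <= n%:R.
  by exists (Num.bound m); apply/ltW/archi_boundP; rewrite addr_ge0.
exists n => //; rewrite /m in hn; have := normr_ge0 x; have := normr_ge0 y.
by move=> x0 y0; split; rewrite /I /= in_itv /= -ler_norml; lra.
Qed.

(* The library declares only the product of two probabilities canonically
   sigma-finite; Fubini for [lebesgue3] needs this instance. *)
Definition plane_measure := lam2.
HB.instance Definition _ := Measure.copy plane_measure lam2.
HB.instance Definition _ := Measure_isSigmaFinite.Build _ _ _ plane_measure lam2_sigma_finite.

Variables (P P' : R -> R) (a : R).
Hypotheses (a1 : a < 1) (dP : forall q, der P q (P' q)) (cP' : continuous P').
Hypothesis P0 : forall q, a <= q -> P q = 0.

Lemma flux_deriv_out q : 1 <= q -> P' q = 0.
Proof.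
move=> q1; apply: der_unique (dP q) _.
have e0 : 0 < q - a by rewrite subr_gt0 (lt_le_trans a1).
apply: (@der_near_eq _ (fun=> 0) _ _ _ (q - a) e0); last exact: derC.
by move=> y; rewrite ltr_norml => /andP[h _]; rewrite P0 //; lra.
Qed.

Let cP : continuous P. Proof. by move=> q; exact: der_cont (dP q). Qed.

(** The derivative in [t] of [t P (c + t^2)]: one of the three terms in the divergence of
    [x P (|x|^2)], along a coordinate line at distance [sqrt c] from the origin. *)
Let h (c t : R) := P (c + t ^+ 2) + 2 * t ^+ 2 * P' (c + t ^+ 2).

Lemma line_flux_out c t : 1 <= c + t ^+ 2 -> h c t = 0.
Proof. by move=> ct1; rewrite /h P0 ?flux_deriv_out // ?mulr0 ?addr0 // (le_trans (ltW a1)). Qed.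

Lemma line_flux_int c : 0 <= c -> (\int[lam]_t (h c t)%:E = 0)%E.
Proof.
move=> c0; apply: (@ftc_support (fun t => t * P (c + t ^+ 2))) => [t|t|t t1].
- have d2 : der (fun t => c + t ^+ 2) t (2 * t) by dsolve => /=; ring.
  have d3 := derO d2 (dP _).
  by apply: der_eq (derM (derI t) d3) _; rewrite /h; ring.
- have c2 : ct (fun t : R => P (c + t ^+ 2)) t.
    by apply: (ctO (h := P)); [ctauto|exact: cP].
  have c3 : ct (fun t : R => P' (c + t ^+ 2)) t.
    by apply: (ctO (h := P')); [ctauto|exact: cP'].
  suff : ct (fun t : R => P (c + t ^+ 2) + 2 * t ^+ 2 * P' (c + t ^+ 2)) t by [].
  ctauto.
have ct1 : 1 <= c + t ^+ 2 by lra.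
by rewrite line_flux_out // P0 ?mulr0 // (le_trans (ltW a1)).
Qed.

Lemma line_flux_bound : exists M, forall c t, 0 <= c -> `|h c t| <= M.
Proof.
have bd (F : R -> R) : continuous F -> exists M, forall q, 0 <= q <= 1 -> `|F q| <= M.
  move=> cF; have [|c c01 hc] := @EVT_max R (fun q => `|F q|) 0 1 ler01.
    apply: continuous_subspaceT => x; apply: (@continuous_comp _ _ _ F (fun z => `|z|)).
      exact: cF.
    exact: norm_continuous.
  by exists `|F c| => q q01; apply: hc; rewrite in_itv.
have [M hM] := bd _ cP; have [M' hM'] := bd _ cP'.
exists (M + 2 * M') => c t c0.
have M0 : 0 <= M by apply: le_trans (hM 0 _); rewrite ?lexx ?ler01.
have M0' : 0 <= M' by apply: le_trans (hM' 0 _); rewrite ?lexx ?ler01.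
have [q1|q1] := leP 1 (c + t ^+ 2); first by rewrite line_flux_out // normr0; lra.
have t2 := sqr_ge0 t.
have q01 : 0 <= c + t ^+ 2 <= 1 by lra.
rewrite /h (le_trans (ler_normD _ _)) // lerD ?hM //.
rewrite normrM ger0_norm; last by lra.
by apply: ler_pM; rewrite ?hM' //; lra.
Qed.

Lemma measurable_line_flux d (T : measurableType d) (c t : T -> R) : measurable_fun setT c ->
  measurable_fun setT t -> measurable_fun setT (fun p => h (c p) (t p)).
Proof.
move=> mc mt.
have mq : measurable_fun setT (fun p => c p + t p ^+ 2).
  by apply: measurable_funD => //; exact: measurable_funX.
apply: measurable_funD.
  exact: (measurableT_comp (continuous_measurable_fun cP) mq).
apply: measurable_funM; last exact: (measurableT_comp (continuous_measurable_fun cP') mq).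
by apply: measurable_funM; [exact: measurable_cst|exact: measurable_funX].
Qed.

Lemma plane_flux_x c : 0 <= c -> lam2.-integrable setT (fun p => (h (c + p.2 ^+ 2) p.1)%:E) /\
  (\int[lam2]_p (h (c + p.2 ^+ 2) p.1)%:E = 0)%E.
Proof.
move=> c0; have [M hM] := line_flux_bound.
have i : lam2.-integrable setT (EFin \o (fun p : R * R => h (c + p.2 ^+ 2) p.1)).
  apply: (@integrable_support _ _ lam2 (I1 `*` I1) (fun p : R * R => h (c + p.2 ^+ 2) p.1) M).
  - exact: measurableX.
  - exact: lam2_box.
  - apply: measurable_line_flux; last exact: measurable_fst.
    by apply: measurable_funD; [exact: measurable_cst|apply: measurable_funX; exact: measurable_snd].
  - by move=> p; apply: hM; rewrite addr_ge0 ?sqr_ge0.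
  move=> [x y] hp /=; apply: line_flux_out; rewrite leNgt; apply/negP => lt1; apply: hp.
  have x2 := sqr_ge0 x; have y2 := sqr_ge0 y.
  by split; apply: sq_le1 => /=; lra.
split; first exact: i.
rewrite -(integral21_prod_meas1 i) /fubini_G.
by rewrite integral0_eq // => y _; exact: (line_flux_int (addr_ge0 c0 (sqr_ge0 y))).
Qed.

Lemma plane_flux_y c : 0 <= c -> lam2.-integrable setT (fun p => (h (c + p.1 ^+ 2) p.2)%:E) /\
  (\int[lam2]_p (h (c + p.1 ^+ 2) p.2)%:E = 0)%E.
Proof.
move=> c0; have [M hM] := line_flux_bound.
have i : lam2.-integrable setT (EFin \o (fun p : R * R => h (c + p.1 ^+ 2) p.2)).
  apply: (@integrable_support _ _ lam2 (I1 `*` I1) (fun p : R * R => h (c + p.1 ^+ 2) p.2) M).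
  - exact: measurableX.
  - exact: lam2_box.
  - apply: measurable_line_flux; last exact: measurable_snd.
    by apply: measurable_funD; [exact: measurable_cst|apply: measurable_funX; exact: measurable_fst].
  - by move=> p; apply: hM; rewrite addr_ge0 ?sqr_ge0.
  move=> [x y] hp /=; apply: line_flux_out; rewrite leNgt; apply/negP => lt1; apply: hp.
  have x2 := sqr_ge0 x; have y2 := sqr_ge0 y.
  by split; apply: sq_le1 => /=; lra.
split; first exact: i.
rewrite -(integral12_prod_meas1 i) /fubini_F.
by rewrite integral0_eq // => y _; exact: (line_flux_int (addr_ge0 c0 (sqr_ge0 y))).
Qed.

Definition qsum (p : R * R * R) : R := p.1.1 ^+ 2 + p.1.2 ^+ 2 + p.2 ^+ 2.

Lemma nsq_vec3 p : nsq (vec3 p) = qsum p.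
Proof. by rewrite /nsq sum3 !mxE. Qed.

Let m1 : measurable_fun setT (fun p : R * R * R => p.1.1).
Proof. exact: (measurableT_comp measurable_fst measurable_fst). Qed.
Let m2 : measurable_fun setT (fun p : R * R * R => p.1.2).
Proof. exact: (measurableT_comp measurable_snd measurable_fst). Qed.
Let m3 : measurable_fun setT (fun p : R * R * R => p.2).
Proof. exact: measurable_snd. Qed.

Lemma measurable_qsum : measurable_fun setT qsum.
Proof.
by apply: measurable_funD; [apply: measurable_funD|]; exact: measurable_funX.
Qed.

Lemma integrable_line_flux (c t : R * R * R -> R) : measurable_fun setT c -> measurable_fun setT t ->
  (forall p, 0 <= c p) -> (forall p, c p + t p ^+ 2 = qsum p) ->
  (lebesgue3 R).-integrable setT (EFin \o (fun p => h (c p) (t p))).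
Proof.
move=> mc mt c0 ec; have [M hM] := line_flux_bound.
apply: (@integrable_support _ _ (lebesgue3 R) ((I1 `*` I1) `*` I1) (fun p => h (c p) (t p)) M).
- by apply: measurableX => //; exact: measurableX.
- exact: lam3_box.
- exact: measurable_line_flux.
- by move=> p; exact: hM.
move=> p hp; apply: line_flux_out; rewrite leNgt ec; apply/negP; rewrite /qsum => lt1; apply: hp.
have x2 := sqr_ge0 p.1.1; have y2 := sqr_ge0 p.1.2; have z2 := sqr_ge0 p.2.
by do 2?split; apply: sq_le1 => /=; lra.
Qed.

(** The integrand is the divergence of [x P (|x|^2)]. By Fubini each of its three terms gives 0
    through integration along its own coordinate. *)
Lemma flux_full : (\int[lebesgue3 R]_p (3 * P (qsum p) + 2 * qsum p * P' (qsum p))%:E = 0)%E.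
Proof.
pose f1 (p : R * R * R) := h (p.2 ^+ 2 + p.1.2 ^+ 2) p.1.1.
pose f2 (p : R * R * R) := h (p.2 ^+ 2 + p.1.1 ^+ 2) p.1.2.
pose f3 (p : R * R * R) := h (p.1.1 ^+ 2 + p.1.2 ^+ 2) p.2.
have i1 : (lebesgue3 R).-integrable setT (EFin \o f1).
  apply: integrable_line_flux => //; first by apply: measurable_funD; exact: measurable_funX.
    by move=> p; rewrite addr_ge0 ?sqr_ge0.
  by move=> p; rewrite /qsum; ring.
have i2 : (lebesgue3 R).-integrable setT (EFin \o f2).
  apply: integrable_line_flux => //; first by apply: measurable_funD; exact: measurable_funX.
    by move=> p; rewrite addr_ge0 ?sqr_ge0.
  by move=> p; rewrite /qsum; ring.
have i3 : (lebesgue3 R).-integrable setT (EFin \o f3).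
  apply: integrable_line_flux => //; first by apply: measurable_funD; exact: measurable_funX.
    by move=> p; rewrite addr_ge0 ?sqr_ge0.
have z1 : (\int[lebesgue3 R]_p (EFin \o f1) p = 0)%E.
  apply: etrans (esym (@integral21_prod_meas1 _ _ _ _ _ plane_measure lam _ i1)) _; apply: integral0_eq => z _.
  by have [_ e] := plane_flux_x (sqr_ge0 z); exact: e.
have z2 : (\int[lebesgue3 R]_p (EFin \o f2) p = 0)%E.
  apply: etrans (esym (@integral21_prod_meas1 _ _ _ _ _ plane_measure lam _ i2)) _; apply: integral0_eq => z _.
  by have [_ e] := plane_flux_y (sqr_ge0 z); exact: e.
have z3 : (\int[lebesgue3 R]_p (EFin \o f3) p = 0)%E.
  apply: etrans (esym (@integral12_prod_meas1 _ _ _ _ _ plane_measure lam _ i3)) _; apply: integral0_eq => z _.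
  exact: (line_flux_int (addr_ge0 (sqr_ge0 z.1) (sqr_ge0 z.2))).
have e p : (3 * P (qsum p) + 2 * qsum p * P' (qsum p))%:E = ((f1 p)%:E + (f2 p)%:E + (f3 p)%:E)%E.
  rewrite -!EFinD; congr EFin; rewrite /f1 /f2 /f3 /h.
  have -> : p.2 ^+ 2 + p.1.2 ^+ 2 + p.1.1 ^+ 2 = qsum p by rewrite /qsum; ring.
  have -> : p.2 ^+ 2 + p.1.1 ^+ 2 + p.1.2 ^+ 2 = qsum p by rewrite /qsum; ring.
  rewrite -[p.1.1 ^+ 2 + p.1.2 ^+ 2 + p.2 ^+ 2]/(qsum p).
  by move: (P (qsum p)) (P' (qsum p)) => u w; rewrite /qsum; ring.
under eq_integral do rewrite e.
rewrite integralD //; last exact: integrableD.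
by rewrite integralD // z1 z2 z3 !adde0.
Qed.

End Flux.

(** * Integrals of radial functions over the ball *)

Section RadialIntegral.
Context {R : realType}.
Implicit Types (k : R -> R) (q : R).
Local Notation lam := (@lebesgue_measure R).
Local Notation D := (@vec3 R @^-1` unit_ball R).

Lemma ball3E p : D p = (qsum p < 1) :> Prop.
Proof. by rewrite /= -[LHS]/(unit_ball R (vec3 p)) unit_ballE nsq_vec3. Qed.

Lemma qsum_ge0 (p : R * R * R) : 0 <= qsum p.
Proof. by rewrite /qsum !addr_ge0 ?sqr_ge0. Qed.

Lemma measurable_ball3 : measurable (D : set (R * R * R)).
Proof.
have -> : (D : set (R * R * R)) = setT `&` (@qsum R @^-1` [set` `]-oo, (1 : R)[]).
  by rewrite setTI; apply/funext => p; rewrite ball3E /= in_itv.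
by apply: measurable_qsum => //; exact: measurable_itv.
Qed.

Lemma ball3_box p : D p -> (([set` `[(-1 : R), 1]] `*` [set` `[(-1 : R), 1]]) `*` [set` `[(-1 : R), 1]]) p.
Proof.
rewrite ball3E /qsum => lt1.
have x2 := sqr_ge0 p.1.1; have y2 := sqr_ge0 p.1.2; have z2 := sqr_ge0 p.2.
by do 2?split; apply: sq_le1 => /=; lra.
Qed.

Lemma ball3_finite : (lebesgue3 R D < +oo)%E.
Proof.
apply: le_lt_trans (@lam3_box R); apply: le_measure; rewrite ?inE.
- exact: measurable_ball3.
- by apply: measurableX => //; exact: measurableX.
- by move=> p; exact: ball3_box.
Qed.

Lemma continuous_bound01 k : continuous k -> exists M, forall q, 0 <= q <= 1 -> `|k q| <= M.
Proof.
move=> cF; have [|c c01 hc] := @EVT_max R (fun q => `|k q|) 0 1 ler01.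
  apply: continuous_subspaceT => x; apply: (@continuous_comp _ _ _ k (fun z => `|z|)).
    exact: cF.
  exact: norm_continuous.
by exists `|k c| => q q01; apply: hc; rewrite in_itv.
Qed.

Lemma measurable_radial k : continuous k -> measurable_fun D (k \o @qsum R).
Proof.
move=> ck; apply: measurable_funTS.
exact: (measurableT_comp (continuous_measurable_fun ck) measurable_qsum).
Qed.

Lemma bounded_radial k : continuous k -> [bounded (k \o @qsum R) p | p in (D : set (R * R * R))].
Proof.
move=> /continuous_bound01[M hM]; exists M; split; first exact: num_real.
move=> N /ltW MN p Dp /=; apply: le_trans MN; apply: hM.
by rewrite qsum_ge0 ltW //; move: Dp; rewrite ball3E.
Qed.

Lemma integrable_radial k : continuous k -> (lebesgue3 R).-integrable D (EFin \o (k \o @qsum R)).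
Proof.
move=> ck; apply: measurable_bounded_integrable.
- exact: measurable_ball3.
- exact: ball3_finite.
- exact: measurable_radial.
- exact: bounded_radial.
Qed.

Definition radint k : R := \int[lebesgue3 R]_(p in D) k (qsum p).

Lemma radintD k1 k2 : continuous k1 -> continuous k2 ->
  radint (fun q => k1 q + k2 q) = radint k1 + radint k2.
Proof.
move=> c1 c2; rewrite /radint.
exact: (@RintegralD _ _ _ (lebesgue3 R) D (k1 \o @qsum R) (k2 \o @qsum R) measurable_ball3 (integrable_radial c1) (integrable_radial c2)).
Qed.

Lemma radintZ c k : continuous k -> radint (fun q => c * k q) = c * radint k.
Proof. by move=> ck; rewrite /radint; exact: (@RintegralZl _ _ _ (lebesgue3 R) D (k \o @qsum R) c measurable_ball3 (integrable_radial ck)). Qed.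

Lemma radint_flux (P P' : R -> R) a : a < 1 -> (forall q, der P q (P' q)) ->
  continuous P' -> (forall q, a <= q -> P q = 0) ->
  radint (fun q => 3 * P q + 2 * q * P' q) = 0.
Proof.
move=> a1 dP cP' P0; rewrite /radint Rintegral_mkcond /Rintegral.
rewrite -[RHS]/(fine 0%E) -(flux_full a1 dP cP' P0); congr fine.
apply: eq_integral => p _; rewrite patchE; case: ifPn => // /negP pD.
have q1 : 1 <= qsum p.
  by rewrite leNgt; apply/negP => lt1; apply: pD; apply: mem_set; rewrite ball3E.
by rewrite P0 ?(flux_deriv_out a1 dP P0 q1) ?mulr0 ?addr0 // (le_trans (ltW a1)).
Qed.

(** A small box with corner [(sqrt q0, 0, 0)] lies in the ball and carries [k >= k q0 / 2]. *)
Lemma radint_gt0 k q0 : continuous k -> (forall q, 0 <= k q) -> 0 < q0 < 1 -> 0 < k q0 ->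
  0 < radint k.
Proof.
move=> ck k0 /andP[q00 q01] kq.
have [d /= d0 hd] := ct_dist (ck q0) (divr_gt0 kq (ltr0n R 2)).
have kap q : `|q - q0| < d -> k q0 / 2 <= k q.
  by move=> h; have := hd q; rewrite /= distrC h => /(_ isT); rewrite ltr_norml; lra.
(* On a box of side [e] with corner at distance [r < 1] the squared norm grows by at most
   [2 r e + 3 e^2 < 6 e]. *)
pose e := Num.min 1 (Num.min d (1 - q0)) / 6.
have m0 : 0 < Num.min 1 (Num.min d (1 - q0)) by rewrite !lt_min ltr01 d0 subr_gt0.
have e0 : 0 < e by rewrite divr_gt0.
have e1 : 6 * e <= 1 by rewrite mulrC divfK // ge_min lexx.
have ed : 6 * e <= d by rewrite mulrC divfK // !ge_min lexx orbT.
have eq : 6 * e <= 1 - q0 by rewrite mulrC divfK // !ge_min lexx !orbT.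
clearbody e; pose r := Num.sqrt q0.
have r2 : r ^+ 2 = q0 by rewrite sqr_sqrtr // ltW.
have r0 : 0 < r by rewrite sqrtr_gt0.
have r1 : r < 1 by rewrite -(ltr_pXn2r (_ : 0 < 2)%N) ?nnegrE ?ltW // r2 expr1n.
pose B := (([set` `[r, r + e]] `*` [set` `[0, e]]) `*` [set` `[0, e]]) : set (R * R * R).
have mB : measurable B by apply: measurableX => //; exact: measurableX.
have BD p : B p -> q0 <= qsum p < q0 + 6 * e.
  rewrite /B /= => -[[/= ]]; rewrite !in_itv /= => /andP[x1 x2] /andP[y1 y2] /andP[z1 z2].
  have ee : e ^+ 2 <= e by rewrite expr2 ler_piMl ?ltW //; lra.
  have X1 : r ^+ 2 <= p.1.1 ^+ 2 by rewrite lerXn2r // nnegrE; lra.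
  have X2 : p.1.1 ^+ 2 <= (r + e) ^+ 2 by rewrite lerXn2r // nnegrE; lra.
  have Y2 : p.1.2 ^+ 2 <= e ^+ 2 by rewrite lerXn2r // nnegrE; lra.
  have Z2 : p.2 ^+ 2 <= e ^+ 2 by rewrite lerXn2r // nnegrE; lra.
  have Y1 := sqr_ge0 p.1.2; have Z1 := sqr_ge0 p.2.
  have re : r * e < e by rewrite gtr_pMl.
  by rewrite /qsum; apply/andP; split; nra.
have vol : (lebesgue3 R B = (e * e * e)%:E)%E.
  have lv (x : R) : lam [set` `[x, x + e]] = e%:E.
    by rewrite lebesgue_measure_itv /= lte_fin ifT; [congr EFin; ring|lra].
  rewrite product_measure1E //; last exact: measurableX.
  rewrite !EFinM; congr (_ * _)%E; last by have := lv 0; rewrite add0r; exact.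
  apply: etrans (product_measure1E _ _ _ _) _ => //; congr (_ * _)%E; first exact: lv.
  by have := lv 0; rewrite add0r; exact.
suff h : ((k q0 / 2 * (e * e * e))%:E <= \int[lebesgue3 R]_(p in D) (k (qsum p))%:E)%E.
  have ff := @integrable_fin_num _ _ _ (lebesgue3 R) D measurable_ball3 (EFin \o (k \o @qsum R)) (integrable_radial ck).
  rewrite -(fineK ff) lee_fin in h; apply: lt_le_trans h.
  by rewrite !mulr_gt0 ?divr_gt0.
have mk : measurable_fun D (fun p => (k (qsum p))%:E).
  by apply/measurable_EFinP; exact: measurable_radial.
have BsD : B `<=` D by move=> p /BD/andP[_ h]; rewrite ball3E; lra.
apply: (@le_trans _ _ (\int[lebesgue3 R]_(p in B) (k (qsum p))%:E)%E); last first.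
  apply: ge0_subset_integral => //; first exact: measurable_ball3.
  by move=> p _; rewrite lee_fin.
rewrite EFinM -vol -integral_cst //; apply: ge0_le_integral => //.
- by move=> p _; rewrite lee_fin divr_ge0 // ltW.
- by apply: measurable_funS mk => //; exact: measurable_ball3.
by move=> p /BD/andP[h1 h2]; rewrite lee_fin kap // ger0_norm; lra.
Qed.

End RadialIntegral.

(** * Cut-offs and Green's identity in the variable [q] *)

Section Cutoff.
Context {R : realType}.
Implicit Types (q : R).

(** Formulas in [sqrt q] make sense for [q > 0]; a factor vanishing for [q <= a] carries them over
    to the whole line. *)
Lemma der_localized (F F' : R -> R) a : 0 < a -> (forall q, q <= a -> F q = 0 /\ F' q = 0) ->
  (forall q, 0 < q -> der F q (F' q)) -> forall q, der F q (F' q).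
Proof.
move=> a0 F0 dF q; have [|q0] := ltP 0 q; first exact: dF.
have qa : q <= a by apply: le_trans q0 (ltW a0).
rewrite (F0 q qa).2; apply: (@der_near_eq _ (fun=> 0) _ _ _ a a0); last exact: derC.
by move=> y; rewrite ltr_norml => /andP[_ h]; rewrite (F0 y _).1 //; lra.
Qed.

Lemma ct_localized (F : R -> R) a : 0 < a -> (forall q, q <= a -> F q = 0) ->
  (forall q, 0 < q -> ct F q) -> continuous F.
Proof.
move=> a0 F0 cF q; have [|q0] := ltP 0 q; first exact: cF.
suff d : der F q 0 by exact: der_cont d.
apply: (@der_near_eq _ (fun=> 0) _ _ _ a a0); last exact: derC.
by move=> y; rewrite ltr_norml => /andP[_ h]; rewrite F0 //; lra.
Qed.

Definition ramp (a h q : R) : R := step ((q - a) / h).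
Definition ramp1 (a h q : R) : R := step1 ((q - a) / h) / h.

Lemma der_affine a h q : h != 0 -> der (fun q => (q - a) / h) q h^-1.
Proof. by move=> h0; dsolve => /=; ring. Qed.

Lemma der_ramp a h q : h != 0 -> der (ramp a h) q (ramp1 a h q).
Proof. by move=> h0; apply: der_eq (derO (der_affine a q h0) (der_step _)) _. Qed.

Lemma smooth_affine a h : smooth (fun q : R => (q - a) / h).
Proof.
apply: smoothM; last exact: smooth_cst.
by apply: smoothD; [exact: smooth_id|exact: smooth_cst].
Qed.

Lemma smooth_ramp a h : smooth (ramp a h).
Proof. exact: smooth_comp smooth_step (smooth_affine a h). Qed.

Lemma smooth_ramp1 a h : smooth (ramp1 a h).
Proof.
apply: smoothM; last exact: smooth_cst.
exact: smooth_comp smooth_step1 (smooth_affine a h).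
Qed.

Lemma ramp_le a h q : 0 < h -> q <= a -> ramp a h q = 0.
Proof. by move=> h0 qa; rewrite /ramp step_le0 // ler_pdivrMr // mul0r subr_le0. Qed.

Lemma ramp_ge a h q : 0 < h -> a + h <= q -> ramp a h q = 1.
Proof. by move=> h0 qa; rewrite /ramp step_ge1 // ler_pdivlMr // mul1r; lra. Qed.

Lemma ramp1_out a h q : 0 < h -> ~~ (a < q < a + h) -> ramp1 a h q = 0.
Proof.
move=> h0 hq; rewrite /ramp1 step1_out ?mul0r //; apply: contra hq => /andP[h1 h2].
rewrite ltr_pdivlMr // mul0r in h1; rewrite ltr_pdivrMr // mul1r in h2.
by apply/andP; split; lra.
Qed.

Lemma ramp1_ge0 a h q : 0 < h -> 0 <= ramp1 a h q.
Proof. by move=> h0; rewrite /ramp1 divr_ge0 ?step1_ge0 // ltW. Qed.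

Lemma sqrt_gt0 q : 0 < q -> 0 < Num.sqrt q. Proof. by rewrite sqrtr_gt0. Qed.

Lemma ct_sqrtV (F : R -> R) q : 0 < q -> ct F q -> ct (fun q => F q / Num.sqrt q) q.
Proof.
move=> q0 cF; have cs : ct (fun q => Num.sqrt q) q by exact: sqrt_continuous.
by ctauto; rewrite gt_eqF // sqrtr_gt0.
Qed.

Lemma cont_ramp1_sqrt a h : 0 < a -> 0 < h -> continuous (fun q => ramp1 a h q / Num.sqrt q).
Proof.
move=> a0 h0; apply: (@ct_localized _ a a0) => [q qa|q q0].
  by rewrite ramp1_out ?mul0r // negb_and -!leNgt qa.
by apply: ct_sqrtV => //; exact: smooth_ct (smooth_ramp1 a h).
Qed.

(* The difference of the two integrands is the divergence of a radial field
   supported away from the origin and from the sphere. *)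
Lemma flux_ramp a h a' h' : 0 < a -> 0 < h -> a + h < 1 -> 0 < a' -> 0 < h' -> a' + h' < 1 ->
  radint (fun q => ramp1 a h q / Num.sqrt q) = radint (fun q => ramp1 a' h' q / Num.sqrt q).
Proof.
move=> a0 h0 ah a0' h0' ah'.
pose W q := ramp a h q - ramp a' h' q; pose W1 q := ramp1 a h q - ramp1 a' h' q.
have dW q : der W q (W1 q).
  have d1 := der_ramp a q (lt0r_neq0 h0); have d2 := der_ramp a' q (lt0r_neq0 h0').
  by rewrite /W /W1; dsolve.
pose P q := W q / (q * Num.sqrt q).
pose P' q := W1 q / (q * Num.sqrt q) - 3 / 2 * W q / (q ^+ 2 * Num.sqrt q).
pose m := Num.min a a'; pose M := Num.max (a + h) (a' + h').
have m0 : 0 < m by rewrite lt_min a0.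
have M1 : M < 1 by rewrite gt_max ah.
have low q : q <= m -> W q = 0 /\ W1 q = 0.
  rewrite le_min => /andP[q1 q2]; rewrite /W /W1 !ramp_le // !ramp1_out ?subrr //.
    by rewrite negb_and -!leNgt q2.
  by rewrite negb_and -!leNgt q1.
have dP : forall q, der P q (P' q).
  apply: (@der_localized _ _ m m0) => [q qm|q q0].
    by have [w0 w1] := low q qm; rewrite /P /P' w0 w1 !mul0r mulr0 mul0r subrr.
  have ds := der_sqrt q0; have dw := dW q; have s0 := sqrt_gt0 q0.
  have s2 : Num.sqrt q ^+ 2 = q by rewrite sqr_sqrtr // ltW.
  rewrite /P /P'; dsolve => /=; first by rewrite mulf_neq0 // gt_eqF.
  by move: (Num.sqrt q) s0 s2 => s s0 <-; field; rewrite gt_eqF.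
have cP' : continuous P'.
  apply: (@ct_localized _ m m0) => [q qm|q q0].
    by have [w0 w1] := low q qm; rewrite /P' w0 w1 mul0r mulr0 mul0r subrr.
  have cs : ct (fun q => Num.sqrt q) q by exact: sqrt_continuous.
  have cW : ct W q by exact: der_cont (dW q).
  have c1 : ct (ramp1 a h) q by exact: smooth_ct (smooth_ramp1 a h).
  have c2 : ct (ramp1 a' h') q by exact: smooth_ct (smooth_ramp1 a' h').
  have cW1 : ct W1 q by rewrite /W1; ctauto.
  have s0 := lt0r_neq0 (sqrt_gt0 q0); have q0' := lt0r_neq0 q0.
  by rewrite /P'; ctauto; rewrite !mulf_neq0 ?expf_neq0.
have P0 q : M <= q -> P q = 0.
  by rewrite ge_max => /andP[q1 q2]; rewrite /P /W !ramp_ge // subrr mul0r.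
have := radint_flux M1 dP cP' P0.
have -> : (fun q => 3 * P q + 2 * q * P' q) =
    fun q => 2 * (ramp1 a h q / Num.sqrt q) + (-2) * (ramp1 a' h' q / Num.sqrt q).
  apply/funext => q; have [q0|q0] := ltP 0 q; last first.
    have [|w0 w1] := low q; first by apply: le_trans q0 (ltW m0).
    have -> : ramp1 a h q = ramp1 a' h' q by apply/eqP; rewrite -subr_eq0; apply/eqP.
    by rewrite /P /P' w0 w1; ring.
  rewrite /P /P' /W1; have s0 := sqrt_gt0 q0.
  by move: (Num.sqrt q) s0 => s s0; field; rewrite !gt_eqF.
have k1 := cont_ramp1_sqrt a0 h0; have k2 := cont_ramp1_sqrt a0' h0'.
have c (k : R -> R) e : continuous k -> continuous (fun q => e * k q).
  by move=> ck q; have ckq : ct k q := ck q; suff : ct (fun q => e * k q) q by []; ctauto.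
rewrite radintD; [|exact: c|exact: c].
by rewrite !radintZ //; lra.
Qed.

(** By [flux_ramp] this number is the same for all ramps. It stands for [2 pi] and cancels in the
    end, so its positivity is the property to establish. *)
Definition flux_const : R := radint (fun q => ramp1 (1/3) (1/3) q / Num.sqrt q).

Lemma flux_rampE a h : 0 < a -> 0 < h -> a + h < 1 ->
  radint (fun q => ramp1 a h q / Num.sqrt q) = flux_const.
Proof. by move=> a0 h0 ah; apply: flux_ramp => //; lra. Qed.

Lemma flux_const_gt0 : 0 < flux_const.
Proof.
apply: (@radint_gt0 _ _ (1/2)).
- by apply: cont_ramp1_sqrt; lra.
- by move=> q; rewrite divr_ge0 ?sqrtr_ge0 // ramp1_ge0 //; lra.
- lra.
apply: divr_gt0; last by rewrite sqrtr_gt0; lra.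
have -> : ramp1 (1/3) (1/3) (1/2 : R) = step1 (1/2) * 3.
  by rewrite /ramp1 (_ : (1/2 - 1/3) / (1/3) = 1/2 :> R); field.
by rewrite mulr_gt0 // step1_gt0 //; lra.
Qed.

Section Source.
Variables (mu : R) (Y Y1 V V1 : R -> R) (kap : R).
Hypotheses (dY : forall q, 0 < q -> der Y q (Y1 q)) (dV : forall q, 0 < q -> der V q (V1 q)).
Hypotheses (cY1 : forall q, 0 < q -> ct Y1 q) (cV1 : forall q, 0 < q -> ct V1 q).
Hypothesis wronskian : forall q, 0 < q ->
  (V q * Y1 q - V1 q * Y q) * (q * Num.sqrt q) = kap.
Variables (X1 X2 : R -> R) (a b : R).
Hypotheses (a0 : 0 < a) (b1 : b < 1) (X1D : forall q, der X1 q (X2 q)) (X2c : continuous X2).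
Hypothesis X0 : forall q, q <= a -> X1 q = 0 /\ X2 q = 0.
Hypothesis Xb : forall q, b <= q -> X1 q = 0.

(** If [y] solves the radial Helmholtz equation, this is [- Delta - mu] applied to the product of
    [y] with a cut-off whose first two derivatives are [x1] and [x2]. *)
Definition source (y y1 x1 x2 : R -> R) q : R :=
  - (4 * q * (2 * y1 q * x1 q + y q * x2 q) + 6 * y q * x1 q).

Lemma source_cont : continuous (source Y Y1 X1 X2).
Proof.
apply: (ct_localized a0) => [q qa|q q0]; first by have [x1 x2] := X0 qa; rewrite /source x1 x2; ring.
have c1 : ct Y q by exact: der_cont (dY q0).
have c2 : ct Y1 q by exact: cY1.
have c3 : ct X1 q by exact: der_cont (X1D q).
have c4 : ct X2 q by exact: X2c.
by rewrite /source; ctauto.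
Qed.

Lemma prod_source_cont : continuous (fun q => V q * source Y Y1 X1 X2 q).
Proof.
apply: (ct_localized a0) => [q qa|q q0].
  by have [x1 x2] := X0 qa; rewrite /source x1 x2; ring.
have c1 : ct V q by exact: der_cont (dV q0).
have c2 : ct (source Y Y1 X1 X2) q by exact: source_cont.
ctauto.
Qed.

(** Green's identity: [V] times the source differs from the divergence of a compactly supported
    radial field by a multiple of [X1] times the Wronskian of [V] and [Y], and that Wronskian is
    [kap / q^(3/2)]. *)
Lemma radint_source : radint (fun q => V q * source Y Y1 X1 X2 q) =
  - (4 * kap) * radint (fun q => X1 q / Num.sqrt q).
Proof.
pose P q := -2 * (V q * Y q * X1 q).
pose P' q := -2 * (V1 q * Y q * X1 q + V q * Y1 q * X1 q + V q * Y q * X2 q).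
have dP : forall q, der P q (P' q).
  apply: (der_localized a0) => [q qa|q q0].
    by have [x1 x2] := X0 qa; rewrite /P /P' x1 x2; split; ring.
  have h1 := dY q0; have h2 := dV q0; have h3 := X1D q.
  by rewrite /P /P'; dsolve => /=; ring.
have cP' : continuous P'.
  apply: (ct_localized a0) => [q qa|q q0].
    by have [x1 x2] := X0 qa; rewrite /P' x1 x2; ring.
  have c1 : ct Y q by exact: der_cont (dY q0).
  have c2 : ct Y1 q by exact: cY1.
  have c3 : ct X1 q by exact: der_cont (X1D q).
  have c4 : ct X2 q by exact: X2c.
  have c5 : ct V q by exact: der_cont (dV q0).
  have c6 : ct V1 q by exact: cV1.
  by rewrite /P'; ctauto.
have cP : continuous P by move=> q; exact: der_cont (dP q).
have P0 q : b <= q -> P q = 0 by move=> /Xb x; rewrite /P x !mulr0.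
have cX : continuous (fun q => X1 q / Num.sqrt q).
  apply: (ct_localized a0) => [q qa|q q0]; first by rewrite (X0 qa).1 mul0r.
  by apply: ct_sqrtV => //; exact: der_cont (X1D q).
have -> : (fun q => V q * source Y Y1 X1 X2 q) =
    fun q => (3 * P q + 2 * q * P' q) + - (4 * kap) * (X1 q / Num.sqrt q).
  apply/funext => q; have [q0|q0] := ltP 0 q; last first.
    have [|x1 x2] := X0 (q := q); first by apply: le_trans q0 (ltW a0).
    by rewrite /source /P /P' x1 x2; ring.
  have s0 := sqrt_gt0 q0; have s2 : Num.sqrt q ^+ 2 = q by rewrite sqr_sqrtr // ltW.
  rewrite -(wronskian q0) /source /P /P'.
  move: (Num.sqrt q) s0 s2 (V q) (V1 q) (Y q) (Y1 q) (X1 q) (X2 q) => s s0 s2 v v1 y y1 x1 x2.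
  by rewrite -s2; field; rewrite gt_eqF.
rewrite radintD.
- by rewrite (radint_flux b1 dP cP' P0) add0r radintZ.
- move=> q; have c1 : ct P q by exact: cP.
  have c2 : ct P' q by exact: cP'.
  suff : ct (fun q => 3 * P q + 2 * q * P' q) q by [].
  ctauto.
move=> q; have c1 : ct (fun q => X1 q / Num.sqrt q) q by exact: cX.
exact: (ctM (@ctC _ _ (- (4 * kap)) q) c1).
Qed.

End Source.

End Cutoff.

(** * Test functions for the Green function with pole at the centre *)

Section GreenTest.
Context {R : realType}.
Implicit Types (q : R).
Variables (th : R).
Hypothesis th0 : 0 < th.

(* In the variable q = |x|^2: the radial solutions sin(th(1-r))/r and
   sin(th r)/(th r) of the Helmholtz equation. *)
Definition ysol q : R := sin (th * (1 - Num.sqrt q)) / Num.sqrt q.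
Definition ysol1 q : R :=
  - (th * cos (th * (1 - Num.sqrt q)) * Num.sqrt q + sin (th * (1 - Num.sqrt q))) /
  (2 * q * Num.sqrt q).
Definition ysol2 q : R := - (6 * ysol1 q + th ^+ 2 * ysol q) / (4 * q).
Definition zsol q : R := sin (th * Num.sqrt q) / (th * Num.sqrt q).
Definition zsol1 q : R :=
  (th * Num.sqrt q * cos (th * Num.sqrt q) - sin (th * Num.sqrt q)) / (2 * th * q * Num.sqrt q).

Lemma sqrt_sq q : 0 < q -> Num.sqrt q ^+ 2 = q.
Proof. by move=> q0; rewrite sqr_sqrtr // ltW. Qed.

Lemma der_ysol q : 0 < q -> der ysol q (ysol1 q).
Proof.
move=> q0; have ds := der_sqrt q0; have s0 := sqrt_gt0 q0; have s2 := sqrt_sq q0.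
rewrite /ysol /ysol1; dsolve => /=; first by rewrite gt_eqF.
move: (cos _) (sin _) => c S; move: (Num.sqrt q) s0 s2 => s s0 <-.
by field; rewrite gt_eqF.
Qed.

Lemma der_ysol1 q : 0 < q -> der ysol1 q (ysol2 q).
Proof.
move=> q0; have ds := der_sqrt q0; have s0 := sqrt_gt0 q0; have s2 := sqrt_sq q0.
rewrite /ysol2 /ysol1 /ysol; dsolve => /=; first by rewrite !mulf_neq0 ?pnatr_eq0 // gt_eqF.
move: (cos _) (sin _) => c S; move: (Num.sqrt q) s0 s2 => s s0 <-.
by field; rewrite gt_eqF.
Qed.

Lemma der_zsol q : 0 < q -> der zsol q (zsol1 q).
Proof.
move=> q0; have ds := der_sqrt q0; have s0 := sqrt_gt0 q0; have s2 := sqrt_sq q0.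
rewrite /zsol /zsol1; dsolve => /=; first by rewrite mulf_neq0 // gt_eqF.
move: (cos _) (sin _) => c S; move: (Num.sqrt q) s0 s2 => s s0 <-.
by field; rewrite !gt_eqF.
Qed.

Lemma ct_ysol1 q : 0 < q -> ct ysol1 q.
Proof. by move=> q0; exact: der_cont (der_ysol1 q0). Qed.

Lemma ct_zsol1 q : 0 < q -> ct zsol1 q.
Proof.
move=> q0; have cs : ct (fun q => Num.sqrt q) q by exact: sqrt_continuous.
have s0 := sqrt_gt0 q0.
by rewrite /zsol1; ctauto; rewrite !mulf_neq0 ?pnatr_eq0 // gt_eqF.
Qed.

Lemma wronskian_yy q : 0 < q -> (ysol q * ysol1 q - ysol1 q * ysol q) * (q * Num.sqrt q) = 0.
Proof. by move=> _; ring. Qed.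

Lemma wronskian_zy q : 0 < q ->
  (zsol q * ysol1 q - zsol1 q * ysol q) * (q * Num.sqrt q) = - (sin th / 2).
Proof.
move=> q0; have s0 := sqrt_gt0 q0; have s2 := sqrt_sq q0.
have e : sin th = sin (th * Num.sqrt q) * cos (th * (1 - Num.sqrt q)) +
    cos (th * Num.sqrt q) * sin (th * (1 - Num.sqrt q)).
  by rewrite -sinD; congr sin; ring.
rewrite e /zsol /ysol1 /zsol1 /ysol.
move: (cos (th * Num.sqrt q)) (sin (th * Num.sqrt q)) => c1 S1.
move: (cos _) (sin _) => c S; move: (Num.sqrt q) s0 s2 => s s0 <-.
by field; rewrite !gt_eqF.
Qed.

Variables (f : R -> R) (M c0 : R).
Hypotheses (f_smooth : smooth f) (f_der : forall t, der step1 t (f t))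
  (f_out : forall t, ~~ (0 <= t <= 1) -> f t = 0) (M0 : 0 < M) (fM : forall t, `|f t| <= M)
  (step1M : forall t, `|step1 t| <= M)
  (c00 : 0 < c0) (step1c : forall t, 1/3 <= t <= 2/3 -> c0 <= step1 t :> R).

Definition ramp2 (a h q : R) : R := f ((q - a) / h) / h ^+ 2.

Lemma der_ramp1 a h q : h != 0 -> der (ramp1 a h) q (ramp2 a h q).
Proof.
move=> h0; have := derM (derO (der_affine a q h0) (f_der _)) (derC h^-1 q).
by move/der_eq; apply; rewrite /ramp2; field.
Qed.

Lemma ramp2_cont a h : continuous (ramp2 a h).
Proof.
move=> q; apply: smooth_ct; apply: smoothM; last exact: smooth_cst.
exact: smooth_comp f_smooth (smooth_affine a h).
Qed.

Lemma ramp2_out a h q : 0 < h -> ~~ (a <= q <= a + h) -> ramp2 a h q = 0.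
Proof.
move=> h0 hq; rewrite /ramp2 f_out ?mul0r //; apply: contra hq => /andP[h1 h2].
rewrite ler_pdivlMr // mul0r in h1; rewrite ler_pdivrMr // mul1r in h2.
by apply/andP; split; lra.
Qed.

Lemma ramp12_le a h q : 0 < h -> q < a -> ramp1 a h q = 0 /\ ramp2 a h q = 0.
Proof.
move=> h0 qa; split; [rewrite ramp1_out|rewrite ramp2_out] => //; rewrite negb_and.
  by rewrite -leNgt ltW.
by rewrite -ltNge qa.
Qed.

Definition ysource a h := source ysol ysol1 (ramp1 a h) (ramp2 a h).

Definition wide a h q : R := ramp1 (a - h) (3 * h) q / Num.sqrt q.

(** [78 = 3 * 26]: the terms of the source contribute at most [4 + 12 + 6 <= 26] multiples of
    [(th + 1) M / h], while the wide ramp has derivative at least [c0 / (3 h)]. *)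
Definition source_const : R := 78 * (th + 1) * M / c0.

Lemma source_const_gt0 : 0 < source_const.
Proof. by apply: divr_gt0 => //; apply: mulr_gt0 => //; apply: mulr_gt0 => //; rewrite addr_gt0. Qed.

(** The integral of [wide] does not depend on [h], so the source keeps bounded mass as the layer
    shrinks. The second derivative of the ramp, of order [h^-2], is tamed by
    [q |sin (th (1 - sqrt q))| = O(h)]: in the inner layer [q <= 3 h], in the outer one the sine is
    small. *)
Lemma ysource_bound a h q : 0 < a -> 0 < h -> a + h <= 1 ->
  (a + h <= 3 * h \/ 1 - 3 * h <= a) -> `|ysource a h q| <= source_const * wide a h q.
Proof.
move=> a0 h0 ah1 hah; have t0 := th0.
have w0 : 0 <= wide a h q by rewrite /wide divr_ge0 ?sqrtr_ge0 // ramp1_ge0 // mulr_gt0.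
have [/andP[qa qb]|hq] := boolP (a <= q <= a + h); last first.
  rewrite /ysource /source ramp2_out // ramp1_out //; last first.
    by apply: contra hq => /andP[? ?]; rewrite !ltW.
  by rewrite !mulr0 !addr0 mulr0 oppr0 normr0 mulr_ge0 // ltW // source_const_gt0.
have q0 : 0 < q by lra.
have s0 := sqrt_gt0 q0; have s2 := sqrt_sq q0; rewrite /wide /ysource /source /ysol /ysol1.
have s1 : Num.sqrt q <= 1 by rewrite -sqrtr1 ler_sqrt //; lra.
have B1 : `|ramp1 a h q| <= M / h.
  by rewrite /ramp1 normrM normfV (gtr0_norm h0) ler_pM2r ?invr_gt0.
have B2 : `|ramp2 a h q| <= M / h ^+ 2.
  by rewrite /ramp2 normrM normfV (gtr0_norm (exprn_gt0 2 h0)) ler_pM2r ?invr_gt0 ?exprn_gt0.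
have K : c0 / (3 * h) <= ramp1 (a - h) (3 * h) q.
  have h3 : 0 < 3 * h by rewrite mulr_gt0.
  rewrite /ramp1 ler_pM2r ?invr_gt0 //; apply: step1c.
  by rewrite ler_pdivlMr // ler_pdivrMr //; lra.
set S := sin (th * (1 - Num.sqrt q)); set c := cos (th * (1 - Num.sqrt q)).
have S1 : `|S| <= 1 by rewrite sin_max.
have C1 : `|c| <= 1 by rewrite cos_max.
have S3 : q * `|S| <= (th + 1) * (3 * h).
  have [hh|hh] := hah.
    have : q * `|S| <= (3 * h) * 1 by apply: ler_pM => //; lra.
    have : 0 <= th * (3 * h) by rewrite mulr_ge0 ?mulr_ge0 // ltW.
    by lra.
  have qs : q <= Num.sqrt q by rewrite -{1}s2 expr2 ler_piMl // ltW.
  have t1 : `|S| <= th * (1 - Num.sqrt q).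
    by apply: abs_sin_lex; rewrite mulr_ge0 ?(ltW th0) // subr_ge0.
  have t2 : th * (1 - Num.sqrt q) <= th * (3 * h) by rewrite ler_pM2l //; lra.
  have t3 : q * `|S| <= 1 * (th * (3 * h)) by apply: ler_pM => //; lra.
  lra.
have S4 : `|th * c * Num.sqrt q + S| <= th + 1.
  rewrite (le_trans (ler_normD _ _)) // lerD //.
  rewrite !normrM (gtr0_norm th0) (gtr0_norm s0) -[leRHS]mulr1.
  by apply: ler_pM => //; [rewrite mulr_ge0 // ltW|rewrite ler_piMr // ltW].
move: (ramp1 a h q) (ramp2 a h q) B1 B2 (ramp1 _ _ q) K => x1 x2 B1 B2 k K.
set N := th * c * Num.sqrt q + S in S4 *.
have -> : - (4 * q * (2 * (- N / (2 * q * Num.sqrt q)) * x1 + S / Num.sqrt q * x2) +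
    6 * (S / Num.sqrt q) * x1) = (4 * N * x1 - 4 * q * S * x2 - 6 * S * x1) / Num.sqrt q.
  by clearbody N S; move: (Num.sqrt q) s0 s2 => s s0 <-; field; rewrite gt_eqF.
rewrite normrM normfV (gtr0_norm s0) mulrA ler_pM2r ?invr_gt0 //.
have T1 : `|N| * `|x1| <= (th + 1) * (M / h) by exact: ler_pM.
have T2 : q * `|S| * `|x2| <= (th + 1) * (3 * h) * (M / h ^+ 2).
  by apply: ler_pM => //; rewrite mulr_ge0 // ltW.
have T3 : `|S| * `|x1| <= 1 * (M / h) by exact: ler_pM.
have e2 : (th + 1) * (3 * h) * (M / h ^+ 2) = 3 * ((th + 1) * (M / h)) by field; rewrite gt_eqF.
rewrite e2 in T2.
have Mh : 0 < M / h by exact: divr_gt0.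
have T4 : M / h <= (th + 1) * (M / h) by rewrite ler_peMl ?(ltW Mh) //; lra.
have T5 : source_const * (c0 / (3 * h)) <= source_const * k by rewrite ler_pM2l // source_const_gt0.
have e3 : source_const * (c0 / (3 * h)) = 26 * ((th + 1) * (M / h)).
  by rewrite /source_const; field; rewrite !gt_eqF.
rewrite e3 in T5; apply: le_trans T5.
have U : `|4 * N * x1 - 4 * q * S * x2 - 6 * S * x1| <=
    4 * (`|N| * `|x1|) + 4 * (q * `|S| * `|x2|) + 6 * (`|S| * `|x1|).
  apply: le_trans (ler_normB _ _) _; apply: lerD; last first.
    by rewrite !normrM (ger0_norm (ler0n R 6)) -!mulrA.
  apply: le_trans (ler_normB _ _) _; apply: lerD.
    by rewrite !normrM (ger0_norm (ler0n R 4)) -!mulrA.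
  by rewrite !normrM (ger0_norm (ler0n R 4)) (gtr0_norm q0) -!mulrA.
apply: le_trans U _; rewrite mul1r in T3.
have add3 (z1 z2 z3 z4 z5 : R) : 0 < z5 -> z1 <= z4 -> z2 <= 3 * z4 -> z3 <= z5 -> z5 <= z4 ->
  4 * z1 + 4 * z2 + 6 * z3 <= 26 * z4 by lra.
exact: add3 Mh T1 T2 T3 T4.
Qed.

Lemma ysource_cont a h : 0 < a -> 0 < h -> continuous (ysource a h).
Proof.
move=> a0 h0; have a2 : 0 < a / 2 by rewrite divr_gt0.
apply: (source_cont der_ysol ct_ysol1 a2) => [q||q qa].
- by apply: der_ramp1; rewrite gt_eqF.
- exact: ramp2_cont.
- by apply: ramp12_le => //; lra.
Qed.

Section ZY.
Variables (a h : R).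
Hypotheses (a0 : 0 < a) (h0 : 0 < h) (ah : a + h < 1).

Let a2 : 0 < a / 2. Proof. by rewrite divr_gt0. Qed.
Let X1D q : der (ramp1 a h) q (ramp2 a h q). Proof. by apply: der_ramp1; rewrite gt_eqF. Qed.
Let X0 q : q <= a / 2 -> ramp1 a h q = 0 /\ ramp2 a h q = 0.
Proof. by move=> qa; have a0' := a0; apply: ramp12_le => //; lra. Qed.
Let Xb q : a + h <= q -> ramp1 a h q = 0.
Proof. by move=> qa; rewrite ramp1_out // negb_and -!leNgt qa orbT. Qed.

Lemma ysource_y_cont : continuous (fun q => ysol q * ysource a h q).
Proof. exact: (prod_source_cont der_ysol der_ysol ct_ysol1 a2 X1D (@ramp2_cont a h) X0). Qed.

Lemma ysource_z_cont : continuous (fun q => zsol q * ysource a h q).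
Proof. exact: (prod_source_cont der_ysol der_zsol ct_ysol1 a2 X1D (@ramp2_cont a h) X0). Qed.

Lemma radint_y : radint (fun q => ysol q * ysource a h q) = 0.
Proof.
rewrite (radint_source der_ysol der_ysol ct_ysol1 ct_ysol1 wronskian_yy a2 ah X1D (@ramp2_cont a h) X0 Xb).
by rewrite mulr0 oppr0 mul0r.
Qed.

Lemma radint_z : radint (fun q => zsol q * ysource a h q) = 2 * sin th * flux_const.
Proof.
rewrite (radint_source der_ysol der_zsol ct_ysol1 ct_zsol1 wronskian_zy a2 ah X1D (@ramp2_cont a h) X0 Xb).
by rewrite flux_rampE //; field.
Qed.

End ZY.

Section TestFunction.
Variables (h : R).
Hypotheses (h0 : 0 < h) (h8 : 8 * h <= 1).

(** A plateau: 0 near the centre, 1 in between, 0 near the sphere. *)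
Let W q := ramp (2 * h) h q - ramp (1 - 3 * h) h q.
Let W1 q := ramp1 (2 * h) h q - ramp1 (1 - 3 * h) h q.
Let W2 q := ramp2 (2 * h) h q - ramp2 (1 - 3 * h) h q.

Definition test_profile q := W q * ysol q.

Lemma ramps_low q : q <= h -> [/\ W q = 0, W1 q = 0 & W2 q = 0].
Proof.
have h0' := h0; have h8' := h8; move=> qh.
have q1 : q < 2 * h by lra.
have q2 : q < 1 - 3 * h by lra.
have [e1 e2] := ramp12_le h0 q1; have [e3 e4] := ramp12_le h0 q2.
by rewrite /W /W1 /W2 e1 e2 e3 e4 !ramp_le ?subrr //; exact: ltW.
Qed.

Lemma ramps_der q : der W q (W1 q).
Proof.
have hn := lt0r_neq0 h0.
by have d1 := der_ramp (2 * h) q hn; have d2 := der_ramp (1 - 3 * h) q hn; rewrite /W /W1; dsolve.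
Qed.

Lemma ramps1_der q : der W1 q (W2 q).
Proof.
have hn := lt0r_neq0 h0.
by have d1 := der_ramp1 (2 * h) q hn; have d2 := der_ramp1 (1 - 3 * h) q hn; rewrite /W1 /W2; dsolve.
Qed.

Lemma test_profile_smooth : smooth test_profile.
Proof.
have h2 : 0 < h / 2 by rewrite divr_gt0.
(* [tau] is positive everywhere and equals [q] for [q >= h], so its square root is smooth on the
   whole line; below [h] the factor [W] vanishes. *)
pose c := ramp (h / 2) (h / 2); pose tau q := c q * q + (1 + - c q).
have sc : smooth c := smooth_ramp _ _.
have stau : smooth tau.
  apply: smoothD; first exact: smoothM sc smooth_id.
  by apply: smoothD; [exact: smooth_cst|exact: smoothN].
have tau0 q : 0 < tau q.
  have /andP[c0' c1] : 0 <= c q <= 1 by exact: step01.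
  have [qh|qh] := leP q (h / 2); first by rewrite /tau /c ramp_le //; lra.
  have qp : 0 < q by lra.
  have cq : 0 <= c q * q by rewrite mulr_ge0 // ltW.
  have [c1'|c1'] := eqVneq (c q) 1; first by rewrite /tau c1' mul1r subrr addr0.
  have : c q < 1 by rewrite lt_neqAle c1'.
  by rewrite /tau; lra.
have -> : test_profile = fun q => W q * (sin (th * (1 + - Num.sqrt (tau q))) * (Num.sqrt (tau q))^-1).
  apply/funext => q; rewrite /test_profile; have [qh|qh] := leP q h.
    by have [-> _ _] := ramps_low qh; rewrite !mul0r.
  have -> : tau q = q by rewrite /tau /c ramp_ge //; [ring|lra].
  by [].
have ss : smooth (fun q => Num.sqrt (tau q)) by exact: smooth_sqrt.
apply: smoothM.
  by apply: smoothD; [exact: smooth_ramp|apply: smoothN; exact: smooth_ramp].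
apply: smoothM; last by apply: smoothV => // q; rewrite gt_eqF // sqrtr_gt0.
apply: (@smooth_comp _ sin (fun q => th * (1 + - Num.sqrt (tau q)))); first exact: smooth_sin.
apply: smoothM; first exact: smooth_cst.
by apply: smoothD; [exact: smooth_cst|exact: smoothN].
Qed.

Lemma test_profile_test : test_function (fun x : 'rV[R]_3 => test_profile (nsq x)).
Proof.
have h0' := h0; have h8' := h8.
apply: (@test_function_radial _ _ (1 - 2 * h) test_profile_smooth); first by lra.
move=> q hq; have e1 : ramp (2 * h) h q = 1 by apply: ramp_ge => //; lra.
have e2 : ramp (1 - 3 * h) h q = 1 by apply: ramp_ge => //; lra.
by rewrite /test_profile /W e1 e2 subrr mul0r.
Qed.

Lemma test_profile0 : test_profile 0 = 0.
Proof. by rewrite /test_profile; have [|-> _ _] := @ramps_low 0; [exact: ltW|rewrite mul0r]. Qed.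

(** [ysol2] is given by the Helmholtz equation, so the terms in which the cut-off is not
    differentiated cancel, and only the two layers remain. *)
Lemma test_profile_source (x : 'rV[R]_3) :
  - laplacian (fun x => test_profile (nsq x)) x - th ^+ 2 * test_profile (nsq x) =
  ysource (2 * h) h (nsq x) - ysource (1 - 3 * h) h (nsq x).
Proof.
pose F1 q := W1 q * ysol q + W q * ysol1 q.
pose F2 q := W2 q * ysol q + 2 * (W1 q * ysol1 q) + W q * ysol2 q.
have d1 : forall q, der test_profile q (F1 q).
  apply: (der_localized h0) => [q qh|q q0].
    by have [w w1 w2] := ramps_low qh; rewrite /test_profile /F1 w w1 !mul0r addr0.
  by have w := ramps_der q; have y := der_ysol q0; rewrite /test_profile /F1; dsolve.
have d2 : forall q, der F1 q (F2 q).
  apply: (der_localized h0) => [q qh|q q0].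
    by have [w w1 w2] := ramps_low qh; rewrite /F1 /F2 w w1 w2 !mul0r !mulr0 !addr0.
  have w := ramps_der q; have w1 := ramps1_der q; have y := der_ysol q0; have y1 := der_ysol1 q0.
  by rewrite /F1 /F2; dsolve => /=; ring.
rewrite (laplacian_radial x d1 d2); move: (nsq x) => q.
have [qh|qh] := leP q h.
  have [w w1 w2] := ramps_low qh; rewrite /F1 /F2 /test_profile w w1 w2.
  have [c1 c2] : ramp1 (2 * h) h q = 0 /\ ramp2 (2 * h) h q = 0.
    by have h0' := h0; apply: ramp12_le => //; lra.
  have [c3 c4] : ramp1 (1 - 3 * h) h q = 0 /\ ramp2 (1 - 3 * h) h q = 0.
    by have h0' := h0; have h8' := h8; apply: ramp12_le => //; lra.
  by rewrite /ysource /source c1 c2 c3 c4; ring.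
have q0 : 0 < q by apply: lt_trans qh.
rewrite /F1 /F2 /test_profile /ysource /source /ysol2 /W /W1 /W2.
by field; rewrite gt_eqF.
Qed.

End TestFunction.

End GreenTest.

(** * The value of the regular part at the centre *)

Section GreenValue.
Context {R : realType}.
Implicit Types (q : R) (x : 'rV[R]_3).
Local Notation D := (@vec3 R @^-1` unit_ball R).

Lemma norm_le_enorm x : `|x| <= enorm x.
Proof.
rewrite /Num.norm /= mx_normrE; apply: (big_ind (fun z : R => z <= enorm x)) => [|u v uM vM|[k i] _ /=].
- exact: enorm_ge0.
- by rewrite ge_max uM vM.
by rewrite ord1 coord_le_enorm.
Qed.

Lemma ct_near0 (w : 'rV[R]_3 -> R) : {for 0, continuous w} ->
  forall e, 0 < e -> exists2 d, 0 < d & forall x, nsq x < d -> `|w x - w 0| < e.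
Proof.
move=> cw e e0; have /nbhs_ballP[d /= d0 hd] := ct_dist cw e0.
exists (d ^+ 2) => [|x xd]; first by rewrite exprn_gt0.
apply: hd; rewrite -ball_normE /ball_ /= sub0r normrN.
apply: le_lt_trans (norm_le_enorm x) _.
by rewrite -(ltr_pXn2r (_ : 0 < 2)%N) ?nnegrE ?enorm_ge0 ?ltW // sqr_enorm.
Qed.

Lemma small_near_sphere (u : 'rV[R]_3 -> R) :
  {within closed_unit_ball R `\ 0, continuous u} -> (forall x, unit_sphere R x -> u x = 0) ->
  forall e, 0 < e -> exists2 d, 0 < d & forall x, unit_ball R x -> 1 - d < nsq x -> `|u x| <= e.
Proof.
move=> cu u0 e e0.
pose A : set 'rV[R]_3 := [set x | 1/2 <= nsq x <= 1].
have AE : A = (@nsq R) @^-1` [set t | t <= 1] `&` (@nsq R) @^-1` [set t | 1/2 <= t].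
  by apply/funext => x; apply/propext; split=> [/andP[]|[h1 h2]] //; apply/andP.
have cA : closed A.
  rewrite AE; apply: closedI; apply: preimage_closed => [y _|];
    first [exact: nsq_continuous | exact: closed_le | exact: closed_ge].
have kA : compact A by apply: (@nsq_le_compact _ _ 1 cA) => x /andP[].
have sA : A `<=` closed_unit_ball R `\ 0.
  move=> x /andP[x1 x2]; split; first by rewrite closed_unit_ballE.
  by move=> /= x0; move: x1; rewrite x0 /nsq sum3 !mxE; lra.
have cuA : {within A, continuous u} := continuous_subspaceW sA cu.
(* [F] is positive on the closed annulus, as [u] vanishes on the sphere, and equals [1 - nsq x]
   wherever [|u x| >= e]; its minimum therefore bounds the width of the layer. *)
pose F x := Num.max 0 (e - `|u x|) + (1 - nsq x).
have cnA : {within A, continuous (@nsq R)}.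
  by apply: continuous_subspaceT; exact: nsq_continuous.
have cF : {within A, continuous F}.
  move=> x; have c1 : @ct R (subspace A) u x := cuA x.
  have cn : @ct R (subspace A) (@nsq R) x := cnA x.
  have ch : {for u x, continuous (fun z => Num.max 0 (e - `|z|))}.
    have cz : ct (fun z : R => `|z|) (u x) by exact: norm_continuous.
    suff : ct (fun z : R => Num.max 0 (e - `|z|)) (u x) by [].
    apply: ct_max; first exact: ctC.
    by apply: ctD; [exact: ctC|exact: ctN].
  have c2 := ctO c1 ch.
  exact: (ctD c2 (ctD (@ctC R (subspace A) 1 x) (ctN cn))).
have A0 : A !=set0.
  exists (1 *: basis_vec R 0); rewrite /A /= nsq_basis expr1n; apply/andP; split; lra.
have [c /set_mem Ac hc] := EVT_min_rV A0 kA cF.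
have Fc : 0 < F c.
  have /andP[_ c1] := Ac; have m0 : 0 <= Num.max 0 (e - `|u c|) by rewrite le_max lexx.
  have [c2|c2] := ltP (nsq c) 1; first by rewrite /F; lra.
  have cS : unit_sphere R c by apply/unit_sphereE/eqP; rewrite eq_le c1 c2.
  rewrite /F u0 // normr0 subr0.
  have : e <= Num.max 0 e by rewrite le_max lexx orbT.
  by lra.
exists (Num.min (F c) (1/2)); first by rewrite lt_min Fc /=; lra.
move=> x; rewrite unit_ballE => x1; rewrite ltrBlDr -ltrBlDl lt_min => /andP[h1 h2].
have Ax : A x by apply/andP; split; lra.
have := hc x (mem_set Ax); rewrite leNgt => /negP h; rewrite leNgt; apply/negP => eu; apply: h.
rewrite {1}/F; have -> : Num.max 0 (e - `|u x|) = 0 by apply/max_idPl; rewrite subr_le0 ltW.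
by rewrite add0r.
Qed.

Lemma norm_integral_le_radint (F : R * R * R -> R) (k : R -> R) : continuous k ->
  (lebesgue3 R).-integrable D (EFin \o F) -> (forall p, D p -> `|F p| <= k (qsum p)) ->
  `|\int[lebesgue3 R]_(p in D) F p| <= radint k.
Proof.
move=> ck iF hF.
apply: le_trans (@le_normr_Rintegral _ _ _ (lebesgue3 R) D F (@measurable_ball3 R) iF) _.
apply: le_Rintegral; first exact: measurable_ball3.
- exact: integrable_norm.
- exact: (integrable_radial ck).
- exact: hF.
Qed.

Lemma layer_bounds (h : R) : 0 < h -> 8 * h <= 1 ->
  [/\ 0 < 2 * h, 2 * h + h < 1, 0 < 1 - 3 * h & 1 - 3 * h + h < 1] /\
  [/\ 0 < 2 * h - h, 2 * h + 2 * h < 1, 0 < 1 - 3 * h - h & 1 - 3 * h + 2 * h < 1].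
Proof. by move=> h0 h8; split; split; lra. Qed.

Lemma outer_layer (h d q : R) : 0 < h -> 5 * h <= d -> 1 - 3 * h <= q -> 1 - d < q.
Proof. by move=> h0 hd hq; lra. Qed.

Lemma inner_layer (h d q : R) : 0 < h -> 5 * h <= d -> 2 * h <= q -> q <= 2 * h + h -> 0 < q < d.
Proof. by move=> h0 hd hq hq'; lra. Qed.

Lemma inner_width (h : R) : 2 * h + h <= 3 * h. Proof. by lra. Qed.

Lemma wide_cont (a h : R) : 0 < h -> 0 < a - h -> continuous (wide a h).
Proof. by move=> h0 ah; apply: cont_ramp1_sqrt => //; rewrite mulr_gt0. Qed.

Lemma wide_ge0 (a h q : R) : 0 < h -> 0 <= wide a h q.
Proof. by move=> h0; rewrite /wide divr_ge0 ?sqrtr_ge0 // ramp1_ge0 // mulr_gt0. Qed.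

Lemma radint_wide (a h c : R) : 0 < h -> 0 < a - h -> a + 2 * h < 1 ->
  radint (fun q => c * wide a h q) = c * flux_const.
Proof.
move=> h0 ah ah1; rewrite radintZ; last exact: wide_cont.
by rewrite /wide flux_rampE // ?mulr_gt0 //; lra.
Qed.

Variables (mu : R) (G g : 'rV[R]_3 -> 'rV[R]_3 -> R).
Hypotheses (mu0 : 0 < mu) (mupi : mu < pi ^+ 2).
Hypotheses (hG : green_function mu G) (hg : regular_part G g).

Let th : R := Num.sqrt mu.
Let S : R := sin th.
Let k1 : R := th * cos th / (4 * pi * S).
Let d : R := g 0 0 + k1.

Let th0 : 0 < th. Proof. by rewrite sqrtr_gt0. Qed.
Let thpi : th < pi.
Proof.
rewrite -(ltr_pXn2r (_ : 0 < 2)%N) ?nnegrE ?sqrtr_ge0 ?pi_ge0 //.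
by rewrite sqr_sqrtr // ltW.
Qed.
Let S0 : 0 < S. Proof. by rewrite sin_gt0_pi // th0. Qed.
Let pi0 : 0 < pi :> R. Proof. exact: pi_gt0. Qed.

Lemma ball0 : unit_ball R (0 : 'rV[R]_3).
Proof. by rewrite unit_ballE /nsq sum3 !mxE expr0n /= !addr0. Qed.

(** The radial Helmholtz solution that shares with the Green function the expansion
    [1 / (4 pi r) + g 0 0 + o(1)] at the pole: the [ysol] term contributes [1 / (4 pi r) - k1], and
    [zsol] tends to 1. *)
Let excess q : R := (4 * pi * S)^-1 * ysol th q + d * zsol th q.

Lemma green_near0 e : 0 < e -> exists2 dl, 0 < dl & forall x, 0 < nsq x < dl -> nsq x < 1 ->
  `|G x 0 - excess (nsq x)| <= e.
Proof.
move=> e0.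
have cg : {for (0 : 'rV[R]_3), continuous (fun x => g x 0)}.
  apply: (@continuous_comp _ _ _ (fun x : 'rV[R]_3 => (x, 0 : 'rV[R]_3)) (fun p => g p.1 p.2)).
    exact: (cvg_pair (@cvg_id _ (nbhs (0 : 'rV[R]_3))) (@cvg_cst _ (0 : 'rV[R]_3) _ (nbhs (0 : 'rV[R]_3)) _)).
  exact: (hg.2 0 ball0).
have e2 : 0 < e / 2 by rewrite divr_gt0.
have [d1 d10 hd1] := ct_near0 cg e2.
pose C := th ^+ 2 + `|g 0 0| * th ^+ 2 + 1.
have th2 : 0 < th ^+ 2 by rewrite exprn_gt0.
have g2 : 0 <= `|g 0 0| * th ^+ 2 by rewrite mulr_ge0 // ltW.
have C0 : 0 < C by rewrite /C; lra.
exists (Num.min d1 ((e / 2 / C) ^+ 2)); first by rewrite lt_min d10 exprn_gt0 // divr_gt0.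
move=> x /andP[x0]; rewrite lt_min => /andP[xd1 xd2] x1.
have r2 := sqr_enorm x; set r := enorm x in r2 *.
have sr : Num.sqrt (nsq x) = r by [].
have r0 : 0 < r by rewrite sqrtr_gt0.
have r1 : r < 1 by rewrite -(ltr_pXn2r (_ : 0 < 2)%N) ?nnegrE ?(ltW r0) // r2 expr1n.
have rC : C * r <= e / 2.
  rewrite mulrC -ler_pdivlMr //; apply: ltW.
  by rewrite -(ltr_pXn2r (_ : 0 < 2)%N) ?nnegrE ?(ltW r0) ?(ltW (divr_gt0 _ _)) // r2.
have xn : x != 0.
  by apply/eqP => xe; move: x0; rewrite xe /nsq sum3 !mxE expr0n /= !addr0 ltxx.
have gd : `|g x 0 - g 0 0| < e / 2 by exact: hd1.
have xb : unit_ball R x by rewrite unit_ballE.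
rewrite (hg.1 x 0 xb ball0 xn).
rewrite subr0 -/r /excess /ysol /zsol sr.
have es : sin (th * (1 - r)) = S * cos (th * r) - cos th * sin (th * r).
  by rewrite mulrBr mulr1 sinB.
rewrite es; have tr0 : 0 < th * r by rewrite mulr_gt0.
have trth : th * r < th by rewrite gtr_pMr.
have trpi : th * r < pi by exact: lt_trans trth thpi.
have c1 := @cos_gex R (th * r) (ltW tr0).
have c2 := cos_le1 (th * r).
have z1 : sin (th * r) <= th * r by apply: sin_lex; exact: ltW.
have z2 : th * r * cos (th * r) < sin (th * r) by apply: xcosx_lt_sinx; rewrite tr0.
set c := cos (th * r) in es c1 c2 z2 *; set s := sin (th * r) in es z1 z2 *.
have p4 : 1 <= 4 * pi :> R by have := pi_ge2 R; lra.
have alg (P gx g0 ct : R) : P != 0 ->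
    (4 * P * r)^-1 + gx - ((4 * P * S)^-1 * ((S * c - ct * s) / r) +
      (g0 + th * ct / (4 * P * S)) * (s / (th * r))) =
    (1 - c) / r / (4 * P) + (gx - g0) + g0 * (1 - s / (th * r)).
  by move=> P0; field; rewrite P0 !gt_eqF.
rewrite /d /k1 alg; last by rewrite gt_eqF.
have t1 : `|(1 - c) / r / (4 * pi)| <= th ^+ 2 * r.
  rewrite ger0_norm; last by rewrite !divr_ge0 ?subr_ge0 ?(ltW r0) ?mulr_ge0 ?(ltW pi0).
  rewrite ler_pdivrMr ?mulr_gt0 // ler_pdivrMr //.
  apply: (@le_trans _ _ (th ^+ 2 * r ^+ 2)).
    by move: c1; rewrite exprMn; have := mulr_gt0 th2 (exprn_gt0 2 r0); lra.
  have -> : th ^+ 2 * r * (4 * pi) * r = th ^+ 2 * r ^+ 2 * (4 * pi) by ring.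
  by rewrite ler_peMr // mulr_ge0 ?sqr_ge0.
have t2 : `|g 0 0 * (1 - s / (th * r))| <= `|g 0 0| * th ^+ 2 * r.
  rewrite normrM -mulrA ler_wpM2l // ger0_norm; last by rewrite subr_ge0 ler_pdivrMr // mul1r.
  apply: (@le_trans _ _ (1 - c)).
    by rewrite lerD2l lerN2 ler_pdivlMr // mulrC ltW.
  apply: (@le_trans _ _ (th ^+ 2 * r ^+ 2)).
    by move: c1; rewrite exprMn; have := mulr_gt0 th2 (exprn_gt0 2 r0); lra.
  by rewrite ler_pM2l // expr2 ler_piMr // ltW.
apply: le_trans (ler_normD _ _) _; apply: le_trans (lerD (ler_normD _ _) (lexx _)) _.
move: t1 t2 gd rC r0; rewrite /C.
move: (`|_ / (4 * pi)|) (`|g x 0 - _|) (`|g 0 0 * (1 - _)|) => u1 u2 u3; lra.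
Qed.

(* The test function is [ysol] cut off near the origin and near the sphere. The
   outer layer contributes little since [G] vanishes on the sphere; on the inner
   layer [G - excess] is small, [ysol] has no flux against its own source, and
   [zsol] has flux a nonzero multiple of [flux_const]. *)
Lemma green_value_aux : d = 0.
Proof.
apply/eqP; apply: contraT => dn; have d0 : 0 < `|d| by rewrite normr_gt0.
have [f [fs fd fo [M1 M10 fM1]]] := @step2_ex R.
have [M2 M20 sM2] := @step1_upper R.
have [c0 c00 sc] := @step1_lower R.
pose M := M1 + M2.
have M0 : 0 < M by rewrite addr_gt0.
have fM t : `|f t| <= M by rewrite (le_trans (fM1 t)) // lerDl ltW.
have sM t : `|step1 t| <= M by rewrite (le_trans (sM2 t)) // lerDr ltW.
pose C := source_const th M c0.
have C0 : 0 < C by exact: source_const_gt0.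
(* The two layers together err by at most [2 e C flux_const = |d| S flux_const], half of the flux
   [2 |d| S flux_const] produced by [d zsol]. *)
pose e := `|d| * S / (2 * C).
have e0 : 0 < e by rewrite divr_gt0 // mulr_gt0.
have eC : 2 * (e * C) = `|d| * S by rewrite /e; field; rewrite gt_eqF.
clearbody e.
have [Gi Gt Gc Gs] := hG ball0.
have [d1 d10 hd1] := green_near0 e0.
have [d2 d20 hd2] := small_near_sphere Gc Gs e0.
pose h := Num.min (1/9) (Num.min (d1 / 5) (d2 / 5)).
have h0 : 0 < h by rewrite !lt_min !divr_gt0.
have h8 : 9 * h <= 1.
  have : h <= 1/9 by rewrite ge_min lexx.
  lra.
have hd : 5 * h <= d1.
  have : h <= d1 / 5 by rewrite !ge_min lexx orbT.
  lra.
have hd' : 5 * h <= d2.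
  have : h <= d2 / 5 by rewrite !ge_min lexx !orbT.
  lra.
clearbody h; have h8' : 8 * h <= 1 by apply: le_trans h8; rewrite ler_wpM2r ?(ltW h0) // ler_nat.
have [[a10 a11 a20 a21] [a12 a13 a22 a23]] :
    [/\ 0 < 2 * h, 2 * h + h < 1, 0 < 1 - 3 * h & 1 - 3 * h + h < 1] /\
    [/\ 0 < 2 * h - h, 2 * h + 2 * h < 1, 0 < 1 - 3 * h - h & 1 - 3 * h + 2 * h < 1].
  exact: layer_bounds.
pose si := ysource th f (2 * h) h; pose so := ysource th f (1 - 3 * h) h.
have csi : continuous si by exact: ysource_cont.
have cso : continuous so by exact: ysource_cont.
pose Gp p := G (vec3 p) 0.
have iG k : continuous k -> (lebesgue3 R).-integrable D (EFin \o (fun p => Gp p * k (qsum p))).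
  move=> ck.
  exact: (@integrableMl _ _ _ (lebesgue3 R) D measurable_ball3 _ (k \o @qsum R) Gi (measurable_radial ck) (bounded_radial ck)).
pose ai := \int[lebesgue3 R]_(p in D) (Gp p * si (qsum p)).
pose ao := \int[lebesgue3 R]_(p in D) (Gp p * so (qsum p)).
have mB := @measurable_ball3 R.
have test := test_profile_source th fd fo h0 h8'.
(* The test function vanishes at the pole, so the two source layers balance. *)
have eio : ai = ao.
  have := Gt _ (test_profile_test th fo h0 h8').
  rewrite (_ : nsq (0 : 'rV[R]_3) = 0); last by rewrite /nsq sum3 !mxE expr0n /= !addr0.
  rewrite (test_profile0 th fo h0 h8') => E; apply/eqP; rewrite -subr_eq0; apply/eqP.
  rewrite -[RHS]E /ai /ao; apply: etrans (esym (@RintegralB _ _ _ (lebesgue3 R) D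
    (fun p => Gp p * si (qsum p)) (fun p => Gp p * so (qsum p)) mB (iG _ csi) (iG _ cso))) _.
  apply: eq_Rintegral => p _; rewrite -[mu](sqr_sqrtr (ltW mu0)) test nsq_vec3.
  by rewrite /si /so /Gp mulrBr.
have ec0 : 0 <= e * C := ltW (mulr_gt0 e0 C0).
have bound (F : R * R * R -> R) a : 0 < a - h -> a + 2 * h < 1 ->
    (lebesgue3 R).-integrable D (EFin \o F) ->
    (forall p, D p -> `|F p| <= e * C * wide a h (qsum p)) ->
    `|\int[lebesgue3 R]_(p in D) F p| <= e * C * flux_const.
  move=> ah ah1 iF hF; rewrite -(radint_wide (e * C) h0 ah ah1).
  have cw : continuous (fun q => e * C * wide a h q).
    have cw0 : continuous (wide a h) := wide_cont h0 ah.
    by move=> q; exact: (ctM (@ctC _ _ (e * C) q) (cw0 q)).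
  exact: norm_integral_le_radint cw iF hF.
have so_out q : q < 1 - 3 * h -> so q = 0.
  by move=> qh; have [x1 x2] := ramp12_le fo h0 qh; rewrite /so /ysource /source x1 x2; ring.
have si_out q : ~~ (2 * h <= q <= 2 * h + h) -> si q = 0.
  move=> qh; have x2 := ramp2_out fo h0 qh.
  have x1 : ramp1 (2 * h) h q = 0.
    by apply: (ramp1_out h0); apply: contra qh => /andP[/ltW-> /ltW->].
  by rewrite /si /ysource /source x1 x2 !mulr0 !addr0 mulr0 oppr0.
have bo : `|ao| <= e * C * flux_const.
  apply: (bound _ _ a22 a23 (iG _ cso)) => p Dp.
  have q1 : qsum p < 1 by rewrite -(ball3E p).
  have Bs : `|so (qsum p)| <= C * wide (1 - 3 * h) h (qsum p).
    exact: (ysource_bound th0 fo M0 fM sM c00 sc (qsum p) a20 h0 (ltW a21) (or_intror (lexx _))).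
  rewrite normrM -mulrA; have [qh|qh] := ltP (qsum p) (1 - 3 * h).
    by rewrite (so_out _ qh) normr0 mulr0 mulrA; exact: (mulr_ge0 ec0 (wide_ge0 _ _ h0)).
  apply: ler_pM; [exact: normr_ge0|exact: normr_ge0| |exact: Bs].
  apply: hd2; first by rewrite unit_ballE nsq_vec3.
  by rewrite nsq_vec3; exact: outer_layer h0 hd' qh.
have cy : continuous (fun q => ysol th q * si q) by exact: ysource_y_cont.
have cz : continuous (fun q => zsol th q * si q) by exact: ysource_z_cont.
pose k q := (4 * pi * S)^-1 * (ysol th q * si q) + d * (zsol th q * si q).
have cyc : continuous (fun q => (4 * pi * S)^-1 * (ysol th q * si q)).
  by move=> q; exact: (ctM (@ctC _ _ (4 * pi * S)^-1 q) (cy q)).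
have czc : continuous (fun q => d * (zsol th q * si q)).
  by move=> q; exact: (ctM (@ctC _ _ d q) (cz q)).
have ck : continuous k by move=> q; exact: (ctD (cyc q) (czc q)).
have Ik : radint k = d * (2 * S * flux_const).
  rewrite /k (radintD cyc czc) (radintZ _ cy) (radintZ _ cz) /si (radint_y th fs fd fo a10 h0 a11).
  by rewrite (radint_z th0 fs fd fo a10 h0 a11) mulr0 add0r.
have bi : `|ai - d * (2 * S * flux_const)| <= e * C * flux_const.
  rewrite -Ik /ai; rewrite -(@RintegralB _ _ _ (lebesgue3 R) D
    (fun p => Gp p * si (qsum p)) (k \o @qsum R) mB (iG _ csi) (integrable_radial ck)).
  have ik : (lebesgue3 R).-integrable D (EFin \o (fun p => Gp p * si (qsum p) - k (qsum p))).
    have := @integrableB _ _ _ (lebesgue3 R) D mB _ _ (iG _ csi) (integrable_radial ck).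
    by [].
  apply: (bound _ _ a12 a13 ik) => p Dp.
  have q1 : qsum p < 1 by rewrite -(ball3E p).
  have Bs : `|si (qsum p)| <= C * wide (2 * h) h (qsum p).
    exact: (ysource_bound th0 fo M0 fM sM c00 sc (qsum p) a10 h0 (ltW a11) (or_introl (inner_width h))).
  have -> : Gp p * si (qsum p) - (k \o @qsum R) p = (Gp p - excess (qsum p)) * si (qsum p).
    by rewrite /k /excess /=; ring.
  rewrite normrM -mulrA; have [/andP[qa qb]|qh] := boolP (2 * h <= qsum p <= 2 * h + h); last first.
    by rewrite (si_out _ qh) normr0 mulr0 mulrA; exact: (mulr_ge0 ec0 (wide_ge0 _ _ h0)).
  apply: ler_pM; [exact: normr_ge0|exact: normr_ge0| |exact: Bs].
  rewrite -nsq_vec3; apply: hd1; rewrite nsq_vec3; last exact: q1.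
  exact: inner_layer h0 hd qa qb.
have L0 := @flux_const_gt0 R.
have : `|d| * (2 * S * flux_const) <= 2 * (e * C * flux_const).
  have p0 : 0 < 2 * S * flux_const by rewrite !mulr_gt0.
  rewrite -(gtr0_norm p0) -normrM.
  have -> : d * (2 * S * flux_const) = ao - (ai - d * (2 * S * flux_const)) by rewrite eio; ring.
  by apply: le_trans (ler_normB _ _) _; rewrite [leRHS]mulr_natl mulr2n; exact: lerD bo bi.
rewrite mulrA eC.
have : 0 < `|d| * S * flux_const by rewrite !mulr_gt0.
rewrite -subr_le0 => h1 h2; exfalso; move: h2; rewrite (_ : _ - _ = `|d| * S * flux_const); last by ring.
by rewrite leNgt h1.
Qed.

Lemma green_regular_value : g 0 0 = - (th * cos th / sin th) / (4 * pi).
Proof.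
have := green_value_aux; rewrite /d => /eqP; rewrite addr_eq0 => /eqP ->; rewrite /k1 -/S.
have alg (P c : R) : P != 0 -> - (th * c / (4 * P * S)) = - (th * c / S) / (4 * P).
  by move=> P0; field; rewrite P0 gt_eqF.
by rewrite alg // gt_eqF.
Qed.

End GreenValue.

Theorem theorem1p1 (R : realType) (K0 : R) (f1 : R -> R) :
  0 < K0 ->
  C1_01 f1 ->
  f1 0 = 0 ->
  deriv01 f1 0 != 0 ->
  (limf_esup (fun t : R => ((deriv01 f1 t - deriv01 f1 0) / t)%:E) 0^'+
     < +oo)%E ->
  exists etabar : R, 0 < etabar /\
    forall mu eta : R, 0 < mu -> mu < pi ^+ 2 -> 0 <= eta -> eta <= etabar ->
    (forall t, t \in `[0, 1] -> 0 <= K0 + eta * f1 t) ->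
    {in `[0, 1] &, forall s t, s <= t -> K0 + eta * f1 t <= K0 + eta * f1 s} ->
    forall G g : 'rV[R]_3 -> 'rV[R]_3 -> R,
    green_function mu G -> regular_part G g ->
    (exists u : 'rV[R]_3 -> R,
       classical_solution (fun x => K0 + eta * f1 (enorm x)) mu u)
    <-> - (deriv01 f1 0 * eta / (16 * pi * K0)) < g 0 0.
Proof.
move=> K00 f1C1 f10 _ /(limsup_bound f1C1)[C C0 hC].
(* The bound is [eta C <= 4 K0], the smallness that [solution_implies_green] asks for. *)
exists (4 * K0 / C); split; first by rewrite divr_gt0 ?mulr_gt0.
move=> mu eta mu0 mupi eta0 etaC fnn fnoninc G g hG hg.
rewrite (green_regular_value mu0 mupi hG hg).
set t := Num.sqrt mu * _ / _.
have p0 : 0 < pi :> R := pi_gt0 R.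
have -> : (- (deriv01 f1 0 * eta / (16 * pi * K0)) < - t / (4 * pi)) =
    (- (deriv01 f1 0 * eta) / (4 * K0) < - t).
  rewrite ltr_pdivlMr ?mulr_gt0 //; congr (_ < _).
  have alg (P x : R) : P != 0 -> - (x / (16 * P * K0)) * (4 * P) = - x / (4 * K0).
    by move=> P0; field; rewrite P0 gt_eqF.
  by rewrite alg // gt_eqF.
split=> [[u hu]|]; last exact: green_implies_solution.
apply: (solution_implies_green (C := C)) hu => //.
by rewrite -ler_pdivlMr.
Qed.
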